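(* Let $X$ be a smooth manifold of dimension $n$, and let $V_1,\ldots,V_n\subset C^\infty(X,\mathbb R)$ be finite-dimensional vector subspaces, each equipped with a norm. Assume that for each $i$ the unit ball $B_i\subset V_i$ and the unit ball $B_i^*\subset V_i^*$ of the dual norm are smooth convex bodies. Let $U\subset X$ be a relatively compact open set, let $\mathfrak M(U)$ be the average number of solutions in $U$ with respect to the natural measure $\Xi(V_1,\ldots,V_n)$, let $\mathcal B_{i,{\rm symm}}$ be the $B$-body in $X$ corresponding to the zonoid symmetrization $V_{i,{\rm symm}}$ of $V_i$, and let $\mathcal B_{i,{\rm symm}}^U$ be the restriction of $\mathcal B_{i,{\rm symm}}$ to $U$. Then $$\mathfrak M(U)=\frac{n!}{2^n}\,{\rm vol}(\mathcal B_{1,{\rm symm}}^U,\ldots,\mathcal B_{n,{\rm symm}}^U),$$ where the right-hand side involves the mixed volume of $B$-bodies.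
   Context: For a finite-dimensional real vector space $W$, ${\rm AGr}^1(W)$ is the set (manifold) of affine hyperplanes of $W$. Average number of solutions. A tuple $H=(H_1,\ldots,H_n)\in{\rm AGr}^1(V_1^* )\times\ldots\times{\rm AGr}^1(V_n^* )$ with $H_i=\{v^*\in V_i^*: v^*(f_i)=a_i\}$, $0\ne f_i\in V_i$, $a_i\in\mathbb R$, is identified with the system of equations $f_1-a_1=\ldots=f_n-a_n=0$ on $X$. $N_U(H)$ is the number of isolated solutions of this system in $U$. For a measure $\Xi$ on ${\rm AGr}^1(V_1^* )\times\ldots\times{\rm AGr}^1(V_n^* )$, the average number of solutions in $U$ with respect to $\Xi$ is $\mathfrak M(U)=\int N_U(H)\,d\Xi(H)$. Natural measure. Let $V$ be a finite-dimensional normed space with smooth unit ball $B$ and unit sphere $S=\partial B$. Restrict the norm of $V$ to each tangent space $T_xS\subset V$, let $\mathfrak l(x)$ be the Lebesgue measure on $T_xS$ for which the unit ball of $T_xS$ in this restricted norm has measure $1$, and let $d\mathfrak l$ be the corresponding volume density on $S$. For $x\in S$, $t\in\mathbb R$ put $H(x,t)=\{y\in V^*:\langle x,y\rangle=t\}\in{\rm AGr}^1(V^* )$. The natural measure on ${\rm AGr}^1(V^* )$ is $$\Xi(V)(A)=\frac12\int_{x\in S}\Big(\int_{\{t\in\mathbb R:\,H(x,t)\in A\}}dt\Big)d\mathfrak l(x),$$ and $\Xi(V_1,\ldots,V_n)=\Xi(V_1)\times\ldots\times\Xi(V_n)$ on ${\rm AGr}^1(V_1^* )\times\ldots\times{\rm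 AGr}^1(V_n^* )$. Zonoid symmetrization. Put $h_{\rm symm}(y)=\frac12\int_{x\in S}|\langle x,y\rangle|\,d\mathfrak l(x)$ for $y\in V^*$. This is the support function of a centrally symmetric convex body $B_{\rm symm}\subset V$. The zonoid symmetrization $V_{\rm symm}$ of $V$ is the vector space $V$ with the norm whose unit ball is $B_{\rm symm}$. $B$-bodies. A Banach convex body ($B$-body) $\mathcal E$ in a manifold $Y$ is a collection of compact convex sets $\mathcal E(y)\subset T_y^*Y$, symmetric about $0$ (possibly with empty interior), depending continuously on $y\in Y$. Its volume ${\rm vol}(\mathcal E)$ is the volume of $\bigcup_y\mathcal E(y)\subset T^*Y$ with respect to the volume form $\omega^n/n!$, where $n=\dim Y$ and $\omega$ is the standard symplectic form. Linear combinations with non-negative coefficients are taken fiberwise using Minkowski sum. Then ${\rm vol}(\lambda_1\mathcal E_1+\ldots+\lambda_n\mathcal E_n)$ is a homogeneous polynomial of degree $n$ in $\lambda_1,\ldots,\lambda_n$; the mixed volume ${\rm vol}(\mathcal E_1,\ldots,\mathcal E_n)$ is its coefficient at $\lambda_1\cdots\lambda_n$ divided by $n!$. Restriction of $\mathcal E$ to an open set $U$ means the collection of $\mathcal E(y)$ with $y\in U$. $B$-body of a space of functions. For a finite-dimensional normed space $V\subset C^\infty(X,\mathbb R)$ with unit ball $B\subset V$, define $\theta_V\colon X\to V^*$ by $\theta_V(x)(f)=f(x)$. The $B$-body corresponding to $V$ is $\mathcal B(x)=(d_x\theta_V)^*(B)\subset T_x^*X$, where $(d_x\theta_V)^*\colon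 V=(V^* )^*\to T_x^*X$ is the dual of the differential of $\theta_V$ at $x$. *)

(* Defs.v *)
From HB Require Import structures.
From mathcomp Require Import all_boot all_order all_algebra.
From mathcomp Require Import all_classical all_reals all_analysis.
From mathcomp Require mpoly.

Set Implicit Arguments.
Unset Strict Implicit.
Unset Printing Implicit Defensive.

Import Order.TTheory GRing.Theory Num.Theory.
Import numFieldNormedType.Exports.

Local Open Scope classical_set_scope.
Local Open Scope ring_scope.

(* Product of the (sigma-finite) set functions [mu i], each meaningful on the
   sigma-algebra [M i], as the outer measure of covers by measurable boxes.  The
   index set [K] of the cover is an arbitrary set of naturals so that finite and
   empty covers are allowed also when [I] is empty. *)
Definition prod_measure (R : realType) (I : finType) (T : I -> Type)
    (M : forall i, set (set (T i))) (mu : forall i, set (T i) -> \bar R)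
    (A : set (forall i, T i)) : \bar R :=
  ereal_inf [set s : \bar R | exists (K : set nat) (B : nat -> forall i, set (T i)),
    [/\ forall j i, M i (B j i),
        A `<=` \bigcup_(j in K) [set x | forall i, B j i (x i)] &
        s = \esum_(j in K) (\big[*%E/1%E]_(i : I) mu i (B j i))%E]].

Section Euclidean.
Context {R : realType}.

Definition borelR k := g_sigma_algebraType (@open 'rV[R]_k).

Definition leb k (A : set (borelR k)) : \bar R :=
  prod_measure (fun _ : 'I_k => @measurable _ (measurableTypeR R))
    (fun _ => @lebesgue_measure R) [set x | A (\row_i x i)].

(* Meaningful for open [O]. *)
Fixpoint is_Cr k (W : normedModType R) (r : nat) (O : set 'rV[R]_k)
    (f : 'rV[R]_k -> W) : Prop :=
  (forall x, O x -> {for x, continuous f}) /\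
  (if r is r'.+1 then
     forall u, (forall x, O x -> derivable f x u) /\ is_Cr r' O (fun x => 'D_u f x)
   else True).

Definition smooth_on k (W : normedModType R) (O : set 'rV[R]_k)
  (f : 'rV[R]_k -> W) : Prop := forall r, is_Cr r O f.

End Euclidean.

(* Topology and smooth structure of a finite-dimensional vector space: those of
   R^k through the coordinates in a basis (the choice of which is immaterial). *)
Section FiniteDimensional.
Context {R : realType} (W : vectType R).

Definition vdim : nat := \dim (fullv : {vspace W}).
Definition crd (w : W) : 'rV[R]_vdim := passmx.rVof (vbasis fullv) w.
Definition uncrd (u : 'rV[R]_vdim) : W := passmx.vecof (vbasis fullv) u.

Definition vopen (A : set W) : Prop := open (crd @` A).

Definition boundary (A : set W) : set W :=
  [set w | closure (crd @` A) (crd w) /\ ~ interior (crd @` A) (crd w)].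

Definition pdiff k (psi : 'rV[R]_k -> W) (w u : 'rV[R]_k) : W :=
  uncrd ('D_u (crd \o psi) w).

(* [psi] on [O] is a smooth local parametrization of [S], i.e., an immersion that
   is a homeomorphism onto a relatively open subset of [S]. *)
Definition local_param (S : set W)
    (O : set 'rV[R]_vdim.-1) (psi : 'rV[R]_vdim.-1 -> W) : Prop :=
  [/\ open O /\ smooth_on O (crd \o psi),
      forall w w', O w -> O w' -> psi w = psi w' -> w = w',
      forall w u, O w -> pdiff psi w u = 0 -> u = 0 &
      psi @` O `<=` S /\
      forall O', open O' -> O' `<=` O ->
        exists2 G, vopen G & psi @` O' = S `&` G].

Definition smooth_hypersurface (S : set W) : Prop :=
  forall x, S x -> exists O psi, local_param S O psi /\ (psi @` O) x.

Definition smooth_convex_body (B : set W) : Prop :=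
  [/\ convex_set (B : set (convex_lmodType W)), compact (crd @` B),
      interior (crd @` B) !=set0 & smooth_hypersurface (boundary B)].

Definition dual : vectType R := 'Hom(W, R^o).

End FiniteDimensional.

Definition pointed_vect (R : realType) (V : vectType R) : Type := V.
HB.instance Definition _ (R : realType) (V : vectType R) :=
  Choice.on (pointed_vect V).
HB.instance Definition _ (R : realType) (V : vectType R) :=
  isPointed.Build (pointed_vect V) (0 : V).

Section NormedSpace.
Context {R : realType} {V : vectType R}.

Definition is_norm (N : V -> R) : Prop :=
  [/\ forall v, 0 <= N v, forall v, N v = 0 -> v = 0,
      forall (a : R) v, N (a *: v) = `|a| * N v &
      forall v w, N (v + w) <= N v + N w].

Definition unit_ball (N : V -> R) : set V := [set v | N v <= 1].
Definition unit_sphere (N : V -> R) : set V := [set v | N v = 1].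

Definition dual_norm (N : V -> R) (y : dual V) : R :=
  sup [set `|y v| | v in unit_ball N].

Definition borelV := g_sigma_algebraType (@vopen R V : set (set (pointed_vect V))).

(* The Lebesgue measure on T_xS giving measure 1 to the unit ball of T_xS, pulled
   back by d_w psi : R^(k-1) -> T_xS, x = psi w, is this multiple of [leb]. *)
Definition sphere_density (N : V -> R) (psi : 'rV[R]_(vdim V).-1 -> V)
    (w : 'rV[R]_(vdim V).-1) : \bar R :=
  ((fine (leb [set u | N (pdiff psi w u) <= 1]))^-1)%:E.

(* The measure dl on the unit sphere: integral of the density over pieces, each
   in the image of one local parametrization. *)
Definition sphere_measure (N : V -> R) (A : set borelV) : \bar R :=
  ereal_sup [set s : \bar R |
    exists (p : nat) (O : 'I_p -> set 'rV[R]_(vdim V).-1)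
      (psi : 'I_p -> 'rV[R]_(vdim V).-1 -> V) (D : 'I_p -> set V),
    [/\ forall j, local_param (unit_sphere N) (O j) (psi j),
        forall j, <<s @vopen R V >> (D j) /\ D j `<=` A `&` psi j @` O j,
        trivIset setT D &
        s = (\sum_(j < p)
              \int[@leb R (vdim V).-1]_(w in O j `&` psi j @^-1` D j)
                sphere_density N (psi j) w)%E]].

Definition hyperplane (x : V) (t : R) : set (dual V) := [set y | y x = t].

Definition AGr1 : set (set (dual V)) :=
  [set H | exists (f : V) (a : R), f != 0 /\ H = hyperplane f a].

(* Quotient topology of (f, a) |-> hyperplane f a; sets of subsets of V^* that
   contain no hyperplane are open. *)
Definition AGr_open (A : set (set (dual V))) : Prop :=
  open [set p : 'rV[R]_(vdim V) * R | p.1 != 0 /\ A (hyperplane (uncrd p.1) p.2)].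

Definition natural_measure (N : V -> R) (A : set (set (dual V))) : \bar R :=
  ((2^-1)%:E * \int[sphere_measure N]_(x in unit_sphere N)
                  lebesgue_measure [set t : R | A (hyperplane x t)])%E.

Definition h_symm (N : V -> R) (y : dual V) : \bar R :=
  ((2^-1)%:E * \int[sphere_measure N]_(x in unit_sphere N) (`|y x|)%:E)%E.

(* The compact convex set with support function [h_symm]. *)
Definition B_symm (N : V -> R) : set V :=
  [set v | forall y : dual V, ((y v)%:E <= h_symm N y)%E].

(* The norm with unit ball [B_symm], i.e., its gauge. *)
Definition symm_norm (N : V -> R) (v : V) : R :=
  inf [set r : R | 0 < r /\ B_symm N (r^-1 *: v)].

End NormedSpace.

Record manifold (R : realType) (n : nat) := Manifold {
  mspace :> topologicalType ;
  chart : Type ;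
  cdom : chart -> set mspace ;
  cmap : chart -> mspace -> 'rV[R]_n ;
  cinv : chart -> 'rV[R]_n -> mspace ;
  manifold_hausdorff : hausdorff_space mspace ;
  manifold_countable : @second_countable mspace ;
  cdom_cover : forall x, exists c, cdom c x ;
  cdom_open : forall c, open (cdom c) ;
  cmap_open : forall c, open (cmap c @` cdom c) ;
  cmapK : forall c x, cdom c x -> cinv c (cmap c x) = x ;
  cmap_continuous : forall c x, cdom c x -> {for x, continuous (cmap c)} ;
  cinv_continuous : forall c u, (cmap c @` cdom c) u ->
    {for u, continuous (cinv c)} ;
  transition_smooth : forall c c',
    smooth_on (cmap c @` (cdom c `&` cdom c')) (cmap c' \o cinv c) }.

Section Manifold.
Context {R : realType} {n : nat} {X : manifold R n}.

Definition smooth_fun (f : X -> R) : Prop :=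
  forall c : chart X, smooth_on (cmap c @` cdom c) (f \o cinv c).

(* A covector at x is represented by its components in all the charts around x
   (and 0 in the other charts). *)
Definition covector := chart X -> 'rV[R]_n.

Definition cotangent (x : X) : set covector :=
  [set xi | (forall c, ~ cdom c x -> xi c = 0) /\
    forall c c', cdom c x -> cdom c' x -> forall u : 'rV[R]_n,
      xi c *m u^T = xi c' *m ('D_u (cmap c' \o cinv c) (cmap c x))^T].

(* The measure |omega^n / n!| on T^*X: omega is the sum of dp_i /\ dq_i in the
   coordinates (q, p) of T^*X given by a chart, hence omega^n / n! is the
   Lebesgue measure in these coordinates. *)
Definition liouville (A : set (X * covector)) : \bar R :=
  ereal_sup [set s : \bar R |
    exists (p : nat) (c : 'I_p -> chart X) (D : 'I_p -> set X),
    [/\ forall j, <<s @open X >> (D j) /\ D j `<=` cdom (c j),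
        trivIset setT D &
        s = (\sum_(j < p) @leb R (n + n)
              [set row_mx (cmap (c j) z.1) (z.2 (c j)) | z in
                 A `&` [set z | D j z.1 /\ cotangent z.1 z.2]])%E]].

Definition bvol (U : set X) (E : X -> set covector) : \bar R :=
  liouville [set z | U z.1 /\ E z.1 z.2].

Definition bsum (lambda : 'I_n -> R) (E : 'I_n -> X -> set covector) (x : X) :
    set covector :=
  [set xi | exists zeta : 'I_n -> covector, (forall i, E i x (zeta i)) /\
     xi = fun c => \sum_i lambda i *: zeta i c].

(* [P] is determined by its values at nonnegative arguments; the fiberwise sums
   are restricted to [U] when their volume is taken. *)
Definition mixed_volume (U : set X) (E : 'I_n -> X -> set covector) : R :=
  xget 0 [set m : R | exists P : mpoly.mpoly n R,
    [/\ forall a, mpoly.mcoeff a P != 0 -> mpoly.mdeg a = n,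
        forall lambda : 'I_n -> R, (forall i, 0 <= lambda i) ->
          bvol U (bsum lambda E) = (mpoly.meval lambda P)%:E &
        m = mpoly.mcoeff (mpoly.Multinom [tuple 1%N | i < n]) P / n`!%:R]].

Section FunctionSpace.
(* [ev] realizes the elements of [V] as functions on [X]. *)
Context {V : vectType R} (ev : V -> X -> R^o).

Definition theta (x : X) : dual V := linfun (fun v => ev v x).

(* d_x theta applied to the tangent vector with components [u] in the chart [c]. *)
Definition dtheta (c : chart X) (x : X) (u : 'rV[R]_n) : dual V :=
  pdiff (theta \o cinv c) (cmap c x) u.

(* The covector u |-> <d_x theta u, v>, i.e., the dual of d_x theta applied to [v]
   seen as an element of V^** . *)
Definition dtheta_dual (x : X) (v : V) : covector :=
  fun c => if pselect (cdom c x) then \row_j (dtheta c x (delta_mx 0 j)) v else 0.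

Definition bbody (N : V -> R) (x : X) : set covector :=
  dtheta_dual x @` unit_ball N.

End FunctionSpace.

Section Average.
Context (V : 'I_n -> vectType R) (ev : forall i, V i -> X -> R^o)
  (N : forall i, V i -> R).

Definition hyperplanes := forall i, set (dual (V i)).

Definition hyperplanes_borel : set (set hyperplanes) :=
  [set C | exists i A, <<s @AGr_open R (V i) >> A /\ C = [set H | A (H i)]].

Definition product_natural_measure
    (A : set (g_sigma_algebraType hyperplanes_borel)) : \bar R :=
  prod_measure (fun i => <<s @AGr_open R (V i) >>)
    (fun i => natural_measure (@N i)) A.

(* With H_i = {y | y f_i = a_i}, theta_i(x) is in H_i iff f_i(x) = a_i, so the set
   below is the solution set of the system f_1 - a_1 = ... = f_n - a_n = 0. *)
Definition nb_solutions (U : set X) (H : hyperplanes) : \bar R :=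
  counting (U `&` isolated [set x : X | forall i, H i (theta (@ev i) x)]).

Definition average_solutions (U : set X) : \bar R :=
  (\int[product_natural_measure]_(H in [set H | forall i, AGr1 (H i)])
     nb_solutions U H)%E.

End Average.
End Manifold.

(* Main.v *)
(* Write [l_i] for the measure on the unit sphere of [V i].  In a chart, a system
   [f_i = a_i] with f_i on the spheres is counted by the area formula, so that
   2^n times the average number of solutions has the density
     Delta(u) = int |det (d_u f_1, ..., d_u f_n)| dl_1(f_1) ... dl_n(f_n).
   On the other hand the unit ball of the symmetrized norm is the zonoid with
   support function 1/2 int |<x, y>| dl_i(x), a limit of the zonotopes generated by
   the vectors [l_i(D_j) / 2 *: x_j] for finer and finer partitions (D_j) of the
   sphere with x_j in D_j.  The volume of a zonotope in R^n is 2^n / n! times the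
   sum of |det| over the n-tuples of generators; hence the fiber of
   [sum_i lambda_i B_i] at u has volume
     1/n! sum_a lambda_(a 1) ... lambda_(a n) Delta^a(u), for a : 'I_n -> 'I_n,
   where Delta^a is Delta for the family (V_(a 1), ..., V_(a n)).  Integrating over
   the charts gives a polynomial in lambda, and its coefficient at
   lambda_1 ... lambda_n, collected over the permutations a, is the integral of
   Delta, that is, 2^n times the average number of solutions. *)

Require Import Defs.
From HB Require Import structures.
From mathcomp Require Import all_boot all_order all_algebra.
From mathcomp Require Import all_classical all_reals all_analysis.
From mathcomp Require Import measurable_realfun borel_hierarchy ring lra.
From mathcomp Require Import perm.
From mathcomp Require mpoly.

Set Implicit Arguments.
Unset Strict Implicit.
Unset Printing Implicit Defensive.

Import Order.TTheory GRing.Theory Num.Theory.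
Import numFieldNormedType.Exports.

Local Open Scope classical_set_scope.
Local Open Scope ring_scope.


(** * Products of measures *)

(** The measure on the sphere is a supremum over finite families of parametrized pieces, so its
    finiteness has to be proved. Each piece is compared with the cone over it inside the unit ball:
    the density is at most a constant times the jacobian of the cone map, and cones over disjoint
    pieces are disjoint. Only isolated solutions are counted. This changes nothing: the area formula
    ignores critical points, and a solution with invertible jacobian is isolated. No change of
    variables is proved for Delta. It defines the same measure in two charts because on open sets
    both integrals count solutions, which does not refer to charts, and finite measures that agree
    on open sets are equal. Finiteness on relatively compact sets makes this work, as well as the
    inclusion-exclusion between charts. The symmetrized ball is approximated up to a dilation by q >
    1, for which its support function must be a norm; parametrized pieces of the sphere, of positive
    measure, give this. The volume formula for zonotopes also yields the linear change of variables
    and both bounds in the area formula. *)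

Section Aliases.
Context {d d'} {T : measurableType d} {T' : measurableType d'} {R : realType}.

(** The measurability proof is an argument of the term, so that the measure structure attached below
    can be inferred from it; [sfm] carries the proof of sigma-finiteness in the same way. *)
Definition pushm (m : {measure set T -> \bar R}) (f : T -> T')
  (mf : measurable_fun setT f) : set T' -> \bar R := pushforward m f.

HB.instance Definition _ m f mf :=
  let m' := measure_function_pushforward__canonical__measure_function_Measure m mf in
  isMeasure.Build _ T' R (@pushm m f mf) (measure0 m') (measure_ge0 m')
    (@measure_semi_sigma_additive _ _ _ m').

Definition sfm (m : {measure set T -> \bar R}) (_ : sigma_finite setT m) :
  set T -> \bar R := m.

HB.instance Definition _ m h := Measure.on (@sfm m h).
HB.instance Definition _ m h := Measure_isSigmaFinite.Build _ _ _ (@sfm m h) h.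

End Aliases.

Section ProductMeasure.
Context {R : realType} {I : finType} {d : I -> measure_display}
  {T : forall i, measurableType (d i)}.
Implicit Types (mu : forall i, {measure set (T i) -> \bar R}).

Definition rect_sys : set (set (forall i, T i)) :=
  [set C | exists i A, measurable A /\ C = [set x : forall i, T i | A (x i)]].

Definition prodT := g_sigma_algebraType rect_sys.

HB.instance Definition _ := Measurable.on prodT.

Definition pm mu : set prodT -> \bar R :=
  prod_measure (fun i => @measurable _ (T i)) mu.

Definition box (B : forall i, set (T i)) : set prodT := [set x | forall i, B i (x i)].

Lemma measurable_box (B : forall i, set (T i)) :
  (forall i, measurable (B i)) -> measurable (box B).
Proof.
move=> mB; rewrite (_ : box B = \bigcap_(i in setT) [set x : prodT | B i (x i)]); last first.
  by apply/seteqP; split => [x Bx i _|x Bx i]; [exact: Bx|exact: (Bx i)].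
by apply: fin_bigcap_measurable => // i _; apply: sub_sigma_algebra; exists i, (B i).
Qed.

Lemma measurable_coord i : measurable_fun setT (fun x : prodT => x i).
Proof. by move=> _ Y mY; rewrite setTI; apply: sub_sigma_algebra; exists i, Y. Qed.

Lemma measurable_fun_prodT d' (T' : measurableType d') (D : set T') (f : T' -> prodT) :
  (forall i, measurable_fun D (fun t => f t i)) -> measurable_fun D f.
Proof.
move=> mf; have [mD|/(_ _)] := pselect (measurable D); last by move=> mD /mD.
apply: (@measurability _ _ _ prodT D f rect_sys) => // _ [_ [i [A [mA ->]]] <-]; exact: mf.
Qed.

Lemma measurable_fun_coord d' (T' : measurableType d') (f : T' -> prodT) i :
  measurable_fun setT f -> measurable_fun setT (fun t => f t i).
Proof. by move=> mf; have H := measurableT_comp (@measurable_coord i) mf; exact: H. Qed.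

Lemma mule_prod_ge0 (s : seq I) (P : pred I) (a : I -> \bar R) :
  (forall i, 0 <= a i)%E -> (0 <= \big[*%E/1%E]_(i <- s | P i) a i)%E.
Proof. by move=> a0; elim/big_ind : _ => // *; exact: mule_ge0. Qed.

Lemma pm_ge0 mu A : (0 <= pm mu A)%E.
Proof.
apply: le_ereal_inf_tmp => _ [K [B [_ _ ->]]]; apply: esum_ge0 => j _.
exact: mule_prod_ge0.
Qed.

Lemma pm0 mu : pm mu set0 = 0%E.
Proof.
apply/eqP; rewrite eq_le pm_ge0 andbT; apply: ereal_inf_lbound.
by exists set0, (fun _ _ => set0); split => //; rewrite esum_set0.
Qed.

Lemma le_pm mu : {homo pm mu : A B / A `<=` B >-> (A <= B)%E}.
Proof.
move=> A B AB; apply: ereal_inf_le_tmp => _ [K [C [mC BC ->]]].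
by exists K, C; split => //; exact: subset_trans BC.
Qed.

Lemma pm_sigma_subadditive mu : sigma_subadditive (pm mu).
Proof.
move=> A; have [[i ioo]|noo] := pselect (exists i, pm mu (A i) = +oo%E).
  rewrite (eseries_pinfty _ _ ioo) ?leey// => n _.
  by rewrite -ltNye (lt_le_trans _ (pm_ge0 _ _)).
have fA i : pm mu (A i) \is a fin_num.
  by rewrite ge0_fin_numE ?pm_ge0// ltey; apply/eqP => Aoo; apply: noo; exists i.
apply/lee_addgt0Pr => e e0.
have /choice[K /choice[B KB]] : forall n, exists (K : set nat) (B : nat -> forall i, set (T i)),
  [/\ forall j i, measurable (B j i), A n `<=` \bigcup_(j in K) box (B j) &
   (\esum_(j in K) (\big[*%E/1%E]_(i : I) mu i (B j i)) <= pm mu (A n) + (e / (2 ^ n.+1)%:R)%:E)%E].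
  move=> n; have en : 0 < e / (2 ^ n.+1)%:R by rewrite divr_gt0// ltr0n expn_gt0.
  have [_ [K [B [mB AB ->]]] h] := lb_ereal_inf_adherent en (fA n).
  by exists K, B; split => //; exact: ltW.
have := epsilon_trick xpredT (fun n => pm_ge0 mu (A n)) (ltW e0).
apply: le_trans; rewrite nneseries_esumT; last first.
  by move=> n; rewrite adde_ge0 ?pm_ge0// lee_fin divr_ge0// ltW.
apply: (@le_trans _ _ (\esum_(n in setT) \esum_(j in K n)
    (\big[*%E/1%E]_(i : I) mu i (B n j i)))%E); last first.
  by apply: le_esum => n _; have [_ _] := KB n.
rewrite esum_esum; last by move=> *; exact: mule_prod_ge0.
(* The covers of all the [A n] are merged into one, indexed by the codes of the pairs (n, j). *)
pose F (c : nat) := if (unpickle c : option (nat * nat)) is Some nj then B nj.1 nj.2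
  else fun i => set0.
apply: ereal_inf_lbound; exists (pickle @` (setT `*`` K)), F; split.
- move=> j i; rewrite /F; case: unpickle => // nj.
  by have [] := KB nj.1.
- move=> x [n _ Anx]; have [_ AK _] := KB n; have [j Kj Bx] := AK _ Anx.
  exists (pickle (n, j)); first by exists (n, j).
  by rewrite /F pickleK.
- rewrite esum_image; last by move=> x y _ _; exact: (pcan_inj pickleK).
  by apply: eq_esum => -[n j] _; rewrite /F pickleK.
Qed.

HB.instance Definition _ mu := isOuterMeasure.Build R prodT (pm mu)
  (pm0 mu) (pm_ge0 mu) (@le_pm mu) (@pm_sigma_subadditive mu).

(** Caratheodory sets form a sigma-algebra, so cylinders are enough. Cutting the i-th side of every
    box splits a cover of [X] into covers of its two parts without changing the total mass. *)
Lemma pm_caratheodory mu (A : set prodT) : measurable A ->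
  (pm mu).-cara.-measurable A.
Proof.
move: A; apply: smallest_sub; first exact: (@sigma_algebra_measurable _ (caratheodory_type (pm mu))).
move=> _ [i [A [mA ->]]]; apply: le_caratheodory_measurable => X.
apply: le_ereal_inf_tmp => _ [K [B [mB XB ->]]].
pose B1 (C : set (T i)) j := dfwith (B j) i (B j i `&` C).
have B1E C j x : box (B1 C j) x <-> box (B j) x /\ C (x i).
  split=> [h|[h Cx] k].
    split=> [k|]; last by have := h i; rewrite /B1 dfwithin => -[].
    have := h k; rewrite /B1; have [<-|ik] := eqVneq i k; last by rewrite dfwithout.
    by rewrite dfwithin => -[].
  rewrite /B1; have [<-|ik] := eqVneq i k; last by rewrite dfwithout.
  by rewrite dfwithin.
have mB1 C j k : measurable C -> measurable (B1 C j k).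
  move=> mC; rewrite /B1; have [<-|ik] := eqVneq i k; last by rewrite dfwithout.
  by rewrite dfwithin; exact: measurableI.
have pB1 C j : (\big[*%E/1%E]_k mu k (B1 C j k) =
    mu i (B j i `&` C) * \big[*%E/1%E]_(k | k != i) mu k (B j k))%E.
  rewrite (bigD1 i)//= /B1 dfwithin; congr (_ * _)%E.
  by apply: eq_bigr => k ki; rewrite dfwithout// eq_sym.
have le1 C Y : measurable C -> (Y `<=` X `&` [set x | C (x i)]) ->
    (pm mu Y <= \esum_(j in K) \big[*%E/1%E]_k mu k (B1 C j k))%E.
  move=> mC YX; apply: ereal_inf_lbound; exists K, (B1 C); split => //.
    by move=> j k; exact: mB1.
  move=> x /YX [Xx Cx]; have [j Kj Bx] := XB _ Xx.
  by exists j => //; apply/B1E.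
apply: (@le_trans _ _ (\esum_(j in K) \big[*%E/1%E]_k mu k (B1 A j k) +
  \esum_(j in K) \big[*%E/1%E]_k mu k (B1 (~` A) j k))%E).
  by apply: leeD; apply: le1 => //; exact: measurableC.
rewrite -esumD; [|by move=> *; exact: mule_prod_ge0..].
apply: le_esum => j _; rewrite !pB1 -ge0_muleDl//.
rewrite [leRHS](bigD1 i)//= le_eqVlt; apply/orP; left; apply/eqP; congr (_ * _)%E.
rewrite -measureU; [|by apply: measurableI => //; exact: measurableC..|].
  by rewrite -setIUr setUv setIT.
by rewrite setIACA setICr setI0.
Qed.

Lemma pm_semi_sigma_additive mu : semi_sigma_additive (pm mu).
Proof.
move=> F mF tF mUF.
apply: (@caratheodory_measure_sigma_additive R prodT (pm mu)) => //.
- by move=> i; exact: pm_caratheodory.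
- exact: pm_caratheodory.
Qed.

HB.instance Definition _ mu := isMeasure.Build _ prodT R (pm mu)
  (pm0 mu) (pm_ge0 mu) (@pm_semi_sigma_additive mu).

Lemma measurable_fun_prode (s : seq I) (g : forall i, T i -> \bar R) :
  (forall i, @measurable_fun _ _ (T i) (\bar R) setT (g i)) ->
  measurable_fun setT (fun x : prodT => \big[*%E/1%E]_(i <- s) g i (x i)).
Proof.
move=> mg; elim: s => [|i s IH].
  rewrite [X in measurable_fun _ X](_ : _ = cst 1%E); first exact: measurable_cst.
  by apply/funext => x; rewrite big_nil.
rewrite [X in measurable_fun _ X](_ : _ = (fun x : prodT => g i (x i)) \* (fun x => \big[*%E/1%E]_(i <- s) g i (x i)))%E; last first.
  by apply/funext => x; rewrite big_cons.
apply: emeasurable_funM => //.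
by apply: (measurableT_comp (mg i)); exact: measurable_coord.
Qed.

(** An iterated binary product along [s]: it starts from a Dirac mass, and a coordinate [i] is added
    by pushing [mu i \x m] forward along the map that overwrites the i-th coordinate. The
    exhaustions [F] carry sigma-finiteness through the induction. *)
Lemma prod_measure_exists (mu : forall i, {sigma_finite_measure set (T i) -> \bar R})
   (F : forall i, nat -> set (T i)) (s : seq I) :
  (forall i, [/\ setT = \bigcup_n F i n, {homo F i : n m / (n <= m)%N >-> (n <= m)%O} &
     forall n, measurable (F i n) /\ (mu i (F i n) < +oo)%E]) -> uniq s ->
  exists2 m : {sigma_finite_measure set prodT -> \bar R},
  forall n, (m [set x : prodT | forall i, i \in s -> F i n (x i)] < +oo)%E &
  forall g : (forall i, T i -> \bar R), (forall i x, 0 <= g i x)%E ->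
    (forall i, @measurable_fun _ _ (T i) (\bar R) setT (g i)) ->
  (\int[m]_x \big[*%E/1%E]_(i <- s) g i (x i) = \big[*%E/1%E]_(i <- s) \int[mu i]_x g i x)%E.
Proof.
move=> HF; pose E (s' : seq I) n := [set x : prodT | forall i, i \in s' -> F i n (x i)].
have mE s' n : measurable (E s' n).
  rewrite (_ : E s' n = box (fun i => if i \in s' then F i n else setT)).
    by apply: measurable_box => i; case: ifP => // _; have [_ _ /(_ n)[]] := HF i.
  apply/seteqP; split=> x Ex i; first by case: ifPn => // /Ex.
  by move=> si; have := Ex i; rewrite si.
have EU s' : \bigcup_n E s' n = setT.
  apply/seteqP; split=> // x _.
  have /choice[k Hk] : forall i, exists k, F i k (x i).
    move=> i; have [FT _ _] := HF i.
    by have : [set: T i] (x i) by []; rewrite FT => -[k _ ?]; exists k.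
  exists (\max_i k i)%N => // i _; have [_ Fn _] := HF i.
  by apply: (subsetPset _ _ (Fn _ _ _)) (Hk i); exact: leq_bigmax.
elim: s => [_|i s IH /= /andP[iNs /IH[m m1 mE2]]].
  exists (\d_(point : prodT)) => [n|g g0 mg].
    exact: ltry.
  under eq_integral do rewrite big_nil.
  by rewrite big_nil integral_dirac// diracT mul1e.
pose phi (tx : T i * prodT) : prodT := dfwith tx.2 i tx.1.
have mphi : measurable_fun setT phi.
  apply: measurable_fun_prodT => k; rewrite /phi.
  have [<-|ik] := eqVneq i k.
    apply: (eq_measurable_fun (fun t => t.1)) => [t _|]; first by rewrite dfwithin.
    exact: measurable_fst.
  apply: (eq_measurable_fun (fun t : T i * prodT => t.2 k)) => [t _|]; first by rewrite dfwithout.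
  exact: measurable_fun_coord measurable_snd.
pose M := pushm (mu i \x m)%E mphi.
have Moo n : (M (E (i :: s) n) < +oo)%E.
  rewrite /M /= /pushm /pushforward.
  rewrite (_ : _ @^-1` _ = F i n `*` E s n); last first.
    apply/seteqP; split=> -[t x] /=.
      move=> h; split.
        by have := h i (mem_head _ _); rewrite /phi/= dfwithin.
      move=> k ks; have := h k; rewrite inE ks orbT => /(_ isT).
      by rewrite /phi/= dfwithout//; apply: contraNneq iNs => ->.
    move=> [ht hx] k; rewrite inE => /orP[/eqP->|ks].
      by rewrite /phi dfwithin.
    rewrite /phi dfwithout/=; first exact: hx.
    by apply: contraNneq iNs => ->.
  have [_ _ /(_ n)[mFn Foo]] := HF i.
  rewrite (product_measure1E (mu i) m mFn (mE s n)) lte_mul_pinfty ?ge0_fin_numE//; exact: m1.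
have Ms : sigma_finite setT M.
  by exists (E (i :: s)) => // n; split => //; exact: mE.
exists (sfm Ms) => [n|g g0 mg]; first exact: Moo.
rewrite big_cons /sfm /M ge0_integral_pushforward//; last 2 first.
- exact: measurable_fun_prode.
- by move=> x _; exact: mule_prod_ge0.
rewrite preimage_setT.
have phiE (tx : T i * prodT) : (\big[*%E/1%E]_(k <- i :: s) g k (phi tx k) =
    g i tx.1 * \big[*%E/1%E]_(k <- s) g k (tx.2 k))%E.
  rewrite big_cons /phi dfwithin; congr (_ * _)%E.
  apply: eq_big_seq => k ks; rewrite dfwithout//.
  by apply: contraNneq iNs => ->.
under eq_integral do rewrite /comp phiE.
have mP := measurable_fun_prode s mg.
rewrite (fubini_tonelli1 (m1 := mu i) (m2 := m) (fun tx => g i tx.1 * \big[*%E/1%E]_(k <- s) g k (tx.2 k))%E); last 2 first.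
- apply: emeasurable_funM; first exact: measurableT_comp (mg i) measurable_fst.
  exact: measurableT_comp mP measurable_snd.
- by move=> x; apply: mule_ge0 => //; exact: mule_prod_ge0.
rewrite /fubini_F /=.
under eq_integral => t _.
  rewrite ge0_integralZl//; last by move=> x _; exact: mule_prod_ge0.
  rewrite mE2//.
  over.
rewrite ge0_integralZr//.
by apply: mule_prod_ge0 => k; exact: integral_ge0.
Qed.

Lemma prod_indic (B : forall i, set (T i)) (x : prodT) :
  (\big[*%E/1%E]_i (\1_(B i) (x i))%:E = (\1_(box B) x)%:E :> \bar R)%E.
Proof.
rewrite !indicE; have [Bx|nBx] := pselect (box B x).
  rewrite mem_set// big1// => i _; rewrite indicE mem_set//; exact: Bx.
rewrite [in RHS]memNset//; move/existsNP : nBx => [i Bi].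
by rewrite (bigD1 i)//= indicE memNset// mul0e.
Qed.


Section SigmaFinite.
Variable mu : forall i, {sigma_finite_measure set (T i) -> \bar R}.

Let boxes := [set box B | B in [set B | forall i, measurable (B i)]].

Lemma sigma_boxes : @measurable _ prodT = <<s boxes >>.
Proof.
apply/seteqP; split; apply: smallest_sub; try exact: smallest_sigma_algebra.
- move=> _ [i [A [mA ->]]]; apply: sub_sigma_algebra.
  exists (dfwith (fun=> setT) i A).
    move=> k; have [<-|ik] := eqVneq i k; first by rewrite dfwithin.
    by rewrite dfwithout.
  apply/seteqP; split=> x; first by move=> /(_ i); rewrite dfwithin.
  move=> Ax k; have [<-|ik] := eqVneq i k; first by rewrite dfwithin.
  by rewrite dfwithout.
- by move=> _ [B mB <-]; exact: measurable_box.
Qed.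

Lemma prod_measure_unique (m1 m2 : {measure set prodT -> \bar R}) :
  (forall B, (forall i, measurable (B i)) ->
     m1 (box B) = \big[*%E/1%E]_i mu i (B i)) ->
  (forall B, (forall i, measurable (B i)) ->
     m2 (box B) = \big[*%E/1%E]_i mu i (B i)) ->
  forall A, measurable A -> m1 A = m2 A.
Proof.
move=> m1E m2E.
pose F i := projT1 (cid ((sigma_finiteP setT (mu i)).1 (sigma_finiteT (mu i)))).
have HF i := projT2 (cid ((sigma_finiteP setT (mu i)).1 (sigma_finiteT (mu i)))).
rewrite -/(F _) in HF.
move=> A mA; apply: (measure_unique boxes (fun n => box (fun i => F i n))) => //.
- exact: sigma_boxes.
- move=> _ _ [B1 mB1 <-] [B2 mB2 <-]; exists (fun i => B1 i `&` B2 i).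
    by move=> i; exact: measurableI.
  by apply/seteqP; split=> x; [move=> h; split=> i; case: (h i)|move=> [h1 h2] i].
- by move=> n; exists (fun i => F i n) => // i; have [_ _ /(_ n)[]] := HF i.
- apply/seteqP; split=> // x _.
  have /choice[k Hk] : forall i, exists k, F i k (x i).
    move=> i; have [FT _ _] := HF i.
    by have : [set: T i] (x i) by []; rewrite FT => -[k _ ?]; exists k.
  exists (\max_i k i)%N => // i; have [_ Fn _] := HF i.
  by apply: (subsetPset _ _ (Fn _ _ _)) (Hk i); exact: leq_bigmax.
- by move=> _ [B mB <-]; rewrite m1E// m2E.
- move=> n; rewrite /= m1E; last by move=> i; have [_ _ /(_ n)[]] := HF i.
  suff : (\big[*%E/1%E]_i mu i (F i n))%E \is a fin_num.
    by rewrite ge0_fin_numE// mule_prod_ge0.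
  elim/big_ind : _ => //; first exact: fin_numM.
  by move=> i _; rewrite ge0_fin_numE//; have [_ _ /(_ n)[]] := HF i.
Qed.

(** On a box, [pm] is at most the mass of the cover by that box alone, and at least [m] of the box
    because [m] is subadditive along any cover. Boxes determine a sigma-finite measure, so [pm] is
    the iterated product on measurable sets. *)
Lemma pm_exists : exists m : {sigma_finite_measure set prodT -> \bar R},
  (forall A, measurable A -> pm mu A = m A) /\
  forall g : (forall i, T i -> \bar R), (forall i x, 0 <= g i x)%E ->
    (forall i, @measurable_fun _ _ (T i) (\bar R) setT (g i)) ->
  (\int[m]_x \big[*%E/1%E]_i g i (x i) = \big[*%E/1%E]_i \int[mu i]_x g i x)%E.
Proof.
pose F i := projT1 (cid ((sigma_finiteP setT (mu i)).1 (sigma_finiteT (mu i)))).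
have HF i := projT2 (cid ((sigma_finiteP setT (mu i)).1 (sigma_finiteT (mu i)))).
rewrite -/(F _) in HF.
have [m _ mE] := prod_measure_exists HF (index_enum_uniq I).
exists m; split => // A mA.
have mbox B : (forall i, measurable (B i)) ->
     m (box B) = (\big[*%E/1%E]_i mu i (B i))%E.
  move=> mB; have := @mE (fun i x => (\1_(B i) x)%:E).
  under eq_integral do rewrite prod_indic.
  rewrite integral_indic// ?setIT; last exact: measurable_box.
  move=> -> //; last first.
    by move=> i; apply/measurable_EFinP; exact: measurable_indic.
  by apply: eq_bigr => i _; rewrite integral_indic// setIT.
apply: (prod_measure_unique _ mbox mA) => B mB; apply/eqP; rewrite eq_le; apply/andP; split.
  apply: ereal_inf_lbound; exists [set 0%N], (fun=> B); split => //.
    by move=> x Bx; exists 0%N.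
  by rewrite esum_set1//; exact: mule_prod_ge0.
apply: le_ereal_inf_tmp => _ [K [C [mC BC ->]]].
pose C' j := if j \in K then box (C j) else set0.
have mC' j : measurable (C' j).
  by rewrite /C'; case: ifP => // _; exact: measurable_box.
rewrite -mbox//; apply: (@le_trans _ _ (\sum_(j <oo) m (C' j))%E).
  apply: measure_sigma_subadditive => //; first exact: measurable_box.
  by move=> x /BC [j Kj Cx]; exists j => //; rewrite /C' mem_set.
rewrite nneseries_esumT// [leRHS]esum_mkcond.
apply: le_esum => j _; rewrite /C'; case: ifP => // _; last by rewrite measure0.
by rewrite mbox.
Qed.

Lemma pm_box B : (forall i, measurable (B i)) ->
  pm mu (box B) = (\big[*%E/1%E]_i mu i (B i))%E.
Proof.
move=> mB; have [m [pmE mE]] := pm_exists; rewrite pmE; last exact: measurable_box.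
have := @mE (fun i x => (\1_(B i) x)%:E).
under eq_integral do rewrite prod_indic.
rewrite integral_indic// ?setIT; last exact: measurable_box.
move=> -> //; last first.
  by move=> i; apply/measurable_EFinP; exact: measurable_indic.
by apply: eq_bigr => i _; rewrite integral_indic// setIT.
Qed.

Lemma pm_sigma_finite : sigma_finite setT (pm mu).
Proof.
have [m [mE _]] := pm_exists; have [F FT Foo] := sigma_finiteT m.
by exists F => // n; have [mF ?] := Foo n; rewrite mE.
Qed.

HB.instance Definition _ := Measure_isSigmaFinite.Build _ _ _ (pm mu) pm_sigma_finite.

Lemma pm_integral (g : forall i, T i -> \bar R) : (forall i x, 0 <= g i x)%E ->
    (forall i, @measurable_fun _ _ (T i) (\bar R) setT (g i)) ->
  (\int[pm mu]_x \big[*%E/1%E]_i g i (x i) = \big[*%E/1%E]_i \int[mu i]_x g i x)%E.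
Proof.
move=> g0 mg; have [m [pmE <-//]] := pm_exists.
by apply: eq_measure_integral => A mA _; exact: pmE.
Qed.

Lemma pm_unique (m : {measure set prodT -> \bar R}) :
  (forall B, (forall i, measurable (B i)) ->
     m (box B) = \big[*%E/1%E]_i mu i (B i)) ->
  forall A, measurable A -> m A = pm mu A.
Proof. by move=> mE; apply: prod_measure_unique => //; exact: pm_box. Qed.

End SigmaFinite.
End ProductMeasure.

(** * Lebesgue measure on row vectors *)

Section BorelRow.
Context {R : realType}.
Implicit Types (n k : nat).

Lemma mx_norm_ltP m n (x : 'M[R]_(m, n)) c : 0 < c ->
  `|x| < c <-> forall i j, `|x i j| < c.
Proof.
move=> c0; rewrite (_ : (`|x| < c : Prop) = ball (0 : 'M[R]_(m, n)) c x); last first.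
  rewrite (_ : ball _ _ _ = ball_ Num.norm 0 c x); first by rewrite /ball_ /= sub0r normrN.
  exact: (congr1 (fun g => g 0 c x) (@mx_norm_ball R m n)).
split=> [[_ h] i j|h]; first by have := h i j; rewrite /ball/= mxE sub0r normrN.
by split=> // i j; rewrite /ball/= mxE sub0r normrN.
Qed.

Lemma le_coord_norm m n (x : 'M[R]_(m, n)) i j : `|x i j| <= `|x|.
Proof.
apply/ler_addgt0Pr => e e0; apply/ltW; apply: (proj1 (mx_norm_ltP x _)).
  by rewrite (lt_le_trans e0)// lerDr.
by rewrite ltrDl.
Qed.

Lemma mx_norm_leP m n (x : 'M[R]_(m, n)) c : 0 <= c ->
  (forall i j, `|x i j| <= c) -> `|x| <= c.
Proof.
move=> c0 h; apply/ler_addgt0Pr => e e0; apply/ltW/mx_norm_ltP => [|i j].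
  by rewrite (lt_le_trans e0)// lerDr.
by rewrite (le_lt_trans (h _ _))// ltrDl.
Qed.

Definition cbox n (a b : 'rV[R]_n) : set (borelR n) :=
  [set u : 'rV[R]_n | forall i, a 0 i <= u 0 i <= b 0 i].

Lemma closed_cbox n (a b : 'rV[R]_n) : closed (cbox a b : set 'rV[R]_n).
Proof.
rewrite (_ : cbox a b = \bigcap_(i in setT)
    ((fun u : 'rV[R]_n => u 0 i) @^-1` [set x | a 0 i <= x <= b 0 i])); last first.
  by apply/seteqP; split=> [u h i _|u h i]; [exact: h|exact: (h i)].
apply: closed_bigI => i _; apply: closed_comp.
  by move=> u _; exact: coord_continuous.
by rewrite -set_itvcc; exact: itv_closed.
Qed.

Lemma borel_open n (A : set 'rV[R]_n) : open A -> measurable (A : set (borelR n)).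
Proof. by move=> oA; exact: sub_sigma_algebra. Qed.

Lemma borel_closed n (A : set 'rV[R]_n) : closed A -> measurable (A : set (borelR n)).
Proof.
by move=> cA; rewrite -[A]setCK; apply: measurableC; apply: borel_open; exact: closed_openC.
Qed.

Lemma measurable_cbox n (a b : 'rV[R]_n) : measurable (cbox a b).
Proof. by apply: borel_closed; exact: closed_cbox. Qed.

(** Boxes with rational corners. The last clause places each point in the interior of some box,
    which then has positive volume. *)
Lemma open_cbox_cover n (U : set 'rV[R]_n) : open U ->
  exists F : nat -> set (borelR n), [/\ U = \bigcup_k F k,
   forall k, F k = set0 \/ exists a b, F k = cbox a b &
   forall x, U x -> exists k a b, [/\ F k = cbox a b, forall i, a 0 i < x 0 i &
     forall i, x 0 i < b 0 i]].
Proof.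
move=> oU; pose I := ({ffun 'I_n -> rat} * {ffun 'I_n -> rat})%type.
pose B (p : I) : set (borelR n) := cbox (\row_i ratr (p.1 i)) (\row_i ratr (p.2 i)).
pose F k : set (borelR n) := if (unpickle k : option I) is Some p then
   (if pselect (B p `<=` U) then B p else set0) else set0.
have FU k : F k `<=` U 
  by rewrite /F; case: (unpickle k) => [p|]; [case: (pselect (B p `<=` U)) => BU|]; rewrite //=; exact: sub0set.
have cov x : U x -> exists k a b, [/\ F k x, F k = cbox a b, forall i, a 0 i < x 0 i &
     forall i, x 0 i < b 0 i].
  move=> Ux; have [e /= e0 xU] : exists2 e, 0 < e & ball (x : 'rV[R]_n) e `<=` U.
    by have := oU _ Ux => /nbhs_ballP[e /= e0 xU]; exists e.
  have /choice[q1 q1P] : forall i, exists q, x 0 i - e < ratr q < x 0 i.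
    move=> i; have /rat_in_itvoo[q] : x 0 i - e < x 0 i by rewrite ltrBlDr ltrDl.
    by rewrite in_itv; exists q.
  have /choice[q2 q2P] : forall i, exists q, x 0 i < ratr q < x 0 i + e.
    move=> i; have /rat_in_itvoo[q] : x 0 i < x 0 i + e by rewrite ltrDl.
    by rewrite in_itv; exists q.
  pose p : I := ([ffun i => q1 i], [ffun i => q2 i]).
  have Bp : B p `<=` U.
    move=> u Bu; apply: xU; split=> // i j; rewrite ord1 /ball /= ltr_distlC.
    have := Bu j; rewrite !mxE /= !ffunE.
    have /andP[+ _] := q1P j; have /andP[_ +] := q2P j; lra.
  have FB : F (pickle p) = B p by rewrite /F pickleK; case: (pselect (B p `<=` U)).
  exists (pickle p), (\row_i ratr (p.1 i)), (\row_i ratr (p.2 i)); rewrite FB; split => //.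
  - move=> i; rewrite !mxE /= !ffunE.
    have /andP[_ +] := q1P i; have /andP[+ _] := q2P i; lra.
  - by move=> i; rewrite !mxE ffunE; have /andP[] := q1P i.
  - by move=> i; rewrite !mxE ffunE; have /andP[] := q2P i.
exists F; split.
- apply/seteqP; split=> [x Ux|x [k _]]; last exact: FU.
  by have [k [a [b [Fk _ _ _]]]] := cov x Ux; exists k.
- move=> k; rewrite /F; case: unpickle => [p|]; last by left.
  by case: (pselect (B p `<=` U)) => ?; [right; exists (\row_i ratr (p.1 i)), (\row_i ratr (p.2 i))|left].
- by move=> x /cov[k [a [b [_ ? ? ?]]]]; exists k, a, b.
Qed.

(** The empty set is included to make the system stable under intersection, as the uniqueness of
    measures requires. *)
Definition cboxes n : set (set (borelR n)) :=
  [set A | A = set0 \/ exists a b : 'rV[R]_n, (forall i, a 0 i <= b 0 i) /\ A = cbox a b].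

Lemma cbox_in_cboxes n (a b : 'rV[R]_n) : cboxes (cbox a b).
Proof.
have [h|/existsNP[i abi]] := pselect (forall i, a 0 i <= b 0 i).
  by right; exists a, b.
by left; apply/seteqP; split=> // x /(_ i); move/negP: abi; lra.
Qed.

Lemma sigma_cboxes n : @measurable _ (borelR n) = <<s @cboxes n >>.
Proof.
apply/seteqP; split; apply: smallest_sub; try exact: smallest_sigma_algebra.
- move=> U /open_cbox_cover[F [-> FP _]].
  apply: (@bigcup_measurable _ (g_sigma_algebraType (@cboxes n))) => k _.
  apply: sub_sigma_algebra; have [->|[a [b ->]]] := FP k; first by left.
  exact: cbox_in_cboxes.
- by move=> _ [->|[a [b [_ ->]]]]; [exact: measurable0|exact: measurable_cbox].
Qed.

Lemma measurable_coordR n i : measurable_fun setT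
  (fun u : borelR n => u 0 i : measurableTypeR R).
Proof.
apply: (measurability (@RGenOInfty.G R)); first exact: RGenOInfty.measurableE.
move=> _ [_ [x ->] <-]; rewrite setTI; apply: borel_open.
rewrite (_ : [set` _] = [set t | x < t]); last by apply/seteqP; split=> t /=; rewrite in_itv/= andbT.
apply: open_comp; last exact: open_gt.
by move=> u _; exact: coord_continuous.
Qed.

Lemma measurable_fun_borel d (T : measurableType d) n (D : set T) (f : T -> borelR n) :
  (forall i, measurable_fun D (fun t => f t 0 i : measurableTypeR R)) ->
  measurable_fun D f.
Proof.
move=> mf mD; apply: (measurability (@cboxes n)) => //; first exact: sigma_cboxes.
move=> _ [_ [->|[a [b [_ ->]]]] <-]; first by rewrite preimage_set0 setI0.
rewrite (_ : D `&` _ = \bigcap_(i in setT) (D `&` (fun t => f t 0 i) @^-1` `[a 0 i, b 0 i]) `&` D); last first.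
  apply/seteqP; split=> [x [Dx h]|x [h Dx]].
    by split=> // i _; split=> //=; rewrite in_itv /=; exact: h.
  by split=> // i; have [//|_] := h i; rewrite /= in_itv.
apply: measurableI => //; apply: fin_bigcap_measurable => // i _.
exact: mf.
Qed.

Lemma continuous_on_measurable n (Y : topologicalType) (O : set 'rV[R]_n) (f : 'rV[R]_n -> Y) A :
  open O -> (forall x, O x -> {for x, continuous f}) -> open A -> open (O `&` f @^-1` A).
Proof.
move=> oO cf oA; rewrite openE => x [Ox Ax]; apply: filterI; first exact: oO.
by apply: cf => //; exact: open_nbhs_nbhs.
Qed.

Lemma measurable_fun_cont n (O : set 'rV[R]_n) (f : 'rV[R]_n -> R) :
  open O -> (forall x, O x -> {for x, continuous f}) ->
  measurable_fun (O : set (borelR n)) (f : borelR n -> measurableTypeR R).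
Proof.
move=> oO cf mO; apply: (measurability (@RGenOInfty.G R)) => //; first exact: RGenOInfty.measurableE.
move=> _ [_ [x ->] <-]; apply: borel_open; apply: continuous_on_measurable => //.
Qed.

Lemma measurable_fun_cont_row n m (O : set 'rV[R]_n) (f : 'rV[R]_n -> 'rV[R]_m) :
  open O -> (forall x, O x -> {for x, continuous f}) ->
  measurable_fun (O : set (borelR n)) (f : borelR n -> borelR m).
Proof.
move=> oO cf mO; apply: (@measurability _ _ (borelR n) (borelR m) O f (@open 'rV[R]_m)) => //.
move=> _ [A oA <-]; apply: borel_open; exact: continuous_on_measurable.
Qed.

End BorelRow.

Section Lebesgue.
Context {R : realType}.
Local Notation mu1 := (@lebesgue_measure R).

Let rowf n (x : @prodT 'I_n _ (fun=> measurableTypeR R)) : borelR n := \row_i x i.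

Let measurable_rowf n : measurable_fun setT (@rowf n).
Proof.
apply: measurable_fun_borel => i.
rewrite [X in measurable_fun _ X](_ : _ = (fun x => x i)).
  exact: (@measurable_coord _ _ (fun=> measurableTypeR R)).
by apply/funext => x; rewrite mxE.
Qed.

Let pmR n : {sigma_finite_measure set (@prodT 'I_n _ (fun=> measurableTypeR R)) -> \bar R} :=
  pm (fun=> mu1 : {sigma_finite_measure set (measurableTypeR R) -> \bar R}).

(** By conversion, [leb] is the image of the product measure under [rowf] and inherits its measure
    structure. *)
HB.instance Definition _ n := Measure.copy (@leb R n) (pushm (pmR n) (@measurable_rowf n)).

Lemma leb_boxE n (B : 'I_n -> set R) : (forall i, measurable (B i)) ->
  leb [set u : borelR n | forall i, B i (u 0 i)] = (\big[*%E/1%E]_i mu1 (B i))%E.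
Proof.
move=> mB; have <- := pm_box (fun=> mu1 : {sigma_finite_measure set (measurableTypeR R) -> \bar R}) mB.
rewrite /leb; congr (prod_measure _ _ _).
by apply/seteqP; split=> x h i; have := h i; rewrite mxE.
Qed.

Lemma leb_cbox n (a b : 'rV[R]_n) : (forall i, a 0 i <= b 0 i) ->
  leb (cbox a b) = (\prod_i (b 0 i - a 0 i))%:E.
Proof.
move=> ab; rewrite -prodEFin.
rewrite (_ : cbox a b = [set u : borelR n | forall i, `[a 0 i, b 0 i]%classic (u 0 i)]); last first.
  by apply/seteqP; split=> u h i; have := h i; rewrite /= in_itv.
rewrite (leb_boxE (B := fun i => `[a 0 i, b 0 i]%classic))//; apply: eq_bigr => i _; rewrite lebesgue_measure_itv /= lte_fin.
by case: ltgtP (ab i) => // -> _; rewrite subrr.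
Qed.

Definition cube n k : set (@borelR R n) := cbox (const_mx (- k%:R)) (const_mx k%:R).
Arguments cube n k : clear implicits.

Lemma cube_cover n : \bigcup_k (cube n k) = setT.
Proof.
apply/seteqP; split=> // u _; exists (Num.bound `|u|) => // i; rewrite !mxE -ler_norml.
apply: le_trans (le_coord_norm _ _ _) _; apply: ltW; exact: archi_boundP.
Qed.

Lemma leb_sigma_finite n : sigma_finite setT (@leb R n).
Proof.
exists (cube n) => [|k]; first by rewrite cube_cover.
split; first exact: measurable_cbox.
by rewrite leb_cbox ?ltry// => i; rewrite !mxE; have : 0 <= k%:R :> R by []; lra.
Qed.

HB.instance Definition _ n := Measure_isSigmaFinite.Build _ _ _ (@leb R n) (@leb_sigma_finite n).

Lemma leb_unique2 n (m1 m2 : {measure set (borelR n) -> \bar R}) :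
  (forall k, m1 (cube n k) < +oo)%E ->
  (forall a b : 'rV[R]_n, (forall i, a 0 i <= b 0 i) -> m1 (cbox a b) = m2 (cbox a b)) ->
  forall A, measurable A -> m1 A = m2 A.
Proof.
move=> m1oo m12 A mA; apply: (measure_unique (@cboxes R n) (cube n)) => //.
- exact: sigma_cboxes.
- move=> _ _ [->|[a [b [_ ->]]]] [->|[a' [b' [_ ->]]]]; rewrite ?setI0 ?set0I; try by left.
  rewrite (_ : _ `&` _ = cbox (\row_i Num.max (a 0 i) (a' 0 i)) (\row_i Num.min (b 0 i) (b' 0 i))).
    exact: cbox_in_cboxes.
  apply/seteqP; split=> u.
    by move=> [h1 h2] i; rewrite !mxE ge_max le_min; move: (h1 i) (h2 i) => /andP[-> ->] /andP[-> ->].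
  by move=> h; split=> i; have := h i; rewrite !mxE ge_max le_min => /andP[/andP[? ?] /andP[? ?]]; apply/andP.
- by move=> k; exact: cbox_in_cboxes.
- exact: cube_cover.
- by move=> _ [->|[a [b [ab ->]]]]; rewrite ?measure0// m12.
Qed.

Lemma leb_unique n (m : {measure set (borelR n) -> \bar R}) :
  (forall a b : 'rV[R]_n, (forall i, a 0 i <= b 0 i) -> m (cbox a b) = (\prod_i (b 0 i - a 0 i))%:E) ->
  forall A, measurable A -> leb A = m A.
Proof.
move=> mE; apply: leb_unique2 => [k|a b ab]; last by rewrite mE//= leb_cbox.
by rewrite /= leb_cbox ?ltry// => i; rewrite !mxE; have : 0 <= k%:R :> R by []; lra.
Qed.

Lemma leb_trans n (v : 'rV[R]_n) (A : set (borelR n)) : measurable A ->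
  leb [set u | A (u + v)] = leb A.
Proof.
move=> mA.
have mf : measurable_fun setT (fun u : borelR n => u + v : borelR n).
  apply: (@measurable_fun_cont_row R n n setT (fun u => u + v)); first exact: openT.
  by move=> x _; exact: (cvgD cvg_id (cvg_cst v)).
transitivity (pushm (@leb R n) mf A) => //; apply/esym; apply: leb_unique mA => a b ab.
rewrite /pushm /pushforward /=.
rewrite (_ : _ @^-1` _ = cbox (a - v) (b - v)).
  rewrite leb_cbox; last by move=> i; rewrite !mxE lerD2r.
  by congr (_%:E); apply: eq_bigr => i _; rewrite !mxE; ring.
by apply/seteqP; split=> u h i; have := h i; rewrite !mxE lerBlDr lerBrDr.
Qed.

Definition ins n (i : 'I_n.+1) (y : 'rV[R]_n) (s : R) : 'rV[R]_n.+1 :=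
  \row_j (if unlift i j is Some k then y 0 k else s).

Lemma ins_eq n (i : 'I_n.+1) y s : ins i y s 0 i = s.
Proof. by rewrite mxE unlift_none. Qed.

Lemma ins_lift n (i : 'I_n.+1) y s k : ins i y s 0 (lift i k) = y 0 k.
Proof. by rewrite mxE liftK. Qed.

Lemma ins_col' n (i : 'I_n.+1) (u : 'rV[R]_n.+1) : ins i (col' i u) (u 0 i) = u.
Proof.
apply/rowP => j; rewrite mxE; case: unliftP => [k ->|->//]; by rewrite mxE.
Qed.

Lemma measurable_ins n (i : 'I_n.+1) :
  measurable_fun setT (fun p : borelR n * measurableTypeR R => ins i p.1 p.2 : borelR n.+1).
Proof.
apply: measurable_fun_borel => j.
rewrite [X in measurable_fun _ X](_ : _ =
   (fun p : borelR n * measurableTypeR R => if unlift i j is Some k then p.1 0 k else p.2)); last first.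
  by apply/funext => p; rewrite mxE.
case: unliftP => [k _|_]; last exact: measurable_snd.
have H := measurableT_comp (@measurable_coordR R n k) (@measurable_fst _ _ (borelR n) (measurableTypeR R)).
exact: H.
Qed.

Lemma leb_ins n (i : 'I_n.+1) A : measurable A ->
  leb A = (@leb R n \x mu1)%E [set p | A (ins i p.1 p.2)].
Proof.
apply: (leb_unique (m := pushm (@leb R n \x mu1)%E (@measurable_ins n i))) => a b ab.
rewrite /pushm /pushforward /=.
rewrite (_ : _ @^-1` _ = cbox (col' i a) (col' i b) `*` `[a 0 i, b 0 i]%classic); last first.
  apply/seteqP; split=> -[y s] /=.
    move=> h; split; last by have := h i; rewrite /= ins_eq in_itv.
    by move=> k; have := h (lift i k); rewrite /= ins_lift !mxE.
  move=> [h1 h2] j; case: (unliftP i j) => [k ->|->].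
    by have := h1 k; rewrite /= ins_lift !mxE.
  by rewrite /= ins_eq; move: h2; rewrite in_itv.
rewrite /= product_measure1E//; last exact: measurable_cbox.
rewrite /= leb_cbox; last by move=> k; rewrite !mxE.
rewrite lebesgue_measure_itv /= lte_fin (bigD1_ord i)//= mulrC EFinM.
congr (_ * _)%E; first by congr (_%:E); apply: eq_bigr => k _; rewrite !mxE.
by case: ltgtP (ab i) => // -> _; rewrite subrr.
Qed.

Lemma leb_row_mx n m A : measurable A ->
  leb A = (@leb R n \x @leb R m)%E [set p : 'rV[R]_n * 'rV[R]_m | A (row_mx p.1 p.2)].
Proof.
have mrow : measurable_fun setT (fun p : @borelR R n * @borelR R m => row_mx p.1 p.2 : @borelR R (n + m)).
  apply: measurable_fun_borel => j.
  rewrite [X in measurable_fun _ X](_ : _ =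
   (fun p : @borelR R n * @borelR R m => match fintype.split j with inl k => p.1 0 k | inr k => p.2 0 k end)); last first.
    by apply/funext => p; rewrite mxE.
  case: fintype.splitP => k _.
    have H := measurableT_comp (@measurable_coordR R n k) (@measurable_fst _ _ (@borelR R n) (@borelR R m)).
    exact: H.
  have H := measurableT_comp (@measurable_coordR R m k) (@measurable_snd _ _ (@borelR R n) (@borelR R m)).
  exact: H.
apply: (leb_unique (m := pushm (@leb R n \x @leb R m)%E mrow)) => a b ab.
rewrite /pushm /pushforward /=.
rewrite (_ : _ @^-1` _ = cbox (lsubmx a) (lsubmx b) `*` cbox (rsubmx a) (rsubmx b)); last first.
  apply/seteqP; split=> -[y s] /=.
    move=> h; split=> k; first by have := h (lshift m k); rewrite /= row_mxEl !mxE.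
    by have := h (rshift n k); rewrite /= row_mxEr !mxE.
  move=> [h1 h2] j; case: (fintype.split_ordP j) => k ->.
    by have := h1 k; rewrite /= row_mxEl !mxE.
  by have := h2 k; rewrite /= row_mxEr !mxE.
rewrite /= product_measure1E//; [|exact: measurable_cbox..].
rewrite /= !leb_cbox; [|by move=> k; rewrite !mxE..].
rewrite big_split_ord /= EFinM.
by congr ((_ %:E * _ %:E)%E); apply: eq_bigr => k _; rewrite !mxE.
Qed.

(** An empty product is 1: R^0 is a point of mass 1. The recursion on the dimension of a zonotope
    ends here. *)
Lemma leb0 (A : set (borelR 0)) (u : 'rV[R]_0) : A u -> leb A = 1%E.
Proof.
move=> Au; have -> : A = cbox 0 0.
  apply/seteqP; split=> [v _ []//|v _]; by rewrite (_ : v = u)//; apply/rowP => -[].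
by rewrite leb_cbox; [rewrite big_ord0|case].
Qed.

Lemma leb_open_gt0 n (A : set 'rV[R]_n) : open A -> A !=set0 -> (0 < leb (A : set (borelR n)))%E.
Proof.
move=> oA [x Ax]; have [F [AF _ /(_ x Ax)[k [a [b [Fk ax xb]]]]]] := open_cbox_cover oA.
apply: (@lt_le_trans _ _ (leb (cbox a b))).
  rewrite leb_cbox; last by move=> i; have := ax i; have := xb i; lra.
  by rewrite lte_fin; apply: prodr_gt0 => i _; have := ax i; have := xb i; lra.
apply: le_measure; rewrite ?inE; [exact: measurable_cbox|exact: borel_open|].
by rewrite AF -Fk; exact: bigcup_sup.
Qed.

Lemma leb_bounded n (A : set (borelR n)) (M : R) : measurable A ->
  (forall u, A u -> `|u : 'rV[R]_n| <= M) -> (leb A < +oo)%E.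
Proof.
move=> mA AM; apply: (@le_lt_trans _ _ (leb (cube n (Num.bound `|M|)))).
  apply: le_measure; rewrite ?inE //; first exact: measurable_cbox.
  move=> u /AM uM i; rewrite !mxE -ler_norml (le_trans (le_coord_norm _ _ _))//.
  rewrite (le_trans uM)// (le_trans (ler_norm _))// ltW//; exact: archi_boundP.
by rewrite leb_cbox ?ltry// => i; rewrite !mxE; have : 0 <= (Num.bound `|M|)%:R :> R by []; lra.
Qed.

End Lebesgue.

(** * Volume of zonotopes *)

Section RowTopology.
Context {R : realType}.

Lemma cvg_row (T : Type) (F : set_system T) (FF : Filter F) n (f : T -> 'rV[R]_n) (l : 'rV[R]_n) :
  (forall i, (fun t => f t 0 i) @ F --> l 0 i) -> f @ F --> l.
Proof.
move=> h; apply/cvgrPdist_lt => e e0.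
have : \forall t \near F, forall i, `|l 0 i - f t 0 i| < e.
  by apply: filter_forall => i; move/cvgrPdist_lt: (h i) => /(_ e e0).
by apply: filterS => t ht; apply/mx_norm_ltP => // i j; rewrite ord1 !mxE.
Qed.

Lemma continuous_row (T : topologicalType) n (f : T -> 'rV[R]_n) x :
  (forall i, {for x, continuous (fun t => f t 0 i)}) -> {for x, continuous f}.
Proof. by move=> h; apply: cvg_row => i; exact: h. Qed.

Lemma continuous_coord (T : topologicalType) n (f : T -> 'rV[R]_n) x i :
  {for x, continuous f} -> {for x, continuous (fun t => f t 0 i)}.
Proof.
move=> cf; have := @continuous_comp _ _ _ f (fun u : 'rV[R]_n => u 0 i) x cf.
by apply; exact: coord_continuous.
Qed.

Lemma eq_continuous_at (T U : topologicalType) (f g : T -> U) x : f =1 g ->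
  {for x, continuous f} -> {for x, continuous g}.
Proof. by move=> /funext ->. Qed.

Lemma continuous_bigsum (T : topologicalType) (I : Type) (r : seq I) (P : pred I) (f : I -> T -> R) x :
  (forall i, {for x, continuous (f i)}) -> {for x, continuous (fun t => \sum_(i <- r | P i) f i t)}.
Proof.
move=> cf; elim: r => [|i r IH].
  by apply: (@eq_continuous_at T R (fun=> 0)); [move=> t; rewrite big_nil|exact: cst_continuous].
apply: (@eq_continuous_at _ _ (fun t => (if P i then f i t else 0) + \sum_(i <- r | P i) f i t)).
  by move=> t; rewrite big_cons; case: ifP; rewrite ?add0r.
apply: (@continuousD _ R) => //; case: (P i); first exact: cf.
exact: cst_continuous.
Qed.

Lemma continuous_bigprod (T : topologicalType) (I : Type) (r : seq I) (P : pred I) (f : I -> T -> R) x :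
  (forall i, {for x, continuous (f i)}) -> {for x, continuous (fun t => \prod_(i <- r | P i) f i t)}.
Proof.
move=> cf; elim: r => [|i r IH].
  by apply: (@eq_continuous_at T R (fun=> 1)); [move=> t; rewrite big_nil|exact: cst_continuous].
apply: (@eq_continuous_at _ _ (fun t => (if P i then f i t else 1) * \prod_(i <- r | P i) f i t)).
  by move=> t; rewrite big_cons; case: ifP; rewrite ?mul1r.
apply: continuousM => //; case: (P i); first exact: cf.
exact: cst_continuous.
Qed.

Lemma continuous_det (T : topologicalType) n (f : T -> 'M[R]_n) x :
  (forall i j, {for x, continuous (fun t => f t i j)}) -> {for x, continuous (fun t => \det (f t))}.
Proof.
move=> cf; rewrite /determinant; apply: continuous_bigsum => s.
apply: continuousM; first exact: cst_continuous.
exact: continuous_bigprod.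
Qed.

Lemma continuous_mulmx n m (X : 'M[R]_(n, m)) : continuous (fun u : 'rV[R]_n => u *m X).
Proof.
move=> u; apply: continuous_row => j.
apply: (@eq_continuous_at _ _ (fun t : 'rV[R]_n => \sum_i t 0 i * X i j)).
  by move=> t; rewrite mxE.
apply: continuous_bigsum => i; apply: continuousM; last exact: cst_continuous.
exact: coord_continuous.
Qed.

Lemma compact_cbox n (a b : 'rV[R]_n) : compact (cbox a b : set 'rV[R]_n).
Proof.
rewrite (_ : cbox a b = [set v : 'rV[R]_n | forall i, `[a 0 i, b 0 i]%classic (v ord0 i)]).
  by apply: (@rV_compact R n (fun i => `[a 0 i, b 0 i]%classic)) => i; exact: segment_compact.
by apply/seteqP; split=> u h i; have := h i; rewrite /= in_itv.
Qed.

Lemma compact_image (T U : topologicalType) (f : T -> U) (A : set T) :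
  (forall x, A x -> {for x, continuous f}) -> compact A -> compact (f @` A).
Proof.
move=> cf; apply: continuous_compact.
apply: continuous_in_subspaceT => x; rewrite inE; exact: cf.
Qed.

Lemma compact_borel n (K : set 'rV[R]_n) : compact K -> measurable (K : set (borelR n)).
Proof. by move=> cK; apply: borel_closed; apply: compact_closed => //; exact: norm_hausdorff. Qed.

Lemma compact_interval (S : set R) : compact S -> S !=set0 ->
  (forall a b c, S a -> S b -> a <= c <= b -> S c) ->
  exists a b, a <= b /\ S = `[a, b]%classic.
Proof.
move=> cS S0 conv.
have [a + amin] := compact_EVT_min S0 cS (continuous_subspaceT (fun x => cvg_id)).
have [b + bmax] := compact_EVT_max S0 cS (continuous_subspaceT (fun x => cvg_id)).
rewrite !inE => Sb Sa; exists a, b; split; first by apply: amin; rewrite inE.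
apply/seteqP; split=> x; rewrite /= in_itv /=; last exact: conv.
by move=> Sx; rewrite amin ?bmax ?inE.
Qed.

End RowTopology.

Section Zonotope.
Context {R : realType}.
Local Notation mu1 := (@lebesgue_measure R).

Definition zon n N (X : 'M[R]_(N, n)) : set (borelR n) :=
  (fun s : 'rV[R]_N => s *m X) @` cbox (const_mx (-1)) (const_mx 1).

Lemma compact_zon n N (X : 'M[R]_(N, n)) : compact (zon X : set 'rV[R]_n).
Proof.
apply: compact_image; last exact: compact_cbox.
by move=> s _; exact: continuous_mulmx.
Qed.

Lemma cube_convex n (s t : 'rV[R]_n) k : 0 <= k <= 1 ->
  cbox (const_mx (-1)) (const_mx 1) s -> cbox (const_mx (-1)) (const_mx 1) t ->
  cbox (const_mx (-1)) (const_mx 1) ((1 - k) *: s + k *: t).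
Proof. by move=> hk hs ht i; move: (hs i) (ht i); rewrite !mxE; nra. Qed.

Definition cvx n (K : set 'rV[R]_n) := forall u v k, K u -> K v -> 0 <= k <= 1 ->
  K ((1 - k) *: u + k *: v).

Lemma cvx_zon n N (X : 'M[R]_(N, n)) : cvx (zon X).
Proof.
move=> _ _ k [s hs <-] [t ht <-] hk; exists ((1 - k) *: s + k *: t).
  exact: cube_convex.
by rewrite mulmxDl -!scalemxAl.
Qed.

(** On each slice where [s] is constant the shear is a translation; hence the integral over [s] is
    taken last. *)
Lemma leb_shear n (i : 'I_n.+1) (v : 'rV[R]_n) A : measurable A ->
  leb A = (@leb R n \x mu1)%E [set p | A (ins i (p.1 + p.2 *: v) p.2)].
Proof.
move=> mA; rewrite (leb_ins i mA).
have swap B : measurable B -> (@leb R n \x mu1)%E B = (@leb R n \x^ mu1)%E B.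
  by move=> mB; apply: product_measure_unique => // C D mC mD; rewrite /= product_measure2E.
have mi : measurable [set p : borelR n * measurableTypeR R | A (ins i p.1 p.2)].
  by rewrite -[X in measurable X]setTI; exact: measurable_ins.
have msh : measurable_fun setT (fun p : borelR n * measurableTypeR R =>
    (p.1 + p.2 *: v, p.2) : borelR n * measurableTypeR R).
  apply/measurable_fun_pairP; split; last exact: measurable_snd.
  apply: measurable_fun_borel => k.
  rewrite [X in measurable_fun _ X](_ : _ = (fun p : borelR n * measurableTypeR R => p.1 0 k + p.2 * v 0 k)); last first.
    by apply/funext => p; rewrite !mxE.
  apply: measurable_funD.
    have H := measurableT_comp (@measurable_coordR R n k) (@measurable_fst _ _ (borelR n) (measurableTypeR R)).
    exact: H.
  by apply: measurable_funM => //; exact: measurable_snd.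
have ms : measurable [set p : borelR n * measurableTypeR R | A (ins i (p.1 + p.2 *: v) p.2)].
  have := msh measurableT _ mi; by rewrite setTI.
rewrite (swap _ mi) (swap _ ms) /product_measure2; apply: eq_integral => s _ /=.
have := @leb_trans R n (s *: v) (ysection [set p | A (ins i p.1 p.2)] s) _.
move=> <-; last exact: measurable_ysection.
congr (leb _); apply/seteqP; split=> y; by rewrite /ysection /= !inE.
Qed.

(** Cavalieri along [w]: [K'] is [K] plus the segment [-w, w], and [P] projects along [w]. Each line
    parallel to [w] meets the convex compact [K] in an interval or not at all, and passing to [K']
    lengthens every nonempty interval by the same amount. *)
Lemma leb_add_segment n (i : 'I_n.+1) (w : 'rV[R]_n.+1) (K K' : set 'rV[R]_n.+1) (P : 'M[R]_(n.+1, n)) :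
  w 0 i != 0 -> compact K -> compact K' -> cvx K ->
  (forall u : 'rV[R]_n.+1, u *m P = col' i (u - (u 0 i / w 0 i) *: w) :> 'rV[R]_n) ->
  (forall u : 'rV[R]_n.+1, K' u <-> exists k : R, -1 <= k <= 1 /\ K (u - k *: w)) ->
  @leb R n.+1 K' = (@leb R n.+1 K + (2 * `|w 0 i|)%:E * @leb R n [set u *m P | u in K])%E.
Proof.
move=> w0 cK cK' vK PE K'E.
pose v := (w 0 i)^-1 *: col' i w.
(* [L y] runs along the line through [y] with direction [w], and its parameter is the i-th
   coordinate. *)
pose L y s := ins i y 0 + (s / w 0 i) *: w.
have LE y s : ins i (y + s *: v) s = L y s.
  apply/rowP => j; rewrite !mxE; case: unliftP => [k ->|->]; last by rewrite add0r divfK.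
  by rewrite !mxE mulrA.
have Li y s : L y s 0 i = s by rewrite !mxE unlift_none add0r divfK.
have LP y s : L y s *m P = y.
  rewrite PE Li; apply/rowP => k; by rewrite !mxE liftK addrK.
have LK u : L (u *m P) (u 0 i) = u.
  apply/rowP => j; rewrite PE !mxE; case: unliftP => [k ->|->]; last by rewrite add0r divfK.
  by rewrite !mxE subrK.
pose S (A : set 'rV[R]_n.+1) y := [set s : R | A (L y s)].
have lebS (A : set 'rV[R]_n.+1) : compact A -> @leb R n.+1 A = (\int[@leb R n]_y mu1 (S A y))%E /\
     measurable_fun setT (fun y : borelR n => mu1 (S A y)).
  move=> /compact_borel mA.
  have mA' : measurable [set p : borelR n * measurableTypeR R | A (ins i (p.1 + p.2 *: v) p.2)].
    have mf : measurable_fun setT (fun p : borelR n * measurableTypeR R => ins i (p.1 + p.2 *: v) p.2 : borelR n.+1).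
      apply: measurable_fun_borel => j.
      rewrite [X in measurable_fun _ X](_ : _ = (fun p : borelR n * measurableTypeR R =>
        (if unlift i j is Some k then p.1 0 k else 0) + p.2 / w 0 i * w 0 j)); last first.
        by apply/funext => p; rewrite LE !mxE.
      apply: measurable_funD; last first.
        by do 2 apply: measurable_funM => //; exact: measurable_snd.
      case: unliftP => // k _.
      have H := measurableT_comp (@measurable_coordR R n k) (@measurable_fst _ _ (borelR n) (measurableTypeR R)).
      exact: H.
    by have := mf measurableT _ mA; rewrite setTI.
  have SE y : S A y = xsection [set p : borelR n * measurableTypeR R | A (ins i (p.1 + p.2 *: v) p.2)] y.
    by apply/seteqP; split=> s; rewrite /S /xsection /= inE /= LE.
  split.
    rewrite (leb_shear i v mA) /product_measure1; apply: eq_integral => y _ /=.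
    by rewrite SE.
  under eq_fun do rewrite SE; exact: measurable_fun_xsection.
have [-> mS] := lebS K cK; have [-> mS'] := lebS K' cK'.
have cPK : compact [set u *m P | u in K].
  by apply: compact_image cK => u _; exact: continuous_mulmx.
have mPK := compact_borel cPK.
have -> : ((2 * `|w 0 i|)%:E * @leb R n [set u *m P | u in K] =
   \int[@leb R n]_y ((2 * `|w 0 i|)%:E * (\1_([set u *m P | u in K] : set (borelR n)) y)%:E))%E.
  rewrite ge0_integralZl//; last by apply/measurable_EFinP; exact: measurable_indic.
  by rewrite integral_indic// setIT.
rewrite -ge0_integralD//; last first.
  by apply: emeasurable_funM => //; apply/measurable_EFinP; exact: measurable_indic.
apply: eq_integral => y _.
have wa : 0 < `|w 0 i| by rewrite normr_gt0.
have S'E s : S K' y s <-> exists k, -1 <= k <= 1 /\ S K y (s - k * w 0 i).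
  rewrite /S /= K'E; split=> -[k [k1 Kk]]; exists k; split=> //; move: Kk;
    by rewrite /L mulrBl mulfK// scalerBl addrA.
have [yK|nyK] := pselect ([set u *m P | u in K] y); last first.
  have S0 : S K y = set0.
    by apply/seteqP; split=> // s Ks; apply: nyK; exists (L y s).
  have -> : S K' y = set0.
    by apply/seteqP; split=> // s /S'E[k [_]]; rewrite S0.
  by rewrite S0 measure0 indicE memNset// mule0 adde0.
have [a [b [ab SE]]] : exists a b, a <= b /\ S K y = `[a, b]%classic.
  apply: compact_interval.
  - have -> : S K y = (fun u : 'rV[R]_n.+1 => u 0 i) @` (K `&` [set u | u *m P = y]).
      apply/seteqP; split=> [s Ks|_ [u [Ku uy] <-]]; last by rewrite /S /= -uy LK.
      by exists (L y s); rewrite ?Li; split=> //; exact: LP.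
    apply: compact_image; first by move=> u _; exact: coord_continuous.
    apply: compact_closedI => //; rewrite [X in closed X](_ : _ = (fun u => u *m P) @^-1` [set y])//.
    apply: closed_comp; first by move=> u _; exact: continuous_mulmx.
    by apply: compact_closed; [exact: norm_hausdorff|exact: compact_set1].
  - by case: yK => u Ku <-; exists (u 0 i); rewrite /S /= LK.
  - move=> s1 s2 s h1 h2 /andP[s1s ss2]; have [s12|] := eqVneq s1 s2.
      by rewrite (_ : s = s1)//; move: s1s ss2; rewrite -s12; lra.
    move=> s12; have s12' : 0 < s2 - s1 by move: s12; rewrite lt_def subr_eq0 eq_sym => -> /=; lra.
    have := vK _ _ ((s - s1) / (s2 - s1)) h1 h2.
    have k01 : 0 <= (s - s1) / (s2 - s1) <= 1.
      by rewrite divr_ge0 ?ler_pdivrMr//=; lra.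
    move=> /(_ k01); rewrite /S /=; congr K.
    apply/rowP => j; rewrite !mxE; move: (unlift i j) => o; field.
    by apply/andP; split => //; lra.
(* In the parameter [s] the segment [-w, w] has length 2|w_i|, so the interval grows by |w_i| at
   each end. *)
have -> : S K' y = `[a - `|w 0 i|, b + `|w 0 i|]%classic.
  apply/seteqP; split=> s.
    move=> /S'E[k [k1]]; rewrite SE /= !in_itv /=.
    have : `|k * w 0 i| <= `|w 0 i| by rewrite normrM ler_piMl// ler_norml.
    rewrite ler_norml; lra.
  rewrite /= in_itv /= => hs; apply/S'E; rewrite SE /=.
  have [sa|as_] := ltP s a.
    exists ((s - a) / w 0 i); rewrite divfK// subKr in_itv /= lexx ab; split => //.
    rewrite -ler_norml normrM normfV ler_pdivrMr// mul1r ler_norml; lra.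
  have [bs|sb] := ltP b s.
    exists ((s - b) / w 0 i); rewrite divfK// subKr in_itv /= lexx ab; split => //.
    rewrite -ler_norml normrM normfV ler_pdivrMr// mul1r ler_norml; lra.
  by exists 0; rewrite mul0r subr0 in_itv /= as_ sb; split => //; lra.
rewrite SE !lebesgue_measure_itv /= !lte_fin indicE mem_set// mule1.
have -> : a - `|w 0 i| < b + `|w 0 i| by lra.
have -> : (if (a < b)%R then b%:E + (- a)%:E else 0%R)%E = (b - a)%:E.
  by case: ltgtP ab => // -> _; rewrite subrr.
by rewrite -!EFinD; congr (_%:E); ring.
Qed.

(** The tuples are ordered and a repeated row gives determinant 0, so this is n! times the sum of
    the absolute values of the maximal minors. *)
Definition maxdets n N (X : 'M[R]_(N, n)) : R :=
  \sum_(f : {ffun 'I_n -> 'I_N}) `|\det (rowsub f X)|.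

Lemma maxdets0 N (X : 'M[R]_(N, 0)) : maxdets X = 1.
Proof.
rewrite /maxdets (eq_bigr (fun=> 1)); last by move=> f _; rewrite det_mx00 normr1.
by rewrite sumr_const card_ffun !card_ord expn0.
Qed.

(** The projection along [w] onto the hyperplane where the i-th coordinate vanishes, written in the
    other coordinates: one step of Gaussian elimination. *)
Definition elimx n (i : 'I_n.+1) (w : 'rV[R]_n.+1) : 'M[R]_(n.+1, n) :=
  \matrix_(j, k) ((j == lift i k)%:R - (j == i)%:R * (w 0 (lift i k) / w 0 i)).

Lemma mul_elimx n i (w u : 'rV[R]_n.+1) :
  u *m elimx i w = col' i (u - (u 0 i / w 0 i) *: w) :> 'rV[R]_n.
Proof.
apply/rowP => k; rewrite !mxE.
under eq_bigr => j _ do rewrite mxE mulrBr.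
rewrite sumrB; congr (_ - _).
  rewrite (bigD1 (lift i k))//= eqxx mulr1 big1 ?addr0// => j /negbTE ->; exact: mulr0.
rewrite (bigD1 i)//= eqxx mul1r big1 ?addr0; first by rewrite mulrA mulrAC.
by move=> j /negbTE ->; rewrite mul0r mulr0.
Qed.

(** The column operations collected in the unipotent matrix [C] turn row [p] into w_i times a basis
    vector; then the determinant is expanded along that row. *)
Lemma det_elimx n i (w : 'rV[R]_n.+1) (M : 'M[R]_n.+1) p : w 0 i != 0 -> row p M = w ->
  `|\det M| = `|w 0 i| * `|\det (row' p M *m elimx i w)|.
Proof.
move=> w0 Mp.
pose c j := if j == i then 0 else w 0 j / w 0 i.
pose C : 'M[R]_n.+1 := \matrix_(q, j) ((q == j)%:R - (q == i)%:R * c j).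
have detC : \det C = 1.
  rewrite (expand_det_col C i) (bigD1 i)//= big1 ?addr0; last first.
    by move=> q qi; rewrite mxE (negbTE qi) /= mul0r subr0 mul0r.
  rewrite mxE eqxx /c eqxx mulr0 subr0 mul1r /cofactor -signr_odd oddD addbb expr0 mul1r.
  rewrite (_ : row' _ _ = 1%:M) ?det1//; apply/matrixP => q j; rewrite !mxE.
  by rewrite (inj_eq lift_inj) (eq_sym _ i) (negbTE (neq_lift _ _)) mul0r subr0.
have MC q j : (M *m C) q j = M q j - M q i * c j.
  rewrite mxE; under eq_bigr => k _ do rewrite mxE mulrBr.
  rewrite sumrB (bigD1 j)//= eqxx mulr1 big1 ?addr0; last by move=> k /negbTE ->; exact: mulr0.
  congr (_ - _); rewrite (bigD1 i)//= eqxx mul1r big1 ?addr0// => k /negbTE ->.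
  by rewrite mul0r mulr0.
have -> : \det M = \det (M *m C) by rewrite det_mulmx detC mulr1.
have wE j : M p j = w 0 j by rewrite -Mp mxE.
rewrite (expand_det_row _ p) (bigD1 i)//= big1 ?addr0; last first.
  move=> j ji; rewrite MC !wE /c (negbTE ji).
  by rewrite (_ : w 0 j - _ = 0) ?mul0r//; field.
rewrite MC !wE /c eqxx mulr0 subr0 normrM; congr (_ * _).
rewrite /cofactor normrM normrX normrN1 expr1n mul1r; congr (`|\det _|).
apply/matrixP => q k.
have -> : (row' p M *m elimx i w) q k = (row q (row' p M) *m elimx i w) 0 k.
  by rewrite -row_mul [RHS]mxE.
rewrite mul_elimx [LHS]mxE [LHS]mxE MC !mxE /c eq_sym (negbTE (neq_lift _ _)).
by rewrite mulrA mulrAC.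
Qed.

Let insrow n N (X : 'M[R]_(N.+1, n.+1)) (p : 'I_n.+1) (g : {ffun 'I_n -> 'I_N}) : {ffun 'I_n.+1 -> 'I_N.+1} :=
  [ffun q => if unlift p q is Some k then lift ord0 (g k) else ord0].

(** A tuple that uses row [ord0] twice has determinant 0. The others avoid this row or use it at
    exactly one position [p]. *)
Lemma maxdets_rec n N (X : 'M[R]_(N.+1, n.+1)) :
  maxdets X = maxdets (row' ord0 X) +
    \sum_p \sum_(g : {ffun 'I_n -> 'I_N}) `|\det (rowsub (insrow X p g) X)|.
Proof.
pose F (f : {ffun 'I_n.+1 -> 'I_N.+1}) := `|\det (rowsub f X)|.
have Fdup (f : {ffun 'I_n.+1 -> 'I_N.+1}) p q : p != q -> f p = f q -> F f = 0.
  move=> pq fpq; rewrite /F (determinant_alternate pq) ?normr0// => j.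
  by rewrite !mxE fpq.
have FE f : F f = (if [forall p, f p != ord0] then F f else 0) +
   \sum_p (if (f p == ord0) && [forall k, f (lift p k) != ord0] then F f else 0).
  have [|/forallPn[p]] := boolP [forall p, f p != ord0].
    move=> /forallP h; rewrite big1 ?addr0// => p _.
    by rewrite (negbTE (h p)).
  rewrite negbK => /eqP fp; rewrite add0r (bigD1 p)//= fp eqxx /=.
  have [|/forallPn[k]] := boolP [forall k, f (lift p k) != ord0].
    move=> /forallP h; rewrite big1 ?addr0// => q qp.
    case: (unlift_some (_ : p != q)) => [|k -> _]; first by rewrite eq_sym.
    by rewrite (negbTE (h k)).
  rewrite negbK => /eqP fk; have F0 : F f = 0.
    by apply: (Fdup f p (lift p k)); rewrite ?neq_lift// fp fk.
  by rewrite F0 add0r big1// => q _; case: ifP.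
have lift0 (I : finType) (f : {ffun I -> 'I_N.+1}) : (forall p, f p != ord0) ->
    exists g : {ffun I -> 'I_N}, f = [ffun p => lift ord0 (g p)].
  move=> h; have /fin_all_exists[g gE] : forall p, exists j, f p = lift ord0 j.
    by move=> p; case: (unlift_some (_ : ord0 != f p)) => [|j ? _]; [rewrite eq_sym|exists j].
  by exists [ffun p => g p]; apply/ffunP => p; rewrite !ffunE.
rewrite /maxdets (eq_bigr _ (fun f _ => FE f)) big_split /= exchange_big /=; congr (_ + _).
- rewrite -big_mkcond /=.
  pose h (g : {ffun 'I_n.+1 -> 'I_N}) := [ffun p => lift ord0 (g p)] : {ffun 'I_n.+1 -> 'I_N.+1}.
  rewrite (eq_bigl (fun f => f \in h @: [set: {ffun 'I_n.+1 -> 'I_N}]%SET)); last first.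
    move=> f; apply/forallP/imsetP => [/lift0[g ->]|[g _ -> p]]; first by exists g.
    by rewrite ffunE eq_sym neq_lift.
  rewrite big_imset /=; last first.
    by move=> g g' _ _ /ffunP hg; apply/ffunP => p; have := hg p; rewrite !ffunE => /lift_inj.
  apply: eq_big => [g|g _]; first by rewrite inE.
  rewrite /F; congr (`|\det _|); apply/matrixP => q j; by rewrite !mxE ffunE.
- apply: eq_bigr => p _; rewrite -big_mkcond /=.
  rewrite (eq_bigl (fun f => f \in (insrow X p) @: [set: {ffun 'I_n -> 'I_N}]%SET)); last first.
    move=> f; apply/andP/imsetP => [[/eqP fp /forallP h]|[g _ ->]].
      have [g gE] := lift0 _ [ffun k => f (lift p k)] (fun k => ltac:(rewrite ffunE; exact: h)).
      exists g => //; apply/ffunP => q; rewrite ffunE; case: unliftP => [k ->|->//].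
      by have /ffunP/(_ k) := gE; rewrite !ffunE.
    split; first by rewrite ffunE unlift_none.
    by apply/forallP => k; rewrite ffunE liftK eq_sym neq_lift.
  rewrite big_imset /=; first by apply: eq_big => [g|g _]; rewrite ?inE.
  move=> g g' _ _ /ffunP hg; apply/ffunP => k; have := hg (lift p k).
  by rewrite !ffunE liftK => /lift_inj.
Qed.

Lemma maxdets_elim n N (X : 'M[R]_(N.+1, n.+1)) i : X ord0 i != 0 ->
  maxdets X = maxdets (row' ord0 X) +
    n.+1%:R * `|X ord0 i| * maxdets (row' ord0 X *m elimx i (row ord0 X)).
Proof.
move=> Xi; rewrite maxdets_rec; congr (_ + _).
rewrite (eq_bigr (fun=> `|X ord0 i| * maxdets (row' ord0 X *m elimx i (row ord0 X)))).
  by rewrite sumr_const card_ord -[LHS]mulr_natl mulrA.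
move=> p _; rewrite /maxdets mulr_sumr; apply: eq_bigr => g _.
have Xi' : row ord0 X 0 i != 0 by rewrite mxE.
rewrite (@det_elimx _ i (row ord0 X) _ p) ?mxE//; last first.
  by apply/rowP => j; rewrite !mxE ffunE unlift_none.
rewrite -mul_rowsub_mx; congr (_ * `|\det (_ *m _)|).
by apply/matrixP => k j; rewrite !mxE ffunE liftK.
Qed.

Lemma maxdets_row0 n N (X : 'M[R]_(N.+1, n.+1)) : row ord0 X = 0 ->
  maxdets X = maxdets (row' ord0 X).
Proof.
move=> X0; rewrite maxdets_rec big1 ?addr0// => p _; rewrite big1// => g _.
rewrite (expand_det_row _ p) big1 ?normr0// => j _.
rewrite mxE ffunE unlift_none; have /rowP/(_ j) := X0; rewrite !mxE => ->.
by rewrite mul0r.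
Qed.

Lemma zon_add n N (X : 'M[R]_(N.+1, n)) u :
  zon X u <-> exists k : R, -1 <= k <= 1 /\ zon (row' ord0 X) (u - k *: row ord0 X).
Proof.
have mulE (s : 'rV[R]_N) k : ins ord0 s k *m X = k *: row ord0 X + s *m row' ord0 X.
  apply/rowP => j; rewrite !mxE big_ord_recl ins_eq; congr (_ + _).
  by apply: eq_bigr => q _; rewrite ins_lift !mxE.
split=> [[s hs <-]|[k [hk [s hs su]]]].
  exists (s 0 ord0); split; first by have := hs ord0; rewrite !mxE.
  exists (col' ord0 s); first by move=> j; have := hs (lift ord0 j); rewrite !mxE.
  by rewrite -{2}(ins_col' ord0 s) mulE addrC addKr.
exists (ins ord0 s k).
  move=> j; rewrite !mxE; case: unliftP => [q _|_]; last exact: hk.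
  by have := hs q; rewrite !mxE.
by rewrite mulE su addrC subrK.
Qed.

Lemma zon_mul n m N (X : 'M[R]_(N, n)) (P : 'M[R]_(n, m)) :
  [set u *m P | u in (zon X : set 'rV[R]_n)] = zon (X *m P).
Proof.
apply/seteqP; split=> [_ [_ [s hs <-] <-]|_ [s hs <-]]; first by exists s; rewrite ?mulmxA.
by exists (s *m X); [exists s|rewrite mulmxA].
Qed.

(* Adding a generator w to a zonotope adds 2|w_i| times the volume of its
   projection along w; the sum of the maximal minors obeys the same recursion. *)
Lemma leb_zon n N (X : 'M[R]_(N, n)) : leb (zon X) = (2 ^+ n / n`!%:R * maxdets X)%:E.
Proof.
elim: N n X => [|N IH] [|n] X.
- rewrite (@leb0 _ _ (0 *m X)); last by exists 0 => // -[].
  by rewrite maxdets0 expr0 fact0 divr1 mulr1.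
- have -> : zon X = cbox 0 0.
    apply/seteqP; split=> [_ [s _ <-] i|u u0]; first by rewrite !mxE big_ord0 lexx.
    exists 0; first by case.
    apply/rowP => i; rewrite mxE big_ord0; have := u0 i; rewrite !mxE => ?.
    by apply/eqP; rewrite eq_le.
  rewrite leb_cbox// (bigD1 ord0)//= subrr mul0r /maxdets.
  rewrite big_pred0 ?mulr0// => f; by have := f ord0 => -[].
- rewrite (@leb0 _ _ (0 *m X)); last first.
    by exists 0 => // i; rewrite !mxE oppr_le0 ler01.
  by rewrite maxdets0 expr0 fact0 divr1 mulr1.
- have [X0|] := eqVneq (row ord0 X) 0.
    rewrite maxdets_row0// -IH; congr (leb _); apply/seteqP; split=> u.
      by move=> /zon_add[k [_]]; rewrite X0 scaler0 subr0.
    move=> Xu; apply/zon_add; exists 0; rewrite X0 scaler0 subr0; split=> //.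
    by rewrite oppr_le0 ler01.
  move=> /rV0Pn[i]; rewrite mxE => Xi.
  have Xi' : row ord0 X 0 i != 0 by rewrite mxE.
  rewrite (leb_add_segment Xi' (@compact_zon _ _ _) (@compact_zon _ _ _) (@cvx_zon _ _ (row' ord0 X)) (mul_elimx i _) (@zon_add _ _ X)).
  rewrite zon_mul !IH (maxdets_elim Xi) mxE -EFinM -EFinD; congr (_%:E).
  rewrite exprS factS natrM; have n0 : n.+1%:R != 0 :> R by rewrite pnatr_eq0.
  have f0 : n`!%:R != 0 :> R by rewrite pnatr_eq0 -lt0n fact_gt0.
  move: n0 f0; move: (n.+1%:R : R) (n`!%:R : R) => a b a0 b0; field; exact/andP.
Qed.

(** The image of a box is a translate of the zonotope generated by the rows of [L] scaled by the
    half sides. The formula is therefore a case of [leb_zon], also for singular [L]. *)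
Lemma leb_diag_image n (a b : 'rV[R]_n) (L : 'M[R]_n) : (forall i, a 0 i <= b 0 i) ->
  leb [set u *m L | u in (cbox a b : set 'rV[R]_n)] = (`|\det L| * \prod_i (b 0 i - a 0 i))%:E.
Proof.
move=> ab; pose X : 'M[R]_n := diag_mx (2^-1 *: (b - a)).
pose c : 'rV[R]_n := 2^-1 *: (a + b).
(* The constant is read off from the cube, which is itself a zonotope of known volume. *)
have maxdets1 : maxdets (1%:M : 'M[R]_n) = n`!%:R.
  have : leb (zon (1%:M : 'M[R]_n)) = (2 ^+ n)%:E.
    rewrite (_ : zon _ = cbox (const_mx (-1)) (const_mx 1)).
      rewrite leb_cbox; last by move=> i; rewrite !mxE; lra.
      rewrite (eq_bigr (fun=> 2)) ?prodr_const ?card_ord// => i _.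
      by rewrite !mxE; lra.
    by apply/seteqP; split=> [_ [s hs <-]|u hu]; rewrite ?mulmx1//; exists u; rewrite ?mulmx1.
  rewrite leb_zon => -[] /(canRL (mulKf _)) ->.
    rewrite mulrC invf_div mulrCA divff ?mulr1// expf_neq0//.
  by rewrite mulf_neq0 ?expf_neq0// invr_eq0 pnatr_eq0 -lt0n fact_gt0.
have -> : [set u *m L | u in (cbox a b : set 'rV[R]_n)] =
   [set u | zon (X *m L) (u + - (c *m L))].
  have ba i : 0 <= b 0 i - a 0 i by rewrite subr_ge0.
  apply/seteqP; split=> [_ [u ub <-]|u [s hs]].
    exists (\row_i ((u 0 i - c 0 i) * 2 / (b 0 i - a 0 i))).
      move=> i; rewrite !mxE; have /andP[h1 h2] := ub i.
      (* On a degenerate side the division by 0 returns 0, a valid coefficient because that side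
         contributes nothing. *)
      have [->|ab0] := eqVneq (b 0 i - a 0 i) 0; first by rewrite invr0 mulr0; lra.
      have ab1 : 0 < b 0 i - a 0 i by rewrite lt_def ab0 ba.
      by rewrite ler_pdivlMr// ler_pdivrMr//; lra.
    rewrite mulmxA -mulmxBl; congr (_ *m L); apply/rowP => i.
    rewrite mul_mx_diag !mxE; have /andP[h1 h2] := ub i.
    have [ab0|ab0] := eqVneq (b 0 i - a 0 i) 0; last by field.
    by rewrite ab0 invr0; lra.
  move=> suE; exists (s *m X + c).
    move=> i; rewrite mul_mx_diag !mxE; have := hs i; rewrite !mxE => /andP[h1 h2].
    by have := ba i; nra.
  by rewrite mulmxDl -mulmxA suE subrK.
rewrite leb_trans; last by apply: compact_borel; exact: compact_zon.
rewrite leb_zon; congr (_%:E).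
rewrite /maxdets (eq_bigr (fun f : {ffun 'I_n -> 'I_n} => `|\det (rowsub f (1%:M : 'M[R]_n))| * (`|\det X| * `|\det L|))).
  rewrite -mulr_suml -/(maxdets _) maxdets1 det_diag.
  rewrite ger0_norm; last by apply: prodr_ge0 => i _; rewrite !mxE mulr_ge0 ?invr_ge0// subr_ge0.
  under eq_bigr do rewrite !mxE.
  rewrite big_split /= prodr_const card_ord exprVn.
  field; by rewrite expf_neq0 ?pnatr_eq0 -?lt0n ?fact_gt0.
by move=> f _; rewrite -!normrM -!det_mulmx mul_rowsub_mx mul1mx.
Qed.

Lemma leb_lin n (L : 'M[R]_n) (A : set (borelR n)) : L \in unitmx -> measurable A ->
  leb ([set u | A (u *m L)] : set (borelR n)) = (`|\det L|^-1%:E * leb A)%E.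
Proof.
move=> uL mA.
have mf : measurable_fun setT (fun u : borelR n => u *m L : borelR n).
  by apply: (@measurable_fun_cont_row R n n setT) => [|x _]; [exact: openT|exact: continuous_mulmx].
have k0 : 0 <= `|\det L|^-1 by rewrite invr_ge0.
have m1E (a b : 'rV[R]_n) : (forall i, a 0 i <= b 0 i) ->
    leb ([set u | cbox a b (u *m L)] : set (borelR n)) = (`|\det L|^-1 * \prod_i (b 0 i - a 0 i))%:E.
  move=> ab; rewrite -normfV -det_inv -leb_diag_image//; congr (leb _).
  apply/seteqP; split=> [u h|_ [u h <-]]; last by rewrite /= mulmxKV.
  by exists (u *m L) => //; rewrite mulmxK.
apply: (@leb_unique2 R n (pushm (@leb R n) mf) (mscale (NngNum k0) (@leb R n))) => // [k|a b ab].
  by rewrite [X in (X < _)%E]m1E ?ltry// => i; rewrite !mxE; have : 0 <= k%:R :> R by []; lra.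
by rewrite [LHS]m1E// EFinM -(leb_cbox ab).
Qed.

End Zonotope.

(** * Strict differentiability *)

Section StrictDifferentiability.
Context {R : realType}.

(** Both points vary near [x]. This gives estimates at the centre of any small cube that contains
    [x], and the Lipschitz bound of the contraction used for the lower estimate. *)
Definition strict_diff n (W : normedModType R) (f : 'rV[R]_n -> W) (x : 'rV[R]_n) (df : 'rV[R]_n -> W) :=
  forall e, 0 < e -> exists2 d, 0 < d & forall y z : 'rV[R]_n, `|y - x| < d -> `|z - x| < d ->
    `|f y - f z - df (y - z)| <= e * `|y - z|.

Definition C1on n (W : normedModType R) (O : set 'rV[R]_n) (f : 'rV[R]_n -> W) :=
  forall x, O x -> forall i, derivable f x (delta_mx 0 i) /\
     {for x, continuous (fun y => 'D_(delta_mx 0 i) f y)}.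

Lemma Cr_C1on n (W : normedModType R) (O : set 'rV[R]_n) (f : 'rV[R]_n -> W) :
  is_Cr 1 O f -> C1on O f.
Proof. by move=> [_ h] x Ox i; have [h1 [h2 _]] := h (delta_mx 0 i); split; [exact: h1|exact: h2]. Qed.

Lemma finite_delta (I : finType) (P : I -> R -> Prop) :
  (forall i, exists2 d, 0 < d & P i d) -> (forall i d d', 0 < d' <= d -> P i d -> P i d') ->
  exists2 d, 0 < d & forall i, P i d.
Proof.
move=> /(_ _)/cid2-/all_sig2[d d0 Pd] mono.
have s0 : 0 < 1 + \sum_i (d i)^-1.
  by rewrite ltr_wpDr// sumr_ge0// => i _; rewrite invr_ge0 ltW.
(* A positive number below every [d i], which makes sense for an empty index type too. *)
exists (1 + \sum_i (d i)^-1)^-1; first by rewrite invr_gt0.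
move=> i; apply: mono (Pd i); rewrite invr_gt0 s0 /= invf_ple ?posrE//.
rewrite (bigD1 i)//= addrCA lerDl addr_ge0// sumr_ge0// => j _.
by rewrite invr_ge0 ltW.
Qed.

Lemma mvt_bound (g g' : R -> R) (c e h : R) :
  (forall t, Num.min 0 h <= t <= Num.max 0 h -> is_derive t 1 g (g' t) /\ `|g' t - c| <= e) ->
  `|g h - g 0 - h * c| <= e * `|h|.
Proof.
move=> H.
have key (a b : R) : a <= b -> (forall t, a <= t <= b -> is_derive t 1 g (g' t) /\ `|g' t - c| <= e) ->
    `|g b - g a - (b - a) * c| <= e * (b - a).
  move=> ab K; have [||t tab ->] := @MVT_segment R g g' a b ab.
  - by move=> t /=; rewrite in_itv /= => /andP[at_ tb]; have [] := K t; rewrite // !ltW.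
  - apply: derivable_within_continuous => t; rewrite in_itv /= => tab.
    by have [] := K t tab.
  - rewrite (_ : _ - _ = (g' t - c) * (b - a)); last by ring.
    rewrite normrM (ger0_norm (_ : 0 <= b - a)) ?subr_ge0// ler_wpM2r ?subr_ge0//.
    by have [] := K t; rewrite ?in_itv in tab.
have [h0|h0] := leP 0 h.
  have := key 0 h h0; rewrite subr0 (ger0_norm h0); by apply => t ht; apply: H; rewrite min_l// max_r.
have := key h 0 (ltW h0) => /(_ _)/wrap[].
  by move=> t ht; apply: H; rewrite min_r ?max_l// ltW.
rewrite sub0r (ltr0_norm h0); apply: le_trans.
by rewrite -normrN le_eqVlt; apply/orP; left; apply/eqP; congr `|_|; ring.
Qed.

Lemma derive_line n (W : normedModType R) (f : 'rV[R]_n -> W) (w u : 'rV[R]_n) (t : R) :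
  derivable f (w + t *: u) u -> is_derive t 1 (fun s : R => f (w + s *: u)) ('D_u f (w + t *: u)).
Proof.
move=> df.
have E : (fun h : R => h^-1 *: (((fun s : R => f (w + s *: u)) \o shift t) (h *: (1 : R)) - f (w + t *: u))) =
         (fun h : R => h^-1 *: ((f \o shift (w + t *: u)) (h *: u) - f (w + t *: u))).
  apply/funext => h /=; congr (_ *: (f _ - _)).
  by rewrite scalerDl addrCA [h *: 1]mulr1 addrC.
by apply: DeriveDef; rewrite /derivable /derive E.
Qed.

(** One walks from [z] to [y] changing one coordinate at a time and applies the mean value theorem
    to each step. The intermediate points stay in the ball because the norm is the sup norm. *)
Lemma scalar_strict n (O : set 'rV[R]_n) (f : 'rV[R]_n -> R) x :
  open O -> O x -> C1on O f ->
  strict_diff f x (fun u => \sum_i u 0 i * 'D_(delta_mx 0 i) f x).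
Proof.
move=> oO Ox fC e e0; pose e' := e / n.+1%:R.
have e'0 : 0 < e' by rewrite divr_gt0.
have [d d0 xdO] : exists2 d, 0 < d & ball x d `<=` O.
  by have /nbhs_ballP[d /= d0 ?] := oO _ Ox; exists d.
have [|i d1 d2|d' d'0 xd'] := @finite_delta 'I_n (fun i d => forall y, ball x d y ->
    `|'D_(delta_mx 0 i) f x - 'D_(delta_mx 0 i) f y| < e').
- move=> i; have [_] := fC x Ox i.
  by move=> /cvgrPdist_lt/(_ e' e'0)/nbhs_ballP[d1 /= d10 H]; exists d1.
- by move=> /andP[_ d21] H y /(le_ball d21); exact: H.
exists (Num.min d d'); first by rewrite lt_min d0.
have {}xd y : ball x (Num.min d d') y -> O y /\ forall i, `|'D_(delta_mx 0 i) f x - 'D_(delta_mx 0 i) f y| < e'.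
  move=> yb; split; first by apply: xdO; apply: le_ball yb; rewrite ge_min lexx.
  by move=> i; apply: xd'; apply: le_ball yb; rewrite ge_min lexx orbT.
have m0 : 0 < Num.min d d' by rewrite lt_min d0.
move: (Num.min d d') m0 xd => {d d' d0 d'0 xdO xd'} d d0 xd y z yx zx.
have inball (u : 'rV[R]_n) : (forall j, Num.min (y 0 j) (z 0 j) <= u 0 j <= Num.max (y 0 j) (z 0 j)) -> ball x d u.
  move=> hu; rewrite -ball_normE /= distrC; apply/mx_norm_ltP => // i j; rewrite ord1 !mxE.
  move/mx_norm_ltP : yx => /(_ d0 0 j); move/mx_norm_ltP : zx => /(_ d0 0 j).
  rewrite !mxE !ltr_norml; have := hu j; rewrite ge_min le_max.
  by move=> /andP[/orP[?|?] /orP[?|?]] /andP[? ?] /andP[? ?]; apply/andP; split; lra.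
pose w (k : nat) : 'rV[R]_n := \row_j (if (j < k)%N then y 0 j else z 0 j).
have wn : w n = y by apply/rowP => j; rewrite mxE ltn_ord.
have w0 : w 0%N = z by apply/rowP => j; rewrite mxE.
have wS (k : 'I_n) : w k.+1 = w k + (y 0 k - z 0 k) *: delta_mx 0 k.
  apply/rowP => j; rewrite !mxE eqxx /= ltnS leq_eqVlt val_eqE.
  have [->|jk] := eqVneq j k; first by rewrite ltnn mulr1 addrCA subrr addr0.
  by rewrite /= mulr0 addr0.
have -> : f y - f z = \sum_(k < n) (f (w k.+1) - f (w k)).
  by rewrite -(big_mkord xpredT (fun k => f (w k.+1) - f (w k))) telescope_sumr// wn w0.
rewrite -sumrB; apply: (le_trans (ler_norm_sum _ _ _)).
apply: (@le_trans _ _ (\sum_(k < n) e' * `|y - z|)); last first.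
  rewrite sumr_const card_ord -mulrnAl ler_wpM2r// -mulr_natr /e' -mulrA ger_pMr//.
  by rewrite mulrC ler_pdivrMr// mul1r ler_nat.
apply: ler_sum => k _; rewrite wS !mxE.
have := @mvt_bound (fun t => f (w k + t *: delta_mx 0 k)) (fun t => 'D_(delta_mx 0 k) f (w k + t *: delta_mx 0 k))
   ('D_(delta_mx 0 k) f x) e' (y 0 k - z 0 k).
rewrite scale0r addr0 => H; apply: (le_trans (H _)); last first.
  rewrite ler_wpM2l ?(ltW e'0)//; have := le_coord_norm (y - z) 0 k; by rewrite !mxE.
move=> t ht; have wb : ball x d (w k + t *: delta_mx 0 k).
  apply: inball => j; rewrite !mxE eqxx /=.
  have [->|jk] := eqVneq j k.
    rewrite ltnn mulr1; move: ht; rewrite ge_min le_max => /andP[/orP[?|?] /orP[?|?]];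
    rewrite ge_min le_max; apply/andP; split; apply/orP; [right|right|right|left|left|right|left|left]; lra.
  rewrite /= mulr0 addr0; case: ifP => _; by rewrite ge_min le_max !lexx ?orbT.
have [Ow Dw] := xd _ wb; split.
  by apply: derive_line; have [] := fC _ Ow k.
by rewrite distrC ltW.
Qed.

Lemma derive_coord n m (F : 'rV[R]_n -> 'rV[R]_m) x v j : derivable F x v ->
  derivable (fun y => F y 0 j) x v /\ 'D_v (fun y => F y 0 j) x = ('D_v F x) 0 j.
Proof.
move=> dF; have cF : (fun h : R => h^-1 *: ((F \o shift x) (h *: v) - F x)) @ 0^' --> 'D_v F x by exact: dF.
have c : (fun h : R => h^-1 *: (((fun y => F y 0 j) \o shift x) (h *: v) - F x 0 j)) @ 0^' --> ('D_v F x) 0 j.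
  have := cvg_comp _ _ cF (@coord_continuous R 1 m 0 j ('D_v F x)).
  by move=> h; apply: cvg_trans h; apply: near_eq_cvg; apply: nearW => h; rewrite /= !mxE.
by split; [apply/cvg_ex; eexists; exact: c|exact: cvg_lim c].
Qed.

Definition jac n m (F : 'rV[R]_n -> 'rV[R]_m) x : 'M[R]_(n, m) :=
  \matrix_(i, j) ('D_(delta_mx 0 i) F x) 0 j.

Lemma continuous_at_on (T U : topologicalType) (O : set T) (f g : T -> U) x :
  open O -> O x -> (forall y, O y -> f y = g y) ->
  {for x, continuous f} -> {for x, continuous g}.
Proof.
move=> oO Ox fg cf; have gx := fg x Ox.
suff : g @ x --> f x by rewrite gx.
apply: cvg_trans cf.
by apply: near_eq_cvg; near=> y; apply/fg; near: y; apply: open_nbhs_nbhs; split.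
Unshelve. all: by end_near. Qed.

Lemma C1on_coord n m (O : set 'rV[R]_n) (F : 'rV[R]_n -> 'rV[R]_m) j : open O ->
  C1on O F -> C1on O (fun y => F y 0 j).
Proof.
move=> oO FC x Ox i; have [dF cF] := FC x Ox i; have [d1 d2] := derive_coord j dF.
split => //.
apply: (@continuous_at_on _ _ O (fun y => ('D_(delta_mx 0 i) F y) 0 j)) => //.
  by move=> y Oy; rewrite (derive_coord j (FC y Oy i).1).2.
exact: continuous_coord cF.
Qed.

Lemma row_strict n m (O : set 'rV[R]_n) (F : 'rV[R]_n -> 'rV[R]_m) x :
  open O -> O x -> C1on O F -> strict_diff F x (fun u => u *m jac F x).
Proof.
move=> oO Ox FC e e0.
have [|j d d'|d d0 H] := @finite_delta 'I_m (fun j d => forall y z : 'rV[R]_n, `|y - x| < d -> `|z - x| < d ->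
    `|F y 0 j - F z 0 j - ((y - z) *m jac F x) 0 j| <= e * `|y - z|).
- move=> j; have [d d0 H] := scalar_strict oO Ox (C1on_coord j oO FC) e0.
  exists d => // y z yx zx; have := H y z yx zx; rewrite mxE.
  congr (`|_ - _| <= _); apply: eq_bigr => i _; rewrite !mxE.
  by rewrite (derive_coord j (FC x Ox i).1).2.
- move=> /andP[_ dd'] H y z yx zx; apply: H; exact: lt_le_trans dd'.
exists d => // y z yx zx; apply: mx_norm_leP; first by rewrite mulr_ge0// ltW.
by move=> i j; rewrite ord1 mxE [(F y - F z) 0 j]mxE [(- F z) 0 j]mxE [(- (_ *m _)) 0 j]mxE; exact: H.
Qed.

Lemma strict_differentiable n (W : normedModType R) (f : 'rV[R]_n -> W) (df : {linear 'rV[R]_n -> W}) x :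
  continuous df -> strict_diff f x df -> differentiable f x /\ 'd f x = df :> (_ -> _).
Proof.
move=> cdf sf.
have E : f \o shift x = cst (f x) + df +o_ (0 : 'rV[R]_n) id.
  apply/eqaddoP => e e0; have [d d0 H] := sf e e0.
  apply: filterS (nbhs0_lt d0) => h hd /=.
  have := H (h + x) x; rewrite addrK subrr normr0 => /(_ hd d0).
  by rewrite !fctE /= opprD addrA.
have dE := diff_unique cdf E; split => //.
by apply/diff_locallyP; rewrite dE.
Unshelve. all: by end_near. Qed.

Lemma row_differentiable n m (O : set 'rV[R]_n) (F : 'rV[R]_n -> 'rV[R]_m) x :
  open O -> O x -> C1on O F -> differentiable F x /\ 'd F x = mulmxr (jac F x) :> (_ -> _).
Proof.
move=> oO Ox FC; apply: strict_differentiable; first exact: continuous_mulmx.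
by move=> e e0; exact: (row_strict oO Ox FC e0).
Qed.

Lemma row_derive n m (O : set 'rV[R]_n) (F : 'rV[R]_n -> 'rV[R]_m) x u :
  open O -> O x -> C1on O F -> 'D_u F x = u *m jac F x.
Proof. by move=> oO Ox FC; have [dF dE] := row_differentiable oO Ox FC; rewrite deriveE// dE. Qed.

Lemma C1on_continuous n m (O : set 'rV[R]_n) (F : 'rV[R]_n -> 'rV[R]_m) x :
  open O -> O x -> C1on O F -> {for x, continuous F}.
Proof. by move=> oO Ox FC; apply: differentiable_continuous; have [] := row_differentiable oO Ox FC. Qed.

Lemma continuous_jac n m (O : set 'rV[R]_n) (F : 'rV[R]_n -> 'rV[R]_m) x i j :
  O x -> C1on O F -> {for x, continuous (fun y => jac F y i j)}.
Proof.
move=> Ox FC; have [_ cF] := FC x Ox i.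
apply: (@eq_continuous_at _ _ (fun y => ('D_(delta_mx 0 i) F y) 0 j)).
  by move=> y; rewrite mxE.
exact: continuous_coord.
Qed.

End StrictDifferentiability.

(** * The area formula *)

Section Counting.
Context {R : realType}.

Lemma einf_ge (u : (\bar R)^nat) (c : \bar R) k0 :
  (forall k, (k0 <= k)%N -> (c <= u k)%E) -> (c <= limn_einf u)%E.
Proof.
move=> h; rewrite limn_einf_lim (cvg_lim _ (@cvg_einfs_sup _ u))//.
apply: (@le_trans _ _ (einfs u k0)); last by apply: ereal_sup_ubound; exists k0.
by apply: le_ereal_inf_tmp => _ [k /= kk <-]; exact: h.
Qed.

Lemma einf_le (u : (\bar R)^nat) (c : \bar R) :
  (forall k, (u k <= c)%E) -> (limn_einf u <= c)%E.
Proof.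
move=> h; rewrite limn_einf_lim (cvg_lim _ (@cvg_einfs_sup _ u))//.
apply: ge_ereal_sup => _ [k _ <-]; apply: le_trans (h k).
by apply: ereal_inf_lbound; exists k => /=.
Qed.

(** Comparisons of counts, finite or infinite, are thus reduced to injections from ['I_M]. *)
Lemma counting_geP (T : choiceType) (A : set T) (M : nat) :
  (M%:R%:E <= counting A :> \bar R)%E <-> exists p : 'I_M -> T, injective p /\ forall i, A (p i).
Proof.
split.
  have pick (s : seq T) : uniq s -> (M <= size s)%N -> (forall x, x \in s -> A x) ->
      exists p : 'I_M -> T, injective p /\ forall i, A (p i).
    move=> us Ms sA; have [M00|M0] := posnP M.
      have E : 'I_M -> False by case=> i; rewrite M00.
      by exists (fun i => False_rect _ (E i)); split=> i; case: (E i).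
    have x0 : T by case: s Ms {us sA} => [|x ?]; rewrite ?leqn0 // => /eqP M00; rewrite M00 in M0.
    exists (fun i => nth x0 s i); split.
      move=> i j /eqP; rewrite nth_uniq ?(leq_trans (ltn_ord _))//.
      by move=> /eqP ij; exact: val_inj.
    by move=> i; apply: sA; apply: mem_nth; exact: leq_trans (ltn_ord i) Ms.
  rewrite /counting; case: asboolP => [finA|/infinite_set_fset inf _].
    rewrite lee_fin ler_nat => MA; apply: (pick _ (finmap.fset_uniq _) MA) => x.
    by rewrite in_fset_set// in_setE.
  by have [B BA MB] := inf M; exact: pick (finmap.fset_uniq _) MB BA.
move=> [p [pinj pA]]; rewrite /counting; case: asboolP => [finA|]; last by rewrite leey.
rewrite lee_fin ler_nat -[X in (X <= _)%N](card_ord M) cardE -(size_map p).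
apply: uniq_leq_size; first by rewrite map_inj_uniq// enum_uniq.
by move=> _ /mapP[i _ ->]; rewrite in_fset_set// inE.
Qed.

Lemma counting_le (T : choiceType) (A : set T) (c : \bar R) :
  (forall M, (M%:R%:E <= counting A :> \bar R)%E -> (M%:R%:E <= c)%E) -> (counting A <= c)%E.
Proof.
move=> h; have [finA|infA] := pselect (finite_set A).
  have := h (size (finmap.enum_fset (fset_set A))).
  by rewrite /counting asboolT// => /(_ (lexx _)).
rewrite /counting asboolF//; case: c h => [c| |] h //; last first.
  by have := h 0%N; rewrite /counting asboolF// leey => /(_ isT).
have := h (Num.truncn `|c|).+1; rewrite /counting asboolF// leey lee_fin => /(_ isT).
have := truncn_itv (normr_ge0 c) => /andP[_ hc] /(lt_le_trans hc).
by rewrite ltNge ler_norm.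
Qed.

Lemma counting_ge0 (T : choiceType) (A : set T) : (0 <= counting A :> \bar R)%E.
Proof. by rewrite /counting; case: ifP => // _; rewrite lee_fin. Qed.

Lemma le_counting (T : choiceType) (A B : set T) : A `<=` B ->
  (counting A <= counting B :> \bar R)%E.
Proof.
move=> AB; apply: counting_le => M /counting_geP[p [pinj pA]].
by apply/counting_geP; exists p; split=> // i; exact: AB.
Qed.

Lemma counting_image (T T' : choiceType) (A : set T) (B : set T') (f : T -> T') (g : T' -> T) :
  (forall x, A x -> B (f x) /\ g (f x) = x) -> (forall y, B y -> A (g y) /\ f (g y) = y) ->
  (counting A = counting B :> \bar R)%E.
Proof.
move=> fA gB; apply/eqP; rewrite eq_le; apply/andP; split; apply: counting_le => M /counting_geP[p [pinj pA]];
  apply/counting_geP.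
  exists (fun i => f (p i)); split=> [i j ij|i]; last by have [] := fA _ (pA i).
  by apply: pinj; rewrite -(fA _ (pA i)).2 ij (fA _ (pA j)).2.
exists (fun i => g (p i)); split=> [i j ij|i]; last by have [] := gB _ (pA i).
by apply: pinj; rewrite -(gB _ (pA i)).2 ij (gB _ (pA j)).2.
Qed.

End Counting.

(** * Volume of the image of a small cube *)

Section CubeEstimate.
Context {R : realType} {n : nat}.
Implicit Types (F : 'rV[R]_n -> 'rV[R]_n) (a : 'rV[R]_n).

(** Half-open, so that the cubes of a grid are disjoint. *)
Definition hcube a r : set (borelR n) := [set u : 'rV[R]_n | forall i, a 0 i <= u 0 i < a 0 i + r].

Lemma measurable_hcube a r : measurable (hcube a r).
Proof.
rewrite (_ : hcube a r = \bigcap_(i in setT) ((fun u : borelR n => u 0 i : measurableTypeR R) @^-1` `[a 0 i, a 0 i + r[)).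
  apply: fin_bigcap_measurable => // i _; rewrite -[X in measurable X]setTI.
  by apply: measurable_coordR => //; exact: measurable_itv.
apply/seteqP; split=> u h i; last by have := h i Logic.I; rewrite /= in_itv.
by move=> _; rewrite /= in_itv; exact: h.
Qed.

Lemma leb_hcube a r : 0 < r -> leb (hcube a r) = (r ^+ n)%:E.
Proof.
move=> r0; rewrite (_ : hcube a r = [set u : borelR n | forall i, `[a 0 i, a 0 i + r[%classic (u 0 i)]); last first.
  by apply/seteqP; split=> u h i; have := h i; rewrite /= in_itv.
rewrite (leb_boxE (B := fun i => `[a 0 i, a 0 i + r[%classic))//.
rewrite (eq_bigr (fun=> r%:E)); first by rewrite prodEFin prodr_const card_ord.
move=> i _; rewrite lebesgue_measure_itv /= lte_fin ltrDl r0 -EFinD; congr (_%:E); ring.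
Qed.

Lemma maxdets_scale N (X : 'M[R]_(N, n)) r : maxdets (r *: X) = `|r| ^+ n * maxdets X.
Proof.
rewrite /maxdets mulr_sumr; apply: eq_bigr => f _.
rewrite (_ : rowsub f (r *: X) = r *: rowsub f X); last by apply/matrixP => i j; rewrite !mxE.
by rewrite detZ normrM normrX.
Qed.

Lemma maxdets_sq (L : 'M[R]_n) : maxdets L = n`!%:R * `|\det L|.
Proof.
have := @leb_diag_image R n (const_mx (-1)) (const_mx 1) L.
rewrite -/(zon L) leb_zon => /(_ _)/wrap[i|]; first by rewrite !mxE; lra.
rewrite (eq_bigr (fun=> 2)); last by move=> i _; rewrite !mxE; ring.
rewrite prodr_const card_ord => -[] H.
have f0 : n`!%:R != 0 :> R by rewrite pnatr_eq0 -lt0n fact_gt0.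
have p0 : 2 ^+ n != 0 :> R by rewrite expf_neq0.
apply: (mulfI (mulf_neq0 p0 (invr_neq0 f0))); by rewrite H; field; rewrite ?f0 ?p0.
Qed.

Lemma continuous_norm_at (T : topologicalType) (W : normedModType R) (g : T -> W) x :
  {for x, continuous g} -> {for x, continuous (fun t => `|g t|)}.
Proof. by move=> cg; apply: continuous_comp => //; exact: norm_continuous. Qed.

(** Up to the factor 2^n this is the volume of the zonotope of [L] thickened by a cube of half side
    [h]. It depends continuously on [h], and at h = 0 the added generators vanish. *)
Lemma maxdets_small (L : 'M[R]_n) e : 0 < e ->
  exists2 d, 0 < d & forall h, 0 <= h <= d -> maxdets (col_mx L (h%:M : 'M[R]_n)) / n`!%:R <= `|\det L| + e.
Proof.
move=> e0; pose g (h : R) := maxdets (col_mx L (h%:M : 'M[R]_n)) / n`!%:R.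
have g0 : g 0 = `|\det L|.
  rewrite /g; have : leb (zon (col_mx L (0%:M : 'M[R]_n))) = leb (zon L).
    congr (leb _); apply/seteqP; split=> [_ [s hs <-]|_ [s hs <-]].
      exists (lsubmx s); first by move=> i; have := hs (lshift n i); rewrite !mxE.
      by rewrite -[s in RHS]hsubmxK mul_row_col -scalemx1 scale0r mulmx0 addr0.
    exists (row_mx s 0); last by rewrite mul_row_col mul0mx addr0.
    move=> i; rewrite !mxE; case: fintype.splitP => j _; last by rewrite !mxE; lra.
    by have := hs j; rewrite !mxE.
  have f0 : n`!%:R != 0 :> R by rewrite pnatr_eq0 -lt0n fact_gt0.
  rewrite !leb_zon maxdets_sq => -[] /mulfI -> //; by field.
have cg : {for 0, continuous g}.
  apply: continuousM; last exact: cst_continuous.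
  apply: continuous_bigsum => f; apply: continuous_norm_at.
  apply: continuous_det => i j.
  apply: (@eq_continuous_at _ _ (fun h => match fintype.split (f i) with inl k => L k j | inr k => h *+ (k == j) end)).
    by move=> h; rewrite !mxE; case: fintype.splitP => k _; rewrite ?mxE.
  case: fintype.splitP => k _; first exact: cst_continuous.
  case: (k == j); [exact: cvg_id|exact: cst_continuous].
move: cg => /cvgrPdist_lt/(_ e e0)/nbhs_ballP[d /= d0 H].
exists (d / 2); first by rewrite divr_gt0.
move=> h /andP[h0 hd]; have := H h; rewrite /ball /= sub0r normrN ger0_norm// => /(_ _)/wrap[].
  by rewrite (le_lt_trans hd)// ltr_pdivrMr// ltr_pMr// ltr1n.
by rewrite -/(g h) -g0 => /ltW; rewrite ler_norml => /andP[? _]; lra.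
Qed.

Lemma mulmx_bound N m (X : 'M[R]_(N, m)) : exists2 C, 0 < C & forall u : 'rV[R]_N, `|u *m X| <= C * `|u|.
Proof.
exists (1 + \sum_i \sum_j `|X i j|).
  by rewrite ltr_wpDr// sumr_ge0// => i _; rewrite sumr_ge0.
move=> u; apply: mx_norm_leP; first by rewrite mulr_ge0// addr_ge0// sumr_ge0// => i _; rewrite sumr_ge0.
move=> i j; rewrite ord1 mxE; apply: (le_trans (ler_norm_sum _ _ _)).
apply: (@le_trans _ _ ((\sum_i \sum_j `|X i j|) * `|u|)); last by rewrite ler_wpM2r// lerDr.
rewrite mulr_suml; apply: ler_sum => k _; rewrite normrM mulrC.
apply: ler_pM => //; last exact: le_coord_norm.
by rewrite (bigD1 j)//= lerDl sumr_ge0.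
Qed.


(** A half-open cube is a countable union of closed boxes, whose images are compact. *)
Lemma image_hcube_measurable (F : 'rV[R]_n -> 'rV[R]_n) (a : 'rV[R]_n) r (O : set 'rV[R]_n) :
  (forall x, O x -> {for x, continuous F}) -> hcube a r `<=` O ->
  measurable (F @` hcube a r : set (borelR n)).
Proof.
move=> cF QO; pose b k : 'rV[R]_n := \row_i (a 0 i + r - k.+1%:R^-1).
have -> : hcube a r = \bigcup_k (cbox a (b k)).
  apply/seteqP; split=> [u uQ|u [k _ uk] i]; last first.
    have := uk i; rewrite mxE => /andP[-> h]; rewrite (le_lt_trans h)// ltrBlDr ltrDl.
    by rewrite invr_gt0.
  have [|i d d' /andP[_ dd] h|d d0 H] := @finite_delta R 'I_n (fun i d => u 0 i <= a 0 i + r - d).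
  - move=> i; have /andP[_ h] := uQ i; exists (a 0 i + r - u 0 i); lra.
  - lra.
  exists (Num.bound d^-1) => // i; rewrite mxE; have /andP[-> _] := uQ i => /=.
  apply: le_trans (H i) _; rewrite lerB// invf_ple ?posrE// ltW//.
  have d1 : 0 <= d^-1 by rewrite invr_ge0 ltW.
  by rewrite (lt_trans (archi_boundP d1))// ltr_nat.
rewrite image_bigcup; apply: bigcup_measurable => k _; apply: compact_borel.
apply: compact_image (@compact_cbox _ _ _ _) => u uk; apply: cF; apply: QO => i.
have := uk i; rewrite mxE => /andP[-> h]; rewrite (le_lt_trans h)// ltrBlDr ltrDl.
by rewrite invr_gt0.
Qed.

Lemma hcube_dist (a x y : 'rV[R]_n) r : 0 < r -> hcube a r x -> hcube a r y -> `|y - x| < r.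
Proof.
move=> r0 hx hy; apply/mx_norm_ltP => // i j; rewrite ord1 !mxE ltr_norml.
by move: (hx j) (hy j) => /andP[? ?] /andP[? ?]; apply/andP; split; lra.
Qed.

Variables (O : set 'rV[R]_n) (F : 'rV[R]_n -> 'rV[R]_n).
Hypotheses (oO : open O) (FC : C1on O F).

Let cF x : O x -> {for x, continuous F}.
Proof. by move=> Ox; exact: C1on_continuous oO Ox FC. Qed.

(** By strict differentiability at [x] the image lies in a translate of a zonotope, generated by the
    rows of r/2 times the jacobian and by a small cube that absorbs the remainder. [maxdets_small]
    bounds its volume. *)
Lemma cube_est_upper x e : O x -> 0 < e -> exists2 d, 0 < d & forall a r, 0 < r < d -> hcube a r x ->
  hcube a r `<=` O /\ (leb (F @` hcube a r : set (borelR n)) <= ((`|\det (jac F x)| + e) * r ^+ n)%:E)%E.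
Proof.
move=> Ox e0; have [h h0 hP] := maxdets_small (jac F x) e0.
have [d1 d10 H] := row_strict oO Ox FC h0.
have /nbhs_ballP[d2 /= d20 xO] := oO Ox.
exists (Num.min d1 d2); first by rewrite lt_min d10.
move=> a r /andP[r0]; rewrite lt_min => /andP[rd1 rd2] xQ.
have QO : hcube a r `<=` O.
  move=> y yQ; apply: xO; rewrite -ball_normE /= distrC.
  by rewrite (lt_trans (hcube_dist r0 xQ yQ)).
split=> //; pose q : 'rV[R]_n := \row_i (a 0 i + r / 2).
have qQ : hcube a r q by move=> i; rewrite mxE; apply/andP; split; lra.
pose Z := zon (col_mx (r / 2 *: jac F x) ((h * (r / 2))%:M : 'M[R]_n)).
apply: (@le_trans _ _ (leb ([set u | Z (u + - F q)] : set (borelR n)))).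
  apply: le_measure; rewrite ?inE; first exact: (image_hcube_measurable (@cF) QO).
    have mf : measurable_fun setT (fun u : borelR n => u + - F q : borelR n).
      apply: (@measurable_fun_cont_row R n n setT (fun u => u + - F q)); first exact: openT.
      by move=> z _; exact: (cvgD cvg_id (cvg_cst _)).
    by have := mf measurableT _ (compact_borel (@compact_zon _ _ _ (col_mx (r / 2 *: jac F x) ((h * (r / 2))%:M : 'M[R]_n)))); rewrite setTI.
  move=> _ [y yQ <-] /=.
  have := H y q; rewrite (lt_trans (hcube_dist r0 xQ yQ))// (lt_trans (hcube_dist r0 xQ qQ))// => /(_ isT isT).
  set w := F y - F q - _ => wle.
  have yq : `|y - q| <= r / 2.
    apply: mx_norm_leP => [|i j]; first by rewrite divr_ge0// ltW.
    by rewrite ord1 !mxE ler_norml; have /andP[? ?] := yQ j; apply/andP; split; lra.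
  have r2 : 0 < r / 2 by rewrite divr_gt0.
  have hr2 : 0 < h * (r / 2) by rewrite mulr_gt0.
  (* The first coefficients produce the linear part of F y - F q, the last ones the remainder [w],
     of norm at most h r / 2. *)
  exists (row_mx ((r / 2)^-1 *: (y - q)) ((h * (r / 2))^-1 *: w)).
    move=> i; rewrite !mxE -ler_norml; case: fintype.splitP => j _.
      rewrite mxE normrM gtr0_norm ?invr_gt0// ler_pdivrMl// mulr1.
      exact: le_trans (le_coord_norm _ _ _) yq.
    rewrite mxE normrM gtr0_norm ?invr_gt0// ler_pdivrMl// mulr1.
    apply: le_trans (le_coord_norm _ _ _) _; apply: le_trans wle _.
    by rewrite ler_wpM2l// ltW.
  rewrite mul_row_col -scalemxAl -scalemxAr scalerA mulVf ?gt_eqF// scale1r.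
  by rewrite mul_mx_scalar scalerA mulfV ?gt_eqF// scale1r /w addrCA subrr addr0.
rewrite leb_trans; last by apply: compact_borel; exact: compact_zon.
rewrite leb_zon lee_fin.
rewrite (_ : col_mx _ _ = (r / 2) *: col_mx (jac F x) (h%:M : 'M[R]_n)); last first.
  by rewrite (mulrC h) -scale_scalar_mx scale_col_mx.
rewrite maxdets_scale gtr0_norm ?divr_gt0// expr_div_n.
have := hP h; rewrite lexx ltW// => /(_ isT).
have p0 : 2 ^+ n != 0 :> R by rewrite expf_neq0.
rewrite (_ : 2 ^+ n / _ * _ = maxdets (col_mx (jac F x) h%:M) / n`!%:R * r ^+ n).
  by move=> ?; rewrite ler_wpM2r// exprn_ge0// ltW.
have f0 : n`!%:R != 0 :> R by rewrite pnatr_eq0 -lt0n fact_gt0.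
by field; rewrite ?f0 ?p0.
Qed.

(** When the jacobian [L] is invertible, the image of the cube contains F q + v L for all [v] in a
    cube whose side is [k] times smaller, with [k] close to 1: the equation F y = F q + v L is
    solved by a contraction. *)
Lemma cube_est_lower x e : O x -> 0 < e -> exists2 d, 0 < d & forall a r, 0 < r < d -> hcube a r x ->
  (((`|\det (jac F x)| - e) * r ^+ n)%:E <= leb (F @` hcube a r : set (borelR n)))%E.
Proof.
move=> Ox e0; have [L0|L0] := eqVneq (\det (jac F x)) 0.
  exists 1 => // a r /andP[r0 _] _; rewrite L0 normr0 sub0r mulNr.
  apply: (@le_trans _ _ 0%E); last exact: measure_ge0.
  by rewrite lee_fin oppr_le0 mulr_ge0// ?exprn_ge0// ltW.
set L := jac F x in L0 *.
have uL : L \in unitmx by rewrite unitmxE unitfE.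
have [k /andP[k0 k1] kP] : exists2 k : R, 0 < k < 1 & `|\det L| - e <= `|\det L| * k ^+ n.
  have : {for (1 : R), continuous (fun k : R => `|\det L| * k ^+ n)}.
    apply: continuousM; [exact: cst_continuous|exact: exprn_continuous].
  move=> /cvgrPdist_lt/(_ e e0)/nbhs_ballP[d /= d0 H].
  exists (1 - Num.min (2^-1) (d / 2)).
    rewrite ltrBlDr ltrDl lt_min divr_gt0//= invr_gt0 ltr0n andbT subr_gt0 gt_min invf_lt1 ?ltr1n//.
  have := H (1 - Num.min (2^-1) (d / 2)); rewrite /ball /= opprB addrCA subrr addr0.
  have m0 : 0 <= Num.min 2^-1 (d / 2) by rewrite le_min invr_ge0 ler0n divr_ge0// ltW.
  rewrite ger0_norm// => /(_ _)/wrap[].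
    by rewrite gt_min; apply/orP; right; lra.
  by rewrite expr1n mulr1 => /ltW; rewrite ler_norml => /andP[_]; lra.
(* The contraction below has ratio 1 - k / rho and preserves the ball of radius rho r / 2 about the
   centre, because (1 - k / rho) rho + k = rho. *)
pose rho := (k + 1) / 2.
have [C C0 HC] := mulmx_bound (invmx L).
pose h := (1 - k / rho) / C.
have rho1 : k < rho < 1 by rewrite /rho; apply/andP; split; lra.
have kr : k / rho < 1 by rewrite ltr_pdivrMr; lra.
have h0 : 0 < h by rewrite /h divr_gt0// subr_gt0.
have [d1 d10 H] := row_strict oO Ox FC h0.
have /nbhs_ballP[d2 /= d20 xO] := oO Ox.
exists (Num.min d1 d2); first by rewrite lt_min d10.
move=> a r /andP[r0]; rewrite lt_min => /andP[rd1 rd2] xQ.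
have QO : hcube a r `<=` O.
  move=> y yQ; apply: xO; rewrite -ball_normE /= distrC.
  by rewrite (lt_trans (hcube_dist r0 xQ yQ)).
pose q : 'rV[R]_n := \row_i (a 0 i + r / 2).
have UQ y : `|y - q| <= rho * (r / 2) -> hcube a r y.
  move=> yq i; have := le_trans (le_coord_norm _ 0 i) yq; rewrite !mxE ler_norml => /andP[h1 h2].
  have : rho * (r / 2) < r / 2 by rewrite gtr_pMl ?divr_gt0//; case/andP: rho1.
  by move=> ?; apply/andP; split; lra.
pose w : 'rV[R]_n := const_mx (k * (r / 2)).
have kr0 : 0 <= k * (r / 2) by rewrite mulr_ge0 ?divr_ge0 ?(ltW k0) ?(ltW r0).
apply: (@le_trans _ _ (leb ([set u | [set v *m L | v in (cbox (- w) w : set 'rV[R]_n)] (u + - F q)] : set (borelR n)))).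
  rewrite leb_trans; last first.
    by apply: compact_borel; apply: compact_image (@compact_cbox _ _ _ _) => u _; exact: continuous_mulmx.
  rewrite leb_diag_image; last by move=> i; rewrite !mxE; lra.
  rewrite lee_fin (eq_bigr (fun=> k * r)); last by move=> i _; rewrite !mxE; lra.
  by rewrite prodr_const card_ord exprMn mulrA ler_wpM2r// exprn_ge0// ltW.
apply: le_measure; rewrite ?inE; last first.
- move=> t [v hv tv].
  have vle : `|v| <= k * (r / 2).
    by apply: mx_norm_leP => // i j; rewrite ord1 ler_norml; have := hv j; rewrite !mxE.
  (* The Newton map with derivative frozen at [L]; its fixed points solve F y = F q + v L. *)
  pose T y := q + v - (F y - F q - (y - q) *m L) *m invmx L.
  have TT y z : `|y - q| <= rho * (r / 2) -> `|z - q| <= rho * (r / 2) ->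
      `|T y - T z| <= (1 - k / rho) * `|y - z|.
    move=> yq zq; have -> : T y - T z = - ((F y - F z - (y - z) *m L) *m invmx L).
      have -> : F y - F z - (y - z) *m L = (F y - F q - (y - q) *m L) - (F z - F q - (z - q) *m L).
        rewrite !mulmxBl; move: (y *m L) (z *m L) (q *m L) => y' z' q'.
        by apply/rowP => i; rewrite !mxE; ring.
      rewrite mulmxBl /T; move: (_ *m invmx L) (_ *m invmx L) => y' z'.
      by apply/rowP => i; rewrite !mxE; ring.
    rewrite normrN; apply: le_trans (HC _) _.
    rewrite -(@ler_pM2l _ C^-1) ?invr_gt0// mulKf ?gt_eqF// mulrA [C^-1 * _]mulrC -/h.
    have := H y z; rewrite (lt_trans (hcube_dist r0 xQ (UQ _ yq)))// (lt_trans (hcube_dist r0 xQ (UQ _ zq)))//.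
    exact.
  have qq : `|q - q| <= rho * (r / 2).
    by rewrite subrr normr0 mulr_ge0 ?divr_ge0 ?(ltW r0)//; case/andP: rho1; lra.
  have Tq : T q = q + v by rewrite /T !subrr mul0mx subrr mul0mx subr0.
  have TU y : `|y - q| <= rho * (r / 2) -> `|T y - q| <= rho * (r / 2).
    move=> yq; have := TT y q yq qq; rewrite Tq => h1.
    rewrite (_ : T y - q = (T y - (q + v)) + v); last by rewrite opprD addrA subrK.
    apply: le_trans (ler_normD _ _) _; apply: le_trans (lerD h1 vle) _.
    apply: (@le_trans _ _ ((1 - k / rho) * (rho * (r / 2)) + k * (r / 2))).
      by rewrite lerD2r ler_wpM2l// subr_ge0 ltW.
    rewrite le_eqVlt; apply/orP; left; apply/eqP; field.
    by move: rho1; rewrite /rho; lra.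
  pose U := cbox (q - const_mx (rho * (r / 2))) (q + const_mx (rho * (r / 2))).
  have UE y : U y <-> `|y - q| <= rho * (r / 2).
    split=> [hy|hy i].
      apply: mx_norm_leP => [|i j]; first by have := qq; rewrite subrr normr0.
      by rewrite ord1 !mxE ler_norml; have := hy j; rewrite !mxE; lra.
    have := le_trans (le_coord_norm _ 0 i) hy; rewrite !mxE ler_norml; lra.
  have cT (y : 'rV[R]_n) : U y -> {for y, continuous (fun y => `|T y - y|)}.
    move=> /UE yU; apply: (@continuous_norm_at _ 'rV[R]_n (fun y => T y - y)).
    have cFy : {for y, continuous F} by apply: cF; apply: QO; exact: UQ.
    have cyL : {for y, continuous (fun y : 'rV[R]_n => (y - q) *m L)}.
      apply: (@continuous_comp _ _ _ (fun y : 'rV[R]_n => y - q) (fun u => u *m L)); last exact: continuous_mulmx.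
      by apply: (@cvgB R 'rV[R]_n _ (nbhs y) _ id (fun=> q)); [exact: cvg_id|exact: cvg_cst].
    apply: (@cvgB R 'rV[R]_n _ (nbhs y) _ T id); last exact: cvg_id.
    apply: cvgB; first exact: cvg_cst.
    apply: (@continuous_comp _ _ _ (fun y => F y - F q - (y - q) *m L) (fun u => u *m invmx L)); last exact: continuous_mulmx.
    apply: (@cvgB R 'rV[R]_n _ (nbhs y) _ (fun y => F y - F q)).
      by apply: (@cvgB R 'rV[R]_n _ (nbhs y) _ F (fun=> F q)) => //; exact: cvg_cst.
    exact: cyL.
  (* The fixed point is a minimum of |T y - y| on a compact ball: a positive minimum would be
     lowered by applying [T] once more. *)
  have [||y yU ymin] := @compact_EVT_min _ R (fun y => `|T y - y|) U _ (@compact_cbox _ _ _ _).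
  - by exists q; apply/UE.
  - by apply: continuous_in_subspaceT => y /set_mem; exact: cT.
  move: yU => /set_mem/UE yU.
  have Ty : T y = y.
    apply/eqP; rewrite -subr_eq0 -normr_eq0; apply/negP => /negP; rewrite -normr_gt0 normr_id => T0.
    have h1 := ymin (T y) (mem_set (proj2 (UE _) (TU _ yU))).
    have h2 := TT (T y) y (TU _ yU) yU.
    have : (1 - k / rho) * `|T y - y| < `|T y - y|.
      by rewrite gtr_pMl// ltrBlDr ltrDl divr_gt0//; move: rho1; rewrite /rho; lra.
    lra.
  exists y; first exact: UQ.
  have : (F y - F q - (y - q) *m L) *m invmx L = v - (y - q).
    move: Ty; rewrite /T => /eqP; rewrite subr_eq => /eqP E.
    by rewrite opprB addrA [v + q]addrC E [RHS]addrAC subrr add0r.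
  move=> /(congr1 (fun u => u *m L)); rewrite mulmxKV// [RHS]mulmxBl tv => /addIr E.
  by apply: (@addIr _ (- F q)); rewrite E.
- exact: (image_hcube_measurable (@cF) QO).
- have mf : measurable_fun setT (fun u : borelR n => u + - F q : borelR n).
    apply: (@measurable_fun_cont_row R n n setT (fun u => u + - F q)); first exact: openT.
    by move=> z _; exact: (cvgD cvg_id (cvg_cst _)).
  have mK : measurable ([set v *m L | v in (cbox (- w) w : set 'rV[R]_n)] : set (borelR n)).
    by apply: compact_borel; apply: compact_image (@compact_cbox _ _ _ _) => u _; exact: continuous_mulmx.
  by have := mf measurableT _ mK; rewrite setTI.
Qed.

End CubeEstimate.

Section DensityPush.
Context d d' (T : measurableType d) (T' : measurableType d') (R : realType) (m : {measure set T -> \bar R})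
  (D : set T) (mD : measurable D) (g : T -> \bar R) (mg : measurable_fun D g) (g0 : forall x, (0 <= g x)%E)
  (f : T -> T') (mf : measurable_fun D f).

(* The proofs are arguments of [dpush] so that the measure structure below is
   attached to the term. *)
Definition dpush of measurable D & measurable_fun D g & (forall x, (0 <= g x)%E) & measurable_fun D f :=
  fun A : set T' => (\int[m]_(x in D `&` f @^-1` A) g x)%E.

Let dp := dpush mD mg g0 mf.

Let dp0 : dp set0 = 0%E.
Proof. by rewrite /dp /dpush preimage_set0 setI0 integral_set0. Qed.

Let dp_ge0 A : (0 <= dp A)%E. Proof. exact: integral_ge0. Qed.

Let dp_sigma : semi_sigma_additive dp.
Proof.
move=> F mF tF mUF; rewrite /dp /dpush preimage_bigcup setI_bigcupr ge0_integral_bigcup//.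
- apply: is_cvg_ereal_nneg_natsum_cond => k _ _; exact: integral_ge0.
- by move=> k; exact: mf.
- by apply: measurable_funS mg => // x [k _ []].
- apply/trivIsetP => i j _ _ ij; apply/seteqP; split=> // x [[_ xi] [_ xj]].
  by have /trivIsetP/(_ i j Logic.I Logic.I ij)/seteqP[h _] := tF; exact: (h (f x)).
Qed.

HB.instance Definition _ := isMeasure.Build _ T' R (dpush mD mg g0 mf) dp0 dp_ge0 dp_sigma.

End DensityPush.

Lemma borel_unique (R : realType) n (m1 m2 : {measure set (borelR n) -> \bar R}) :
  (m1 setT < +oo)%E -> (forall A : set 'rV[R]_n, open A -> m1 A = m2 A) ->
  forall A, measurable A -> m1 A = m2 A.
Proof.
move=> fin m12 A mA; apply: (measure_unique (@open 'rV[R]_n : set (set (borelR n))) (fun=> [set: borelR n])) => //.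
- by move=> B C oB oC; exact: openI.
- by move=> _; exact: openT.
- by apply/seteqP; split=> // x _; exists 0%N.
Qed.

Lemma measurable_fun_limn_einf (R : realType) d (T : measurableType d) (D : set T) (f : (T -> \bar R)^nat) :
  (forall k, measurable_fun D (f k)) -> measurable_fun D (fun x => limn_einf (f ^~ x)).
Proof.
move=> mf; have mg : measurable_fun D (fun x => limn_esup (fun k => - f k x)%E).
  by apply: measurable_fun_limn_esup => k; exact: (measurableT_comp (@oppe_measurable R setT) (mf k)).
exact: (measurableT_comp (@oppe_measurable R setT) mg).
Qed.

Lemma ltr_dist_itv (R : realType) (a b c : R) : `|a - b| < c -> a - c <= b <= a + c.
Proof. by rewrite ltr_norml => /andP[? ?]; apply/andP; split; lra. Qed.

(** * The area formula on a bounded domain *)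

Section AreaBounded.
Context {R : realType} {n : nat}.
Variables (O D : set 'rV[R]_n) (F : 'rV[R]_n -> 'rV[R]_n) (m : R).
Hypotheses (oO : open O) (FC : C1on O F) (oD : open D) (DO : D `<=` O) (m0 : 0 < m)
  (Dm : forall x i, D x -> - m < x 0 i < m).

Let side k : R := 2 * m / 2 ^+ k.
Let Q k (z : {ffun 'I_n -> 'I_(2 ^ k)}) : set (borelR n) :=
  hcube (\row_i (- m + (z i)%:R * side k)) (side k).
Local Arguments Q : clear implicits.
Let J (x : borelR n) : \bar R := (`|\det (jac F x)|)%:E.
(** The dyadic cubes inside [D] where the volume of the image and the integral of the jacobian
    differ by at most [e] times the volume of the cube. *)
Let good e k z : bool := `[< Q k z `<=` D /\
   ((leb (F @` Q k z : set (borelR n)) <= \int[@leb R n]_(x in Q k z) J x + e%:E * leb (Q k z)) /\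
    (\int[@leb R n]_(x in Q k z) J x <= leb (F @` Q k z : set (borelR n)) + e%:E * leb (Q k z)))%E >].
Local Arguments good : clear implicits.

Let side_gt0 k : 0 < side k. Proof. by rewrite /side !mulr_gt0 ?invr_gt0 ?exprn_gt0. Qed.

Let side_small e : 0 < e -> exists k0, forall k, (k0 <= k)%N -> side k < e.
Proof.
move=> e0; exists (Num.truncn (2 * m / e)).+1 => k kk.
rewrite /side ltr_pdivrMr ?exprn_gt0//; rewrite -ltr_pdivrMl// mulrC.
have /truncn_itv/andP[_ h] : 0 <= 2 * m / e by rewrite divr_ge0 ?mulr_ge0// ltW.
apply: lt_le_trans h _; apply: (@le_trans _ _ k%:R); first by rewrite ler_nat.
by rewrite -natrX ler_nat ltnW// ltn_expl.
Qed.

Let grid k x : D x -> exists z, Q k z x.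
Proof.
move=> Dx.
have h (i : 'I_n) : 0 <= (x 0 i + m) / side k < 2 ^+ k.
  have /andP[h1 h2] := Dm i Dx; rewrite divr_ge0 ?(ltW (side_gt0 k))//=; last lra.
  rewrite ltr_pdivrMr// /side mulrCA divff ?mulr1; last by rewrite gt_eqF ?exprn_gt0.
  lra.
have hz (i : 'I_n) : (Num.truncn ((x 0%R i + m) / side k)%R < 2 ^ k)%N.
  have /andP[h1 h2] := h i; rewrite -(ltr_nat R) natrX; apply: le_lt_trans h2.
  by have /andP[] := truncn_itv h1.
exists [ffun i => Ordinal (hz i)] => i; rewrite mxE ffunE /=.
have /andP[h1 h2] := h i; have /andP[a1 a2] := truncn_itv h1.
rewrite ler_pdivlMr// in a1; rewrite ltr_pdivrMr// -natr1 mulrDl mul1r in a2; lra.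
Qed.

Let grid_uniq k z z' x : Q k z x -> Q k z' x -> z = z'.
Proof.
move=> hz hz'; apply/ffunP => i; apply/val_inj; have s0 := side_gt0 k.
have lt (a b : nat) : (a < b)%N -> a%:R * side k + side k <= b%:R * side k.
  by move=> ab; rewrite -[X in _ + X <= _]mul1r -mulrDl ler_pM2r// natr1 ler_nat.
have := hz i; have := hz' i; rewrite !mxE => /andP[a1 a2] /andP[b1 b2].
by case: (ltngtP (z i) (z' i)) => // /lt h; exfalso; lra.
Qed.

Let mQ k z : measurable (Q k z). Proof. exact: measurable_hcube. Qed.
Local Arguments mQ : clear implicits.

Let cJ x : O x -> {for x, continuous (fun y => `|\det (jac F y)|)}.
Proof.
move=> Ox; apply: (@continuous_norm_at R _ R^o (fun y => \det (jac F y))).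
by apply: continuous_det => i j; exact: continuous_jac FC.
Qed.

Let mJ : measurable_fun (D : set (borelR n)) J.
Proof.
apply/measurable_EFinP; apply: (@measurable_fun_cont R n D (fun y => `|\det (jac F y)|)) => //.
by move=> x /DO; exact: cJ.
Qed.

(** Half of [e] pays for the cube estimates at [x], the other half for the oscillation of the
    jacobian on the cube. *)
Let good_ev e x : 0 < e -> D x -> exists k0, forall k, (k0 <= k)%N -> exists z, good e k z /\ Q k z x.
Proof.
move=> e0 Dx; have Ox := DO Dx; have e2 : 0 < e / 2 by rewrite divr_gt0.
have [d1 d10 H1] := cube_est_upper oO FC Ox e2.
have [d2 d20 H2] := cube_est_lower oO FC Ox e2.
have /cvgrPdist_lt/(_ _ e2)/nbhs_ballP[d3 /= d30 H3] := cJ Ox.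
have /nbhs_ballP[d4 /= d40 H4] := oD Dx.
have dm : 0 < Num.min (Num.min d1 d2) (Num.min d3 d4) by rewrite !lt_min d10 d20 d30.
have [k0 H] := side_small dm.
exists k0 => k /H; rewrite !lt_min => /andP[/andP[kd1 kd2] /andP[kd3 kd4]].
have [z zx] := grid k Dx; exists z; split=> //; apply/asboolP.
have s0 := side_gt0 k.
have zb y : Q k z y -> ball x d3 y /\ ball x d4 y.
  move=> zy; have := hcube_dist s0 zx zy; rewrite -!ball_normE /= [X in _ -> X < _ /\ X < _]distrC.
  by move=> h; split; apply: lt_trans h _.
have QD : Q k z `<=` D by move=> y /zb[_ /H4].
have Jb y : Q k z y -> `|\det (jac F x)| - e / 2 <= `|\det (jac F y)| <= `|\det (jac F x)| + e / 2.
  by move=> /zb[/H3 + _]; exact: ltr_dist_itv.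
split=> //.
have [|_ U1] := H1 (\row_i (- m + (z i)%:R * side k)) (side k) _ zx; first by rewrite s0.
have := H2 (\row_i (- m + (z i)%:R * side k)) (side k) _ zx; rewrite s0 => /(_ kd2) L1.
have lQ : leb (Q k z) = (side k ^+ n)%:E by exact: leb_hcube.
have mJQ : measurable_fun (Q k z) J by exact: measurable_funS (borel_open oD) QD mJ.
have IU : (\int[@leb R n]_(x in Q k z) J x <= ((`|\det (jac F x)| + e / 2) * side k ^+ n)%:E)%E.
  rewrite EFinM -lQ -integral_cst//; apply: ge0_le_integral => //; first by move=> y _; rewrite lee_fin.
  by move=> y /Jb; rewrite lee_fin => /andP[].
have IL : (((`|\det (jac F x)| - e / 2) * side k ^+ n)%:E <= \int[@leb R n]_(x in Q k z) J x)%E.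
  have [neg|pos] := leP (`|\det (jac F x)| - e / 2) 0.
    apply: (@le_trans _ _ 0%E); last by apply: integral_ge0 => y _; rewrite lee_fin.
    by rewrite lee_fin pmulr_lle0// exprn_gt0.
  rewrite EFinM -lQ -integral_cst//; apply: ge0_le_integral => //.
  - by move=> y _; rewrite lee_fin ltW.
  - by move=> y /Jb; rewrite lee_fin => /andP[].
rewrite lQ -EFinM; split.
  apply: (le_trans U1); apply: (@le_trans _ _ (((`|\det (jac F x)| - e / 2) * side k ^+ n)%:E + (e * side k ^+ n)%:E)%E).
    by rewrite -EFinD lee_fin -mulrDl ler_pM2r ?exprn_gt0//; lra.
  exact: leeD2r.
apply: (le_trans IU); apply: (@le_trans _ _ (((`|\det (jac F x)| - e / 2) * side k ^+ n)%:E + (e * side k ^+ n)%:E)%E).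
  by rewrite -EFinD lee_fin -mulrDl ler_pM2r ?exprn_gt0//; lra.
exact: leeD2r.
Qed.

Let A e k t := [set z | good e k z && `[< (F @` Q k z) t >]]%SET.
(** An approximation of the fiber count by a finite sum of indicators of images of cubes, hence
    measurable and easy to integrate. *)
Let Nk e k (t : borelR n) : \bar R := (#|A e k t|%:R)%:E.

Let NkE e k t : Nk e k t = (\sum_(z | good e k z) (\1_(F @` Q k z : set (borelR n)) t)%:E)%E.
Proof.
rewrite /Nk -sum1_card natr_sum -sumEFin big_mkcond [RHS]big_mkcond /=; apply: eq_bigr => z _.
rewrite inE indicE; case: (good e k z) => //=; case: asboolP => h; first by rewrite mem_set.
by rewrite memNset.
Qed.

Let Nk_le e k t : (Nk e k t <= counting (D `&` F @^-1` [set t]))%E.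
Proof.
apply/counting_geP.
have h (i : 'I_#|A e k t|) : exists y, Q k (enum_val i) y /\ (D y /\ F y = t).
  have := enum_valP i; rewrite inE => /andP[/asboolP[QD _] /asboolP[y yQ yt]].
  by exists y; split=> //; split=> //; exact: QD.
have [p pP] := choice h; exists p; split=> [i j ij|i]; last by have [_ []] := pP i.
apply: enum_val_inj; apply: (grid_uniq (x := p i)); first by have [] := pP i.
by rewrite ij; have [] := pP j.
Qed.

(** Finitely many points of a fiber fall into distinct cubes once the side is less than their mutual
    distances, and each of these cubes is good from some level on. Conversely, distinct cubes give
    distinct points. *)
Let counting_liminf e t : 0 < e -> counting (D `&` F @^-1` [set t]) = limn_einf (fun k => Nk e k t).
Proof.
move=> e0; apply/eqP; rewrite eq_le; apply/andP; split; last by apply: einf_le => k; exact: Nk_le.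
apply: counting_le => M /counting_geP[p [pinj pA]].
have [d d0 dP] : exists2 d : R, 0 < d & forall i j, i != j -> d <= `|p i - p j|.
  have [|ij d d' dd h|d d0 H] := @finite_delta R ('I_M * 'I_M)%type (fun ij d => ij.1 != ij.2 -> d <= `|p ij.1 - p ij.2|).
  - move=> [i j]; have [->|ij] := eqVneq i j; first by exists 1 => //=; rewrite eqxx.
    exists `|p i - p j| => //=; rewrite normr_gt0 subr_eq0.
    by apply: contraNN ij => /eqP/pinj ->.
  - by case/andP: dd => _ dd /h; exact: le_trans.
  - by exists d => // i j; exact: (H (i, j)).
have hk i : exists k0, forall k, (k0 <= k)%N -> exists z, good e k z /\ Q k z (p i).
  by apply: good_ev => //; have [] := pA i.
have [ks ksP] := choice hk.
have [kd kdP] := side_small d0.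
apply: (@einf_ge _ _ _ (maxn kd (\max_i ks i))) => k; rewrite geq_max => /andP[/kdP kkd kks].
have hz i : exists z, good e k z /\ Q k z (p i).
  by apply: ksP; apply: leq_trans kks; exact: leq_bigmax.
have [z zP] := choice hz.
have zinj : injective z.
  move=> i j zij; apply/eqP; apply/negP => /negP /dP; rewrite leNgt => /negP; apply.
  apply: lt_trans kkd; apply: (@hcube_dist _ _ _ _ _ _ (side_gt0 k)) (zP i).2.
  by rewrite zij; exact: (zP j).2.
rewrite lee_fin ler_nat -[X in (X <= _)%N](card_ord M) -(card_imset _ zinj).
apply: subset_leq_card; apply/fintype.subsetP => _ /imsetP[i _ ->]; rewrite inE (zP i).1 /=.
by apply/asboolP; exists (p i); [exact: (zP i).2|have [_] := pA i].
Qed.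

Let mFQ e k z : good e k z -> measurable (F @` Q k z : set (borelR n)).
Proof.
move=> /asboolP[QD _]; apply: (@image_hcube_measurable _ _ F _ _ O).
  by move=> x Ox; exact: C1on_continuous oO Ox FC.
by move=> x /QD /DO.
Qed.

Let mNk e k : measurable_fun setT (Nk e k).
Proof.
rewrite (_ : Nk e k = fun t => (\sum_(z | good e k z) (\1_(F @` Q k z : set (borelR n)) t)%:E)%E); last first.
  by apply/funext => t; exact: NkE.
rewrite [X in measurable_fun _ X](_ : _ = fun t => (\sum_(z <- [seq z <- index_enum _ | good e k z])
   (\1_(F @` Q k z : set (borelR n)) t)%:E)%E); last by apply/funext => t; rewrite big_filter.
rewrite [X in measurable_fun _ X](_ : _ = fun t => (\sum_(z <- [seq z <- index_enum _ | good e k z])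
   (if good e k z then \1_(F @` Q k z : set (borelR n)) t else 0)%:E)%E); last first.
  apply/funext => t; rewrite !big_filter; apply: eq_bigr => z gz; by rewrite gz.
apply: emeasurable_sum => z; apply/measurable_EFinP; case gz : (good e k z); last exact: measurable_cst.
exact: measurable_indic (mFQ gz).
Qed.

Lemma measurable_counting_bounded : measurable_fun setT (fun t : borelR n => counting (D `&` F @^-1` [set t]) : \bar R).
Proof.
rewrite [X in measurable_fun _ X](_ : _ = fun t => limn_einf (fun k => Nk 1 k t)).
  by apply: measurable_fun_limn_einf => k; exact: mNk.
by apply/funext => t; exact: counting_liminf.
Qed.

Let IN e k : (\int[@leb R n]_t Nk e k t = \sum_(z | good e k z) leb (F @` Q k z : set (borelR n)))%E.
Proof.
rewrite -(big_filter _ (good e k)).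
rewrite (eq_integral (fun t => (\sum_(z <- [seq z <- index_enum _ | good e k z])
   (if good e k z then \1_(F @` Q k z : set (borelR n)) t else 0)%:E)%E)); last first.
  by move=> t _; rewrite NkE !big_filter; apply: eq_bigr => z gz; rewrite gz.
rewrite ge0_integral_sum//; last first.
- by move=> z x _; rewrite lee_fin; case: ifP.
- move=> z; apply/measurable_EFinP; case gz : (good e k z); last exact: measurable_cst.
  exact: measurable_indic (mFQ gz).
rewrite !big_filter; apply: eq_bigr => z gz; rewrite gz integral_indic ?setIT//; exact: mFQ gz.
Qed.

Let IJ e k : (\int[@leb R n]_(x in D) (J x * (\sum_(z | good e k z) (\1_(Q k z) x)%:E)) =
   \sum_(z | good e k z) \int[@leb R n]_(x in Q k z) J x)%E.
Proof.
have mD : measurable (D : set (borelR n)) by exact: borel_open.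
rewrite (eq_integral (fun x => (\sum_(z | good e k z) (J x * (\1_(Q k z) x)%:E))%E)); last first.
  by move=> x _; rewrite ge0_sume_distrr// => z _; rewrite lee_fin.
rewrite -(big_filter _ (good e k)) (eq_integral (fun x => (\sum_(z <- [seq z <- index_enum _ | good e k z]) (J x * (\1_(Q k z) x)%:E))%E)); last first.
  by move=> x _; rewrite big_filter.
rewrite ge0_integral_sum//; last first.
- by move=> z x _; rewrite mule_ge0// lee_fin.
- move=> z; apply: emeasurable_funM => //; apply/measurable_EFinP; exact: measurable_funS measurableT _ (measurable_indic (mQ k z)).
rewrite !big_filter; apply: eq_bigr => z /asboolP[QD _].
rewrite -[in RHS](setIidr QD) integral_mkcondr; apply: eq_integral => x _.
by rewrite patchE indicE; case: (x \in _); rewrite ?mule1 ?mule0.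
Qed.

Let sumQ e k : (\sum_(z | good e k z) leb (Q k z) <= ((2 * m) ^+ n)%:E)%E.
Proof.
apply: (@le_trans _ _ (\sum_z leb (Q k z))%E).
  rewrite big_mkcond; apply: lee_sum => z _; case: ifP => // _; exact: measure_ge0.
rewrite (eq_bigr (fun=> (side k ^+ n)%:E)); last by move=> z _; exact: leb_hcube.
rewrite sumEFin lee_fin sumr_const card_ffun !card_ord -[leLHS]mulr_natl !natrX -exprMn.
by rewrite /side mulrCA divff ?mulr1// gt_eqF ?exprn_gt0.
Qed.

(** Fatou's lemma used twice: for the [Nk], whose lower limit is the count, and for the jacobian cut
    down to the good cubes, whose lower limit is at least the jacobian. *)
Lemma area_formula_bounded :
  (\int[@leb R n]_t counting (D `&` F @^-1` [set t]) = \int[@leb R n]_(x in D) J x)%E.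
Proof.
have mD : measurable (D : set (borelR n)) by exact: borel_open.
pose C := (2 * m) ^+ n; have C0 : 0 < C by rewrite exprn_gt0// mulr_gt0.
have sumE e k : 0 < e -> (\sum_(z | good e k z) (e%:E * leb (Q k z)) <= (e * C)%:E)%E.
  move=> e0; rewrite -ge0_sume_distrr; last by move=> z _; exact: measure_ge0.
  by rewrite EFinM lee_pmul2l// sumQ.
have g1 e k x : (\sum_(z | good e k z) (\1_(Q k z) x)%:E <= 1 :> \bar R)%E.
  have [[z gz zx]|no] := pselect (exists2 z, good e k z & Q k z x); last first.
    by rewrite big1 ?lee01// => z gz; rewrite indicE memNset// => zx; apply: no; exists z.
  rewrite (bigD1 z)//= big1 ?adde0; first by rewrite indicE lee_fin lern1 leq_b1.
  by move=> z' /andP[_ /eqP zz]; rewrite indicE memNset// => zx'; apply: zz; exact: grid_uniq zx' zx.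
apply/eqP; rewrite eq_le; apply/andP; split; apply/lee_addgt0Pr => e' e'0.
  (* With this [e] the errors over a grid of total volume [C] add up to at most e'. *)
  pose e := e' / C; have e0 : 0 < e by rewrite divr_gt0.
  rewrite (eq_integral (fun t => limn_einf (fun k => Nk e k t))); last by move=> t _; exact: counting_liminf.
  apply: (le_trans (fatou (@leb R n) measurableT (mNk e) _)); first by move=> k x _; rewrite lee_fin.
  apply: einf_le => k; rewrite IN.
  apply: (@le_trans _ _ (\sum_(z | good e k z) (\int[@leb R n]_(x in Q k z) J x + e%:E * leb (Q k z)))%E).
    by apply: lee_sum => z /asboolP[_ []].
  rewrite big_split /= leeD//; last by apply: le_trans (sumE e k e0) _; rewrite /e divfK// gt_eqF.
  rewrite -IJ; apply: ge0_le_integral => //.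
  - by move=> x _; apply: mule_ge0; [rewrite lee_fin|apply: sume_ge0 => z _; rewrite lee_fin].
  - apply: emeasurable_funM => //; apply: measurable_funS measurableT _ _ => //.
    rewrite [X in measurable_fun _ X](_ : _ = fun x => (\sum_(z <- [seq z <- index_enum _ | good e k z]) (\1_(Q k z) x)%:E)%E); last first.
      by apply/funext => x; rewrite big_filter.
    apply: emeasurable_sum => z; apply/measurable_EFinP; exact: measurable_indic (mQ k z).
  - by move=> x _; rewrite -[leRHS]mule1; apply: lee_wpmul2l; rewrite ?lee_fin.
pose e := e' / C; have e0 : 0 < e by rewrite divr_gt0.
pose g k x := (J x * (\sum_(z | good e k z) (\1_(Q k z) x)%:E))%E.
have mg k : measurable_fun (D : set (borelR n)) (g k).
  apply: emeasurable_funM => //; apply: measurable_funS measurableT _ _ => //.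
  rewrite [X in measurable_fun _ X](_ : _ = fun x => (\sum_(z <- [seq z <- index_enum _ | good e k z]) (\1_(Q k z) x)%:E)%E); last first.
    by apply/funext => x; rewrite big_filter.
  apply: emeasurable_sum => z; apply/measurable_EFinP; exact: measurable_indic (mQ k z).
have g0 k x : (0 <= g k x)%E by apply: mule_ge0; [rewrite lee_fin|apply: sume_ge0 => z _; rewrite lee_fin].
apply: (@le_trans _ _ (\int[@leb R n]_(x in D) limn_einf (g ^~ x))%E).
  apply: ge0_le_integral => //; [by move=> x _; rewrite lee_fin|exact: measurable_fun_limn_einf|].
  move=> x Dx; have [k0 H] := good_ev e0 Dx; apply: (@einf_ge _ _ _ k0) => k /H[z [gz zx]].
  rewrite /g -[leLHS]mule1; apply: lee_wpmul2l; first by rewrite lee_fin.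
  rewrite (bigD1 z)//= indicE mem_set// leeDl//.
  by apply: sume_ge0 => z' _; rewrite lee_fin.
apply: (le_trans (fatou (@leb R n) mD mg _)) => //.
apply: einf_le => k; rewrite IJ.
apply: (@le_trans _ _ (\sum_(z | good e k z) (leb (F @` Q k z : set (borelR n)) + e%:E * leb (Q k z)))%E).
  by apply: lee_sum => z /asboolP[_ []].
rewrite big_split /= leeD//; last by apply: le_trans (sumE e k e0) _; rewrite /e divfK// gt_eqF.
rewrite -IN; apply: ge0_le_integral => //; first by move=> x _; rewrite lee_fin.
exact: measurable_counting_bounded.
Qed.

End AreaBounded.

(** * The area formula on open sets and for injective maps *)

Section Area.
Context {R : realType} {n : nat}.
Variables (O : set 'rV[R]_n) (F : 'rV[R]_n -> 'rV[R]_n).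
Hypotheses (oO : open O) (FC : C1on O F).
Implicit Types D : set 'rV[R]_n.

Let B k : set 'rV[R]_n := ball 0 (k.+1%:R : R).
Let oB k : open (B k). Proof. exact: ball_open. Qed.

Lemma ball_rVP (x : 'rV[R]_n) r : 0 < r -> ball 0 r x <-> `|x| < r.
Proof. by move=> r0; rewrite -ball_normE /= sub0r normrN. Qed.

Lemma ball_exhaust (x : 'rV[R]_n) : exists k0, forall k, (k0 <= k)%N -> B k x.
Proof.
exists (Num.truncn `|x|) => k kk; apply/ball_rVP => //.
have /andP[_ h] := truncn_itv (normr_ge0 x).
by apply: lt_le_trans h _; rewrite ler_nat.
Qed.

Let oDB D k : open D -> open (D `&` B k).
Proof. by move=> oD; exact: openI. Qed.

Let DBO D k : D `<=` O -> D `&` B k `<=` O.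
Proof. by move=> DO x [/DO]. Qed.

Let DBm D k x i : (D `&` B k) x -> - k.+1%:R < x 0 i < k.+1%:R.
Proof.
move=> [_ /ball_rVP]; rewrite ltr0n => /(_ isT) h.
by rewrite -ltr_norml; apply: le_lt_trans h; exact: le_coord_norm.
Qed.

Let pos k : 0 < k.+1%:R :> R. Proof. by rewrite ltr0n. Qed.

Let mc D k : open D -> D `<=` O ->
  measurable_fun setT (fun t : borelR n => counting ((D `&` B k) `&` F @^-1` [set t]) : \bar R).
Proof.
by move=> oD DO; apply: (measurable_counting_bounded oO FC (@oDB D k oD) (@DBO D k DO) (pos k)) => x i; exact: DBm.
Qed.

Let einf_c D t : counting (D `&` F @^-1` [set t]) =
  limn_einf (fun k => counting ((D `&` B k) `&` F @^-1` [set t]) : \bar R).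
Proof.
apply/eqP; rewrite eq_le; apply/andP; split; last first.
  by apply: einf_le => k; apply: le_counting => x [[]].
apply: counting_le => M /counting_geP[p [pinj pA]].
have [ks ksP] := choice (fun i => ball_exhaust (p i)).
apply: (@einf_ge _ _ _ (\max_i ks i)) => k kk; apply/counting_geP; exists p; split=> // i.
have [Di ti] := pA i; split=> //; split=> //; apply: ksP.
by apply: leq_trans kk; exact: leq_bigmax.
Qed.

Lemma measurable_counting_fiber D : open D -> D `<=` O ->
  measurable_fun setT (fun t : borelR n => counting (D `&` F @^-1` [set t]) : \bar R).
Proof.
move=> oD DO; rewrite [X in measurable_fun _ X](_ : _ =
  fun t => limn_einf (fun k => counting ((D `&` B k) `&` F @^-1` [set t]) : \bar R)).
  by apply: measurable_fun_limn_einf => k; exact: mc.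
by apply/funext => t; exact: einf_c.
Qed.

Lemma measurable_abs_jac D : open D -> D `<=` O ->
  measurable_fun (D : set (borelR n)) (fun x : borelR n => (`|\det (jac F x)|)%:E : \bar R).
Proof.
move=> oD DO; apply/measurable_EFinP; apply: (@measurable_fun_cont R n D (fun y => `|\det (jac F y)|)) => //.
move=> x /DO Ox; apply: (@continuous_norm_at R _ R^o (fun y => \det (jac F y))).
by apply: continuous_det => i j; exact: continuous_jac FC.
Qed.

Theorem area_formula D : open D -> D `<=` O ->
  (\int[@leb R n]_t counting (D `&` F @^-1` [set t]) = \int[@leb R n]_(x in D) (`|\det (jac F x)|)%:E)%E.
Proof.
move=> oD DO; have mD : measurable (D : set (borelR n)) by exact: borel_open.
have mB k : measurable (B k : set (borelR n)) by exact: borel_open.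
have AB k := area_formula_bounded oO FC (@oDB D k oD) (@DBO D k DO) (pos k) (@DBm D k).
have mJ := measurable_abs_jac oD DO.
apply/eqP; rewrite eq_le; apply/andP; split.
  rewrite (eq_integral (fun t : borelR n => limn_einf (fun k => counting ((D `&` B k) `&` F @^-1` [set t])))); last by move=> t _; exact: einf_c.
  apply: (le_trans (fatou (@leb R n) measurableT (fun k => mc k oD DO) _)); first by move=> k x _; exact: counting_ge0.
  apply: einf_le => k; rewrite AB; apply: ge0_subset_integral => //.
  exact: measurableI.
pose g k x : \bar R := ((`|\det (jac F x)|)%:E * (\1_(B k) x)%:E)%E.
have mg k : measurable_fun (D : set (borelR n)) (g k).
  apply: emeasurable_funM => //; apply/measurable_EFinP; exact: measurable_funS measurableT _ (measurable_indic (mB k)).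
have g0 k x : (0 <= g k x)%E by rewrite mule_ge0// lee_fin.
have gE k : (\int[@leb R n]_(x in D) g k x = \int[@leb R n]_t counting ((D `&` B k) `&` F @^-1` [set t]))%E.
  rewrite AB integral_mkcondr; apply: eq_integral => x _.
  by rewrite patchE /g indicE; case: (x \in _); rewrite ?mule1 ?mule0.
apply: (@le_trans _ _ (\int[@leb R n]_(x in D) limn_einf (g ^~ x))%E).
  apply: ge0_le_integral => //; first exact: measurable_fun_limn_einf.
  move=> x Dx; have [k0 H] := ball_exhaust x; apply: (@einf_ge _ _ _ k0) => k /H zx.
  by rewrite /g indicE mem_set// mule1.
apply: (le_trans (fatou (@leb R n) mD mg _)) => //.
apply: einf_le => k; rewrite gE; apply: ge0_le_integral => //.
- by move=> t _; exact: counting_ge0.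
- exact: mc.
- exact: measurable_counting_fiber.
- by move=> t _; apply: le_counting => x [[]].
Qed.

(* By strict differentiability, [F y = F z] would force the invertible jacobian to
   shrink [y - z] by an arbitrarily small factor. *)
Lemma locally_injective x : O x -> \det (jac F x) != 0 ->
  exists2 d, 0 < d & forall y z, ball x d y -> ball x d z -> F y = F z -> y = z.
Proof.
move=> Ox L0; have uL : jac F x \in unitmx by rewrite unitmxE unitfE.
have [C C0 HC] := mulmx_bound (invmx (jac F x)).
have h0 : 0 < (2 * C)^-1 by rewrite invr_gt0 mulr_gt0.
have [d d0 H] := row_strict oO Ox FC h0.
exists d => // y z; rewrite -!ball_normE /= ![`|x - _|]distrC => yd zd yz.
have := H y z yd zd; rewrite yz subrr sub0r normrN => h.
have := HC ((y - z) *m jac F x); rewrite mulmxK// => h'.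
have : `|y - z| <= C * ((2 * C)^-1 * `|y - z|) by apply: (le_trans h'); rewrite ler_pM2l.
rewrite mulrA invfM mulrCA divff ?gt_eqF// mulr1 => h2.
apply/eqP; rewrite -subr_eq0 -normr_eq0; have := normr_ge0 (y - z); rewrite le_eqVlt => /orP[/eqP <-//|p].
lra.
Qed.

Section Injective.
Hypothesis Finj : forall x y, O x -> O y -> F x = F y -> x = y.

Let cF x : O x -> {for x, continuous F}.
Proof. by move=> Ox; exact: C1on_continuous oO Ox FC. Qed.

Let countE (C : set 'rV[R]_n) t : counting ((O `&` F @^-1` C) `&` F @^-1` [set t]) = (\1_(C `&` F @` O) t)%:E :> \bar R.
Proof.
have [[Ct [x Ox xt]]|no] := pselect ((C `&` F @` O) t).
  rewrite indicE mem_set; last by split=> //; exists x.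
  rewrite (_ : _ `&` _ = [set x]); last first.
    apply/seteqP; split=> [y [[Oy Cy] yt]|y ->]; first by apply: Finj => //; rewrite xt.
    by split=> //; split=> //; rewrite /preimage /= xt.
  apply/eqP; rewrite eq_le; apply/andP; split.
    apply: counting_le => -[_|[_|M]]; rewrite ?lee_fin ?ler0n ?lexx//.
    move=> /counting_geP[p [pinj pA]]; have := pinj ord0 (lift ord0 ord0); rewrite (pA ord0) (pA (lift ord0 ord0)).
    by move=> /(_ erefl).
  apply/(@counting_geP R _ [set x] 1); exists (fun=> x); split=> // i j _; by rewrite !ord1.
rewrite indicE memNset//; rewrite (_ : _ `&` _ = set0).
  apply/eqP; rewrite eq_le counting_ge0 andbT; apply: counting_le => -[|M] // /counting_geP[p [_ pA]].
  by have := pA ord0.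
by apply/seteqP; split=> // y [[Oy Cy] yt]; apply: no; split; [rewrite -yt|exists y].
Qed.

(** For injective [F] the fiber count is the indicator of the image, and the fiber count is known to
    be measurable. *)
Lemma measurable_image_inj : measurable (F @` O : set (borelR n)).
Proof.
have := measurable_counting_fiber oO (@subset_refl _ O).
have := @emeasurable_fun_c_infty _ (borelR n) R setT (fun t => counting (O `&` F @^-1` [set t])) measurableT.
move=> /[apply] /(_ 1%E); rewrite setTI; congr measurable.
have E t : counting (O `&` F @^-1` [set t]) = (\1_(F @` O) t)%:E :> \bar R.
  by have := countE setT t; rewrite preimage_setT setIT setTI.
apply/seteqP; split=> t /=; rewrite E indicE lee_fin; last by move=> h; rewrite mem_set.
by have [/set_mem//|] := boolP (t \in _); rewrite ler10.
Qed.

(* Both sides are finite measures in [C] that agree on open sets by the area formula. *)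
Lemma area_formula_inj (C : set (borelR n)) : (leb (F @` O : set (borelR n)) < +oo)%E -> measurable C ->
  (\int[@leb R n]_(x in O `&` F @^-1` C) (`|\det (jac F x)|)%:E = leb (C `&` F @` O : set (borelR n)))%E.
Proof.
move=> fin mC; have mO : measurable (O : set (borelR n)) by exact: borel_open.
have mF : measurable_fun (O : set (borelR n)) (F : borelR n -> borelR n) by exact: measurable_fun_cont_row.
have mFO := measurable_image_inj.
have J0 (x : borelR n) : (0 <= (`|\det (jac F x)|)%:E :> \bar R)%E by rewrite lee_fin.
rewrite -/(dpush (@leb R n) mO (measurable_abs_jac oO (@subset_refl _ O)) J0 mF C) -/(mrestr (@leb R n) mFO C).
apply: esym; apply: borel_unique => //; first by rewrite /= /mrestr setTI.
move=> A oA; rewrite /= /mrestr /dpush.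
rewrite -area_formula; [|exact: continuous_on_measurable|by move=> x []].
rewrite -[X in leb X]setIT -integral_indic//; last by apply: measurableI => //; exact: borel_open.
by apply: eq_integral => t _; rewrite countE.
Qed.

End Injective.
End Area.

(** * Norms and the measure on the unit sphere *)

Section RowNorm.
Context {R : realType} {m : nat}.
Variable NN : 'rV[R]_m -> R.
Hypothesis hN : is_norm (V := 'rV[R]_m : vectType R) NN.

Lemma rnorm0 : NN 0 = 0.
Proof. by have [_ _ h _] := hN; have := h 0 0; rewrite scale0r normr0 mul0r. Qed.

Lemma rnormN u : NN (- u) = NN u.
Proof. by have [_ _ h _] := hN; have := h (-1) u; rewrite scaleN1r normrN1 mul1r. Qed.

Lemma rnorm_ub : exists2 C, 0 < C & forall u, NN u <= C * `|u|.
Proof.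
have [N0 _ NZ ND] := hN.
exists (1 + \sum_i NN (delta_mx 0 i)); first by rewrite ltr_wpDr// sumr_ge0.
move=> u; rewrite {1}[u]row_sum_delta.
apply: (@le_trans _ _ (\sum_i `|u 0 i| * NN (delta_mx 0 i))).
  elim/big_ind2: _ => [|x1 x2 y1 y2 h1 h2|i _]; first by rewrite rnorm0.
    by apply: (le_trans (ND _ _)); rewrite lerD.
  by rewrite NZ.
rewrite mulrDl mul1r mulr_suml; apply: (@le_trans _ _ (\sum_i NN (delta_mx 0 i) * `|u|)); last by rewrite lerDr.
by apply: ler_sum => i _; rewrite mulrC ler_wpM2l//; exact: le_coord_norm.
Qed.

Lemma rnorm_continuous : continuous NN.
Proof.
have [N0 _ NZ ND] := hN; have [C C0 HC] := rnorm_ub.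
have L u v : NN u - NN v <= C * `|u - v|.
  by apply: le_trans (HC _); rewrite lerBlDr; have := ND (u - v) v; rewrite subrK.
suff H (x : 'rV[R]_m) : {for x, continuous NN} by exact: H.
apply/(cvgrPdist_lt (FF := nbhs_filter x)) => e e0; apply/nbhs_ballP; exists (e / C); first by rewrite /= divr_gt0.
move=> y; rewrite -ball_normE /= => h; rewrite ltr_norml.
have h1 := L x y; have h2 := L y x; rewrite distrC in h2.
have h3 : C * `|x - y| < e by rewrite mulrC -ltr_pdivlMr.
by apply/andP; split; lra.
Qed.

Lemma rnorm_lb : exists2 C, 0 < C & forall u, `|u| <= C * NN u.
Proof.
have [N0 N1 NZ ND] := hN.
pose S := [set u : 'rV[R]_m | `|u| = 1].
(* The sphere of the sup norm is empty when m = 0. *)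
have [[s Ss]|S0] := pselect (S !=set0); last first.
  exists 1 => // u; rewrite mul1r; have [->|u0] := eqVneq u 0; first by rewrite normr0.
  exfalso; apply: S0; exists (`|u|^-1 *: u).
  by rewrite /S /= normrZ normfV normr_id mulVf// normr_eq0.
have cS : compact S.
  apply: (@subclosed_compact _ _ (cbox (const_mx (-1)) (const_mx 1))); last 2 first.
  - exact: compact_cbox.
  - by move=> u Su i; rewrite !mxE -ler_norml -Su; exact: le_coord_norm.
  rewrite (_ : S = (@Num.norm R _) @^-1` [set (1 : R)])//.
  by apply: closed_comp => [x _|]; [exact: norm_continuous|exact: closed_eq].
have [||x Sx xmin] := @compact_EVT_min _ R NN S _ cS; first by exists s.
  by apply: continuous_in_subspaceT => x _; exact: rnorm_continuous.
have {}Sx : `|x| = 1 by move: Sx => /set_mem.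
have Nx : 0 < NN x.
  rewrite lt_neqAle N0 andbT; apply/eqP => /esym/N1 x0.
  by move: Sx; rewrite x0 normr0 => /eqP; rewrite eq_sym oner_eq0.
exists (NN x)^-1 => [|u]; first by rewrite invr_gt0.
have [->|u0] := eqVneq u 0; first by rewrite normr0 mulr_ge0// invr_ge0 ltW.
have nu : 0 < `|u| by rewrite normr_gt0.
rewrite -ler_pdivrMl ?invr_gt0// invrK.
have : (`|u|^-1 *: u) \in S.
  by apply/mem_set; rewrite /S /= normrZ normfV normr_id mulVf// normr_eq0.
by move=> /xmin; rewrite NZ normfV normr_id mulrC ler_pdivlMr.
Qed.

Lemma rnorm_ball_measurable r : measurable ([set u | NN u <= r] : set (borelR m)).
Proof.
apply: borel_closed; rewrite (_ : [set u | _] = NN @^-1` [set x | x <= r])//.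
by apply: closed_comp => [x _|]; [exact: rnorm_continuous|exact: closed_le].
Qed.

Lemma leb_rnorm_ball_fin r : (leb ([set u | (NN u <= r)%R] : set (borelR m)) < +oo)%E.
Proof.
have [C C0 HC] := rnorm_lb.
apply: (leb_bounded (M := C * r)); first exact: rnorm_ball_measurable.
by move=> u /= h; apply: le_trans (HC u) _; rewrite ler_pM2l.
Qed.

Lemma leb_rnorm_ball_gt0 : (0 < leb ([set u | (NN u <= 1)%R] : set (borelR m)))%E.
Proof.
apply: (@lt_le_trans _ _ (leb ([set u | (NN u < 1)%R] : set (borelR m)))).
  apply: leb_open_gt0; last by exists 0; rewrite /= rnorm0.
  by apply: (@open_comp _ _ NN [set x | x < 1]) => [x _|]; [exact: rnorm_continuous|exact: open_lt].
apply: le_measure; rewrite ?inE; [|exact: rnorm_ball_measurable|by move=> u /= /ltW].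
apply: borel_open; apply: (@open_comp _ _ NN [set x | x < 1]) => [x _|]; [exact: rnorm_continuous|exact: open_lt].
Qed.

End RowNorm.

Lemma derive_along (R : realType) (U W : normedModType R) (f : U -> W) (x v : U) (g : R -> W) (g' : W) :
  (forall h, f (h *: v + x) = g h) -> is_derive (0 : R) (1 : R) g g' -> is_derive x v f g'.
Proof.
move=> fg [dg eg].
have E : (fun h : R => h^-1 *: ((f \o shift x) (h *: v) - f x)) =
         (fun h : R => h^-1 *: ((g \o shift 0) (h *: (1 : R)) - g 0)).
  apply/funext => h /=; congr (_ *: (_ - _)); first by rewrite fg [h *: 1]mulr1 addr0.
  by rewrite -fg scale0r add0r.
by split; rewrite /derivable ?/derive E.
Qed.

Lemma is_derive_affine (R : realType) (W : normedModType R) (a : R) (b : W) :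
  is_derive (0 : R) (1 : R) (fun h => (a + h) *: b) b.
Proof.
have E : (fun h : R => h^-1 *: (((fun h => (a + h) *: b) \o shift 0) (h *: (1 : R)) - (a + 0) *: b)) @ 0^' --> b.
  apply: cvg_near_cst; near=> h.
  have h0 : h != 0 by near: h; exact: nbhs_dnbhs_neq.
  by rewrite /= addr0 [h *: 1]mulr1 addr0 -scalerBl addrAC subrr add0r scalerA mulVf ?scale1r.
by split; [apply/cvg_ex; exists b|exact: cvg_lim].
Unshelve. all: by end_near. Qed.

Lemma integral_ins (R : realType) n (i : 'I_n.+1) (f : borelR n.+1 -> \bar R) :
  measurable_fun setT f -> (forall z, (0 <= f z)%E) ->
  (\int[@leb R n.+1]_z f z = \int[@leb R n]_y \int[@lebesgue_measure R]_s f (ins i y s))%E.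
Proof.
move=> mf f0; have mfi := measurableT_comp mf (@measurable_ins R n i).
rewrite -[RHS](@fubini_tonelli1 _ _ _ _ R (@leb R n) (@lebesgue_measure R) _ mfi); last by move=> p; exact: f0.
rewrite (@eq_measure_integral _ _ _ setT (pushm (@leb R n \x (@lebesgue_measure R))%E (@measurable_ins R n i))); last first.
  by move=> A mA _; exact: leb_ins.
by rewrite /pushm ge0_integral_pushforward//; exact: measurable_ins.
Qed.

Lemma measurable_col0 (R : realType) k :
  measurable_fun setT (fun z : borelR k.+1 => (col' ord0 z : 'rV[R]_k) : borelR k).
Proof.
apply: (@measurable_fun_borel R _ (borelR k.+1) k setT (fun z : borelR k.+1 => (col' ord0 z : 'rV[R]_k))) => j.
rewrite [X in measurable_fun _ X](_ : _ = fun z : borelR k.+1 => z 0 (lift ord0 j)); first exact: measurable_coordR.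
by apply/funext => z; rewrite mxE.
Qed.

Lemma cone_mx0 (R : realType) k (a : 'rV[R]_k.+1) (J : 'M[R]_(k, k.+1)) j :
  (col_mx a J : 'M[R]_k.+1) ord0 j = a 0 j.
Proof.
rewrite -(@col_mxEu _ 1 k k.+1 a J 0 j); congr (fun_of_matrix _ _ _); exact: val_inj.
Qed.

Lemma cone_mxS (R : realType) k (a : 'rV[R]_k.+1) (J : 'M[R]_(k, k.+1)) i j :
  (col_mx a J : 'M[R]_k.+1) (lift ord0 i) j = J i j.
Proof.
rewrite -(@col_mxEd _ 1 k k.+1 a J i j); congr (fun_of_matrix _ _ _); exact: val_inj.
Qed.

Lemma continuousZ_at (R : realType) (T : topologicalType) (W : normedModType R) (f : T -> R) (g : T -> W) x :
  {for x, continuous f} -> {for x, continuous g} -> {for x, continuous (fun y => f y *: g y)}.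
Proof. by move=> cf cg; exact: cvgZ. Qed.

Lemma continuousV_at (R : realType) (T : topologicalType) (f : T -> R) x : f x != 0 ->
  {for x, continuous f} -> {for x, continuous (fun y => (f y)^-1)}.
Proof. by move=> f0 cf; exact: cvgV. Qed.

Lemma jac_norm (R : realType) k m (NN : 'rV[R]_m -> R) (O : set 'rV[R]_k) (phi : 'rV[R]_k -> 'rV[R]_m) w :
  is_norm (V := 'rV[R]_m : vectType R) NN -> open O -> C1on O phi ->
  (forall w u, O w -> 'D_u phi w = 0 -> u = 0) -> O w ->
  is_norm (V := 'rV[R]_k : vectType R) (fun u => NN (u *m jac phi w)).
Proof.
move=> [N0 N1 NZ ND] oO phiC imm Ow; split=> //.
- by move=> v /N1 h; apply: (imm w v Ow); rewrite (row_derive v oO Ow phiC).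
- by move=> a v; rewrite -scalemxAl NZ.
- by move=> v v'; rewrite mulmxDl.
Qed.

(** * Cones over parametrized pieces of the unit sphere *)

Section Cone.
Context {R : realType} {k : nat}.
Variable NN : 'rV[R]_k.+1 -> R.
Hypothesis hN : is_norm (V := 'rV[R]_k.+1 : vectType R) NN.
Variables (O : set 'rV[R]_k) (phi : 'rV[R]_k -> 'rV[R]_k.+1).
Hypotheses (oO : open O) (phiC : C1on O phi) (phi1 : forall w, O w -> NN (phi w) = 1)
  (phi_inj : forall w w', O w -> O w' -> phi w = phi w' -> w = w')
  (phi_imm : forall w u, O w -> 'D_u phi w = 0 -> u = 0).

(** The affine tangent space supports the unit ball. If it met the open ball at phi w + v dphi,
    moving from [w] in direction [v] would make the norm drop below 1 to first order, against
    [phi1]. *)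
Lemma tangent_norm w s u : O w -> `|s| <= NN (s *: phi w + u *m jac phi w).
Proof.
move=> Ow; have [N0 N1 NZ ND] := hN.
suff H v : 1 <= NN (phi w + v *m jac phi w).
  have [->|s0] := eqVneq s 0; first by rewrite normr0.
  have := H (s^-1 *: u); rewrite -(ler_pM2l (_ : 0 < `|s|)) ?normr_gt0// mulr1 -NZ.
  by rewrite scalerDr -scalemxAl scalerA mulfV// scale1r.
rewrite leNgt; apply/negP => M1; set M := NN _ in M1.
have [C C0 HC] := rnorm_ub hN.
have v0 : 0 < `|v| + 1 by rewrite ltr_wpDl.
(* With this precision the remainder is at most half of the first-order loss e (1 - M). *)
have h0 : 0 < (1 - M) / (2 * C * (`|v| + 1)) by rewrite divr_gt0 ?mulr_gt0// subr_gt0.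
have [d d0 H] := row_strict oO Ow phiC h0.
have /nbhs_ballP[d2 /= d20 wO] := oO Ow.
pose e := Num.min 1 (Num.min d d2 / (2 * (`|v| + 1))).
have e0 : 0 < e by rewrite lt_min ltr01 divr_gt0 ?mulr_gt0// lt_min d0.
have ev : `|w + e *: v - w| < Num.min d d2.
  rewrite addrAC subrr add0r normrZ gtr0_norm//.
  apply: (@le_lt_trans _ _ (Num.min d d2 / (2 * (`|v| + 1)) * `|v|)).
    by rewrite ler_wpM2r// ge_min lexx orbT.
  have dd : 0 < Num.min d d2 by rewrite lt_min d0.
  rewrite mulrAC ltr_pdivrMr ?mulr_gt0// ltr_pM2l//; have := normr_ge0 v; lra.
move: (ev); rewrite lt_min => /andP[evd evd2].
have Oev : O (w + e *: v) by apply: wO; rewrite -ball_normE /= distrC.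
have := H (w + e *: v) w evd; rewrite subrr normr0 => /(_ d0).
rewrite [w + _ - w]addrAC subrr add0r -scalemxAl normrZ gtr0_norm// => h1.
have : NN (phi (w + e *: v)) <= (1 - e) * 1 + e * M + C * ((1 - M) / (2 * C * (`|v| + 1)) * (e * `|v|)).
  rewrite (_ : phi (w + e *: v) = ((1 - e) *: phi w + e *: (phi w + v *m jac phi w)) +
     (phi (w + e *: v) - phi w - e *: (v *m jac phi w))); last first.
    by apply/rowP => i; rewrite !mxE; ring.
  apply: (le_trans (ND _ _)); apply: lerD; last first.
    by apply: (le_trans (HC _)); rewrite ler_pM2l.
  apply: (le_trans (ND _ _)); rewrite !NZ phi1// -/M (gtr0_norm e0) ger0_norm//.
  by rewrite subr_ge0 ge_min lexx.
rewrite phi1//.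
have -> : C * ((1 - M) / (2 * C * (`|v| + 1)) * (e * `|v|)) = e * ((1 - M) * (`|v| / (2 * (`|v| + 1)))).
  by field; rewrite ?gt_eqF.
have : `|v| / (2 * (`|v| + 1)) <= 2^-1.
  by rewrite ler_pdivrMr ?mulr_gt0// mulrA mulVf// mul1r; lra.
move=> h2 h3.
have : e * ((1 - M) * (`|v| / (2 * (`|v| + 1)))) <= e * ((1 - M) * 2^-1).
  by rewrite ler_pM2l// ler_pM2l// subr_gt0.
move=> h4; have : 0 < e * (1 - M) by rewrite mulr_gt0// subr_gt0.
lra.
Qed.

Lemma mul_cone_mx (z : 'rV[R]_k.+1) (a : 'rV[R]_k.+1) (J : 'M[R]_(k, k.+1)) :
  z *m (col_mx a J : 'M[R]_k.+1) = z 0 ord0 *: a + col' ord0 z *m J.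
Proof.
rewrite -[z in LHS](@hsubmxK _ 1 1 k) (@mul_row_col _ 1 1 k).
have -> : @lsubmx _ 1 1 k z *m a = z 0 ord0 *: a.
  by rewrite [X in X *m _]mx11_scalar mul_scalar_mx mxE; congr (z 0 _ *: _); exact: val_inj.
by have -> : @rsubmx _ 1 1 k z = col' ord0 z by apply/rowP => j; rewrite !mxE; congr (z 0 _); exact: val_inj.
Qed.

Let M w : 'M[R]_k.+1 := col_mx (phi w) (jac phi w).
Let Jinj w (u : 'rV[R]_k) : O w -> u *m jac phi w = 0 -> u = 0.
Proof. by move=> Ow; rewrite -(row_derive u oO Ow phiC); exact: phi_imm. Qed.

(** A kernel vector has radial part 0 by [tangent_norm], and then tangential part 0 since [phi] is
    an immersion. *)
Lemma cone_det w : O w -> \det (M w) != 0.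
Proof.
move=> Ow; apply/negP => /det0P[z z0]; rewrite mul_cone_mx => h.
have s0 : z 0 ord0 = 0.
  have := tangent_norm (z 0 ord0) (col' ord0 z) Ow.
  by rewrite h rnorm0// normr_le0 => /eqP.
move: h; rewrite s0 scale0r add0r => /(Jinj Ow) c0; case/eqP: z0.
by rewrite -(ins_col' ord0 z) c0 s0; apply/rowP => j; rewrite !mxE; case: unliftP => // i; rewrite mxE.
Qed.

Let ell w : \bar R := leb ([set u | NN (u *m jac phi w) <= 1] : set (borelR k)).
Let b : R := fine (leb ([set u | NN u <= 1] : set (borelR k.+1))).

Let bE : leb ([set u | NN u <= 1] : set (borelR k.+1)) = b%:E.
Proof. by rewrite fineK// ge0_fin_numE ?measure_ge0// (leb_rnorm_ball_fin hN). Qed.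

Let b0 : 0 < b. Proof. by rewrite -lte_fin -bE (leb_rnorm_ball_gt0 hN). Qed.

Lemma cone_ell w : O w -> exists2 l : R, 0 < l & ell w = l%:E.
Proof.
move=> Ow; have hJ := jac_norm hN oO phiC phi_imm Ow; exists (fine (ell w)); last first.
  by rewrite fineK// ge0_fin_numE ?measure_ge0// (leb_rnorm_ball_fin hJ).
by rewrite fine_gt0// (leb_rnorm_ball_gt0 hJ) (leb_rnorm_ball_fin hJ).
Qed.

(** In the coordinates given by [M w] the unit ball has volume b / |det|. By [tangent_norm] its
    radial coordinate is at most 1 in absolute value, so by the triangle inequality its tangential
    part has norm at most 2: it fits in a cylinder of volume 2 * 2^k times the volume of the
    tangential unit ball. *)
Lemma cone_density_le w : O w -> (fine (ell w))^-1 <= 2 ^+ k.+1 / b * `|\det (M w)|.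
Proof.
move=> Ow; have [l l0 lE] := cone_ell Ow; rewrite lE /=.
have hJ := jac_norm hN oO phiC phi_imm Ow; have [_ _ NZ _] := hN.
pose T2 : set (borelR k) := [set u | NN (u *m jac phi w) <= 2].
have mT2 : measurable T2 := rnorm_ball_measurable hJ 2.
have T2E : leb T2 = (2 ^+ k * l)%:E.
  have u2 : (2%:M : 'M[R]_k) \in unitmx by rewrite unitmxE det_scalar unitfE expf_neq0.
  have := leb_lin u2 mT2; rewrite (_ : [set u | T2 (u *m 2%:M)] = [set u | NN (u *m jac phi w) <= 1]); last first.
    apply/seteqP; split=> u; rewrite /T2 /= mul_mx_scalar -scalemxAl NZ ger0_norm// => h; lra.
  rewrite -/(ell w) lE det_scalar ger0_norm ?exprn_ge0// => h.
  rewrite EFinM h muleA -EFinM mulfV ?mul1e// expf_neq0//.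
pose K : set (borelR k.+1) := [set z | [set u | NN u <= 1] (z *m M w)].
have uM : M w \in unitmx by rewrite unitmxE unitfE cone_det.
have KE : leb K = (`|\det (M w)|^-1 * b)%:E.
  by rewrite leb_lin// ?bE -?EFinM//; exact: (rnorm_ball_measurable hN).
pose K2 : set (borelR k.+1) := [set z : 'rV[R]_k.+1 | `[-1, 1]%classic (z 0 ord0) /\ T2 (col' ord0 z)].
have mcol := @measurable_col0 R k.
have mK2 : measurable K2.
  rewrite (_ : K2 = (fun z : borelR k.+1 => z 0 ord0) @^-1` `[-1, 1]%classic `&` (fun z : borelR k.+1 => col' ord0 z) @^-1` T2)//.
  apply: measurableI; rewrite -[X in measurable X]setTI; last exact: mcol.
  by apply: measurable_coordR => //; exact: measurable_itv.
have K2E : leb K2 = (2 * (2 ^+ k * l))%:E.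
  rewrite (leb_ins ord0)//= (_ : [set p | _] = T2 `*` `[-1, 1]%classic); last first.
    apply/seteqP; split=> -[u s] /=; rewrite /K2 /= ins_eq (_ : col' ord0 (ins ord0 u s) = u); try by case.
      by apply/rowP => j; rewrite mxE ins_lift.
    by apply/rowP => j; rewrite mxE ins_lift.
  rewrite product_measure1E//.
  rewrite /= T2E lebesgue_measure_itv /= lte_fin gtrN ?ltr01// -EFinD -EFinM; congr (_%:E); ring.
have : (leb K <= leb K2)%E.
  apply: le_measure; rewrite ?inE//.
    have mf : measurable_fun setT (fun u : borelR k.+1 => u *m M w : borelR k.+1).
      by apply: (@measurable_fun_cont_row R _ _ setT) => [|x _]; [exact: openT|exact: continuous_mulmx].
    by have := mf measurableT _ (rnorm_ball_measurable hN 1); rewrite setTI.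
  move=> z; rewrite /K /= mul_cone_mx => h.
  have z1 : `|z 0 ord0| <= 1 by apply: le_trans h; exact: tangent_norm.
  split; first by rewrite /= in_itv /= -ler_norml.
  rewrite /T2 /= (_ : _ *m _ = (z 0 ord0 *: phi w + col' ord0 z *m jac phi w) - z 0 ord0 *: phi w).
    have [_ _ _ ND] := hN; apply: (le_trans (ND _ _)); rewrite rnormN// NZ phi1// mulr1.
    by have := lerD h z1.
  by rewrite addrAC subrr add0r.
rewrite KE K2E lee_fin => h.
have d0 : 0 < `|\det (M w)| by rewrite normr_gt0 cone_det.
rewrite -(ler_pM2l l0) mulfV ?gt_eqF// -(ler_pM2r b0).
rewrite (_ : l * _ * b = 2 ^+ k.+1 * `|\det (M w)| * l); last by field; rewrite gt_eqF.
rewrite mul1r -(ler_pM2l (_ : 0 < `|\det (M w)|^-1)) ?invr_gt0//; apply: (le_trans h).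
by rewrite le_eqVlt; apply/orP; left; apply/eqP; rewrite exprS; field; rewrite gt_eqF.
Qed.

Let col0_cont (z : 'rV[R]_k.+1) : {for z, continuous (col' ord0 : 'rV[R]_k.+1 -> 'rV[R]_k)}.
Proof.
apply: continuous_row => j.
by apply: (@eq_continuous_at _ _ (fun z : 'rV[R]_k.+1 => z 0 (lift ord0 j))) => [y|]; [rewrite mxE|exact: continuous_coord].
Qed.

Definition cone_map (z : 'rV[R]_k.+1) : 'rV[R]_k.+1 := z 0 ord0 *: phi (col' ord0 z).
(** The radius stays above 1/2, which keeps the jacobian of the cone map bounded below in terms of
    [M]. *)
Definition cone_dom : set 'rV[R]_k.+1 := [set z : 'rV[R]_k.+1 | 2^-1 < z 0 ord0 < 1 /\ O (col' ord0 z)].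

Lemma open_cone_dom : open cone_dom.
Proof.
rewrite (_ : cone_dom = (fun z : 'rV[R]_k.+1 => z 0 ord0) @^-1` `]2^-1, 1[%classic `&`
   (col' ord0 : 'rV[R]_k.+1 -> 'rV[R]_k) @^-1` O); last first.
  by apply/seteqP; split=> z; rewrite /cone_dom /= in_itv.
apply: openI; apply: open_comp => //; try exact: interval_open.
- by move=> z _; exact: continuous_coord.
- by move=> z _; exact: col0_cont.
Qed.

Let cone_d0 z : is_derive z (delta_mx 0 ord0) cone_map (phi (col' ord0 z)).
Proof.
apply: (derive_along (g := fun h => (z 0 ord0 + h) *: phi (col' ord0 z))); last exact: is_derive_affine.
move=> h; rewrite /cone_map; congr (_ *: phi _).
  by rewrite !mxE !eqxx mulr1 addrC.
by apply/rowP => j; rewrite !mxE /= mulr0 add0r.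
Qed.

Let cone_dl z j : cone_dom z ->
  is_derive z (delta_mx 0 (lift ord0 j)) cone_map (z 0 ord0 *: 'D_(delta_mx 0 j) phi (col' ord0 z)).
Proof.
move=> [_ Ow].
apply: (derive_along (g := fun h => z 0 ord0 *: phi (col' ord0 z + h *: delta_mx 0 j))).
  move=> h; rewrite /cone_map; congr (_ *: phi _).
    by rewrite !mxE /= mulr0 add0r.
  by apply/rowP => i; rewrite !mxE /= addrC (inj_eq lift_inj).
have := @derive_line _ k _ phi (col' ord0 z) (delta_mx 0 j) 0; rewrite scale0r addr0.
move=> /(_ (proj1 (phiC Ow j))) h; exact: is_deriveZ.
Qed.

Lemma cone_C1 : C1on cone_dom cone_map.
Proof.
move=> z Oz i; have [_ Ow] := Oz; split.
  case: (unliftP ord0 i) => [j ->|->]; first by have [] := cone_dl j Oz.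
  by have [] := cone_d0 z.
have cphi : {for col' ord0 z, continuous phi} by exact: C1on_continuous oO Ow phiC.
case: (unliftP ord0 i) => [j ->|->].
  apply: (continuous_at_on open_cone_dom Oz (f := fun y : 'rV[R]_k.+1 => y 0 ord0 *: 'D_(delta_mx 0 j) phi (col' ord0 y))).
    by move=> y Oy; have [_ <-] := cone_dl j Oy.
  apply: continuousZ_at; first exact: continuous_coord.
  by apply: (@continuous_comp _ _ _ (col' ord0) (fun w => 'D_(delta_mx 0 j) phi w)) => //; have [] := phiC Ow j.
apply: (continuous_at_on open_cone_dom Oz (f := fun y : 'rV[R]_k.+1 => phi (col' ord0 y))).
  by move=> y Oy; have [_ <-] := cone_d0 y.
exact: (@continuous_comp _ _ _ (col' ord0) phi).
Qed.

Lemma cone_jac z : cone_dom z -> `|\det (jac cone_map z)| = (z 0 ord0) ^+ k * `|\det (M (col' ord0 z))|.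
Proof.
move=> Oz; have z0 : 0 < z 0 ord0 by case: Oz => /andP[h _] _; apply: lt_trans h; rewrite invr_gt0.
rewrite (_ : jac cone_map z = (@block_mx _ 1 k 1 k 1%:M 0 0 ((z 0 ord0)%:M : 'M[R]_k) : 'M[R]_k.+1) *m M (col' ord0 z)).
  rewrite det_mulmx normrM; congr (_ * _); rewrite (@det_ublock _ 1 k) det1 mul1r det_scalar ger0_norm//.
  by rewrite exprn_ge0// ltW.
rewrite /M (@mul_block_col _ 1 k 1 k) mul1mx !mul0mx addr0 add0r mul_scalar_mx.
apply/matrixP => i j; rewrite mxE; case: (unliftP ord0 i) => [i' ->|->].
  have [_ ->] := cone_dl i' Oz.
  by rewrite cone_mxS !mxE.
by have [_ ->] := cone_d0 z; rewrite cone_mx0.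
Qed.

Lemma cone_normE z : cone_dom z -> NN (cone_map z) = z 0 ord0.
Proof.
move=> [/andP[z0 _] Ow]; have [_ _ NZ _] := hN; rewrite NZ phi1// mulr1 gtr0_norm//.
by apply: lt_trans z0; rewrite invr_gt0.
Qed.

Lemma cone_inj z z' : cone_dom z -> cone_dom z' -> cone_map z = cone_map z' -> z = z'.
Proof.
move=> Oz Oz' e; have e0 : z 0 ord0 = z' 0 ord0 by rewrite -(cone_normE Oz) -(cone_normE Oz') e.
have z0 : z 0 ord0 != 0 by case: Oz => /andP[h _] _; rewrite gt_eqF//; apply: lt_trans h; rewrite invr_gt0.
rewrite -(ins_col' ord0 z) -(ins_col' ord0 z') e0; congr ins.
by apply: phi_inj; [case: Oz|case: Oz'|]; move: e; rewrite /cone_map -e0 => /(scalerI z0).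
Qed.

Lemma cone_image_ball : cone_map @` cone_dom `<=` [set u | NN u <= 1].
Proof. by move=> _ [z Oz <-] /=; rewrite cone_normE//; case: Oz => /andP[_ /ltW]. Qed.

Lemma measurable_cone_image : measurable (cone_map @` cone_dom : set (borelR k.+1)).
Proof. exact: (measurable_image_inj open_cone_dom cone_C1 cone_inj). Qed.

Lemma leb_cone_image_fin : (leb (cone_map @` cone_dom : set (borelR k.+1)) < +oo)%E.
Proof.
apply: le_lt_trans (leb_rnorm_ball_fin hN 1); apply: le_measure; rewrite ?inE.
- exact: measurable_cone_image.
- exact: (rnorm_ball_measurable hN).
- exact: cone_image_ball.
Qed.

Definition radial (D : set 'rV[R]_k.+1) : set (borelR k.+1) := [set v | v != 0 /\ D ((NN v)^-1 *: v)].

Lemma measurable_radial (D : set (borelR k.+1)) : measurable D -> measurable (radial D).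
Proof.
move=> mD; have o0 : open [set v : 'rV[R]_k.+1 | v != 0].
  have := @open_comp _ _ NN [set x | x != 0]; rewrite (_ : NN @^-1` _ = [set v | v != 0]).
    by apply=> [x _|]; [exact: rnorm_continuous|exact: open_neq].
  apply/seteqP; split=> v /=; first by apply: contra_neq => ->; rewrite rnorm0.
  by apply: contra_neq; have [_ h _ _] := hN; exact: h.
rewrite (_ : radial D = [set v | v != 0] `&` (fun v : 'rV[R]_k.+1 => (NN v)^-1 *: v) @^-1` D)//.
have cf (v : 'rV[R]_k.+1) : [set v : 'rV[R]_k.+1 | v != 0] v -> {for v, continuous (fun v => (NN v)^-1 *: v)}.
  move=> /= v0; apply: continuousZ_at; last exact: cvg_id.
  apply: continuousV_at; last exact: rnorm_continuous.
  by apply: contra_neq v0; have [_ h _ _] := hN; exact: h.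
have := @measurable_fun_cont_row R k.+1 k.+1 _ _ o0 cf.
by move=> /(_ (borel_open o0) _ mD).
Qed.

Lemma measurable_cone_mx : measurable_fun (O : set (borelR k)) (fun w : borelR k => (`|\det (M w)|)%:E : \bar R).
Proof.
apply/measurable_EFinP; apply: (@measurable_fun_cont R k O (fun y => `|\det (M y)|)) => //.
move=> w Ow; apply: (@continuous_norm_at R _ R^o (fun y => \det (M y))).
apply: continuous_det => i j; case: (unliftP ord0 i) => [i' ->|->].
  apply: (@eq_continuous_at _ _ (fun y => jac phi y i' j)); last exact: continuous_jac phiC.
  by move=> y; rewrite /M cone_mxS.
apply: (@eq_continuous_at _ _ (fun y => phi y 0 j)).
  by move=> y; rewrite /M cone_mx0.
apply: (@continuous_comp _ _ _ phi (fun u : 'rV[R]_k.+1 => u 0 j)); last exact: continuous_coord.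
exact: C1on_continuous oO Ow phiC.
Qed.

(** The jacobian of the cone map is z_0^k |det M| with z_0 between 1/2 and 1: the radial interval
    gives one factor 1/2, and the bound on z_0^k gives the other [k]. *)
Lemma cone_piece (D : set (borelR k.+1)) : measurable D ->
  ((2 ^- k.+1)%:E * \int[@leb R k]_(w in O `&` phi @^-1` D) (`|\det (M w)|)%:E <=
     leb (radial D `&` cone_map @` cone_dom : set (borelR k.+1)))%E.
Proof.
move=> mD.
have mphi : measurable_fun (O : set (borelR k)) (phi : borelR k -> borelR k.+1).
  by apply: measurable_fun_cont_row => // w Ow; exact: C1on_continuous oO Ow phiC.
have mE : measurable (O `&` phi @^-1` D : set (borelR k)) by apply: mphi => //; exact: borel_open.
set E : set (borelR k) := O `&` phi @^-1` D in mE *.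
rewrite -(area_formula_inj open_cone_dom cone_C1 cone_inj leb_cone_image_fin (measurable_radial mD)).
have cEP z : (cone_dom `&` cone_map @^-1` radial D) z <-> `]2^-1, 1[%classic (z 0 ord0) /\ E (col' ord0 z).
  have [Ez|nE] := pselect (cone_dom z); last first.
    split=> [[/nE]//|[]] /=; rewrite in_itv => ? [? ?]; exfalso; exact: nE.
  have z0 : 0 < z 0 ord0 by case: Ez => /andP[h _] _; apply: lt_trans h; rewrite invr_gt0.
  have e : (NN (cone_map z))^-1 *: cone_map z = phi (col' ord0 z).
    by rewrite cone_normE// /cone_map scalerA mulVf ?scale1r// gt_eqF.
  split=> [[[z1 Ow] [_]]|[z1 [Ow Dz]]]; first by rewrite e => Dz; split=> //=; rewrite in_itv.
  split=> //; split; last by rewrite e.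
  by apply/eqP => /(congr1 NN); rewrite cone_normE// rnorm0// => h; rewrite h ltxx in z0.
have mEO : measurable_fun E (fun w : borelR k => (`|\det (M w)|)%:E : \bar R).
  by apply: measurable_funS measurable_cone_mx; [exact: borel_open|move=> w []].
pose g (z : borelR k.+1) : \bar R := ((\1_(`]2^-1, 1[%classic : set R) (z 0 ord0))%:E * ((fun w => (`|\det (M w)|)%:E) \_ E) (col' ord0 z))%E.
have mres : measurable_fun setT ((fun w : borelR k => (`|\det (M w)|)%:E : \bar R) \_ E).
  exact: (measurable_restrictT _ mE).1 mEO.
have mcol := @measurable_col0 R k.
have res0 w : (0 <= ((fun w : borelR k => (`|\det (M w)|)%:E : \bar R) \_ E) w)%E.
  by rewrite patchE; case: ifP => // _; rewrite lee_fin.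
have mg : measurable_fun setT g.
  apply: emeasurable_funM; last exact: measurableT_comp mres mcol.
  apply/measurable_EFinP.
  rewrite [X in measurable_fun _ X](_ : _ = \1_((fun z : borelR k.+1 => z 0 ord0) @^-1` `]2^-1, 1[%classic))//.
  apply: measurable_indic; rewrite -[X in measurable X]setTI.
  by apply: measurable_coordR => //; exact: measurable_itv.
have g0 z : (0 <= g z)%E by rewrite mule_ge0// lee_fin.
have gI : (\int[@leb R k.+1]_z g z = (2^-1)%:E * \int[@leb R k]_(w in E) (`|\det (M w)|)%:E)%E.
  rewrite (integral_ins ord0)// [in RHS]integral_mkcond -ge0_integralZl//; apply: eq_integral => w _.
  transitivity (\int[@lebesgue_measure R]_s (((fun w : borelR k => (`|\det (M w)|)%:E : \bar R) \_ E) w * (\1_(`]2^-1, 1[%classic : set R) s)%:E))%E.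
    apply: eq_integral => s _; rewrite /g ins_eq muleC (_ : col' ord0 (ins ord0 w s) = w)//.
    by apply/rowP => j; rewrite mxE ins_lift.
  rewrite ge0_integralZl//; last by apply/measurable_EFinP; exact: measurable_indic.
  rewrite integral_indic//= setIT lebesgue_measure_itv /= lte_fin invf_lt1 ?ltr1n// -EFinD.
  by rewrite [RHS]muleC; congr (_ * _%:E)%E; lra.
have mA : measurable (cone_dom `&` cone_map @^-1` radial D : set (borelR k.+1)).
  apply: (@measurable_fun_cont_row R k.+1 k.+1 cone_dom cone_map open_cone_dom).
  - by move=> z Oz; exact: C1on_continuous open_cone_dom Oz cone_C1.
  - exact: borel_open open_cone_dom.
  - exact: measurable_radial.
rewrite [leRHS]integral_mkcond exprSr invfM EFinM -muleA -gI -ge0_integralZl//.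
apply: ge0_le_integral => //.
- by move=> z _; rewrite mule_ge0// lee_fin invr_ge0 exprn_ge0.
- exact: emeasurable_funM.
- apply: (measurable_restrictT _ mA).1; apply: measurable_funS (measurable_abs_jac cone_C1 open_cone_dom (@subset_refl _ _)).
    exact: borel_open open_cone_dom.
  by move=> z [].
move=> z _; rewrite patchE; case: ifPn => [/set_mem Az|/negP Az].
  have [z1 Ez] := (cEP z).1 Az; rewrite /g indicE mem_set// mul1e patchE mem_set//.
  rewrite cone_jac; last by case: Az.
  rewrite -EFinM lee_fin ler_wpM2r// -exprVn lerXn2r ?nnegrE ?invr_ge0//.
    by case: Az => -[/andP[h _] _] _; rewrite ltW//; apply: lt_trans h; rewrite invr_gt0.
  by case: Az => -[/andP[h _] _] _; rewrite ltW.
rewrite /g indicE patchE; case: ifPn => [/set_mem Ez|_]; last by rewrite !mule0.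
rewrite memNset ?mul0e ?mule0// => z1; apply: Az; apply/mem_set/cEP; split=> //.
Qed.

End Cone.

Lemma integral_gt0 d (T : measurableType d) (R : realType) (mu : {measure set T -> \bar R})
  (D : set T) (f : T -> \bar R) : measurable D -> measurable_fun D f ->
  (forall x, D x -> (0 < f x)%E) -> (0 < mu D)%E -> (0 < \int[mu]_(x in D) f x)%E.
Proof.
move=> mD mf f0 D0; rewrite lt_neqAle integral_ge0 ?andbT; last by move=> x /f0 /ltW.
apply/eqP => e0; have : (\int[mu]_(x in D) `|f x|)%E = 0%E.
  by rewrite e0; apply: eq_integral => x /set_mem/f0 fx; rewrite gee0_abs// ltW.
move=> /(ae_eq_integral_abs mu mD mf) [N [mN N0 DN]].
have : (mu D <= mu N)%E.
  apply: le_measure; rewrite ?inE// => x Dx; apply: DN => /= /(_ Dx) fx.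
  by have := f0 x Dx; rewrite fx ltxx.
by rewrite leNgt N0 D0.
Qed.

(** Inversion is continuous away from 0, and the point 0 is treated separately. *)
Lemma measurable_funV (R : realType) d (T : measurableType d) (D : set T) (f : T -> measurableTypeR R) :
  measurable_fun D f -> measurable_fun D (fun x => (f x)^-1 : measurableTypeR R).
Proof.
move=> mf; have mI : measurable_fun setT (fun x : measurableTypeR R => x^-1 : measurableTypeR R).
  apply: (measurability (@RGenOInfty.G R)) => //; first exact: RGenOInfty.measurableE.
  move=> _ [_ [a ->] <-]; rewrite setTI.
  set S := _ @^-1` _.
  have -> : S = (S `&` [set x | x != 0]) `|` (S `&` [set 0]).
    rewrite -setIUr (_ : _ `|` _ = setT) ?setIT//.
    by apply/seteqP; split=> // x _; have [->|] := eqVneq x 0; [right|left].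
  apply: measurableU.
    apply: open_measurable; rewrite openE => x [Sx x0].
    have : \forall y \near x, S y.
      have := @continuousV_at R R id x x0 cvg_id; apply.
      by apply: open_nbhs_nbhs; split=> //; exact: interval_open.
    move=> h; apply: filterI; first exact: h.
    by apply: open_nbhs_nbhs; split=> //; exact: open_neq.
  have [S0|S0] := pselect (S 0).
    by rewrite (_ : _ `&` _ = [set 0])//; apply/seteqP; split=> x; [case|move=> /= ->].
  by rewrite (_ : _ `&` _ = set0)//; apply/seteqP; split=> x // [Sx /= x0]; apply: S0; rewrite -x0.
exact: (measurableT_comp mI mf).
Qed.

(** The volumes are those of the sections of one measurable set of pairs (w, u), so measurability
    comes from Fubini. The jacobian is extended by 0 to have a map defined everywhere. *)
Lemma measurable_ell (R : realType) k m (NN : 'rV[R]_m -> R) (O : set 'rV[R]_k) (phi : 'rV[R]_k -> 'rV[R]_m) :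
  is_norm (V := 'rV[R]_m : vectType R) NN -> open O -> C1on O phi ->
  measurable_fun (O : set (borelR k)) (fun w => leb ([set u | (NN (u *m jac phi w) <= 1)%R] : set (borelR k))).
Proof.
move=> hN oO phiC; have mO : measurable (O : set (borelR k)) by exact: borel_open.
pose J i j (w : borelR k) : measurableTypeR R := ((fun w => jac phi w i j : measurableTypeR R) \_ O) w.
have mJ i j : measurable_fun setT (J i j).
  apply: (measurable_restrictT _ mO).1; apply: (@measurable_fun_cont R k O (fun w => jac phi w i j)) => // w Ow.
  exact: continuous_jac phiC.
pose P (p : borelR k * borelR k) : borelR m := \row_j \sum_i (p.2 0 i * J i j p.1).
have mP : measurable_fun setT P.
  apply: measurable_fun_borel => j.
  rewrite [X in measurable_fun _ X](_ : _ = fun p : borelR k * borelR k => \sum_i (p.2 0 i * J i j p.1)); last first.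
    by apply/funext => p; rewrite mxE.
  apply: measurable_sum => i; apply: measurable_funM.
    have H := measurableT_comp (@measurable_coordR R k i) (@measurable_snd _ _ (borelR k) (borelR k)); exact: H.
  have H := measurableT_comp (mJ i j) (@measurable_fst _ _ (borelR k) (borelR k)); exact: H.
pose A : set (borelR k * borelR k) := P @^-1` [set u | NN u <= 1].
have mA : measurable A.
  by rewrite -[A]setTI; apply: mP => //; exact: (rnorm_ball_measurable hN).
have := measurable_funS measurableT (@subsetT _ (O : set (borelR k))) (measurable_fun_xsection (@leb R k) mA).
apply: eq_measurable_fun => w /set_mem Ow /=; congr (leb _).
apply/seteqP; split=> u; rewrite /xsection /= ?in_setE /A /P /=.
  move=> h; rewrite (_ : _ *m _ = \row_j \sum_i (u 0 i * J i j w))//.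
  by apply/rowP => j; rewrite !mxE; apply: eq_bigr => i _; rewrite /J patchE mem_set.
move=> h; rewrite (_ : \row_j _ = u *m jac phi w)//.
by apply/rowP => j; rewrite !mxE; apply: eq_bigr => i _; rewrite /J patchE mem_set.
Qed.

Lemma measurable_density (R : realType) k m (NN : 'rV[R]_m -> R) (O : set 'rV[R]_k) (phi : 'rV[R]_k -> 'rV[R]_m) :
  is_norm (V := 'rV[R]_m : vectType R) NN -> open O -> C1on O phi ->
  measurable_fun (O : set (borelR k)) (fun w => ((fine (leb ([set u | (NN ('D_u phi w) <= 1)%R] : set (borelR k))))^-1)%:E).
Proof.
move=> hN oO phiC; apply/measurable_EFinP; apply: measurable_funV.
have H := measurableT_comp (@fine_measurable R setT measurableT) (measurable_ell hN oO phiC).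
apply: eq_measurable_fun H => w /set_mem Ow /=; congr (fine (leb _)).
by apply/seteqP; split=> u /=; rewrite (row_derive u oO Ow phiC).
Qed.

(** Disjoint pieces of the sphere have disjoint cones, all inside the unit ball of volume [b]. The
    density bound costs 2^m / b and the comparison with cones 2^m, hence 4^m, independently of the
    family. *)
Lemma cone_bound (R : realType) m (NN : 'rV[R]_m -> R) p (O : 'I_p -> set 'rV[R]_m.-1)
    (phi : 'I_p -> 'rV[R]_m.-1 -> 'rV[R]_m) (D : 'I_p -> set (borelR m)) :
  is_norm (V := 'rV[R]_m : vectType R) NN ->
  (forall j, [/\ open (O j), C1on (O j) (phi j) & forall w, O j w -> NN (phi j w) = 1]) ->
  (forall j w w', O j w -> O j w' -> phi j w = phi j w' -> w = w') ->
  (forall j w u, O j w -> 'D_u (phi j) w = 0 -> u = 0) ->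
  (forall j, measurable (D j)) -> trivIset setT D ->
  (\sum_(j < p) \int[@leb R m.-1]_(w in O j `&` phi j @^-1` D j)
     ((fine (leb ([set u | (NN ('D_u (phi j) w) <= 1)%R] : set (borelR m.-1))))^-1)%:E <= (4 ^+ m)%:E)%E.
Proof.
case: m => [|k] in NN O phi D * => hN HO Hinj Himm mD tD.
  (* For m = 0 the only vector is 0, of norm 0, so the unit sphere and all pieces are empty. *)
  rewrite big1 ?lee_fin// => j _; rewrite (_ : _ `&` _ = set0) ?integral_set0//.
  apply/seteqP; split=> // w [Ow _]; have [_ _ /(_ w Ow)] := HO j.
  rewrite (_ : phi j w = 0) ?rnorm0// => [/eqP|]; first by rewrite eq_sym oner_eq0.
  by apply/rowP => -[].
pose b : R := fine (leb ([set u | (NN u <= 1)%R] : set (borelR k.+1))).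
have bE : leb ([set u | (NN u <= 1)%R] : set (borelR k.+1)) = b%:E.
  by rewrite fineK// ge0_fin_numE ?measure_ge0// (leb_rnorm_ball_fin hN).
have b0 : 0 < b by rewrite -lte_fin -bE (leb_rnorm_ball_gt0 hN).
pose C j := radial NN (D j) `&` cone_map (phi j) @` cone_dom (O j) : set (borelR k.+1).
have mC j : measurable (C j).
  have [oO phiC phi1] := HO j; apply: measurableI; first exact: (measurable_radial hN).
  exact: (measurable_cone_image hN oO phiC phi1 (Hinj j)).
apply: (@le_trans _ _ (\sum_(j < p) ((2 ^+ k.+1 / b * 2 ^+ k.+1)%:E * leb (C j)))%E).
  apply: lee_sum => j _; have [oO phiC phi1] := HO j; have {}Himm := Himm j.
  have mphi : measurable_fun (O j : set (borelR k)) (phi j : borelR k -> borelR k.+1).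
    by apply: measurable_fun_cont_row => // w Ow; exact: C1on_continuous oO Ow phiC.
  have mE : measurable (O j `&` phi j @^-1` D j : set (borelR k)) by apply: mphi => //; exact: borel_open.
  have mM := measurable_cone_mx oO phiC.
  have cp := cone_piece hN oO phiC phi1 (Hinj j) (mD j).
  apply: (@le_trans _ _ ((2 ^+ k.+1 / b)%:E * \int[@leb R k]_(w in O j `&` phi j @^-1` D j)
       (`|\det (col_mx (phi j w) (jac (phi j) w) : 'M[R]_k.+1)|)%:E)%E).
    have c0 : 0 <= 2 ^+ k.+1 / b by rewrite divr_ge0 ?exprn_ge0 ?ltW.
    rewrite -ge0_integralZl//; last exact: measurable_funS (borel_open oO) (@subIsetl _ _ _) mM.
    apply: ge0_le_integral => //.
    - by move=> w _; rewrite lee_fin invr_ge0 fine_ge0 ?measure_ge0.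
    - by apply: measurable_funS (measurable_density hN oO phiC); [exact: borel_open|move=> w []].
    - apply: emeasurable_funM => //.
      exact: measurable_funS (borel_open oO) (@subIsetl _ _ _) mM.
    move=> w [Ow _]; rewrite -EFinM lee_fin.
    have := cone_density_le hN oO phiC phi1 Himm Ow.
    rewrite (_ : [set u | NN (u *m jac (phi j) w) <= 1] = [set u | NN ('D_u (phi j) w) <= 1])//.
    by apply/seteqP; split=> u /=; rewrite (row_derive u oO Ow phiC).
  rewrite [X in (_ <= X * _)%E]EFinM -muleA; apply: lee_wpmul2l.
    by rewrite lee_fin divr_ge0 ?exprn_ge0 ?ltW.
  have p2 : (0 < (2 ^- k.+1)%:E :> \bar R)%E by rewrite lte_fin invr_gt0 exprn_gt0.
  rewrite -(lee_pmul2l _ p2)// muleA -EFinM mulVf ?mul1e// gt_eqF ?exprn_gt0//.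
rewrite -ge0_sume_distrr; last by move=> j _; exact: measure_ge0.
apply: (@le_trans _ _ ((2 ^+ k.+1 / b * 2 ^+ k.+1)%:E * b%:E)%E); last first.
  by rewrite -EFinM lee_fin mulrAC divfK ?gt_eqF// -exprMn -natrM.
apply: lee_wpmul2l; first by rewrite lee_fin mulr_ge0 ?divr_ge0 ?exprn_ge0 ?ltW.
have tC : trivIset setT C.
  apply/trivIsetP => i j _ _ ij; apply/seteqP; split=> // v [[[v0 Di] _] [[_ Dj] _]].
  by have /trivIsetP/(_ i j Logic.I Logic.I ij)/seteqP[h _] := tD; exact: (h _ (conj Di Dj)).
rewrite -measure_bigsetU_ord// -bE; apply: le_measure; rewrite ?inE.
- exact: bigsetU_measurable.
- exact: (rnorm_ball_measurable hN).
- apply: (big_ind (fun A : set (borelR k.+1) => A `<=` [set u | NN u <= 1])) => //.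
    by move=> A B hA hB v [/hA|/hB].
  move=> j _ v [_ [z Oz <-]]; have [oO phiC phi1] := HO j.
  by apply: (cone_image_ball hN phi1); exists z.
Qed.

(** * Coordinates in a finite-dimensional space *)

Section Coordinates.
Context {R : realType} (V : vectType R).
Local Notation m := (vdim V).

Lemma crdK (v : V) : uncrd (crd v) = v.
Proof. by rewrite /uncrd /crd passmx.rVofK// vbasisP. Qed.

Lemma uncrdK (u : 'rV[R]_m) : crd (uncrd u : V) = u.
Proof. by rewrite /uncrd /crd passmx.vecofK// vbasisP. Qed.

Lemma crd_linear : linear (@crd R V).
Proof. exact: passmx.rVof_linear. Qed.

Lemma uncrd_linear : linear (@uncrd R V).
Proof. exact: passmx.vecof_linear. Qed.

HB.instance Definition _ := GRing.isLinear.Build R V 'rV[R]_m _ (@crd R V) crd_linear.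
HB.instance Definition _ := GRing.isLinear.Build R 'rV[R]_m V _ (@uncrd R V) uncrd_linear.

Lemma crd_image (A : set V) : @crd R V @` A = @uncrd R V @^-1` A.
Proof.
apply/seteqP; split=> [_ [v Av <-]|u Au]; first by rewrite /preimage /= crdK.
by exists (uncrd u) => //; rewrite uncrdK.
Qed.

Lemma vopenP (A : set V) : vopen A <-> open (@uncrd R V @^-1` A).
Proof. by rewrite /vopen crd_image. Qed.

Lemma measurable_uncrd : measurable_fun setT (@uncrd R V : borelR m -> @borelV R V).
Proof.
apply: (@measurability _ _ (borelR m) (@borelV R V) setT _ (@vopen R V)) => //.
by move=> _ [A /vopenP oA <-]; rewrite setTI; exact: borel_open.
Qed.

Lemma measurable_crd : measurable_fun setT (@crd R V : @borelV R V -> borelR m).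
Proof.
apply: (@measurability _ _ (@borelV R V) (borelR m) setT _ (@open 'rV[R]_m)) => //.
move=> _ [A oA <-]; rewrite setTI; apply: sub_sigma_algebra; apply/vopenP.
by rewrite (_ : _ @^-1` _ = A)//; apply/seteqP; split=> u; rewrite /preimage /= uncrdK.
Qed.

Lemma norm_crd (N : V -> R) : is_norm N -> is_norm (V := 'rV[R]_m : vectType R) (fun u => N (uncrd u)).
Proof.
move=> [N0 N1 NZ ND]; split=> [v|v /N1 h|a v|v w] //.
- by rewrite -[v]uncrdK h linear0.
- by rewrite linearZ NZ.
- by rewrite linearD.
Qed.

Lemma dual_coordE (y : dual V) (u : 'rV[R]_m) : y (uncrd u) = \sum_i u 0 i * y (uncrd (delta_mx 0 i)).
Proof.
rewrite [uncrd u]/uncrd /passmx.vecof linear_sum; apply: eq_bigr => i _.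
by rewrite linearZ /= /uncrd passmx.vecof_delta.
Qed.

Lemma dual_continuous (y : dual V) : continuous (fun u : 'rV[R]_m => y (uncrd u) : R).
Proof.
move=> u; apply: (@eq_continuous_at _ _ (fun u : 'rV[R]_m => \sum_i u 0 i * y (uncrd (delta_mx 0 i)))).
  by move=> u'; rewrite -dual_coordE.
apply: continuous_bigsum => i; apply: continuousM; [exact: continuous_coord|exact: cst_continuous].
Qed.

Lemma vcont_measurable (f : V -> R) : continuous (fun u : 'rV[R]_m => f (uncrd u)) ->
  measurable_fun setT (f : @borelV R V -> measurableTypeR R).
Proof.
move=> cf; have mf : measurable_fun setT ((fun u => f (uncrd u)) : borelR m -> measurableTypeR R).
  by apply: measurable_fun_cont => // [|u _]; [exact: openT|exact: cf].
have H := measurableT_comp mf measurable_crd.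
by apply: eq_measurable_fun H => v _ /=; rewrite crdK.
Qed.

Lemma dual_measurable (y : dual V) : measurable_fun setT ((fun v => y v) : @borelV R V -> measurableTypeR R).
Proof. exact: vcont_measurable (@dual_continuous y). Qed.

End Coordinates.

(** * The measure on the unit sphere *)

Section SphereMeasure.
Context {R : realType} {V : vectType R} (N : V -> R).
Hypothesis hN : is_norm N.
Local Notation m := (vdim V).
Local Notation S := (unit_sphere N).
Local Notation l := (@sphere_measure R V N).

Let hNN : is_norm (V := 'rV[R]_m : vectType R) (fun u => N (uncrd u)) := norm_crd hN.

Lemma norm_measurable : measurable_fun setT (N : @borelV R V -> measurableTypeR R).
Proof. exact: vcont_measurable (rnorm_continuous hNN). Qed.

Lemma sphere_measurable : measurable (S : set (@borelV R V)).
Proof.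
rewrite (_ : S = N @^-1` [set 1])// -[X in measurable X]setTI.
exact: norm_measurable.
Qed.

Section LocalParam.
Variables (O : set 'rV[R]_m.-1) (psi : 'rV[R]_m.-1 -> V).
Hypothesis lp : local_param S O psi.

Lemma lp_open : open O. Proof. by case: lp => -[]. Qed.
Lemma lp_C1 : C1on O (@crd R V \o psi).
Proof. by case: lp => -[_ sm] _ _ _; exact: Cr_C1on (sm 1). Qed.
Lemma lp_sphere w : O w -> N (uncrd (crd (psi w))) = 1.
Proof. by move=> Ow; rewrite crdK; case: lp => _ _ _ [h _]; apply: h; exists w. Qed.
Lemma lp_inj w w' : O w -> O w' -> (@crd R V \o psi) w = (@crd R V \o psi) w' -> w = w'.
Proof. by case: lp => _ inj _ _ Ow Ow' /= /(congr1 (@uncrd R V)); rewrite !crdK; exact: inj. Qed.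
Lemma lp_imm w u : O w -> 'D_u (@crd R V \o psi) w = 0 -> u = 0.
Proof. by case: lp => _ _ imm _ Ow h; apply: (imm w u Ow); rewrite /pdiff h linear0. Qed.

Lemma lp_measurable : measurable_fun (O : set (borelR m.-1)) (psi : borelR m.-1 -> @borelV R V).
Proof.
have mphi : measurable_fun (O : set (borelR m.-1)) ((@crd R V \o psi) : borelR m.-1 -> borelR m).
  by apply: measurable_fun_cont_row; [exact: lp_open|move=> w Ow; exact: C1on_continuous lp_open Ow lp_C1].
have H := measurableT_comp (@measurable_uncrd R V) mphi.
by apply: eq_measurable_fun H => w _ /=; rewrite crdK.
Qed.

Lemma lp_density_measurable : measurable_fun (O : set (borelR m.-1)) (sphere_density N psi).
Proof. exact: (measurable_density hNN lp_open lp_C1). Qed.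

Lemma lp_density_ge0 w : (0 <= sphere_density N psi w)%E.
Proof. by rewrite lee_fin invr_ge0 fine_ge0// measure_ge0. Qed.

Lemma lp_density_gt0 w : O w -> (0 < sphere_density N psi w)%E.
Proof.
move=> Ow; have hJ := jac_norm hNN lp_open lp_C1 (@lp_imm) Ow.
rewrite lte_fin invr_gt0; apply: fine_gt0.
rewrite (_ : [set u | _] = [set u | N (uncrd (u *m jac (@crd R V \o psi) w)) <= 1]); last first.
  by apply/seteqP; split=> u; rewrite /pdiff /= (row_derive u lp_open Ow lp_C1).
by rewrite (leb_rnorm_ball_gt0 hJ) (leb_rnorm_ball_fin hJ).
Qed.

Definition lp_piece (D : set V) : \bar R :=
  (\int[@leb R m.-1]_(w in O `&` psi @^-1` D) sphere_density N psi w)%E.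

Lemma lp_pieceE : lp_piece =
  dpush (@leb R m.-1) (borel_open lp_open) lp_density_measurable lp_density_ge0 lp_measurable.
Proof. by []. Qed.

End LocalParam.

Let fam (A : set V) (s : \bar R) := exists (p : nat) (O : 'I_p -> set 'rV[R]_m.-1)
      (psi : 'I_p -> 'rV[R]_m.-1 -> V) (D : 'I_p -> set V),
    [/\ forall j, local_param S (O j) (psi j),
        forall j, <<s @vopen R V >> (D j) /\ D j `<=` A `&` psi j @` O j,
        trivIset setT D & s = (\sum_(j < p) lp_piece (O j) (psi j) (D j))%E].

Let lE A : l A = ereal_sup [set s | fam A s]. Proof. by []. Qed.

Let lp_piece_ge0 O psi D : (0 <= lp_piece O psi D)%E.
Proof. by apply: integral_ge0 => w _; exact: lp_density_ge0. Qed.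

(** This uniform bound makes the supremum finite, so that sums of suprema can be handled by
    subtraction in [sm_superadd]. *)
Lemma sphere_measure_le A : (l A <= (4 ^+ m)%:E)%E.
Proof.
rewrite lE; apply: ge_ereal_sup => s [p [Om [psi [D [lp DA tD ->]]]]].
have := @cone_bound R m (fun u => N (uncrd u)) p Om (fun j => @crd R V \o psi j)
  (fun j => @uncrd R V @^-1` D j) hNN.
have -> : (\sum_(j < p) lp_piece (Om j) (psi j) (D j) = \sum_(j < p) \int[@leb R m.-1]_(w in Om j `&` (@crd R V \o psi j) @^-1` (@uncrd R V @^-1` D j))
     ((fine (leb ([set u | (N (uncrd ('D_u (@crd R V \o psi j) w)) <= 1)%R] : set (borelR m.-1))))^-1)%:E)%E.
  apply: eq_bigr => j _; rewrite /lp_piece; congr (integral _ _ _).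
  by apply/seteqP; split=> w [Ow Dw]; split=> //; move: Dw; rewrite /preimage /= crdK.
apply.
- by move=> j; split; [exact: lp_open|exact: lp_C1|move=> w; exact: lp_sphere].
- by move=> j w w'; exact: lp_inj.
- by move=> j w u; exact: lp_imm.
- by move=> j; rewrite -[X in measurable X]setTI; apply: measurable_uncrd => //; case: (DA j).
- apply/trivIsetP => i j _ _ ij; apply/seteqP; split=> // u [Di Dj].
  by have /trivIsetP/(_ i j Logic.I Logic.I ij)/seteqP[h _] := tD; exact: (h (uncrd u)).
Qed.

Let fam_le A s : fam A s -> (s <= l A)%E.
Proof. by move=> h; rewrite lE; exact: ereal_sup_ubound. Qed.

Let sm_ge0 A : (0 <= l A)%E.
Proof.
apply: fam_le; exists 0%N, (fun=> set0), (fun=> fun=> 0), (fun=> set0).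
by split; [case|case|apply/trivIsetP => -[]|rewrite big_ord0].
Qed.

Let sm0 : l set0 = 0%E.
Proof.
apply/eqP; rewrite eq_le sm_ge0 andbT lE; apply: ge_ereal_sup => s [p [Om [psi [D [lp DA tD ->]]]]].
rewrite big1// => j _; rewrite /lp_piece (_ : _ `&` _ = set0) ?integral_set0//.
by apply/seteqP; split=> // w [_ Dw]; have [_ /(_ _ Dw)[]] := DA j.
Qed.

Let sm_mono A B : A `<=` B -> (l A <= l B)%E.
Proof.
move=> AB; rewrite lE; apply: ge_ereal_sup => s [p [Om [psi [D [lp DA tD ->]]]]].
apply: fam_le; exists p, Om, psi, D; split=> // j; have [mD Dj] := DA j; split=> // v /Dj[/AB Bv].
by [].
Qed.

Let fam_cat A B s t : A `&` B = set0 -> fam A s -> fam B t -> fam (A `|` B) (s + t)%E.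
Proof.
move=> AB [p [Om [psi [D [lp DA tD ->]]]]] [p' [Om' [psi' [D' [lp' DB tD' ->]]]]].
pose sp T (f : 'I_p -> T) (f' : 'I_p' -> T) j := match fintype.split j with inl i => f i | inr i => f' i end.
exists (p + p')%N, (sp _ Om Om'), (sp _ psi psi'), (sp _ D D'); split.
- by move=> j; rewrite /sp; case: fintype.splitP => i _.
- move=> j; rewrite /sp; case: fintype.splitP => i _.
    by have [mD Di] := DA i; split=> // v /Di[Av h]; split=> //; left.
  by have [mD Di] := DB i; split=> // v /Di[Av h]; split=> //; right.
- apply/trivIsetP => i j _ _ ij; apply/seteqP; split=> // v; rewrite /sp.
  have disj a b : A a -> B b -> a <> b.
    by move=> Aa Bb ab; have /seteqP[/(_ a) h _] := AB; apply: h; split=> //; rewrite ab.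
  case: fintype.split_ordP ij => i' ->; case: fintype.split_ordP => j' -> ij [Di Dj].
  + by move: ij; rewrite (tD i' j' Logic.I Logic.I (ex_intro _ v (conj Di Dj))) eqxx.
  + by exfalso; have [_ /(_ _ Di)[Av _]] := DA i'; have [_ /(_ _ Dj)[Bv _]] := DB j'; exact: disj Av Bv erefl.
  + by exfalso; have [_ /(_ _ Di)[Bv _]] := DB i'; have [_ /(_ _ Dj)[Av _]] := DA j'; exact: disj Av Bv erefl.
  + by move: ij; rewrite (tD' i' j' Logic.I Logic.I (ex_intro _ v (conj Di Dj))) eqxx.
- rewrite [RHS]big_split_ord; apply: (congr2 (fun x y => x + y)%E); apply: eq_bigr => i _; rewrite /sp.
    by rewrite (_ : fintype.split _ = inl i)//; exact: (unsplitK (inl i)).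
  by rewrite (_ : fintype.split _ = inr i)//; exact: (unsplitK (inr i)).
Qed.

Let fam_ge0 A s : fam A s -> (0 <= s)%E.
Proof. by move=> [p [Om [psi [D [_ _ _ ->]]]]]; exact: sume_ge0. Qed.

Let sm_fin A : l A \is a fin_num.
Proof. by rewrite ge0_fin_numE// (le_lt_trans (sphere_measure_le A))// ltry. Qed.

Let fam_fin A s : fam A s -> s \is a fin_num.
Proof.
move=> As; rewrite ge0_fin_numE ?(fam_ge0 As)// (le_lt_trans (fam_le As))//.
by rewrite -ge0_fin_numE// sm_fin.
Qed.

Let sm_superadd A B : A `&` B = set0 -> (l A + l B <= l (A `|` B))%E.
Proof.
move=> AB; rewrite -leeBrDr//; rewrite [X in (X <= _)%E]lE; apply: ge_ereal_sup => s As.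
rewrite leeBrDr// addeC -leeBrDr ?(fam_fin As)//.
rewrite [X in (X <= _)%E]lE; apply: ge_ereal_sup => t Bt.
by rewrite leeBrDr ?(fam_fin As)// addeC; apply: fam_le; exact: fam_cat.
Qed.

(** Concatenating families gives superadditivity, hence one inequality by monotonicity. For the
    other, every piece of a family is cut along the [F i], and each [lp_piece] is a measure in its
    set argument. *)
Let sm_sigma : semi_sigma_additive (l : set (@borelV R V) -> \bar R).
Proof.
move=> F mF tF mUF.
have cv : cvgn (fun n => \sum_(0 <= i < n) l (F i))%E by apply: is_cvg_ereal_nneg_natsum => k _; exact: sm_ge0.
suff E : (\sum_(0 <= i <oo) l (F i))%E = l (\bigcup_n F n) by rewrite -E; exact: cv.
apply/eqP; rewrite eq_le; apply/andP; split.
  apply: lime_le => //; apply: nearW => n.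
  apply: (@le_trans _ _ (l (\bigcup_(i < n) F i))); last by apply: sm_mono => v [i _ Fi]; exists i.
  elim: n => [|n IHn]; first by rewrite big_geq// sm_ge0.
  rewrite big_nat_recr//= (_ : \bigcup_(i < n.+1) F i = (\bigcup_(i < n) F i) `|` F n); last first.
    apply/seteqP; split=> [v [i /= ]|v [[i /= lin Fi]|Fn]]; last by exists n => /=.
      by rewrite ltnS leq_eqVlt => /orP[/eqP ->|lin] Fi; [right|left; exists i].
    by exists i => //=; exact: ltnW.
  apply: le_trans (sm_superadd _); first exact: leeD2r.
  apply/seteqP; split=> // v [[i /= lin Fi] Fn].
  by move: lin; rewrite (tF i n Logic.I Logic.I (ex_intro _ v (conj Fi Fn))) ltnn.
rewrite lE; apply: ge_ereal_sup => s [p [Om [psi [D [lp DA tD ->]]]]].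
have pE j : lp_piece (Om j) (psi j) (D j) = (\sum_(0 <= i <oo) lp_piece (Om j) (psi j) (D j `&` F i))%E.
  have [mD Dj] := DA j; rewrite (lp_pieceE (lp j)) -measure_semi_bigcup.
  - by congr (_ _); rewrite -setI_bigcupr; apply/esym/setIidl => v /Dj[].
  - by move=> i; exact: measurableI.
  - exact: trivIset_setIl.
  - by rewrite -setI_bigcupr; exact: measurableI.
under eq_bigr do rewrite pE.
rewrite -nneseries_sum; last by move=> j i _; exact: lp_piece_ge0.
apply: lee_nneseries => [i _ _|i _]; first by apply: sume_ge0 => j _.
apply: fam_le; exists p, Om, psi, (fun j => D j `&` F i); split=> //.
- move=> j; have [mD Dj] := DA j; split; first exact: (@measurableI _ (@borelV R V)).
  by move=> v [/Dj[_ h] Fv].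
- exact: trivIset_setIr.
Qed.

Definition sphm of is_norm N : set (@borelV R V) -> \bar R := l.

HB.instance Definition _ := isMeasure.Build _ (@borelV R V) R (sphm hN) sm0 sm_ge0 sm_sigma.

Let sphm_finite : fin_num_fun (sphm hN).
Proof. by move=> A _; exact: sm_fin. Qed.

HB.instance Definition _ := Measure_isFinite.Build _ (@borelV R V) R (sphm hN) sphm_finite.

Lemma sphm_lp_piece (Om : set 'rV[R]_m.-1) psi (D : set (@borelV R V)) : local_param S Om psi ->
  measurable D -> D `<=` psi @` Om -> (lp_piece Om psi D <= sphm hN D)%E.
Proof.
move=> lp mD Dpsi; apply: fam_le; exists 1%N, (fun=> Om), (fun=> psi), (fun=> D); split=> //.
- by move=> _; split=> // v Dv; split=> //; exact: Dpsi.
- by apply/trivIsetP => i j _ _; rewrite !ord1 eqxx.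
- by rewrite big_ord1.
Qed.

End SphereMeasure.

Section SphereProperties.
Context {R : realType} {V : vectType R} (N : V -> R).
Hypotheses (hN : is_norm N) (B_smooth : smooth_convex_body (unit_ball N)).
Local Notation m := (vdim V).
Local Notation S := (unit_sphere N).

Let hNN : is_norm (V := 'rV[R]_m : vectType R) (fun u => N (uncrd u)) := norm_crd hN.

Lemma boundary_unit_ball : boundary (unit_ball N) = S.
Proof.
have cN := rnorm_continuous hNN; have [N0 _ NZ _] := hN.
have E : @crd R V @` unit_ball N = [set u | N (uncrd u) <= 1] by rewrite crd_image.
apply/seteqP; split=> v; rewrite /boundary /= E.
  move=> [cl ni]; have : N v <= 1.
    have : closed [set u : 'rV[R]_m | N (uncrd u) <= 1].
      by apply: (@closed_comp _ _ (fun u : 'rV[R]_m => N (uncrd u)) [set x | x <= 1]) => [x _|]; [exact: cN|exact: closed_le].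
    by rewrite closure_id => h; move: cl; rewrite -h /= crdK.
  rewrite le_eqVlt => /orP[/eqP//|v1]; exfalso; apply: ni.
  have : open [set u : 'rV[R]_m | N (uncrd u) < 1].
    by apply: (@open_comp _ _ (fun u : 'rV[R]_m => N (uncrd u)) [set x | x < 1]) => [x _|]; [exact: cN|exact: open_lt].
  rewrite openE => /(_ (crd v)) /=; rewrite crdK => /(_ v1).
  by apply: filterS => u /= /ltW.
rewrite /unit_sphere /= => v1; split.
  by apply: subset_closure; rewrite /= crdK v1.
rewrite /interior => /nbhs_ballP[e /= e0 he].
have [d d0 dP] : exists2 d : R, 0 < d & ball (crd v) e (crd v + d *: crd v).
  have c0 := normr_ge0 (crd v); have c1 : 0 < 2 * (`|crd v| + 1) by lra.
  exists (e / (2 * (`|crd v| + 1))); first by rewrite divr_gt0.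
  rewrite -ball_normE /= opprD addrA subrr add0r normrN normrZ gtr0_norm ?divr_gt0//.
  by rewrite mulrAC ltr_pdivrMr// ltr_pM2l//; lra.
have := he _ dP; rewrite /= -[X in X + _]scale1r -scalerDl linearZ /= crdK NZ v1 mulr1 gtr0_norm; lra.
Qed.

Lemma sphere_param (x : V) : S x -> exists O psi, local_param S O psi /\ (psi @` O) x.
Proof. by have [_ _ _ h] := B_smooth; rewrite boundary_unit_ball in h; exact: h. Qed.

(* A linear form that does not vanish at some point of the sphere is nonzero on
   an open piece of it, which has positive measure. *)
Lemma sphere_abs_gt0 (y : dual V) : y != 0 -> (0 < \int[sphere_measure N]_(x in S) (`|y x|)%:E)%E.
Proof.
move=> y0; have [N0 N1 NZ ND] := hN.
have [v yv] : exists v, y v != 0.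
  apply/not_existsP => h; case/eqP: y0; apply/lfunP => v; rewrite lfunE /=; apply/eqP.
  by have /negP := h v; rewrite negbK.
have v0 : v != 0 by apply: contra_neq yv => ->; rewrite linear0.
have Nv : 0 < N v by rewrite lt_neqAle N0 andbT; apply: contra_neq v0 => /esym; exact: N1.
pose x := (N v)^-1 *: v.
have Sx : S x by rewrite /unit_sphere /= NZ ger0_norm ?invr_ge0// mulVf// gt_eqF.
have yx : y x != 0 by rewrite linearZ mulf_neq0// invr_neq0// gt_eqF.
have [Om [psi [lp [w0 Ow0 w0x]]]] := sphere_param Sx.
have oO := lp_open lp.
pose O' := Om `&` [set w | y (psi w) != 0].
have oO' : open O'.
  apply: (@continuous_on_measurable _ _ _ Om (fun w => y (psi w) : R) [set t : R | t != 0]); [exact: oO| |exact: open_neq].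
  move=> w Ow; apply: (@eq_continuous_at _ _ (fun w => y (uncrd ((@crd R V \o psi) w)) : R)).
    by move=> w' /=; rewrite crdK.
  apply: (@continuous_comp _ _ _ (@crd R V \o psi) (fun u => y (uncrd u) : R)); last exact: dual_continuous.
  exact: C1on_continuous oO Ow (lp_C1 lp).
have [_ _ _ [psiS /(_ O' oO' (@subIsetl _ _ _))[G oG GE]]] := lp.
have mD : measurable (S `&` G : set (@borelV R V)).
  by apply: measurableI; [exact: sphere_measurable|exact: sub_sigma_algebra].
have my : measurable_fun setT (fun v : @borelV R V => (`|y v|)%:E : \bar R).
  by apply/measurable_EFinP; apply: (measurableT_comp (@normr_measurable R setT)); exact: dual_measurable.
apply: (@lt_le_trans _ _ (\int[sphm hN]_(x in S `&` G) (`|y x|)%:E)%E); last first.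
  apply: ge0_subset_integral => //; first exact: sphere_measurable.
  exact: measurable_funS my.
apply: integral_gt0 => //; first exact: measurable_funS my.
  by move=> z; rewrite -GE => -[w [_ /= yw] <-]; rewrite lte_fin normr_gt0.
apply: lt_le_trans (sphm_lp_piece hN lp mD _); last first.
  by move=> z; rewrite -GE => -[w [Ow _] <-]; exists w.
have mO : measurable (Om `&` psi @^-1` (S `&` G) : set (borelR m.-1)).
  exact: (lp_measurable lp (borel_open oO) mD).
rewrite /lp_piece; apply: integral_gt0 => //.
- by apply: measurable_funS (lp_density_measurable hN lp); [exact: borel_open|exact: subIsetl].
- by move=> w [Ow _]; exact: (lp_density_gt0 hN lp Ow).
apply: (@lt_le_trans _ _ (leb (O' : set (borelR m.-1)))).
  by apply: leb_open_gt0 => //; exists w0; split=> //=; rewrite w0x.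
apply: le_measure; rewrite ?inE//; first exact: borel_open.
by move=> w [Ow yw]; split=> //; rewrite -GE; exists w.
Qed.

End SphereProperties.

(** * The natural measure *)

Lemma integral_mrestr d (T : measurableType d) (R : realType) (mu : {measure set T -> \bar R})
    (D : set T) (mD : measurable D) (f : T -> \bar R) :
  (forall x, 0 <= f x)%E -> measurable_fun setT f ->
  (\int[mrestr mu mD]_x f x = \int[mu]_(x in D) f x)%E.
Proof.
move=> f0 mf; rewrite -(setUv D) ge0_integral_setU//; last 3 first.
- exact: measurableC.
- by rewrite setUv.
- by apply/disj_setPCl.
rewrite [X in (_ + X)%E](_ : _ = 0%E) ?adde0.
  by apply: eq_measure_integral => A mA AD; rewrite /= /mrestr setIidl.
rewrite (eq_measure_integral (@mzero _ T R)) ?integral_measure_zero// => A mA AD.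
by rewrite /= /mrestr (_ : A `&` D = set0) ?measure0//; apply/seteqP; split=> // x [/AD].
Qed.

Lemma continuous_pair_at (T U W : topologicalType) (f : T -> U) (g : T -> W) x :
  {for x, continuous f} -> {for x, continuous g} -> {for x, continuous (fun t => (f t, g t))}.
Proof. by move=> cf cg; exact: cvg_pair. Qed.

Lemma continuous_fst_at (T U : topologicalType) (p : T * U) : {for p, continuous fst}.
Proof. exact: cvg_fst. Qed.

Lemma continuous_snd_at (T U : topologicalType) (p : T * U) : {for p, continuous snd}.
Proof. exact: cvg_snd. Qed.

Lemma continuousB_at (R : realType) (T : topologicalType) (f g : T -> R) x :
  {for x, continuous f} -> {for x, continuous g} -> {for x, continuous (fun t => f t - g t)}.
Proof. by move=> cf cg; exact: cvgB. Qed.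

Lemma open_row_neq0 (R : realType) m : open [set v : 'rV[R]_m | v != 0].
Proof.
rewrite (_ : [set v | _] = Num.norm @^-1` [set x : R | x != 0]).
  by apply: open_comp => [v _|]; [exact: norm_continuous|exact: open_neq].
by apply/seteqP; split=> v /=; rewrite normr_eq0.
Qed.

Lemma open_fst_neq0 (R : realType) m : open [set p : 'rV[R]_m * R | p.1 != 0].
Proof.
have := @open_comp _ _ (fst : 'rV[R]_m * R -> _) [set v | v != 0].
by apply; [move=> p _; exact: continuous_fst_at|exact: open_row_neq0].
Qed.

Lemma open_prod_measurable (R : realType) m (W : set ('rV[R]_m * R)) : open W ->
  measurable (W : set (borelR m * measurableTypeR R)).
Proof.
move=> oW; pose h (z : 'rV[R]_m.+1) : 'rV[R]_m * R := (col' ord0 z, z 0 ord0).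
have oW' : open (h @^-1` W).
  apply: open_comp => // z _; apply: continuous_pair_at; last exact: continuous_coord.
  apply: continuous_row => j; apply: (@eq_continuous_at _ _ (fun z : 'rV[R]_m.+1 => z 0 (lift ord0 j))) => [y|].
    by rewrite mxE.
  exact: continuous_coord.
have := @measurable_ins R m ord0 measurableT _ (borel_open oW').
rewrite setTI; congr measurable; apply/seteqP; split=> -[u s]; rewrite /preimage /h /= ins_eq;
  by rewrite (_ : col' ord0 (ins ord0 u s) = u)//; apply/rowP => j; rewrite mxE ins_lift.
Qed.

(** A count exceeds [a] exactly when it reaches some natural number greater than [a], also when it
    is infinite. *)
Lemma measurable_counting_nat d (T : measurableType d) (R : realType) (C : choiceType) (A : T -> set C) (D : set T) :
  measurable D -> (forall M, measurable (D `&` [set t | (M%:R%:E <= counting (A t) :> \bar R)%E])) ->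
  measurable_fun D (fun t => counting (A t) : \bar R).
Proof.
move=> mD h _; apply: (measurability (@ErealGenOInfty.G R)) => //; first exact: ErealGenOInfty.measurableE.
move=> _ [_ [a ->] <-].
rewrite (_ : _ `&` _ = \bigcup_M (if (a < M%:R)%R then D `&` [set t | (M%:R%:E <= counting (A t) :> \bar R)%E] else set0)).
  by apply: bigcup_measurable => M _; case: ifP.
apply/seteqP; split=> [t [Dt]|t [M _]]; last first.
  case: ifP => // aM [Dt Mt]; split=> //; rewrite /preimage /= in_itv /= andbT.
  by apply: lt_le_trans Mt; rewrite lte_fin.
rewrite /preimage /= in_itv /= andbT => at_.
apply: contrapT => no; move: at_; apply/negP; rewrite -leNgt; apply: counting_le => M Mt.
rewrite lee_fin leNgt; apply/negP => aM; apply: no; exists M => //; by rewrite aM.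
Qed.

(** * Countable bases of a manifold *)

Section SecondCountable.
Context {R : realType} {n : nat} (X : manifold R n).

Lemma basis_enum : exists E : nat -> set X, (forall k, open (E k)) /\
  forall x (D : set X), open D -> D x -> exists k, E k x /\ E k `<=` D.
Proof.
have [B /countable_injP[f finj] [Bo Bb]] := @manifold_countable R n X.
pose E k : set X := xget set0 [set b | B b /\ f b = k].
exists E; split=> [k|x D oD Dx].
  by rewrite /E; case: xgetP => [b _ [/Bo]//|_]; exact: open0.
have [b [Bb' bx] bD] : exists2 b, B b /\ b x & b `<=` D.
  by have [b hb bD] := Bb x D (open_nbhs_nbhs (conj oD Dx)); exists b.
exists (f b); rewrite /E; case: xgetP => [b' _ [Bb2 fb]|/(_ b)]; last by case.
by rewrite (finj b' b _ _ fb)//; apply/mem_set.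
Qed.

(** A closed cube in a chart is compact, hence closed in a Hausdorff space, and so contains the
    closure of every basis set inside it. *)
Lemma compact_basis_nbhd (E : nat -> set X) : (forall k, open (E k)) ->
  (forall x (D : set X), open D -> D x -> exists k, E k x /\ E k `<=` D) ->
  forall x (D : set X), open D -> D x ->
  exists k, [/\ E k x, compact (closure (E k)) & closure (E k) `<=` D].
Proof.
move=> oE bE x D oD Dx; have [c cx] := cdom_cover x.
set u := cmap c x; have cu : (cmap c @` cdom c) u by exists x.
have oD' : open ((cmap c @` cdom c) `&` @cinv _ _ X c @^-1` D).
  by apply: continuous_on_measurable => //; [exact: cmap_open|move=> v; exact: cinv_continuous].
have Du : ((cmap c @` cdom c) `&` @cinv _ _ X c @^-1` D) u by split=> //; rewrite /preimage /= cmapK.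
have /nbhs_ballP[e /= e0 eD] := oD' _ Du.
pose K := cbox (u - const_mx (e / 2)) (u + const_mx (e / 2)).
have KD : K `<=` (cmap c @` cdom c) `&` @cinv _ _ X c @^-1` D.
  move=> v Kv; apply: eD; rewrite -ball_normE /=; apply: (@le_lt_trans _ _ (e / 2)); last lra.
  apply: mx_norm_leP => [|i j]; first by rewrite divr_ge0// ltW.
  by rewrite ord1 !mxE ler_norml; have := Kv j; rewrite !mxE; lra.
have cK : compact (@cinv _ _ X c @` K).
  by apply: compact_image (@compact_cbox _ _ _ _) => v /KD[cv _]; exact: cinv_continuous.
have oN : open (cdom c `&` cmap c @^-1` ball u (e / 2)).
  rewrite openE => y [cy by_]; apply: filterI; first by apply: open_nbhs_nbhs; split=> //; exact: cdom_open.
  apply: (cmap_continuous cy); apply: open_nbhs_nbhs; split=> //; exact: ball_open.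
have [k [kx kN]] : exists k, E k x /\ E k `<=` cdom c `&` cmap c @^-1` ball u (e / 2).
  by apply: bE => //; split=> //; apply: ballxx; rewrite divr_gt0.
have EK : closure (E k) `<=` @cinv _ _ X c @` K.
  have := compact_closed (@manifold_hausdorff _ _ X) cK; rewrite closure_id => ->.
  apply: closureS => y /kN[cy]; rewrite /preimage /= -ball_normE /= => by_.
  exists (cmap c y); last exact: cmapK.
  move=> i; have := le_trans (le_coord_norm (u - cmap c y) 0 i) (ltW by_).
  by rewrite !mxE ler_norml; lra.
exists k; split=> //.
  by apply: subclosed_compact cK EK; exact: closed_closure.
by move=> y /EK[v Kv <-]; have [_] := KD v Kv.
Qed.

End SecondCountable.

(** * The space of affine hyperplanes *)

Section AffineHyperplanes.
Context {R : realType} {V : vectType R}.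
Local Notation m := (vdim V).
Implicit Types (y z : dual V) (f : V) (t e : R).

Definition AGrT := g_sigma_algebraType (@AGr_open R V).

(** The hyperplanes that meet the open cube of half side [e] about [y], in the coordinates of V^*
    dual to the basis of V. *)
Definition hitb y e : set (set (dual V)) :=
  [set H | exists2 z : dual V, H z & forall b, `|z (uncrd (delta_mx 0 b)) - y (uncrd (delta_mx 0 b))| < e].

Definition l1 f : R := \sum_b `|crd f 0 b|.

Lemma l1_gt0 f : f != 0 -> 0 < l1 f.
Proof.
move=> f0; rewrite lt_neqAle sumr_ge0 ?andbT// eq_sym psumr_eq0//.
apply/allPn => /=; apply: contrapT => no; case/eqP: f0; rewrite -[f]crdK (_ : crd f = 0) ?linear0//.
apply/rowP => b; rewrite [RHS]mxE; apply: contrapT => /eqP b0; apply: no.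
by exists b; rewrite ?mem_index_enum//= normr_eq0.
Qed.

Definition dualc (c : 'cV[R]_m) (v : V) : R^o := (crd v *m c) 0 0.

Lemma dualc_linear c : linear (dualc c).
Proof.
by move=> a u v; rewrite /dualc linearP mulmxDl -scalemxAl mxE [X in X + _]mxE.
Qed.

HB.instance Definition _ c := GRing.isLinear.Build R V R^o _ (dualc c) (dualc_linear c).

Lemma dual_crdE y f : y f = \sum_b crd f 0 b * y (uncrd (delta_mx 0 b)).
Proof. by rewrite -{1}[f]crdK dual_coordE. Qed.

(** [l1] is dual to the sup norm in these coordinates, so |y f - t| / l1 f is the distance from [y]
    to the hyperplane. *)
Lemma hitb_hyperplane y e f t : f != 0 -> 0 < e ->
  hitb y e (hyperplane f t) <-> `|y f - t| < e * l1 f.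
Proof.
move=> f0 e0; have D0 := l1_gt0 f0; split=> [[z <- h]|h].
  rewrite dual_crdE (dual_crdE z) -sumrB; apply: le_lt_trans (ler_norm_sum _ _ _) _.
  rewrite /l1 mulr_sumr.
  have le b : `|crd f 0 b * y (uncrd (delta_mx 0 b)) - crd f 0 b * z (uncrd (delta_mx 0 b))| <= e * `|crd f 0 b|.
    by rewrite -mulrBr normrM mulrC ler_wpM2r// distrC ltW.
  have [b b0] : exists b, crd f 0 b != 0.
    apply: contrapT => no; case/eqP: f0; rewrite -[f]crdK (_ : crd f = 0) ?linear0//.
    by apply/rowP => b; rewrite [RHS]mxE; apply: contrapT => /eqP b0; apply: no; exists b.
  rewrite (bigD1 b)//= [ltRHS](bigD1 b)//=; apply: ltr_leD; last by apply: ler_sum => i _.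
  by rewrite -mulrBr normrM mulrC ltr_pM2r ?normr_gt0// distrC.
pose d := (t - y f) / l1 f.
(* A nearest point: [y] is moved by [d] times the sign of each coordinate of [f]. *)
pose c : 'cV[R]_m := \col_b (d * Num.sg (crd f 0 b)).
pose z : dual V := y + linfun (dualc c).
have zE v : z v = y v + (crd v *m c) 0 0 by rewrite /z add_lfunE lfunE.
exists z => [|b].
  rewrite /hyperplane /= zE mxE (eq_bigr (fun b => d * `|crd f 0 b|)); last first.
    by move=> b _; rewrite /c mxE mulrCA [crd f 0 b * _]mulrC -normrEsg.
  by rewrite -mulr_sumr -/(l1 f) /d divfK ?gt_eqF// addrC subrK.
rewrite zE addrAC subrr add0r uncrdK -rowE mxE /c mxE normrM.
have d1 : `|d| < e by rewrite /d normf_div (gtr0_norm D0) ltr_pdivrMr// distrC.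
apply: le_lt_trans d1; rewrite ler_piMr// normr_sg; by case: (_ != 0).
Qed.

Let l1_cont (u : 'rV[R]_m) : {for u, continuous (fun u : 'rV[R]_m => l1 (uncrd u))}.
Proof.
apply: (@eq_continuous_at _ _ (fun u : 'rV[R]_m => \sum_b `|u 0 b|)).
  by move=> u'; rewrite /l1 uncrdK.
by apply: continuous_bigsum => b; apply: (@continuous_norm_at R _ R^o (fun u : 'rV[R]_m => u 0 b)); exact: continuous_coord.
Qed.

Let uncrd_neq0 (u : 'rV[R]_m) : (uncrd u != 0 :> V) = (u != 0).
Proof. by rewrite /uncrd passmx.vecof_eq0// vbasisP. Qed.

Lemma hitb_open y e : 0 < e -> AGr_open (hitb y e).
Proof.
move=> e0; rewrite /AGr_open (_ : [set p | _] = [set p : 'rV[R]_m * R | p.1 != 0 /\ `|y (uncrd p.1) - p.2| < e * l1 (uncrd p.1)]).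
  rewrite openE => -[u t] [/= u0 h].
  have cF : {for (u, t), continuous (fun p : 'rV[R]_m * R => e * l1 (uncrd p.1) - `|y (uncrd p.1) - p.2|)}.
    have c1 := @continuous_fst_at 'rV[R]_m R (u, t); have c2 := @continuous_snd_at 'rV[R]_m R (u, t).
    have cl : {for (u, t), continuous (fun p : 'rV[R]_m * R => l1 (uncrd p.1))}.
      by apply: (@continuous_comp _ _ _ (fst : 'rV[R]_m * R -> _) (fun u => l1 (uncrd u))) => //; exact: l1_cont.
    have cy : {for (u, t), continuous (fun p : 'rV[R]_m * R => y (uncrd p.1) : R)}.
      by apply: (@continuous_comp _ _ _ (fst : 'rV[R]_m * R -> _) (fun u => y (uncrd u) : R)) => //; exact: dual_continuous.
    apply: continuousB_at; first by apply: continuousM => //; exact: cst_continuous.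
    by apply: (@continuous_norm_at R _ R^o (fun p : 'rV[R]_m * R => y (uncrd p.1) - p.2)); exact: continuousB_at.
  have n1 : \forall p \near (u, t), p.1 != 0 :> 'rV[R]_m.
    by apply: (@open_nbhs_nbhs _ (u, t) [set p : 'rV[R]_m * R | p.1 != 0]); split=> //; exact: open_fst_neq0.
  have n2 : \forall p \near (u, t), 0 < e * l1 (uncrd p.1) - `|y (uncrd p.1) - p.2|.
    by apply: (cF [set x | 0 < x]); apply: open_nbhs_nbhs; split; [exact: open_gt|rewrite /= subr_gt0].
  near=> p; split; first by near: p.
  by rewrite -subr_gt0; near: p.
apply/seteqP; split=> -[u t] [/= u0 h]; split=> //.
  by apply/hitb_hyperplane => //; rewrite uncrd_neq0.
by apply/hitb_hyperplane => //; rewrite uncrd_neq0.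
Unshelve. all: by end_near. Qed.

(** No pair (f, a) with nonzero f lands in this set, so the set to be tested is empty. *)
Lemma nonhyp_open : AGr_open (~` AGr1 : set (set (dual V))).
Proof.
rewrite /AGr_open (_ : [set p | _] = set0); first exact: open0.
apply/seteqP; split=> // -[u t] [/= u0 h]; apply: h; exists (uncrd u), t; split=> //.
by rewrite uncrd_neq0.
Qed.

Lemma measurable_AGr1 : measurable (AGr1 : set AGrT).
Proof. by rewrite -(setCK AGr1); apply: measurableC; apply: sub_sigma_algebra; exact: nonhyp_open. Qed.

Lemma measurable_hitb y e : 0 < e -> measurable (hitb y e : set AGrT).
Proof. by move=> e0; apply: sub_sigma_algebra; exact: hitb_open. Qed.

(* [hyperplane 0 t] is not a hyperplane; sending [f = 0] to [set0] makes the map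
   measurable everywhere. *)
Definition hyp (p : @borelV R V * measurableTypeR R) : AGrT :=
  if p.1 == 0 :> V then set0 else hyperplane (p.1 : V) p.2.

Lemma measurable_hyp : measurable_fun setT hyp.
Proof.
apply: (@measurability _ _ _ AGrT setT hyp (@AGr_open R V)) => // _ [A oA <-]; rewrite setTI.
have mc : measurable_fun setT (fun p : @borelV R V * measurableTypeR R => (crd (p.1 : V), p.2) : borelR m * measurableTypeR R).
  apply/measurable_fun_pairP; split; last exact: (@measurable_snd _ _ (@borelV R V) (measurableTypeR R)).
  have H := measurableT_comp (@measurable_crd R V) (@measurable_fst _ _ (@borelV R V) (measurableTypeR R)); exact: H.
have mW (W : set ('rV[R]_m * R)) : open W -> measurable [set p : @borelV R V * measurableTypeR R | W (crd (p.1 : V), p.2)].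
  by move=> oW; have := mc measurableT _ (open_prod_measurable oW); rewrite setTI.
have o0 := @open_fst_neq0 R m.
have z0 : [set p : @borelV R V * measurableTypeR R | p.1 = 0 :> V] = ~` [set p | (crd (p.1 : V)) != 0].
  apply/seteqP; split=> -[v t] /=; first by move=> ->; rewrite linear0 eqxx => /negP.
  by move=> /negP; rewrite negbK => /eqP v0; rewrite -[v]crdK v0 linear0.
have E : hyp @^-1` A = [set p | crd (p.1 : V) != 0 /\ A (hyperplane (uncrd (crd (p.1 : V))) p.2)] `|`
   (if `[< A set0 >] then [set p : @borelV R V * measurableTypeR R | p.1 = 0 :> V] else set0).
  apply/seteqP; split=> -[v t]; rewrite /preimage /hyp /=.
    case: eqP => [v0|/eqP v0] h; first by right; rewrite asboolT.
    left; rewrite crdK; split=> //; apply: contra_neq v0 => c0; by rewrite -[v]crdK c0 linear0.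
  case=> [[c0 h]|].
    rewrite crdK in h; case: eqP => [v0|//]; by rewrite v0 linear0 eqxx in c0.
  by case: asboolP => // A0 /= ->; rewrite eqxx.
rewrite E; apply: measurableU; first exact: (mW _ oA).
by case: ifP => // _; rewrite z0; apply: measurableC; exact: (mW _ o0).
Qed.

End AffineHyperplanes.

#[local] Opaque sphere_measure.

Section NaturalMeasure.
Context {R : realType} {V : vectType R} (N : V -> R).
Hypothesis hN : is_norm N.
Local Notation m := (vdim V).
Local Notation S := (unit_sphere N).

(** Restricting to the sphere lets the integrals run over the whole space, where the product and
    pushforward constructions apply. *)
Definition smeas : {measure set (@borelV R V) -> \bar R} :=
  mrestr (sphm hN) (sphere_measurable hN).

Let smeas_finite A : measurable A -> smeas A \is a fin_num.
Proof.
move=> mA; rewrite /smeas /= /mrestr; apply: fin_num_measure.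
by apply: measurableI => //; exact: sphere_measurable.
Qed.

Definition natm : {measure set (@AGrT R V) -> \bar R} :=
  mscale (2^-1)%:nng (pushm (smeas \x (@lebesgue_measure R))%E (@measurable_hyp R V)).

Lemma sphere_neq0 (x : V) : S x -> x != 0.
Proof.
have [_ _ h _] := hN; move=> Sx; apply/eqP => x0; move: Sx; rewrite /unit_sphere /= x0.
by have := h 0 0; rewrite scale0r normr0 mul0r => -> /eqP; rewrite eq_sym oner_eq0.
Qed.

Let measurable_section A : measurable A ->
  measurable_fun setT (fun x : @borelV R V => lebesgue_measure (xsection (@hyp R V @^-1` A) x)).
Proof.
move=> mA; apply: measurable_fun_xsection.
by rewrite -[X in measurable X]setTI; exact: measurable_hyp.
Qed.

Lemma natmE A : measurable A ->
  natm A = ((2^-1)%:E * \int[sphm hN]_(x in S) lebesgue_measure (xsection (@hyp R V @^-1` A) x))%E.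
Proof.
move=> mA; rewrite -(@integral_mrestr _ _ _ (sphm hN) _ (sphere_measurable hN) _ _ (measurable_section mA))//.
Qed.

Let xsection_hyp A (x : V) : S x -> xsection (@hyp R V @^-1` A) x = [set t | A (hyperplane x t)].
Proof.
by move=> Sx; apply/seteqP; split=> t; rewrite /xsection /= ?in_setE /preimage /hyp /= (negPf (sphere_neq0 Sx)).
Qed.

Lemma natural_measureE (A : set (@AGrT R V)) : measurable A -> natural_measure N A = natm A.
Proof.
move=> mA; rewrite natmE// [LHS](_ : _ = ((2^-1)%:E * \int[sphm hN]_(x in S) lebesgue_measure [set t | A (hyperplane x t)])%E)//.
by congr (_ * _)%E; apply: eq_integral => x /set_mem Sx; rewrite xsection_hyp.
Qed.

Lemma sphere_bounded : exists2 C, 0 < C & forall x : V, S x -> `|crd x| <= C.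
Proof.
have [C C0 HC] := rnorm_lb (norm_crd hN); exists C => // x Sx.
by have := HC (crd x); rewrite crdK (_ : N x = 1)// mulr1.
Qed.

(** The hyperplanes that meet a bounded cube about 0 have finite measure: for [x] on the sphere the
    admissible [t] fill a bounded interval, uniformly in [x]. The sets that are not hyperplanes are
    added to exhaust the space. *)
Lemma natm_sigma_finite : sigma_finite setT natm.
Proof.
exists (fun k => hitb 0 k.+1%:R `|` ~` AGr1).
  apply/seteqP; split=> // H _.
  have [[f [t [f0 ->]]]|nH] := pselect (AGr1 H); last by exists 0%N => //; right.
  have D0 := l1_gt0 f0.
  exists (Num.truncn (`|t| / l1 f)) => //; left; apply/hitb_hyperplane => //.
  rewrite zero_lfunE sub0r normrN -ltr_pdivrMr//.
  have /truncn_itv/andP[_] : 0 <= `|t| / l1 f by rewrite divr_ge0// ltW.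
  exact.
move=> k; have mk : measurable (hitb 0 k.+1%:R `|` ~` AGr1 : set (@AGrT R V)).
  by apply: measurableU; [exact: measurable_hitb|apply: measurableC; exact: measurable_AGr1].
split=> //; have [C C0 HC] := sphere_bounded.
(* A bound for k.+1 times [l1] on the sphere, where each of the [m] coordinates is at most [C]. *)
pose c := k.+1%:R * (C * m%:R); have c0 : 0 <= c by rewrite !mulr_ge0// ltW.
rewrite natmE//.
apply: (@le_lt_trans _ _ ((2^-1)%:E * \int[sphm hN]_(x in S) (cst (2 * c)%:E x))%E); last first.
  rewrite integral_cst; last exact: sphere_measurable.
  rewrite muleA -EFinM; apply: lte_mul_pinfty => //.
    by rewrite lee_fin mulr_ge0// mulr_ge0.
  rewrite ltey_eq fin_num_measure//; exact: sphere_measurable.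
apply: lee_wpmul2l; first by rewrite lee_fin.
apply: ge0_le_integral.
- exact: sphere_measurable.
- by move=> x _; exact: measure_ge0.
- exact: measurable_funS (measurable_section mk).
- exact: measurable_cst.
move=> x Sx; have x0 := sphere_neq0 Sx; rewrite xsection_hyp//.
apply: (@le_trans _ _ (lebesgue_measure `[- c, c]%classic)).
  apply: le_measure; rewrite ?inE//.
    rewrite (_ : [set t | _] = `]- (k.+1%:R * l1 x), k.+1%:R * l1 x[%classic)//.
    apply/seteqP; split=> t /=; rewrite in_itv /= -ltr_norml.
      case=> [/hitb_hyperplane|h]; last by exfalso; apply: h; exists x, t.
      by rewrite zero_lfunE sub0r normrN => ->.
    by move=> h; left; apply/hitb_hyperplane => //; rewrite zero_lfunE sub0r normrN.
  move=> t /= [/hitb_hyperplane|h]; last by exfalso; apply: h; exists x, t.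
  rewrite zero_lfunE sub0r normrN => /(_ x0 (ltr0Sn _ _)) h; rewrite in_itv /= -ler_norml.
  apply: (le_trans (ltW h)); rewrite ler_pM2l//.
  rewrite /l1 -[m in X in _ <= X]card_ord mulr_natr -sumr_const; apply: ler_sum => b _.
  by apply: le_trans (le_coord_norm _ _ _) _; exact: HC.
rewrite lebesgue_measure_itv /= lte_fin -EFinD.
by case: ifP => _; rewrite lee_fin; lra.
Qed.

Lemma smeas_sigma_finite : sigma_finite setT smeas.
Proof.
exists (fun=> setT); first by apply/seteqP; split=> // x _; exists 0%N.
by move=> _; split=> //; rewrite ltey_eq smeas_finite.
Qed.

End NaturalMeasure.

Lemma prod_measure_ext (R : realType) (I : finType) (T : I -> Type) (M : forall i, set (set (T i)))
    (mu mu' : forall i, set (T i) -> \bar R) : (forall i A, M i A -> mu i A = mu' i A) ->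
  prod_measure M mu = prod_measure M mu'.
Proof.
move=> h; apply/funext => A; rewrite /prod_measure; congr ereal_inf; apply/seteqP.
by split=> s [K [B [mB AB ->]]]; exists K, B; split=> //; apply: eq_esum => j _; apply: eq_bigr => i _; rewrite h.
Qed.

Section ProductNatural.
Context {R : realType} {n : nat} (V : 'I_n -> vectType R) (N : forall i, V i -> R).
Hypothesis hN : forall i, is_norm (@N i).

Definition sphs i : {sigma_finite_measure set (@borelV R (V i)) -> \bar R} := sfm (smeas_sigma_finite (hN i)).
Definition natms i : {sigma_finite_measure set (@AGrT R (V i)) -> \bar R} := sfm (natm_sigma_finite (hN i)).
Definition frames := @prodT 'I_n _ (fun i => @borelV R (V i)).
Definition hypsT := @prodT 'I_n _ (fun i => @AGrT R (V i)).
Definition sphp : {sigma_finite_measure set frames -> \bar R} := pm (fun i => @sphs i).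

Definition hyps (p : frames * borelR n) : hypsT :=
  fun i => hyp ((p.1 : forall i, V i) i, (p.2 : 'rV[R]_n) 0 i).

Lemma measurable_hyps : measurable_fun setT hyps.
Proof.
apply: measurable_fun_prodT => i.
have mc : measurable_fun setT (fun p : frames * borelR n => ((p.1 : forall i, V i) i, (p.2 : 'rV[R]_n) 0 i) : @borelV R (V i) * measurableTypeR R).
  apply/measurable_fun_pairP; split.
    have H := measurableT_comp (@measurable_coord _ _ (fun i => @borelV R (V i)) i) (@measurable_fst _ _ frames (borelR n)); exact: H.
  have H := measurableT_comp (@measurable_coordR R n i) (@measurable_snd _ _ frames (borelR n)); exact: H.
have H := measurableT_comp (@measurable_hyp R (V i)) mc; exact: H.
Qed.

Lemma product_natural_pm : product_natural_measure N = pm (fun i => @natms i) :> (set hypsT -> \bar R).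
Proof.
apply: (@prod_measure_ext _ _ (fun i => @AGrT R (V i)) (fun i => measurable)) => i A mA.
exact: natural_measureE.
Qed.

(** Both sides are products on boxes, and boxes determine the product measure. Each natural measure
    contributes one factor 1/2. *)
Lemma product_natural_push (A : set hypsT) : measurable A ->
  product_natural_measure N A = ((2 ^- n)%:E * (sphp \x @leb R n)%E (hyps @^-1` A))%E.
Proof.
move=> mA; rewrite product_natural_pm.
rewrite -(@pm_unique _ _ _ _ (fun i => @natms i) (mscale (2 ^- n)%:nng (pushm (sphp \x @leb R n)%E measurable_hyps)))//.
move=> B mB; rewrite [LHS](_ : _ = ((2 ^- n)%:E * \int[sphp]_f leb (xsection (hyps @^-1` box B) f))%E)//.
pose g i (x : @borelV R (V i)) := lebesgue_measure (xsection (@hyp R (V i) @^-1` B i) x).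
have mhB i : measurable (@hyp R (V i) @^-1` B i) by rewrite -[X in measurable X]setTI; exact: measurable_hyp.
have mg i : measurable_fun setT (@g i) by exact: measurable_fun_xsection.
rewrite (eq_integral (fun f : frames => \big[*%E/1%E]_i @g i ((f : forall i, V i) i))); last first.
  move=> f _; rewrite /g -leb_boxE; last by move=> i; exact: (measurable_xsection _ (mhB i)).
  congr (leb _); apply/seteqP; split=> t; rewrite /xsection /= ?in_setE /preimage /hyps /box /=.
    by move=> h i; rewrite in_setE /=; exact: h.
  by move=> h i; have := h i; rewrite in_setE.
rewrite (@pm_integral _ _ _ _ (fun i => @sphs i) g)//.
rewrite [RHS](eq_bigr (fun i => ((2^-1)%:E * \int[@sphs i]_x @g i x)%E)); last first.
  move=> i _; rewrite -[LHS]/(natm (hN i) (B i)) natmE//.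
  by rewrite -(@integral_mrestr _ _ _ (sphm (hN i)) _ (sphere_measurable (hN i)) _ _ (mg i)).
by rewrite big_split /= prodEFin prodr_const card_ord exprVn.
Qed.

End ProductNatural.

(** * The average number of solutions in a chart *)

Lemma measurable_det d (T : measurableType d) (R : realType) n (D : set T) (A : T -> 'M[R]_n) :
  (forall i j, measurable_fun D (fun t => A t i j : measurableTypeR R)) ->
  measurable_fun D (fun t => \det (A t) : measurableTypeR R).
Proof.
move=> mA; apply: measurable_sum => s; apply: measurable_funM; first exact: measurable_cst.
by apply: measurable_prod => i _; exact: mA.
Qed.

Lemma derivable_row (R : realType) n m (F : 'rV[R]_n -> 'rV[R]_m) x v :
  (forall j, derivable (fun y => F y 0 j) x v) ->
  derivable F x v /\ 'D_v F x = \row_j 'D_v (fun y => F y 0 j) x.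
Proof.
move=> dF.
have h : (fun h : R => h^-1 *: ((F \o shift x) (h *: v) - F x)) @ 0^' --> \row_j 'D_v (fun y => F y 0 j) x.
  apply: cvg_row => j; rewrite mxE.
  have := dF j; rewrite /derivable => /cvgP/cvg_ex[l hl].
  have E : 'D_v (fun y => F y 0 j) x = l by exact: cvg_lim hl.
  rewrite E; apply: cvg_trans hl; apply: near_eq_cvg; near=> y.
  by rewrite !mxE.
by split; [apply/cvg_ex; eexists; exact: h|exact: cvg_lim h].
Unshelve. all: by end_near. Qed.

Lemma C1on_row (R : realType) n m (O : set 'rV[R]_n) (F : 'rV[R]_n -> 'rV[R]_m) : open O ->
  (forall j, C1on O (fun y => F y 0 j)) -> C1on O F.
Proof.
move=> oO FC x Ox i; split; first by apply: (derivable_row _).1 => j; have [] := FC j x Ox i.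
apply: (continuous_at_on oO Ox (f := fun y => \row_j 'D_(delta_mx 0 i) (fun y => F y 0 j) y)).
  by move=> y Oy; rewrite (derivable_row _).2// => j; have [] := FC j y Oy i.
apply: continuous_row => j; apply: (@eq_continuous_at _ _ (fun y => 'D_(delta_mx 0 i) (fun y => F y 0 j) y)).
  by move=> y; rewrite mxE.
by have [] := FC j x Ox i.
Qed.

Section SetIntegral.
Import HBNNSimple.

(** [average_solutions] integrates against a bare set function. Simple functions see only its values
    on measurable sets, so it can be replaced there by a genuine measure. *)
Lemma eq_set_integral d (T : measurableType d) (R : realType) (mu nu : set T -> \bar R) D f :
  (forall A, measurable A -> mu A = nu A) -> (\int[mu]_(x in D) f x = \int[nu]_(x in D) f x)%E.
Proof.
move=> e.
have s (h : {nnsfun T >-> R}) : sintegral mu h = sintegral nu h.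
  by rewrite /sintegral; apply: eq_fsbigr => x _; rewrite e.
have E g : ereal_sup [set sintegral mu h | h in [set h : {nnsfun T >-> R} | forall x, ((h x)%:E <= g x)%E]] =
  ereal_sup [set sintegral nu h | h in [set h : {nnsfun T >-> R} | forall x, ((h x)%:E <= g x)%E]].
  by congr ereal_sup; apply/seteqP; split=> _ [h hg <-]; exists h.
by rewrite /integral !E.
Qed.

End SetIntegral.

(** * Measurability of the number of solutions *)

Section Solutions.
Context {R : realType} {n : nat} (X : manifold R n) (V : 'I_n -> vectType R)
  (ev : forall i : 'I_n, {linear V i -> (X -> R^o)}).
Hypothesis ev_smooth : forall (i : 'I_n) (v : V i), smooth_fun (ev i v).
Arguments ev_smooth : clear implicits.

Definition evx i (x : X) (v : V i) : R^o := ev i v x.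
Lemma evx_linear i x : linear (@evx i x).
Proof. by move=> a u v; rewrite /evx linearP. Qed.
HB.instance Definition _ i x := GRing.isLinear.Build R (V i) R^o _ (@evx i x) (@evx_linear i x).

Lemma thetaE i x v : theta (ev i) x v = ev i v x.
Proof. by rewrite -[LHS]/(linfun (@evx i x) v) lfunE. Qed.

Lemma ev_chart_continuous i v c u : (@cmap _ _ X c @` cdom c) u -> {for u, continuous (ev i v \o @cinv _ _ X c : _ -> R)}.
Proof. by move=> cu; have [h _] := ev_smooth i v c 0%N; exact: h. Qed.

Lemma ev_continuous i v : continuous (ev i v : X -> R).
Proof.
move=> x; have [c cx] := cdom_cover x.
apply: (continuous_at_on (cdom_open c) cx (f := fun y => ev i v (cinv c (cmap c y)))).
  by move=> y cy; rewrite cmapK.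
apply: (@continuous_comp _ _ _ (cmap c) (ev i v \o cinv c : _ -> R)); first exact: cmap_continuous.
by apply: ev_chart_continuous; exists x.
Qed.

Definition sol (H : forall i, set (dual (V i))) : set X := [set x | forall i, H i (theta (ev i) x)].

Definition AGs : set (hypsT V) := [set H | forall i, AGr1 ((H : forall i, set (dual (V i))) i)].

Lemma measurable_AGs : measurable AGs.
Proof.
rewrite (_ : AGs = box (fun i => AGr1 : set (@AGrT R (V i))))//.
by apply: measurable_box => i; exact: measurable_AGr1.
Qed.

Definition hit (D : set X) : set (hypsT V) := AGs `&` [set H | exists2 x, D x & sol H x].

Section Basis.
Variable E : nat -> set X.
Hypotheses (oE : forall k, open (E k))
  (bE : forall x (D : set X), open D -> D x -> exists k, E k x /\ E k `<=` D).

(** If [E k] meets [K], one common point is chosen, and these are the tuples of hyperplanes that all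
    pass within 1/(m+1) of its image under [theta]. *)
Let T (K : set X) (m k : nat) : set (hypsT V) :=
  match pselect (exists x, E k x /\ K x) with
  | left h => [set H | forall i, hitb (theta (ev i) (projT1 (cid h))) (m.+1%:R^-1) ((H : forall i, set (dual (V i))) i)]
  | right _ => set0
  end.

Let measurable_T K m k : measurable (T K m k).
Proof.
rewrite /T; case: pselect => [h|_]; last exact: measurable0.
set q := projT1 _; rewrite (_ : [set H | _] = box (fun i => hitb (theta (ev i) q) (m.+1%:R^-1) : set (@AGrT R (V i))))//.
by apply: measurable_box => i; apply: measurable_hitb; rewrite invr_gt0.
Qed.

(** On a compact set, solvability amounts to approximate solvability at every precision, and
    countably many test points are enough. Conversely the residual [g], continuous on [K], attains
    its minimum, which approximate solutions force to be 0. *)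
Lemma measurable_hit_compact K : compact K -> measurable (hit K).
Proof.
move=> cK; suff -> : hit K = AGs `&` \bigcap_m \bigcup_k T K m k.
  apply: measurableI; first exact: measurable_AGs.
  by apply: bigcap_measurable => // m _; apply: bigcup_measurable => k _; exact: measurable_T.
apply/seteqP; split=> [H [AH [x Kx Hx]]|H [AH hH]]; split=> //.
  move=> m _; have m0 : 0 < m.+1%:R^-1 :> R by rewrite invr_gt0.
  pose D' := [set x' : X | forall i b, `|ev i (uncrd (delta_mx 0 b)) x - ev i (uncrd (delta_mx 0 b)) x'| < m.+1%:R^-1].
  have nD : nbhs x D'.
    apply: filter_forall => i; apply: filter_forall => b.
    have := @ev_continuous i (uncrd (delta_mx 0 b)) x.
    by move=> /cvgrPdist_lt/(_ _ m0).
  have [k [kx kD]] := bE (open_interior D') nD.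
  exists k => //; rewrite /T; case: pselect => [h|]; last by case; exists x.
  case: (cid h) => q [/= Eq Kq] i; exists (theta (ev i) x); first exact: Hx.
  by move=> b; rewrite !thetaE; have /interior_subset := kD _ Eq; exact.
have ft i : exists p : V i * R, p.1 != 0 /\ (H : forall i, set (dual (V i))) i = hyperplane p.1 p.2.
  by have [f [t [f0 ->]]] := AH i; exists (f, t).
pose p i := projT1 (cid (ft i)).
have pP i : (p i).1 != 0 /\ (H : forall i, set (dual (V i))) i = hyperplane (p i).1 (p i).2 := projT2 (cid (ft i)).
pose g x := \sum_i `|ev i (p i).1 x - (p i).2|.
have near m : exists2 q, K q & g q <= m.+1%:R^-1 * \sum_i l1 (p i).1.
  have [k _] := hH m Logic.I; rewrite /T; case: pselect => // h; case: (cid h) => q [/= _ Kq] hq.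
  exists q => //; rewrite mulr_sumr; apply: ler_sum => i _; have [p0 Hp] := pP i.
  have m0 : 0 < m.+1%:R^-1 :> R by rewrite invr_gt0.
  have := hq i; rewrite Hp => /hitb_hyperplane => /(_ p0 m0); rewrite thetaE; exact: ltW.
have cg : continuous g.
  move=> x; apply: continuous_bigsum => i; apply: (@continuous_norm_at R _ R^o (fun x => ev i (p i).1 x - (p i).2)).
  by apply: continuousB_at; [exact: ev_continuous|exact: cst_continuous].
have [||x Kx xmin] := @compact_EVT_min _ R g K _ cK.
- by have [q Kq _] := near 0%N; exists q.
- by apply: continuous_in_subspaceT => x _; exact: cg.
move: Kx => /set_mem Kx; exists x => //.
have gx : g x = 0.
  apply/eqP; rewrite eq_le sumr_ge0 ?andbT// leNgt; apply/negP => g0.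
  have S0 : 0 <= \sum_i l1 (p i).1 by apply: sumr_ge0 => i _; apply: sumr_ge0.
  (* A precision at which the residual would fall below its minimum. *)
  have [q Kq] := near (Num.truncn ((\sum_i l1 (p i).1) / g x)).
  apply/negP; rewrite -ltNge; apply: (@lt_le_trans _ _ (g x)); last by apply: xmin; exact/mem_set.
  rewrite mulrC ltr_pdivrMr// mulrC -ltr_pdivrMr//.
  by have /truncn_itv/andP[] : 0 <= (\sum_i l1 (p i).1) / g x by rewrite divr_ge0// ltW.
move=> i; have [p0 ->] := pP i; rewrite /hyperplane /= thetaE.
move: gx; rewrite /g => /eqP; rewrite psumr_eq0// => /allP/(_ i); rewrite mem_index_enum => /(_ isT).
by rewrite /= normr_eq0 subr_eq0 => /eqP.
Qed.

Lemma measurable_hit D : open D -> measurable (hit D).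
Proof.
move=> oD; suff -> : hit D = \bigcup_k (if `[< compact (closure (E k)) /\ closure (E k) `<=` D >] then hit (closure (E k)) else set0).
  by apply: bigcup_measurable => k _; case: asboolP => // -[cE _]; exact: measurable_hit_compact.
apply/seteqP; split=> [H [AH [x Dx Hx]]|H [k _]]; last first.
  by case: asboolP => // -[_ ED] [AH [x Ex Hx]]; split=> //; exists x => //; exact: ED.
have [k [kx cE ED]] := compact_basis_nbhd oE bE oD Dx.
exists k => //; rewrite asboolT//; split=> //; exists x => //; exact: subset_closure.
Qed.

(** Exactly one solution in [E k]: two different ones would lie in disjoint basis sets inside
    [E k]. *)
Let one k : set (hypsT V) := hit (E k) `\` \bigcup_(ab in [set ab : nat * nat | E ab.1 `<=` E k /\ E ab.2 `<=` E k /\ E ab.1 `&` E ab.2 = set0])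
  (hit (E ab.1) `&` hit (E ab.2)).

Let measurable_one k : measurable (one k).
Proof.
apply: measurableD; first exact: measurable_hit.
rewrite (_ : \bigcup_(ab in _) _ = \bigcup_ab (if `[< E ab.1 `<=` E k /\ E ab.2 `<=` E k /\ E ab.1 `&` E ab.2 = set0 >]
  then hit (E ab.1) `&` hit (E ab.2) else set0)).
  apply: countable_bigcupT_measurable => [|ab]; first exact: countableP.
  by case: ifP => // _; apply: measurableI; exact: measurable_hit.
apply/seteqP; split=> [H [ab /= h Hab]|H [ab _]]; first by exists ab => //; rewrite asboolT.
by case: asboolP => // h Hab; exists ab.
Qed.

Let oneP k (H : hypsT V) : AGs H -> one k H <-> exists x, E k `&` sol H = [set x].
Proof.
move=> AH; split=> [[[_ [x Ex Hx]] no]|[x Ex]].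
  exists x; apply/seteqP; split=> [y [Ey Hy]|y ->//]; apply: contrapT => yx.
  have oh := @manifold_hausdorff _ _ X; rewrite open_hausdorff in oh.
  have /oh[[A B] /= [/set_mem Ay /set_mem Bx] [oA oB /eqP AB]] : y != x by apply/eqP.
  have [a [ay aA]] := bE (openI oA (oE k)) (conj Ay Ey).
  have [b [bx bB]] := bE (openI oB (oE k)) (conj Bx Ex).
  apply: no; exists (a, b) => /=.
    split; first by move=> z /aA[].
    split; first by move=> z /bB[].
    by apply/seteqP; split=> // z [/aA[Az _] /bB[Bz _]]; rewrite -AB.
  by split; split=> //; [exists y|exists x].
have /seteqP[Ex1 /(_ x erefl)[kx Hx]] := Ex.
split; first by split=> //; exists x.
move=> [[a b] /= [ak [bk ab]] [[_ [y ay Hy]] [_ [z bz Hz]]]].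
have yx : y = x by apply: Ex1; split=> //; exact: ak.
have zx : z = x by apply: Ex1; split=> //; exact: bk.
have /seteqP[h _] := ab; apply: (h x); split; [by rewrite -yx|by rewrite -zx].
Qed.

(** Finitely many isolated points have disjoint basis neighbourhoods containing no other solution.
    Only countably many choices of such neighbourhoods exist, which gives measurability. *)
Let nb_geP M D (H : hypsT V) : open D -> AGs H ->
  (M%:R%:E <= counting (D `&` isolated (sol H)) :> \bar R)%E <->
  exists k : {ffun 'I_M -> nat}, (forall j, E (k j) `<=` D) /\ (forall i j, i != j -> E (k i) `&` E (k j) = set0) /\
     forall j, one (k j) H.
Proof.
move=> oD AH; split=> [/counting_geP[p [pinj pA]]|[k [kD [kk ok]]]]; last first.
  have h j : exists x, E (k j) `&` sol H = [set x] by apply/oneP.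
  have [p pP] := choice h; apply/counting_geP; exists p.
  have pE j : E (k j) (p j) /\ sol H (p j) by have /seteqP[_ /(_ _ erefl)] := pP j.
  split=> [i j ij|j]; last first.
    split; first exact: kD (pE j).1.
    split; first by apply/mem_set; have [] := pE j.
    by exists (E (k j)) => //; apply: open_nbhs_nbhs; split; [exact: oE|have [] := pE j].
  apply/eqP/negP => /negP/kk/seteqP[/(_ (p i)) + _]; apply; split; first by have [] := pE i.
  by rewrite ij; have [] := pE j.
have sep : exists W : 'I_M -> set X, (forall j, open (W j) /\ W j (p j)) /\ forall i j, i != j -> W i `&` W j = set0.
  have oh := @manifold_hausdorff _ _ X; rewrite open_hausdorff in oh.
  have h (ij : 'I_M * 'I_M) : exists AB : set X * set X, open AB.1 /\ open AB.2 /\ (ij.1 != ij.2 -> AB.1 (p ij.1) /\ AB.2 (p ij.2) /\ AB.1 `&` AB.2 = set0).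
    have [->|ne] := eqVneq ij.1 ij.2; first by exists (set0, set0); do !split=> //; exact: open0.
    have /oh[[A B] /= [/set_mem Ay /set_mem Bx] [oA oB /eqP AB]] : p ij.1 != p ij.2 by apply: contra_neq ne => /pinj.
    by exists (A, B).
  have [AB ABP] := choice h.
  (* The separating sets for (i, j) and for (j, i) are chosen independently, so both are
     intersected; the diagonal imposes no condition. *)
  pose W i j : set X := if j == i then setT else (AB (i, j)).1 `&` (AB (j, i)).2.
  exists (fun i => [set x | forall j, W i j x]).
  split=> [i|i j ij].
    split; last first.
      move=> j; rewrite /W; case: eqP => // /eqP ji; split.
        by have [_ [_ /=]] := ABP (i, j); rewrite eq_sym => /(_ ji)[].
      by have [_ [_ /=]] := ABP (j, i) => /(_ ji)[_ []].
    rewrite openE => x Wx; apply: filter_forall => j; apply: open_nbhs_nbhs; split=> //.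
    by rewrite /W; case: eqP => // _; [exact: openT|apply: openI; [have [] := ABP (i, j)|have [_ []] := ABP (j, i)]].
  apply/seteqP; split=> // x [/(_ j) + /(_ i)]; rewrite /W (negPf ij) eq_sym (negPf ij).
  move=> [x1 _] [_ x2]; have [_ [_ /=]] := ABP (i, j) => /(_ ij)[_ [_ ab]].
  by have : set0 x by rewrite -[set0]ab; split.
have [W [WP Wd]] := sep.
have h j : exists k, [/\ E k (p j), E k `<=` D `&` W j & one k H].
  have [Dp [Hp [B nB BE]]] := pA j; have [oW Wp] := WP j.
  have [k [kp kD]] := bE (openI (openI oD oW) (open_interior B)) (conj (conj Dp Wp) nB).
  exists k; split=> //; first by move=> x /kD[].
  apply/oneP => //; exists (p j); apply/seteqP; split=> [x [/kD[_ /interior_subset Bx] Hx]|x ->].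
    by rewrite -BE.
  by split=> //; exact/set_mem.
have [k kP] := choice h; exists [ffun j => k j]; split; last split.
- by move=> j; rewrite ffunE; have [_ kD _] := kP j => x /kD[].
- move=> i j ij; rewrite !ffunE; have [_ ki _] := kP i; have [_ kj _] := kP j.
  by apply/seteqP; split=> // x [/ki[_ Wi] /kj[_ Wj]]; rewrite -(Wd i j ij).
- by move=> j; rewrite ffunE; have [] := kP j.
Qed.

Lemma measurable_nb_basis D : open D ->
  measurable_fun AGs (fun H : hypsT V => counting (D `&` isolated (sol H)) : \bar R).
Proof.
move=> oD; apply: measurable_counting_nat => [|M]; first exact: measurable_AGs.
rewrite (_ : _ `&` _ = AGs `&` \bigcup_(k : {ffun 'I_M -> nat})
   (if `[< (forall j, E (k j) `<=` D) /\ (forall i j, i != j -> E (k i) `&` E (k j) = set0) >] then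
      \bigcap_(j in setT) one (k j) else set0)).
  apply: measurableI; first exact: measurable_AGs.
  apply: countable_bigcupT_measurable => [|k]; first exact: countableP.
  by case: ifP => // _; apply: fin_bigcap_measurable => [|j _]; [exact: finite_finset|exact: measurable_one].
apply/seteqP; split=> H [AH].
  move=> /(nb_geP _ oD AH)[k [h1 [h2 h3]]]; split=> //; exists k => //.
  by rewrite asboolT// => j _; exact: h3.
move=> [k _]; case: asboolP => // -[h1 h2] h3; split=> //.
by apply/(nb_geP _ oD AH); exists k; split=> //; split=> // j; exact: h3.
Qed.

End Basis.

Lemma measurable_nb D : open D ->
  measurable_fun AGs (fun H : hypsT V => nb_solutions ev D H : \bar R).
Proof. by have [E [oE bE]] := basis_enum X; exact: measurable_nb_basis oE bE D. Qed.

End Solutions.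

(** * The density of the number of solutions in a chart *)

Section ChartFormula.
Context {R : realType} {n : nat} (X : manifold R n) (V : 'I_n -> vectType R)
  (ev : forall i : 'I_n, {linear V i -> (X -> R^o)}) (N : forall i, V i -> R).
Hypothesis ev_smooth : forall (i : 'I_n) (v : V i), smooth_fun (ev i v).
Hypothesis hN : forall i, is_norm (@N i).
Arguments ev_smooth : clear implicits.

Definition cimg (c : chart X) (D : set X) : set 'rV[R]_n := cmap c @` cdom c `&` @cinv _ _ X c @^-1` D.

Lemma cimgE c (D : set X) : D `<=` cdom c -> cimg c D = cmap c @` D.
Proof.
move=> Dc; apply/seteqP; split=> [u [[x cx <-]]|_ [x Dx <-]].
  by rewrite /preimage /= cmapK// => Dx; exists x.
by split; [exists x => //; exact: Dc|rewrite /preimage /= cmapK//; exact: Dc].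
Qed.

Lemma open_cimg c (D : set X) : open D -> open (cimg c D).
Proof. by move=> oD; apply: continuous_on_measurable => //; [exact: cmap_open|move=> u; exact: cinv_continuous]. Qed.

Definition evc i v c : 'rV[R]_n -> R := fun u => ev i v (@cinv _ _ X c u).

Lemma evc_C1 i v c : C1on (cmap c @` cdom c) (@evc i v c).
Proof. exact: Cr_C1on (ev_smooth i v c 1%N). Qed.

Definition Dmx i c (u : 'rV[R]_n) : 'M[R]_(vdim (V i), n) :=
  \matrix_(b, j) 'D_(delta_mx 0 j) (@evc i (uncrd (delta_mx 0 b)) c) u.

Lemma uncrd_sum i (f : V i) : f = \sum_b crd f 0 b *: uncrd (delta_mx 0 b).
Proof.
rewrite -{1}[f]crdK [uncrd _]/uncrd /passmx.vecof; apply: eq_bigr => b _.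
by rewrite /uncrd passmx.vecof_delta.
Qed.

Lemma evc_derive i f c u j : (cmap c @` cdom c) u ->
  'D_(delta_mx 0 j) (@evc i f c) u = (crd f *m Dmx i c u) 0 j.
Proof.
move=> cu.
have E : @evc i f c = fun u => \sum_b (crd f 0 b *: (@evc i (uncrd (delta_mx 0 b)) c : 'rV[R]_n -> R) u).
  apply/funext => u'; rewrite /evc {1}[f]uncrd_sum linear_sum fct_sumE; apply: eq_bigr => b _.
  by rewrite linearZ.
rewrite [RHS]mxE E (_ : (fun u => _) = \sum_b (crd f 0 b *: (@evc i (uncrd (delta_mx 0 b)) c : 'rV[R]_n -> R))); last first.
  by apply/funext => u'; rewrite fct_sumE.
rewrite derive_sum; last first.
  by move=> b; apply: derivableZ; have [] := @evc_C1 i (uncrd (delta_mx 0 b)) c u cu j.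
apply: eq_bigr => b _; rewrite deriveZ; first by rewrite [Dmx i c u b j]mxE.
by have [] := @evc_C1 i (uncrd (delta_mx 0 b)) c u cu j.
Qed.

Definition sysmx c (f : frames V) u : 'M[R]_n := \matrix_(i, j) (crd ((f : forall i, V i) i) *m Dmx i c u) 0 j.

(* Up to the factor [2 ^- n], the density of the average number of solutions in
   the chart [c]. *)
Definition delta c u : \bar R := (\int[sphp hN]_f (`|\det (sysmx c f u)|)%:E)%E.

Let Ff c (f : frames V) (u : 'rV[R]_n) : 'rV[R]_n := \row_i @evc i ((f : forall i, V i) i) c u.

Let FfC c f : C1on (cmap c @` cdom c) (Ff c f).
Proof.
apply: C1on_row; first exact: cmap_open.
move=> j x cx i; have [h1 h2] := @evc_C1 j ((f : forall i, V i) j) c x cx i.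
have E : (fun y => Ff c f y 0 j) = @evc j ((f : forall i, V i) j) c by apply/funext => y; rewrite mxE.
by rewrite E.
Qed.

Let Ff_jac c f u : (cmap c @` cdom c) u -> \det (jac (Ff c f) u) = \det (sysmx c f u).
Proof.
move=> cu; rewrite -det_tr; congr (\det _); apply/matrixP => i j.
have [dF _] := FfC f cu j.
rewrite [LHS]mxE [RHS]mxE [LHS]mxE -(derive_coord i dF).2 (_ : (fun y => Ff c f y 0 i) = @evc i ((f : forall i, V i) i) c).
  exact: evc_derive.
by apply/funext => y; rewrite mxE.
Qed.

Let nbm D : hypsT V -> \bar R := (fun H => nb_solutions ev D H) \_ (@AGs R n V).

Let measurable_nbm D : open D -> measurable_fun setT (nbm D).
Proof. by move=> oD; apply: (measurable_restrictT _ (@measurable_AGs R n V)).1; exact: measurable_nb. Qed.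

Let nbm_ge0 D H : (0 <= nbm D H)%E.
Proof. by rewrite /nbm patchE; case: ifP => // _; exact: counting_ge0. Qed.

Lemma average_push D : open D ->
  average_solutions ev N D = ((2 ^- n)%:E * \int[sphp hN]_f \int[@leb R n]_t nbm D (hyps (f, t)))%E.
Proof.
move=> oD.
rewrite [LHS](_ : _ = \int[(product_natural_measure N : set (hypsT V) -> \bar R)]_(H in @AGs R n V) nb_solutions ev D H)%E//.
have k0 : 0 <= 2 ^- n :> R by rewrite invr_ge0 exprn_ge0.
pose k := NngNum k0.
transitivity (\int[mscale k (pushm (sphp hN \x @leb R n)%E (@measurable_hyps R n V))]_(H in @AGs R n V) nb_solutions ev D H)%E.
  by apply: eq_set_integral => A mA; rewrite product_natural_push.
have mn := measurable_nbm oD.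
rewrite [LHS]integral_mkcond -/(nbm D).
rewrite ge0_integral_mscale//.
congr (_ * _)%E; rewrite [LHS]ge0_integral_pushforward//; last exact: measurable_hyps.
have mh := measurableT_comp mn (@measurable_hyps R n V).
by rewrite -[RHS](@fubini_tonelli1 _ _ _ _ R (sphp hN) (@leb R n) _ mh)//; move=> p; exact: nbm_ge0.
Qed.

Lemma hyperplane_nonempty (W : vectType R) (f : W) t : f != 0 -> hyperplane f t !=set0.
Proof.
move=> f0; have D0 := l1_gt0 f0.
have e0 : 0 < (`|t| + 1) / l1 f by rewrite divr_gt0// ltr_wpDl.
have h : `|(0 : dual W) f - t| < (`|t| + 1) / l1 f * l1 f by rewrite zero_lfunE sub0r normrN divfK ?gt_eqF//; lra.
by have [z zt _] := (@hitb_hyperplane R W 0 _ f t f0 e0).2 h; exists z.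
Qed.

(** The area formula for the map u |-> (f_i(u)). From above, isolated solutions are among all
    solutions. From below, critical points are removed: the integral of |det| does not change, and
    the remaining solutions are isolated by [locally_injective]. *)
Lemma inner_integral c D f : open D -> D `<=` cdom c ->
  (\int[@leb R n]_t nbm D (hyps (f, t)) = \int[@leb R n]_(u in cimg c D) (`|\det (sysmx c f u)|)%:E)%E.
Proof.
move=> oD Dc; have oc : open (cmap c @` cdom c) by exact: cmap_open.
have oW := @open_cimg c D oD; have Wc : cimg c D `<=` cmap c @` cdom c by move=> u [].
(* If some f_i is 0, the matrix has a zero row, and the i-th component of [hyps] is empty, which no
   hyperplane is: both sides vanish. *)
have [[i fi0]|fn0] := pselect (exists i, (f : forall i, V i) i = 0).
  rewrite integral0_eq; last first.
    move=> t _; rewrite /nbm patchE memNset// => /(_ i) [g [a [g0]]].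
    rewrite /hyps /= fi0 /hyp /= eqxx => E.
    have [y] := hyperplane_nonempty a g0; by rewrite -E.
  rewrite integral0_eq// => u Wu; rewrite (_ : \det _ = 0) ?normr0//.
  rewrite (expand_det_row _ i) big1// => j _; rewrite [X in X * _]mxE fi0 linear0 mul0mx mxE mul0r//.
have f0 i : (f : forall i, V i) i != 0 by apply/eqP => fi; apply: fn0; exists i.
have AH t : @AGs R n V (hyps (f, t)).
  by move=> i; exists ((f : forall i, V i) i), ((t : 'rV[R]_n) 0 i); split=> //; rewrite /hyps /hyp /= (negPf (f0 i)).
have solE t x : sol ev (hyps (f, t)) x <-> forall i, ev i ((f : forall i, V i) i) x = (t : 'rV[R]_n) 0 i.
  by split=> h i; have := h i; rewrite /hyps /hyp /= (negPf (f0 i)) /hyperplane /= thetaE.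
have FE t u : (cmap c @` cdom c) u -> Ff c f u = t <-> sol ev (hyps (f, t)) (cinv c u).
  move=> cu; split=> [<-|/solE h]; first by apply/solE => i; rewrite mxE.
  by apply/rowP => i; rewrite mxE; exact: h.
have mn : measurable_fun setT (fun t : borelR n => nbm D (hyps (f, t))).
  have mh := measurableT_comp (measurable_nbm oD) (@measurable_hyps R n V).
  by have H := measurableT_comp mh (@measurable_pair1 _ _ (frames V) (borelR n) f); exact: H.
have nE t : nbm D (hyps (f, t)) = counting (D `&` isolated (sol ev (hyps (f, t)))).
  by rewrite /nbm patchE mem_set.
have jE : (\int[@leb R n]_(u in cimg c D) (`|\det (sysmx c f u)|)%:E = \int[@leb R n]_(u in cimg c D) (`|\det (jac (Ff c f) u)|)%:E)%E.
  by apply: eq_integral => u /set_mem/Wc cu; rewrite Ff_jac.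
(* The noncritical points of the system. *)
pose W' := cimg c D `&` [set u | \det (jac (Ff c f) u) != 0].
have W'c : W' `<=` cmap c @` cdom c by move=> u [/Wc].
have oW' : open W'.
  apply: (@continuous_on_measurable _ _ _ _ (fun u => \det (jac (Ff c f) u) : R) [set x : R | x != 0]); [exact: oW| |exact: open_neq].
  move=> u /Wc cu; apply: continuous_det => i j; exact: (continuous_jac cu (@FfC c f)).
rewrite jE; apply/eqP; rewrite eq_le; apply/andP; split.
  rewrite -(area_formula oc (@FfC c f) oW Wc); apply: ge0_le_integral => //.
  - exact: (measurable_counting_fiber oc (@FfC c f) oW Wc).
  move=> t _; rewrite nE.
  apply: (@le_trans _ _ (counting (D `&` sol ev (hyps (f, t))))).
    by apply: le_counting => x [Dx [/set_mem Hx _]].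
  rewrite (@counting_image R _ _ _ (cimg c D `&` Ff c f @^-1` [set t]) (cmap c) (cinv c))//.
    move=> x [Dx Hx]; rewrite cmapK; last exact: Dc.
    have cx : (cmap c @` cdom c) (cmap c x) by exists x => //; exact: Dc.
    split=> //; split; first by split=> //; rewrite /preimage /= cmapK//; exact: Dc.
    by apply/FE => //; rewrite cmapK//; exact: Dc.
  move=> u [[cu Du] ut]; have [x cx xu] := cu.
  by rewrite -xu cmapK// ; split=> //; split; [move: Du; rewrite /preimage /= -xu cmapK|move: ut => /(FE t u cu); rewrite -xu cmapK].
apply: (@le_trans _ _ (\int[@leb R n]_(u in W') (`|\det (jac (Ff c f) u)|)%:E)%E).
  rewrite [leLHS]integral_mkcond [leRHS]integral_mkcond; apply: ge0_le_integral => //.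
  - by move=> u _; rewrite patchE; case: ifP => // _; rewrite lee_fin.
  - apply: (measurable_restrictT _ (borel_open oW)).1; exact: (measurable_abs_jac (@FfC c f) oW Wc).
  - apply: (measurable_restrictT _ (borel_open oW')).1; exact: (measurable_abs_jac (@FfC c f) oW' W'c).
  move=> u _; rewrite !patchE; case: ifPn => [/set_mem Wu|_]; last by case: ifP => // _; rewrite lee_fin.
  have [d0|d0] := eqVneq (\det (jac (Ff c f) u)) 0; first by rewrite d0 normr0; case: ifP.
  by rewrite mem_set.
rewrite -(area_formula oc (@FfC c f) oW' W'c); apply: ge0_le_integral => //.
- by move=> t _; exact: counting_ge0.
- exact: (measurable_counting_fiber oc (@FfC c f) oW' W'c).
move=> t _; rewrite nE.
rewrite -(@counting_image R _ _ (cinv c @` (W' `&` Ff c f @^-1` [set t])) _ (cmap c) (cinv c)).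
- apply: le_counting => _ [u [[[cu Du] /= du] ut] <-]; split=> //.
  have Hu : sol ev (hyps (f, t)) (cinv c u) by apply/FE.
  split; first exact/mem_set.
  have [d d0 inj] := locally_injective oc (@FfC c f) cu du.
  have [x cx xu] := cu; have ux : cinv c u = x by rewrite -xu cmapK.
  exists (cdom c `&` cmap c @^-1` ball u d).
    rewrite ux; apply: filterI; first by apply: open_nbhs_nbhs; split=> //; exact: cdom_open.
    by apply: (cmap_continuous cx); rewrite xu; apply: nbhsx_ballx.
  apply/seteqP; split=> [y [[cy yb] Hy]|_ ->]; last first.
    by split=> //; split; [rewrite ux|rewrite /preimage /= ux xu; exact: ballxx].
  have e : cmap c y = u.
    apply: inj => //; first exact: ballxx.
    rewrite ut; apply/FE; first by exists y.
    by rewrite cmapK.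
  by rewrite -e cmapK.
- move=> _ [u [[[cu Du] du] ut] <-]; have [x cx xu] := cu.
  have e : cmap c (cinv c u) = u by rewrite -xu cmapK.
  by rewrite e.
- move=> u [[[cu Du] du] ut]; have [x cx xu] := cu.
  by split; [exists u|rewrite -xu cmapK].
Qed.

Lemma measurable_sysmx_det c (O : set 'rV[R]_n) : open O -> O `<=` cmap c @` cdom c ->
  measurable_fun setT (fun p : frames V * borelR n => (`|\det (sysmx c p.1 p.2)|%:E * (\1_O (p.2 : 'rV[R]_n))%:E)%E).
Proof.
move=> oO Oc; have mO : measurable (O : set (borelR n)) by exact: borel_open.
pose J i b j (u : borelR n) : measurableTypeR R := ((fun u => Dmx i c u b j : measurableTypeR R) \_ O) u.
have mJ i b j : measurable_fun setT (J i b j).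
  apply: (measurable_restrictT _ mO).1; apply: (@measurable_fun_cont R n O (fun u => Dmx i c u b j)) => // u Ou.
  have [_ cu] := @evc_C1 i (uncrd (delta_mx 0 b)) c u (Oc _ Ou) j.
  by apply: (@eq_continuous_at _ _ (fun u => 'D_(delta_mx 0 j) (@evc i (uncrd (delta_mx 0 b)) c) u)) => // y; rewrite mxE.
pose P (p : frames V * borelR n) : 'M[R]_n := \matrix_(i, j) \sum_b (crd ((p.1 : forall i, V i) i) 0 b * J i b j p.2).
have mP : measurable_fun setT (fun p => \det (P p) : measurableTypeR R).
  apply: measurable_det => i j.
  rewrite [X in measurable_fun _ X](_ : _ = fun p : frames V * borelR n => \sum_b (crd ((p.1 : forall i, V i) i) 0 b * J i b j p.2)); last first.
    by apply/funext => p; rewrite mxE.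
  apply: measurable_sum => b; apply: measurable_funM.
    have H1 := measurableT_comp (@measurable_coord _ _ (fun i => @borelV R (V i)) i) (@measurable_fst _ _ (frames V) (borelR n)).
    have H2 := measurableT_comp (@measurable_crd R (V i)) (H1 R).
    have H3 := measurableT_comp (@measurable_coordR R (vdim (V i)) b) H2; exact: H3.
  have H := measurableT_comp (mJ i b j) (@measurable_snd _ _ (frames V) (borelR n)); exact: H.
have mI : measurable_fun setT (fun p : frames V * borelR n => (\1_O (p.2 : 'rV[R]_n))%:E : \bar R).
  apply/measurable_EFinP.
  rewrite [X in measurable_fun _ X](_ : _ = \1_(snd @^-1` O : set (frames V * borelR n)))//.
  apply: measurable_indic; rewrite -[X in measurable X]setTI.
  exact: (@measurable_snd _ _ (frames V) (borelR n)).
have mPE : measurable_fun setT (fun p : frames V * borelR n => (`|\det (P p)|)%:E : \bar R).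
  by apply/measurable_EFinP; apply: (measurableT_comp (@normr_measurable R setT) mP).
have H := emeasurable_funM mPE mI; apply: eq_measurable_fun H => p _ /=.
rewrite indicE; case: (boolP (_ \in _)) => [/set_mem Op|_]; last by rewrite !mule0.
congr (_%:E * _)%E; congr `|\det _|; apply/matrixP => i j; rewrite !mxE.
by apply: eq_bigr => b _; rewrite /J patchE mem_set.
Qed.

Lemma delta_ge0 c u : (0 <= delta c u)%E.
Proof. by apply: integral_ge0 => f _; rewrite lee_fin. Qed.

Lemma measurable_delta c (O : set 'rV[R]_n) : open O -> O `<=` cmap c @` cdom c ->
  measurable_fun (O : set (borelR n)) (delta c).
Proof.
move=> oO Oc; have mO : measurable (O : set (borelR n)) by exact: borel_open.
have m1 := measurable_sysmx_det oO Oc.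
have m2 := @measurable_fun_fubini_tonelli_G _ _ _ _ R (sphp hN) _ m1.
have := measurable_funS measurableT (@subsetT _ (O : set (borelR n))) (m2 _).
move=> /(_ _)/wrap[]; first by move=> p; rewrite mule_ge0// lee_fin.
apply: eq_measurable_fun => u /set_mem Ou; rewrite /fubini_G; apply: eq_integral => f _ /=.
by rewrite indicE mem_set// mule1.
Qed.

Lemma average_chart c D : open D -> D `<=` cdom c ->
  average_solutions ev N D = ((2 ^- n)%:E * \int[@leb R n]_(u in cimg c D) delta c u)%E.
Proof.
move=> oD Dc; rewrite average_push//; congr (_ * _)%E.
have oW := @open_cimg c D oD; have Wc : cimg c D `<=` cmap c @` cdom c by move=> u [].
pose h (p : frames V * borelR n) := (`|\det (sysmx c p.1 p.2)|%:E * (\1_(cimg c D) (p.2 : 'rV[R]_n))%:E)%E.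
have h0 p : (0 <= h p)%E by rewrite mule_ge0// lee_fin.
have mh : measurable_fun setT h by exact: measurable_sysmx_det.
transitivity (\int[sphp hN]_f \int[@leb R n]_u h (f, u))%E.
  apply: eq_integral => f _; rewrite (@inner_integral c D f oD Dc) [LHS]integral_mkcond; apply: eq_integral => u _.
  by rewrite patchE /h indicE; case: (_ \in _); rewrite ?mule1 ?mule0.
transitivity (\int[@leb R n]_u \int[sphp hN]_f h (f, u))%E.
  exact: (@fubini_tonelli _ _ _ _ R (sphp hN) (@leb R n) h mh h0).
rewrite [RHS]integral_mkcond; apply: eq_integral => u _.
rewrite patchE /h /= indicE; case: (_ \in _).
  by apply: eq_integral => f _; rewrite mule1.
by rewrite integral0_eq// => f _; rewrite mule0.
Qed.

End ChartFormula.

(** * Zonoid symmetrization *)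

Section Finite.
Context {R : realType}.

Lemma integral_fin d (T : measurableType d) (mu : {measure set T -> \bar R}) (I : finType) (g : T -> I) (F : I -> R) :
  (forall i, measurable (g @^-1` [set i])) -> (forall i, 0 <= F i) ->
  (\int[mu]_x (F (g x))%:E = \sum_i (F i)%:E * mu (g @^-1` [set i]))%E.
Proof.
move=> mg F0.
transitivity (\int[mu]_x (\sum_i ((F i)%:E * (\1_(g @^-1` [set i]) x)%:E)))%E.
  apply: eq_integral => x _; rewrite (bigD1 (g x))//= big1 => [|i ix]; last first.
    by rewrite indicE memNset ?mule0// => /= /esym/eqP; apply/negP.
  by rewrite indicE mem_set// mule1 adde0.
rewrite ge0_integral_sum//.
- apply: eq_bigr => i _; rewrite ge0_integralZl_EFin//.
    by rewrite integral_indic// setIT.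
  by apply/measurable_EFinP; apply: measurable_indic.
- move=> i; apply/measurable_EFinP; apply: measurable_funM; first exact: measurable_cst.
  by apply: measurable_indic.
- by move=> i x _; rewrite mule_ge0// lee_fin.
Qed.

Lemma continuousM_at (T : topologicalType) (f g : T -> R) x :
  {for x, continuous f} -> {for x, continuous g} -> {for x, continuous (fun y => f y * g y)}.
Proof. by move=> cf cg; apply: (@continuousZ_at R T R^o f g x cf cg). Qed.

Lemma lee_exp_limit (n : nat) (a b : \bar R) : (0 <= b)%E ->
  (forall q : R, 1 < q -> (a <= (q ^+ n)%:E * b)%E) -> (a <= b)%E.
Proof.
case: b => [r|_|//]; last by move=> h; rewrite leey.
rewrite lee_fin => r0 h; apply/lee_addgt0Pr => e e0.
have c : {for (1 : R), continuous (fun q : R => q ^+ n * r)}.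
  by apply: (@continuousM_at _ (fun q : R => q ^+ n) (cst r)); [exact: exprn_continuous|exact: cst_continuous].
have /cvgrPdist_lt/(_ e e0)/nbhs_ballP[d /= d0 hd] := c.
have q1 : 1 < 1 + d / 2 by rewrite ltrDl divr_gt0.
apply: (le_trans (h _ q1)); rewrite -EFinM -EFinD lee_fin.
have : ball (1 : R) d (1 + d / 2).
  by rewrite /ball /= opprD addrA subrr sub0r normrN gtr0_norm ?divr_gt0// ltr_pdivrMr// ltr_pMr// ltr1n.
by move=> /hd /=; rewrite expr1n mul1r distrC => /ltr_normlW; lra.
Qed.

Definition dot n (u v : 'rV[R]_n) : R := \sum_i u 0 i * v 0 i.

(* [p] is [q] minus the point of [K] nearest to [q]. *)
Lemma convex_separation n (K : set 'rV[R]_n) (q : 'rV[R]_n) : compact K -> cvx K -> K !=set0 -> ~ K q ->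
  exists p, forall z, K z -> dot p z < dot p q.
Proof.
move=> cK vK K0 Kq; pose D (z : 'rV[R]_n) := dot (q - z) (q - z).
have cD : continuous D.
  move=> z; apply: continuous_bigsum => i.
  have c : {for z, continuous (fun z : 'rV[R]_n => (q - z) 0 i)}.
    apply: (@eq_continuous_at _ _ (fun z : 'rV[R]_n => q 0 i - z 0 i)); first by move=> y; rewrite !mxE.
    by apply: continuousB_at; [exact: cst_continuous|apply: continuous_coord].
  exact: continuousM_at.
have [|z0 /set_mem Kz0 zmin] := @compact_EVT_min _ R D K K0 cK.
  by apply: continuous_in_subspaceT => x _; exact: cD.
pose p : 'rV[R]_n := q - z0; exists p => z Kz.
have dotDl (a b c : 'rV[R]_n) : dot (a + b) c = dot a c + dot b c.
  by rewrite /dot -big_split; apply: eq_bigr => i _; rewrite mxE mulrDl.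
have dotC (a b : 'rV[R]_n) : dot a b = dot b a by apply: eq_bigr => i _; rewrite mulrC.
have dotZl t (a c : 'rV[R]_n) : dot (t *: a) c = t * dot a c.
  by rewrite /dot mulr_sumr; apply: eq_bigr => i _; rewrite mxE mulrA.
have dot_ge0 (a : 'rV[R]_n) : 0 <= dot a a by apply: sumr_ge0 => i _; rewrite -expr2 sqr_ge0.
have pp : 0 < dot p p.
  rewrite lt_neqAle dot_ge0 andbT; apply/eqP => /esym/eqP; rewrite psumr_eq0; last by move=> i _; rewrite -expr2 sqr_ge0.
  move=> /allP h; apply: Kq; suff -> : q = z0 by [].
  apply/rowP => i; have := h i; rewrite mem_index_enum => /(_ isT) /=; rewrite -expr2 sqrf_eq0 !mxE subr_eq0.
  by move/eqP.
pose d : 'rV[R]_n := z - z0.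
have le t : 0 < t -> t <= 1 -> 2 * dot p d <= t * dot d d.
  move=> t0 t1; have Kt : K ((1 - t) *: z0 + t *: z) by apply: vK => //; rewrite ltW.
  have := zmin _ (mem_set Kt); rewrite /D -/p.
  rewrite (_ : q - _ = p + (- t) *: d); last by apply/rowP => i; rewrite !mxE; ring.
  have dotDr (a b e : 'rV[R]_n) : dot e (a + b) = dot e a + dot e b by rewrite !(dotC e) dotDl.
  have dotZr k (a e : 'rV[R]_n) : dot e (k *: a) = k * dot e a by rewrite !(dotC e) dotZl.
  have Q (a b : 'rV[R]_n) k : dot (a + k *: b) (a + k *: b) = dot a a + k * dot a b * 2 + k * (k * dot b b).
    by rewrite !dotDl !dotDr !dotZl !dotZr (dotC b a); ring.
  rewrite Q => h.
  rewrite -(ler_pM2l t0); move: h; set a := dot p p; set b := dot p d; set c := dot d d => h.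
  by nra.
have pd : dot p d <= 0.
  rewrite leNgt; apply/negP => b0.
  have c0 := dot_ge0 d.
  (* For this [t] the term t |d|^2 is less than 2 <p, d>, against the minimality of the distance at
     [z0]. *)
  have t0 : 0 < Num.min 1 (dot p d / (dot d d + 1)) by rewrite lt_min ltr01 divr_gt0//= ltr_wpDl.
  have t1 : Num.min 1 (dot p d / (dot d d + 1)) <= 1 by rewrite ge_min lexx.
  have := le _ t0 t1; apply/negP; rewrite -ltNge.
  apply: (@le_lt_trans _ _ (dot p d / (dot d d + 1) * dot d d)); first by rewrite ler_wpM2r// ge_min lexx orbT.
  by rewrite mulrAC ltr_pdivrMr ?ltr_wpDl//; nra.
have zE : z = z0 + d by rewrite /d addrC subrK.
have qE : q = z0 + p by rewrite /p addrC subrK.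
have dotDr (a b e : 'rV[R]_n) : dot e (a + b) = dot e a + dot e b by rewrite !(dotC e) dotDl.
have e1 : dot p z = dot p z0 + dot p d by rewrite [in LHS]zE; exact: dotDr.
have e2 : dot p q = dot p z0 + dot p p by rewrite [in LHS]qE; exact: dotDr.
by rewrite e1 e2 ltrD2l; exact: le_lt_trans pd pp.
Qed.

Section ZonI.
Context {n : nat} {I : finType}.

Definition zonI (X : I -> 'rV[R]_n) : set (borelR n) := zon (\matrix_(a < #|I|) X (enum_val a)).

Lemma zonIP (X : I -> 'rV[R]_n) u : zonI X u <-> exists t : I -> R, (forall i, `|t i| <= 1) /\ u = \sum_i t i *: X i.
Proof.
have sumE (s : 'rV[R]_#|I|) : s *m \matrix_(a < #|I|) X (enum_val a) = \sum_i s 0 (enum_rank i) *: X i.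
  rewrite mulmx_sum_row (reindex enum_rank)/=; last first.
    by apply: onW_bij; apply: enum_rank_bij.
  by apply: eq_bigr => i _; rewrite rowK enum_rankK.
split=> [[s hs <-]|[t [t1 ->]]].
  by exists (fun i => s 0 (enum_rank i)); split; [move=> i; have := hs (enum_rank i); rewrite !mxE ler_norml|].
exists (\row_a t (enum_val a)); first by move=> a; rewrite !mxE -ler_norml.
by rewrite sumE; apply: eq_bigr => i _; rewrite mxE enum_rankK.
Qed.

Lemma leb_zonI (X : I -> 'rV[R]_n) :
  leb (zonI X) = (2 ^+ n / n`!%:R * \sum_(f : {ffun 'I_n -> I}) `|\det (\matrix_r X (f r))|)%:E.
Proof.
rewrite leb_zon /maxdets; congr (_ * _)%:E.
rewrite (reindex (fun f : {ffun 'I_n -> I} => [ffun r => enum_rank (f r)]))/=; last first.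
  apply: onW_bij; exists (fun f : {ffun 'I_n -> 'I_#|I|} => [ffun r => enum_val (f r) : I]) => f; apply/ffunP => r; rewrite !ffunE.
    by rewrite enum_rankK.
  by rewrite enum_valK.
apply: eq_bigr => f _; congr `|\det _|; apply/matrixP => r j.
by rewrite !mxE ffunE enum_rankK.
Qed.

Lemma zonIZ (X : I -> 'rV[R]_n) c u : zonI X u -> zonI (fun i => c *: X i) (c *: u).
Proof.
move=> /zonIP[t [t1 ->]]; apply/zonIP; exists t; split=> //.
by rewrite scaler_sumr; apply: eq_bigr => i _; rewrite scalerA mulrC -scalerA.
Qed.

Lemma leb_zonIZ (X : I -> 'rV[R]_n) c : 0 <= c -> leb (zonI (fun i => c *: X i)) = ((c ^+ n)%:E * leb (zonI X))%E.
Proof.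
move=> c0; rewrite !leb_zonI -EFinM; congr EFin; rewrite mulrCA; congr (_ * _).
rewrite mulr_sumr; apply: eq_bigr => f _.
rewrite (_ : (\matrix_r (c *: X (f r))) = c *: \matrix_r X (f r)); last by apply/matrixP => r j; rewrite !mxE.
by rewrite detZ normrM ger0_norm// exprn_ge0.
Qed.

Section Graph.
Variables (X : I -> 'rV[R]_n -> 'rV[R]_n) (Om : set 'rV[R]_n).
Hypotheses (oO : open Om) (cX : forall i u, Om u -> {for u, continuous (X i)}).

Definition zgraph (D : set 'rV[R]_n) : set (borelR (n + n)) :=
  [set w | D (lsubmx w) /\ zonI (X ^~ (lsubmx w)) (rsubmx w)].

Let zgraph_compact (C : set 'rV[R]_n) : compact C -> C `<=` Om -> measurable (zgraph C).
Proof.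
move=> cC CO.
pose F (p : 'rV[R]_n * 'rV[R]_#|I|) : 'rV[R]_(n + n) :=
  row_mx p.1 (p.2 *m \matrix_(a < #|I|) X (enum_val a) p.1).
have -> : zgraph C = F @` (C `*` cbox (const_mx (-1)) (const_mx 1)).
  apply/seteqP; split=> [w [Cw [s hs sw]]|_ [[u s] [Cu hs] <-]].
    by exists (lsubmx w, s); [split|rewrite /F/= sw hsubmxK].
  by rewrite /zgraph /F/= row_mxKl row_mxKr; split=> //; exists s.
apply: compact_borel; apply: compact_image; last first.
  by apply: compact_setX => //; exact: compact_cbox.
move=> [u s] [/= Cu _]; apply: continuous_row => j; rewrite /F.
have jE (p : 'rV[R]_n * 'rV[R]_#|I|) : match fintype.split j with inl j => p.1 0 j
   | inr j => \sum_a p.2 0 a * X (enum_val a) p.1 0 j end = row_mx p.1 (p.2 *m \matrix_a X (enum_val a) p.1) 0 j.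
  rewrite mxE; case: fintype.split => // k; rewrite mxE; apply: eq_bigr => a _; by rewrite mxE.
apply: (eq_continuous_at jE).
case: fintype.split => k; first by apply: continuous_coord; exact: continuous_fst_at.
apply: continuous_bigsum => a.
have c1 : {for (u, s), continuous (fun p : 'rV[R]_n * 'rV[R]_#|I| => p.2 0 a)}.
  by apply: continuous_coord; exact: continuous_snd_at.
have c2 : {for (u, s), continuous (fun p : 'rV[R]_n * 'rV[R]_#|I| => X (enum_val a) p.1 0 k)}.
  apply: continuous_coord; apply: continuous_comp; first exact: continuous_fst_at.
  by apply: cX; exact: CO.
exact: (continuousM_at c1 c2).
Qed.

Lemma measurable_lsubmx : measurable_fun setT (fun w : borelR (n + n) => (lsubmx w : 'rV[R]_n) : borelR n).
Proof.
apply: measurable_fun_borel => i.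
rewrite [X in measurable_fun _ X](_ : _ = fun u : borelR (n + n) => u 0 (lshift n i)); first exact: measurable_coordR.
by apply/funext => u; rewrite mxE.
Qed.

(** Over a compact set the graph is a continuous image of a compact set. The open set [Om] is a
    countable union of compact boxes, and restricting to [D] is a measurable condition. *)
Lemma measurable_zgraph (D : set (borelR n)) : measurable D -> D `<=` Om -> measurable (zgraph D).
Proof.
move=> mD DO; have [F [OF Fbox _]] := open_cbox_cover oO.
have -> : zgraph D = (\bigcup_k zgraph (F k)) `&` (fun w : borelR (n + n) => (lsubmx w : 'rV[R]_n) : borelR n) @^-1` D.
  apply/seteqP; split=> [w [Dw zw]|w [[k _ [_ zw]] Dw]]; last by split.
  have : Om (lsubmx w) by exact: DO.
  by rewrite OF => -[k _ Fk]; split=> //; exists k.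
apply: measurableI; last by rewrite -[X in measurable X]setTI; exact: measurable_lsubmx.
apply: bigcup_measurable => k _; apply: zgraph_compact; last by rewrite OF => u Fu; exists k.
by have [->|[a [b ->]]] := Fbox k; [exact: compact0|exact: compact_cbox].
Qed.

Lemma leb_zgraph (D : set (borelR n)) : measurable D -> D `<=` Om ->
  leb (zgraph D) = (\int[@leb R n]_(u in D) leb (zonI (X ^~ u)))%E.
Proof.
move=> mD DO; rewrite leb_row_mx; last exact: measurable_zgraph.
rewrite /product_measure1 integral_mkcond [RHS]integral_mkcond; apply: eq_integral => u _.
rewrite !patchE mem_setT; case: ifPn => [/set_mem Du|/negP Du].
  congr (leb _); apply/seteqP; split=> [p /xsectionP|p zp].
    by rewrite /zgraph /= row_mxKl row_mxKr => -[].
  by apply/xsectionP; rewrite /zgraph/= row_mxKl row_mxKr.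
rewrite /= (_ : xsection _ _ = set0) ?measure0//; apply/seteqP; split=> // p /xsectionP.
by rewrite /zgraph/= row_mxKl row_mxKr => -[Du']; exfalso; apply: Du; exact/mem_set.
Qed.

End Graph.
End ZonI.
End Finite.

(** * Symmetrized balls and zonotopes *)

Section Symmetrization.
Context {R : realType} {V : vectType R} (N : V -> R).
Hypotheses (hN : is_norm N) (B_smooth : smooth_convex_body (unit_ball N)).
Local Notation m := (vdim V).
Local Notation S := (unit_sphere N).
Local Notation SM := (smeas hN).

Let ysum (y : dual V) : R := \sum_b `|y (uncrd (delta_mx 0 b))|.

Let ysum_bound (y : dual V) (v : V) : `|y v| <= ysum y * `|crd v|.
Proof.
rewrite dual_crdE; apply: le_trans (ler_norm_sum _ _ _) _; rewrite /ysum mulr_suml; apply: ler_sum => b _.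
by rewrite normrM mulrC ler_wpM2l//; exact: le_coord_norm.
Qed.

Let ysum_ge0 y : 0 <= ysum y. Proof. by apply: sumr_ge0. Qed.

Let SM_fin : (SM setT < +oo)%E.
Proof. by rewrite /smeas/= /mrestr setTI ltey_eq fin_num_measure//; exact: sphere_measurable. Qed.

Let SM_finA A : measurable A -> SM A \is a fin_num.
Proof.
move=> mA; rewrite ge0_fin_numE//; apply: le_lt_trans SM_fin; apply: le_measure => //; exact: mem_set.
Qed.

Let tot : R := fine (SM setT).
Let totE : SM setT = tot%:E.
Proof. by rewrite fineK// SM_finA. Qed.

Lemma sphere_compact : compact (@crd R V @` S).
Proof.
have [C C0 HC] := sphere_bounded hN; rewrite crd_image.
apply: (@subclosed_compact _ _ (cbox (const_mx (- C)) (const_mx C) : set 'rV[R]_m)); last 2 first.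
- exact: compact_cbox.
- by move=> u Su i; rewrite !mxE -ler_norml; apply: le_trans (le_coord_norm _ _ _) _; rewrite -[u]uncrdK; exact: HC.
rewrite (_ : _ @^-1` _ = (fun u : 'rV[R]_m => N (uncrd u)) @^-1` [set 1])//.
apply: closed_comp; last exact: closed_eq.
by move=> u _; exact: (rnorm_continuous (norm_crd hN)).
Qed.

Let near_pt (s : seq V) e v := find (fun x => `|crd v - crd x| < e) s.

Let measurable_near_pt s e j : measurable ([set v | near_pt s e v = j] : set (@borelV R V)).
Proof.
have mb (x : V) : measurable ([set v : V | `|crd v - crd x| < e] : set (@borelV R V)).
  have o : open [set u : 'rV[R]_m | `|u - crd x| < e].
    rewrite (_ : [set u | _] = ball (crd x) e); first exact: ball_open.
    by apply/seteqP; split=> u; rewrite -ball_normE /= distrC.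
  by have := @measurable_crd R V measurableT _ (borel_open o); rewrite setTI.
rewrite /near_pt; elim: s j => [|x s IHs] j /=.
  case: j => [|j]; first by rewrite (_ : [set v | _] = setT)//; apply/seteqP; split.
  by rewrite (_ : [set v | _] = set0)//; apply/seteqP; split.
case: j => [|j].
  rewrite (_ : [set v | _] = [set v : V | `|crd v - crd x| < e])//.
  by apply/seteqP; split=> v /=; case: ifP.
rewrite (_ : [set v | _] = ~` [set v : V | `|crd v - crd x| < e] `&` [set v | find (fun x => `|crd v - crd x| < e) s = j]).
  by apply: measurableI; [apply: measurableC; exact: mb|exact: IHs].
apply/seteqP; split=> v /=; first by case: ifP => // h [e1]; split.
by case: ifP => [_ [nh _]|_ [_ ->]//]; case: nh.
Qed.

(** A finite net of the compact sphere; each vector goes to the first point of the net that is near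
    it. The number of cells can be any large [p], so that several spaces can share it. *)
Lemma sphere_cells e : 0 < e -> exists p0, forall p, (p0 <= p)%N ->
  exists (phi : V -> 'I_p.+1) (x : 'I_p.+1 -> V),
  [/\ forall j, measurable (phi @^-1` [set j] : set (@borelV R V)),
      forall v, S v -> `|crd v - crd (x (phi v))| < e &
      forall j, S (x j) \/ x j = 0].
Proof.
move=> e0; have cS := sphere_compact; rewrite compact_cover in cS.
have [|u [x Sx <-]|s sS sc] := cS _ (@crd R V @` S) (fun u => ball u e).
- by move=> u _; exact: ball_open.
- by exists (crd x); [exists x|exact: ballxx].
pose ws : seq 'rV[R]_m := finmap.enum_fset s.
pose l := map (@uncrd R V) ws.
have lS x : x \in l -> S x.
  by move=> /mapP[u us ->]; have /set_mem[v Sv <-] := sS u us; rewrite crdK.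
exists (size l) => p lp; exists (fun v => inord (near_pt l e v)), (fun j => nth 0 l j).
have le v : (near_pt l e v <= p)%N by apply: leq_trans lp; exact: find_size.
split=> [j|v Sv|j].
- rewrite (_ : _ @^-1` _ = [set v | near_pt l e v = val j]); first exact: measurable_near_pt.
  apply/seteqP; split=> v /=; first by move=> <-; rewrite inordK ?ltnS.
  by move=> h; apply/val_inj; rewrite /= inordK ?ltnS.
- rewrite inordK ?ltnS//.
  have h : has (fun x => `|crd v - crd x| < e) l.
    have [|u /=] := sc (crd v); first by exists v.
    move=> us; rewrite -ball_normE /= distrC => ub.
    by apply/hasP; exists (uncrd u); [exact: map_f|rewrite uncrdK].
  exact: (nth_find 0 h).
- have [jl|jl] := ltnP j (size l); first by left; apply: lS; exact: mem_nth.
  (* Indices beyond the net receive the vector 0, which generates nothing. *)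
  by right; rewrite nth_default.
Qed.

Definition hs (y : dual V) : R := fine (h_symm N y).

Let mabs (y : dual V) : measurable_fun setT ((fun v => (`|y v|)%:E) : @borelV R V -> \bar R).
Proof.
apply/measurable_EFinP; exact: (measurableT_comp (@normr_measurable R setT) (dual_measurable y)).
Qed.

Let J (y : dual V) : \bar R := (\int[SM]_x (`|y (x : V)|)%:E)%E.

Let JS y : J y = (\int[sphm hN]_(x in S) (`|y x|)%:E)%E.
Proof. by rewrite /J /smeas integral_mrestr//; exact: mabs. Qed.

Let integral_SM_le (f g : V -> R) (mf : measurable_fun setT ((fun v => (f v)%:E) : @borelV R V -> \bar R))
  (mg : measurable_fun setT ((fun v => (g v)%:E) : @borelV R V -> \bar R)) c :
  0 <= c -> (forall v, 0 <= f v) -> (forall v, 0 <= g v) -> (forall v, S v -> f v <= g v + c) ->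
  (\int[SM]_x (f x)%:E <= \int[SM]_x (g x)%:E + (c * tot)%:E)%E.
Proof.
move=> c0 f0 g0 fg.
have -> : (\int[SM]_x (g x)%:E + (c * tot)%:E = \int[SM]_x ((g x)%:E + c%:E))%E.
  rewrite ge0_integralD//.
  - by rewrite integral_cst// EFinM -totE.
  - by move=> x _; rewrite lee_fin.
have e1 := @integral_mrestr _ (@borelV R V) R (sphm hN) S (sphere_measurable hN) (fun x => (f x)%:E) _ mf.
have e2 := @integral_mrestr _ (@borelV R V) R (sphm hN) S (sphere_measurable hN) (fun x => (g x)%:E + c%:E)%E _ (emeasurable_funD mg (measurable_cst c%:E)).
rewrite /smeas e1 => [|x]; last by rewrite lee_fin.
rewrite e2 => [|x]; last by rewrite lee_fin addr_ge0.
apply: ge0_le_integral.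
- exact: sphere_measurable.
- by move=> x _; rewrite lee_fin.
- exact: measurable_funS mf.
- by apply: emeasurable_funD => //; exact: measurable_funS mg.
- by move=> x Sx; rewrite lee_fin; exact: fg.
Qed.

Let J_fin y : J y \is a fin_num.
Proof.
have [C C0 HC] := sphere_bounded hN.
rewrite ge0_fin_numE; last by apply: integral_ge0 => x _; rewrite lee_fin.
apply: le_lt_trans (@integral_SM_le (fun v => `|y v|) (cst 0) (mabs y) _ (ysum y * C) _ _ _ _) _ => //.
- by apply/measurable_EFinP; exact: measurable_cst.
- by rewrite mulr_ge0// ltW.
- by move=> v Sv; rewrite add0r; apply: le_trans (ysum_bound _ _) _; rewrite ler_wpM2l// HC.
- by rewrite integral0 add0e ltry.
Qed.

Lemma h_symmE y : h_symm N y = (hs y)%:E.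
Proof.
rewrite /hs fineK// [h_symm N y](_ : _ = (2^-1)%:E * J y)%E; first by rewrite fin_numM// J_fin.
by rewrite JS.
Qed.

Let hsJ y : (hs y)%:E = ((2^-1)%:E * J y)%E.
Proof. by rewrite -h_symmE JS. Qed.

Let hsE y : hs y = 2^-1 * fine (J y).
Proof. by apply: EFin_inj; rewrite hsJ EFinM fineK ?J_fin. Qed.

Let yp (p : 'rV[R]_m) : dual V := linfun (dualc p^T).

Let ypE p v : yp p v = dot p (crd v).
Proof. by rewrite lfunE /= /dualc mxE; apply: eq_bigr => i _; rewrite [p^T i 0]mxE mulrC. Qed.

(* The support function of [B_symm] is a norm, hence bounded below by a multiple
   of any other one: this makes the discretization error relatively small. *)
Let hs_norm : is_norm (V := 'rV[R]_m : vectType R) (fun p => hs (yp p)).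
Proof.
split.
- by move=> p; rewrite hsE mulr_ge0// fine_ge0// integral_ge0// => x _; rewrite lee_fin.
- move=> p h; apply/eqP/negPn/negP => p0.
  have yp0 : yp p != 0.
    apply: contra_neq p0 => h0; apply/rowP => b.
    have := ypE p (uncrd (delta_mx 0 b)); rewrite h0 zero_lfunE uncrdK /dot (bigD1 b)//= big1 => [|i ib].
      by rewrite !mxE !eqxx mulr1 addr0.
    by rewrite !mxE eqxx/= (negPf ib) mulr0.
  have : (0 < J (yp p))%E by rewrite JS; exact: sphere_abs_gt0.
  rewrite -[J _]fineK ?J_fin// lte_fin.
  by move: h; rewrite hsE; lra.
- move=> a p; rewrite !hsE mulrCA; congr (_ * _); apply: EFin_inj; rewrite EFinM !fineK ?J_fin//.
  rewrite /J -ge0_integralZl_EFin//.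
  apply: eq_integral => x _; rewrite -EFinM !ypE -normrM; congr (`|_|%:E).
  by rewrite /dot mulr_sumr; apply: eq_bigr => i _; rewrite mxE mulrA.
- move=> p q; rewrite !hsE -mulrDr ler_wpM2l// -lee_fin EFinD !fineK ?J_fin//.
  rewrite /J -ge0_integralD//.
  apply: ge0_le_integral => //.
  + by apply: emeasurable_funD; exact: mabs.
  move=> x _; rewrite -EFinD lee_fin !ypE; apply: le_trans (ler_normD _ _).
  rewrite le_eqVlt; apply/orP; left; apply/eqP; congr `|_|.
  by rewrite /dot -big_split; apply: eq_bigr => i _; rewrite mxE mulrDl.
Qed.

Let hs_lb : exists2 C, 0 < C & forall y, ysum y <= C * hs y.
Proof.
have [C C0 HC] := rnorm_lb hs_norm.
exists (1 + m%:R * C); first by rewrite ltr_wpDr// mulr_ge0// ltW.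
move=> y; pose p : 'rV[R]_m := \row_b y (uncrd (delta_mx 0 b)).
have yE : y = yp p.
  by apply/lfunP => v; rewrite ypE dual_crdE; apply: eq_bigr => b _; rewrite [p 0 b]mxE mulrC.
have hy0 : 0 <= hs y by rewrite yE; have [h _ _ _] := hs_norm; exact: h.
apply: (@le_trans _ _ (\sum_(b < m) C * hs y)).
  apply: ler_sum => b _; rewrite [in leRHS]yE; apply: le_trans (HC p).
  by have := le_coord_norm p 0 b; rewrite mxE.
by rewrite -mulr_suml sumr_const card_ord -(mulr_natl C) [leRHS]mulrDl mul1r ler_wpDl.
Qed.

Let hs_ge0 y : 0 <= hs y.
Proof. by rewrite hsE mulr_ge0// fine_ge0// integral_ge0// => x _; rewrite lee_fin. Qed.

Lemma B_symmP v : B_symm N v <-> forall y : dual V, y v <= hs y.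
Proof. by split=> h y; have := h y; rewrite h_symmE lee_fin. Qed.

(** If the gauge of [v] is at most 1, then y v <= r hs y for values of [r] at most 1 up to an
    arbitrarily small error, and [v] lies in the ball in the limit. The infimum is over a nonempty
    set because [hs] dominates a norm. *)
Lemma unit_ball_symm_norm : unit_ball (symm_norm N) = B_symm N.
Proof.
apply/seteqP; split=> v; rewrite /unit_ball /symm_norm /=; set A := [set r : R | _]; last first.
  by move=> Bv; apply: ge_inf; [exists 0 => r [/ltW]|split=> //; rewrite invr1 scale1r].
have [C C0 HC] := hs_lb.
have A0 : A !=set0.
  have r0 : 0 < C * `|crd v| + 1 by rewrite ltr_wpDl// mulr_ge0// ltW.
  exists (C * `|crd v| + 1); split=> //; apply/B_symmP => y.
  rewrite linearZ /= [X in X <= _](_ : _ = (C * `|crd v| + 1)^-1 * y v)// mulrC ler_pdivrMr//.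
  apply: le_trans (ler_norm _) _; apply: le_trans (ysum_bound _ _) _.
  apply: (@le_trans _ _ (C * hs y * `|crd v|)); first by rewrite ler_wpM2r.
  by rewrite mulrDr mulr1 (mulrC C) -mulrA ler_wpDr.
move=> A1; apply/B_symmP => y; apply/ler_addgt0Pr => e e0.
have d0 : 0 < e / (hs y + 1) by rewrite divr_gt0// ltr_wpDl.
have hA : has_inf A by split=> //; exists 0 => r [/ltW].
have [r [r0 /B_symmP/(_ y)]] := inf_adherent d0 hA.
rewrite linearZ /= [X in X <= _](_ : _ = r^-1 * y v)// mulrC ler_pdivrMr// => yr rl.
apply: (le_trans yr); apply: (@le_trans _ _ (hs y * (1 + e / (hs y + 1)))).
  by rewrite ler_wpM2l//; apply: (le_trans (ltW rl)); rewrite lerD2r.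
rewrite mulrDr mulr1 lerD2l mulrCA ger_pMr// ler_pdivrMr ?ltr_wpDl//; lra.
Qed.

Section Cells.
Variables (p : nat) (phi : V -> 'I_p.+1) (x : 'I_p.+1 -> V) (e : R).
Hypotheses (mphi : forall j, measurable (phi @^-1` [set j] : set (@borelV R V)))
  (xphi : forall v, S v -> `|crd v - crd (x (phi v))| < e) (e0 : 0 < e).

Let w j : R := fine (SM (phi @^-1` [set j])).
(** The support function of the zonotope generated by the vectors [X j] below. *)
Let hz (y : dual V) : R := \sum_j w j / 2 * `|y (x j)|.

Let w_ge0 j : 0 <= w j. Proof. by rewrite fine_ge0. Qed.

Let hzE (y : dual V) : (\int[SM]_v (`|y (x (phi v))|)%:E)%E = (2 * hz y)%:E.
Proof.
rewrite (integral_fin SM mphi (F := fun j => `|y (x j)|))// /hz mulr_sumr -sumEFin.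
apply: eq_bigr => j _; rewrite -[SM _]fineK ?SM_finA// -EFinM -/(w j); congr EFin.
by field.
Qed.

Let mhz (y : dual V) : measurable_fun setT ((fun v => (`|y (x (phi v))|)%:E) : @borelV R V -> \bar R).
Proof.
apply/measurable_EFinP.
rewrite (_ : (fun v => _) = fun v => \sum_j `|y (x j)| * \1_(phi @^-1` [set j]) v).
  apply: measurable_sum => j; apply: measurable_funM; first exact: measurable_cst.
  by apply: measurable_indic.
apply/funext => v; rewrite (bigD1 (phi v))//= big1 => [|j jv]; last first.
  by rewrite indicE memNset ?mulr0// => /= /esym/eqP; apply/negP.
by rewrite indicE mem_set// mulr1 addr0.
Qed.

Let hs_hz y : `|hs y - hz y| <= e * tot / 2 * ysum y.
Proof.
have c0 : 0 <= ysum y * e by rewrite mulr_ge0// ltW.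
have b (v : V) : S v -> `|y v - y (x (phi v))| <= ysum y * e.
  move=> Sv; rewrite -linearB; apply: le_trans (ysum_bound _ _) _.
  by rewrite ler_wpM2l// linearB ltW// xphi.
have h1 := @integral_SM_le (fun v => `|y v|) (fun v => `|y (x (phi v))|) (mabs y) (mhz y) _ c0
  (fun v => normr_ge0 _) (fun v => normr_ge0 _).
have h2 := @integral_SM_le (fun v => `|y (x (phi v))|) (fun v => `|y v|) (mhz y) (mabs y) _ c0
  (fun v => normr_ge0 _) (fun v => normr_ge0 _).
have {}h1 : (J y <= (2 * hz y)%:E + (ysum y * e * tot)%:E)%E.
  by rewrite -hzE; apply: h1 => v Sv; rewrite addrC -lerBlDr; apply: le_trans (b v Sv); apply: lerB_dist.
have {}h2 : ((2 * hz y)%:E <= J y + (ysum y * e * tot)%:E)%E.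
  by rewrite -hzE; apply: h2 => v Sv; rewrite addrC -lerBlDr; apply: le_trans (b v Sv); rewrite distrC; apply: lerB_dist.
move: h1 h2; rewrite -[J y]fineK ?J_fin// -!EFinD !lee_fin => h1 h2.
by rewrite hsE ler_norml; apply/andP; split; lra.
Qed.

Let X j : 'rV[R]_m := (w j / 2) *: crd (x j).

Lemma cells_sub q v : (forall y, hz y <= q * hs y) -> 0 < q -> zonI X (crd v) -> B_symm N (q^-1 *: v).
Proof.
move=> hq q0 /zonIP[t [t1 vE]]; apply/B_symmP => y.
rewrite linearZ /= [X in X <= _](_ : _ = q^-1 * y v)// mulrC ler_pdivrMr// [leRHS]mulrC; apply: le_trans (hq y).
have -> : v = \sum_j (t j * (w j / 2)) *: x j.
  apply: (can_inj (@crdK R V)); rewrite vE linear_sum; apply: eq_bigr => j _.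
  by rewrite [RHS]linearZ /X scalerA.
rewrite linear_sum; apply: ler_sum => j _; rewrite linearZ /= [X in X <= _](_ : _ = t j * (w j / 2) * y (x j))//.
apply: le_trans (ler_norm _) _; rewrite !normrM -mulrA (ger0_norm (w_ge0 j)) (@ger0_norm _ (2^-1))//.
by rewrite ler_piMl// !mulr_ge0.
Qed.

(** A point outside the dilated zonotope would be separated from it by a linear form [y]. At the
    combination with the signs of the y (x j), the form takes the value q hz y on the zonotope,
    against y v <= hs y <= q hz y. *)
Lemma sub_cells q v : (forall y, hs y <= q * hz y) -> 0 < q -> B_symm N v -> zonI (fun j => q *: X j) (crd v).
Proof.
move=> hq q0 /B_symmP Bv; apply: contrapT => nz.
have cz : compact (zonI (fun j => q *: X j) : set 'rV[R]_m) by exact: compact_zon.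
have vz : cvx (zonI (fun j => q *: X j) : set 'rV[R]_m) by exact: cvx_zon.
have [|pp sep] := convex_separation cz vz _ nz.
  by exists 0; apply/zonIP; exists (fun=> 0); split=> [i|]; rewrite ?normr0// big1// => i _; rewrite scale0r.
have Kz : zonI (fun j => q *: X j) (\sum_j Num.sg (yp pp (x j)) *: (q *: X j)).
  by apply/zonIP; exists (fun j => Num.sg (yp pp (x j))); split=> // j; rewrite normr_sg; case: (_ != 0).
have := sep _ Kz; apply/negP; rewrite -leNgt -ypE; apply: le_trans (Bv _) _; apply: le_trans (hq _) _.
have dotE (I : finType) (f : I -> 'rV[R]_m) : dot pp (\sum_i f i) = \sum_i dot pp (f i).
  by rewrite -[LHS]/(dot pp _) /dot exchange_big /=; apply: eq_bigr => i _; rewrite summxE mulr_sumr.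
rewrite dotE /hz mulr_sumr; apply: ler_sum => j _.
have -> : dot pp (Num.sg (yp pp (x j)) *: (q *: X j)) = q * (w j / 2) * (Num.sg (yp pp (x j)) * yp pp (x j)).
  by rewrite [X in _ = _ * (_ * X)]ypE /dot !mulr_sumr; apply: eq_bigr => i _; rewrite !mxE; ring.
by rewrite mulrA -normrEsg.
Qed.

(** A relative error of (q - 1) / q serves both directions: 1 + (q - 1) / q <= q, and hs - hz <= (q
    - 1) / q * hs is the same as hs <= q hz. *)
Lemma cells_close q C : 1 < q -> (forall y, ysum y <= C * hs y) -> 0 < C -> e * (C * (tot + 1)) <= 2 * ((q - 1) / q) ->
  (forall y, hz y <= q * hs y) /\ (forall y, hs y <= q * hz y).
Proof.
move=> q1 HC C0 ec; have q0 : 0 < q by lra.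
have tot0 : 0 <= tot by rewrite fine_ge0.
have h y : `|hs y - hz y| <= (q - 1) / q * hs y.
  apply: le_trans (hs_hz y) _.
  apply: (@le_trans _ _ (e * tot / 2 * (C * hs y))); first by rewrite ler_wpM2l// divr_ge0// mulr_ge0// ltW.
  rewrite (_ : _ * (C * hs y) = e * (C * tot) / 2 * hs y); last by ring.
  rewrite ler_wpM2r//; have : e * (C * tot) <= e * (C * (tot + 1)).
    by rewrite ler_pM2l// ler_pM2l//; lra.
  lra.
have qq : (q - 1) / q <= q - 1 by rewrite ler_pdivrMr// ler_peMr//; lra.
split=> y; have := h y; rewrite ler_norml => /andP[h1 h2].
  have : (q - 1) / q * hs y <= (q - 1) * hs y by rewrite ler_wpM2r.
  lra.
have : q * (hs y - hz y) <= q * ((q - 1) / q * hs y) by rewrite ler_pM2l.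
by rewrite (_ : q * ((q - 1) / q * hs y) = (q - 1) * hs y); [lra|field; rewrite gt_eqF].
Qed.

End Cells.

(* Replacing the measure on the sphere by finitely many atoms turns [B_symm] into
   a zonotope, up to a dilation by [q]. *)
Lemma symm_approx q : 1 < q -> exists p0, forall p, (p0 <= p)%N ->
  exists (phi : V -> 'I_p.+1) (x : 'I_p.+1 -> V),
  let X := fun j => (fine (SM (phi @^-1` [set j])) / 2) *: crd (x j) in
  [/\ forall j, measurable (phi @^-1` [set j] : set (@borelV R V)),
      forall v, S v -> `|crd v - crd (x (phi v))| < q - 1,
      forall j, S (x j) \/ x j = 0,
      forall v, zonI X (crd v) -> B_symm N (q^-1 *: v) &
      forall v, B_symm N v -> zonI (fun j => q *: X j) (crd v)].
Proof.
move=> q1; have [C C0 HC] := hs_lb; have q0 : 0 < q by lra.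
have tot0 : 0 <= tot by rewrite fine_ge0.
have D0 : 0 < C * (tot + 1) by rewrite mulr_gt0// ltr_wpDl.
(* The first bound makes the representatives converge when q tends to 1, the second is the precision
   that [cells_close] needs. *)
pose e := Num.min (q - 1) (2 * ((q - 1) / q) / (C * (tot + 1))).
have e0 : 0 < e by rewrite lt_min subr_gt0 q1/= divr_gt0// mulr_gt0// divr_gt0// subr_gt0.
have [p0 hp] := sphere_cells e0; exists p0 => p /hp[phi [x [mphi xphi xS]]]; exists phi, x => X.
have ec : e * (C * (tot + 1)) <= 2 * ((q - 1) / q) by rewrite -ler_pdivlMr// ge_min lexx orbT.
have [h1 h2] := cells_close mphi xphi e0 q1 HC C0 ec.
split=> //.
- by move=> v Sv; apply: (lt_le_trans (xphi v Sv)); rewrite ge_min lexx.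
- by move=> v zv; exact: (@cells_sub p phi x q v h1 q0 zv).
- by move=> v; exact: (@sub_cells p phi x q v h2 q0).
Qed.

End Symmetrization.

(** * Fibers of sums of B-bodies *)

Lemma cvg_det (R : realType) (T : Type) (F : set_system T) (FF : Filter F) n (f : T -> 'M[R]_n) (l : 'M[R]_n) :
  (forall i j, (fun t => f t i j) @ F --> l i j) -> (fun t => \det (f t)) @ F --> \det l.
Proof.
move=> fl; rewrite /determinant; apply: (cvg_big (@add_continuous R)) => s _.
apply: cvgM; first exact: cvg_cst.
by apply: (cvg_big (@mul_continuous R)) => i _; exact: fl.
Qed.

Lemma det_bound (R : realType) n (A : 'M[R]_n) C : (forall i j, `|A i j| <= C) -> `|\det A| <= n`!%:R * C ^+ n.
Proof.
move=> AC; rewrite /determinant; apply: (le_trans (ler_norm_sum _ _ _)).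
apply: (@le_trans _ _ (\sum_(s : 'S_n) C ^+ n)).
  apply: ler_sum => s _; rewrite normrM normrX normrN1 expr1n mul1r normr_prod.
  rewrite -[in leRHS](card_ord n) -prodr_const; apply: ler_prod => i _.
  by rewrite normr_ge0 AC.
by rewrite sumr_const (eq_card (_ : _ =i 'S_n))// card_Sn mulr_natl.
Qed.

Lemma det_rowZ (R : realType) n (c : 'I_n -> R) (A : 'I_n -> 'rV[R]_n) :
  \det (\matrix_r (c r *: A r)) = (\prod_r c r) * \det (\matrix_r A r).
Proof.
rewrite (_ : \matrix_r (c r *: A r) = diag_mx (\row_r c r) *m \matrix_r A r).
  by rewrite det_mulmx det_diag; congr (_ * _); apply: eq_bigr => i _; rewrite mxE.
by apply/matrixP => i j; rewrite mul_diag_mx !mxE.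
Qed.

Lemma det_neg_abs (R : realType) n (A : 'M[R]_n) (s : 'S_n) : `|\det (\matrix_(i, j) A (s i) j)| = `|\det A|.
Proof.
rewrite (_ : \matrix_(i, j) A (s i) j = row_perm s A); last by apply/matrixP => i j; rewrite !mxE.
by rewrite row_permE det_mulmx det_perm normrM normrX normrN1 expr1n mul1r.
Qed.

(** * Riemann sums of the density *)

Section RiemannSum.
Context {R : realType} {n : nat} (X : manifold R n) (V : 'I_n -> vectType R)
  (ev : forall i : 'I_n, {linear V i -> (X -> R^o)}) (N : forall i, V i -> R).
Hypothesis hN : forall i, is_norm (@N i).
Variables (c : chart X) (u : 'rV[R]_n).

Definition sysrow (y : forall i, V i) : 'M[R]_n := \matrix_(r, j) (crd (y r) *m Dmx ev r c u) 0 j.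

Definition wts p (phi : forall i, V i -> 'I_p.+1) i j : R := fine (smeas (hN i) (@phi i @^-1` [set j])).

(* Riemann sum of [delta] for the partitions of the spheres by the [phi i]. *)
Definition riem p (phi : forall i, V i -> 'I_p.+1) (x : forall i, 'I_p.+1 -> V i) : R :=
  \sum_(J : {ffun 'I_n -> 'I_p.+1}) (\prod_r wts phi r (J r)) * `|\det (sysrow (fun r => x r (J r)))|.

Let SM_fin i A : measurable A -> smeas (hN i) A \is a fin_num.
Proof.
move=> mA; rewrite ge0_fin_numE//; apply: (@le_lt_trans _ _ (smeas (hN i) setT)).
  by apply: le_measure => //; exact: mem_set.
rewrite /smeas/= /mrestr setTI; have h : sphm (hN i) (unit_sphere (@N i)) \is a fin_num.
  by apply: fin_num_measure; exact: sphere_measurable.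
by rewrite ltey_eq h.
Qed.

Lemma wts_ge0 p (phi : forall i, V i -> 'I_p.+1) i j : 0 <= wts phi i j.
Proof. by rewrite fine_ge0. Qed.

Section Cell.
Variables (p : nat) (phi : forall i, V i -> 'I_p.+1) (x : forall i, 'I_p.+1 -> V i).
Hypothesis mphi : forall i j, measurable (@phi i @^-1` [set j] : set (@borelV R (V i))).

Let cellmap (f : frames V) : {ffun 'I_n -> 'I_p.+1} := [ffun r => @phi r ((f : forall i, V i) r)].

Let cellmapE J : cellmap @^-1` [set J] = box (fun r => @phi r @^-1` [set J r] : set (@borelV R (V r))).
Proof.
apply/seteqP; split=> f /=; first by move=> <- r; rewrite /preimage /= ffunE.
by move=> h; apply/ffunP => r; rewrite ffunE; exact: h.
Qed.

Let measurable_cellmap J : measurable (cellmap @^-1` [set J]).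
Proof. by rewrite cellmapE; apply: measurable_box => r; exact: mphi. Qed.

Let cell_det (f : frames V) : R := `|\det (sysrow (fun r => x r (@phi r ((f : forall i, V i) r))))|.

Let cell_detE f : cell_det f = `|\det (sysrow (fun r => x r (cellmap f r)))|.
Proof. by rewrite /cell_det; congr `|\det _|; apply/matrixP => r j; rewrite !mxE ffunE. Qed.

Lemma riem_integral :
  (riem phi x)%:E = (\int[sphp hN]_f (`|\det (sysrow (fun r => x r (@phi r ((f : forall i, V i) r))))|)%:E)%E.
Proof.
transitivity (\int[sphp hN]_f (`|\det (sysrow (fun r => x r (cellmap f r)))|)%:E)%E; last first.
  by apply: eq_integral => f _; rewrite -cell_detE.
rewrite (integral_fin (sphp hN) measurable_cellmap (F := fun J : {ffun 'I_n -> 'I_p.+1} => `|\det (sysrow (fun r => x r (J r)))|))//.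
rewrite /riem -sumEFin; apply: eq_bigr => J _; rewrite mulrC EFinM; congr (_ * _)%E.
rewrite cellmapE [RHS](pm_box (sphs hN)); last by move=> r; exact: mphi.
rewrite -prodEFin; apply: eq_bigr => r _; rewrite /wts fineK//; exact: SM_fin.
Qed.

Lemma measurable_cell_det : measurable_fun setT (fun f : frames V =>
  (`|\det (sysrow (fun r => x r (@phi r ((f : forall i, V i) r))))|)%:E : \bar R).
Proof.
apply/measurable_EFinP.
rewrite [X in measurable_fun _ X](_ : _ = fun f => \sum_J `|\det (sysrow (fun r => x r ((J : {ffun _ -> _}) r)))| * \1_(cellmap @^-1` [set J]) f).
  apply: measurable_sum => J; apply: measurable_funM; first exact: measurable_cst.
  by apply: measurable_indic.
apply/funext => f; rewrite -[LHS]/(cell_det f) cell_detE (bigD1 (cellmap f))//= big1 => [|J Jf]; last first.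
  by rewrite indicE memNset ?mulr0// => /= /esym/eqP; apply/negP.
by rewrite indicE mem_set// mulr1 addr0.
Qed.

End Cell.

Lemma measurable_sysrow : measurable_fun setT (fun f : frames V => (`|\det (sysrow f)|)%:E : \bar R).
Proof.
apply/measurable_EFinP; apply: (measurableT_comp (@normr_measurable R setT)).
apply: measurable_det => i j.
rewrite [X in measurable_fun _ X](_ : _ = fun f : frames V => \sum_b (crd ((f : forall i, V i) i) 0 b * Dmx ev i c u b j)).
  apply: measurable_sum => b; apply: measurable_funM; last exact: measurable_cst.
  have H2 := measurableT_comp (@measurable_crd R (V i)) (@measurable_coord _ _ (fun i => @borelV R (V i)) i).
  have H3 := measurableT_comp (@measurable_coordR R (vdim (V i)) b) H2; exact: H3.
by apply/funext => f; rewrite /sysrow mxE mxE.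
Qed.

Lemma deltaE : delta ev hN c u = (\int[sphp hN]_f (`|\det (sysrow f)|)%:E)%E.
Proof. by []. Qed.

Let bsph i : exists2 C, 0 < C & forall x : V i, unit_sphere (@N i) x -> `|crd x| <= C.
Proof. exact: sphere_bounded. Qed.

Lemma sphp_setT : (sphp hN setT < +oo)%E.
Proof.
rewrite (_ : setT = box (fun i => setT : set (@borelV R (V i)))); last by apply/seteqP; split.
rewrite [X in (X < _)%E](pm_box (sphs hN))//.
have h i : exists r : R, sphs hN i setT = r%:E.
  by exists (fine (sphs hN i setT)); rewrite fineK//; exact: SM_fin.
have [r rE] := choice h.
by rewrite (eq_bigr (fun i => (r i)%:E)) ?prodEFin ?ltry.
Qed.

Lemma sphp_ae : {ae (sphp hN : set (frames V) -> \bar R), forall f : frames V, forall i, unit_sphere (@N i) ((f : forall i, V i) i)}.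
Proof.
pose B : set (frames V) := box (fun i => unit_sphere (@N i) : set (@borelV R (V i))).
have mS i : measurable (unit_sphere (@N i) : set (@borelV R (V i))) by exact: sphere_measurable.
have mB : measurable B by exact: measurable_box.
have BT : sphp hN B = sphp hN setT.
  have -> : setT = box (fun i => setT : set (@borelV R (V i))) by apply/seteqP; split.
  rewrite [LHS](pm_box (sphs hN))// [RHS](pm_box (sphs hN))//; apply: eq_bigr => i _.
  by rewrite /sphs /sfm /smeas/= /mrestr setIid setTI.
exists (~` B); split => //; first exact: measurableC.
have h : (sphp hN B + sphp hN (~` B) = sphp hN B)%E.
  by rewrite -measureU ?setUv ?setICr//; exact: measurableC.
have Bf : sphp hN B \is a fin_num by rewrite BT ge0_fin_numE// sphp_setT.
by rewrite -[LHS](@addeK _ (sphp hN B) (sphp hN (~` B)) Bf) [X in (X - _)%E]addeC h subee.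
Qed.

Lemma sysrow_bound : exists2 B, 0 <= B & forall y : (forall i, V i),
  (forall i, unit_sphere (@N i) (y i) \/ y i = 0) -> `|\det (sysrow y)| <= B.
Proof.
have h i : exists C : R, 0 <= C /\ forall v : V i, unit_sphere (@N i) v \/ v = 0 -> `|crd v *m Dmx ev i c u| <= C.
  have [C C0 HC] := bsph i; have [K K0 HK] := mulmx_bound (Dmx ev i c u).
  exists (K * C); split; first by rewrite mulr_ge0// ltW.
  move=> v [Sv|->]; last by rewrite linear0 mul0mx normr0 mulr_ge0// ltW.
  by apply: le_trans (HK _) _; rewrite ler_pM2l// HC.
have [C CP] := choice h.
have C0 : 0 <= \sum_i C i by apply: sumr_ge0 => i _; have [] := CP i.
exists (n`!%:R * (\sum_i C i) ^+ n); first by rewrite mulr_ge0// exprn_ge0.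
move=> y hy; apply: det_bound => i j; rewrite mxE; apply: le_trans (le_coord_norm _ _ _) _.
apply: (@le_trans _ _ (C i)); first by have [_] := CP i; apply.
by rewrite (bigD1 i)//= lerDl sumr_ge0// => k _; have [] := CP k.
Qed.

Section Convergence.
Variables (p : nat -> nat) (phi : forall k i, V i -> 'I_(p k).+1) (x : forall k i, 'I_(p k).+1 -> V i) (e : nat -> R).
Hypotheses (mphi : forall k i j, measurable (@phi k i @^-1` [set j] : set (@borelV R (V i))))
  (xphi : forall k i v, unit_sphere (@N i) v -> `|crd v - crd (x i (@phi k i v))| < e k)
  (e0 : e k @[k --> \oo] --> (0 : R))
  (xS : forall k i (j : 'I_(p k).+1), unit_sphere (@N i) (x i j) \/ x i j = 0).

(** Dominated convergence: a Riemann sum is the integral of the determinant at the representatives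
    of the cells, which converge on the spheres, and the determinants are uniformly bounded there.
    The measure is concentrated on the spheres and finite. *)
Lemma riem_cvg : delta ev hN c u \is a fin_num /\
  (riem (@phi k) (@x k))%:E @[k --> \oo] --> delta ev hN c u.
Proof.
have [B B0 HB] := sysrow_bound.
pose F k (f : frames V) : \bar R := (`|\det (sysrow (fun r => x r (@phi k r ((f : forall i, V i) r))))|)%:E.
have [|||||iF _] := @dominated_convergence _ (frames V) R (sphp hN) setT measurableT F
  (fun f => (`|\det (sysrow f)|)%:E) (cst B%:E).
- by move=> k; exact: (@measurable_cell_det (p k) (@phi k) (@x k) (@mphi k)).
- exact: measurable_sysrow.
- have [A [mA A0 hA]] := sphp_ae; exists A; split=> //; apply: subset_trans hA.
  apply: subsetC => f Sf _; apply/cvg_EFin; first by near=> k.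
  apply: (@cvg_norm _ R^o); apply: cvg_det => i j.
  rewrite [X in _ --> X](_ : _ = \sum_b (crd ((f : forall i, V i) i) 0 b * Dmx ev i c u b j)); last by rewrite !mxE.
  apply: (@cvg_trans _ ((fun k => \sum_b (crd (x i (@phi k i ((f : forall i, V i) i))) 0 b * Dmx ev i c u b j)) @ \oo)).
    by apply: near_eq_cvg; near=> k; rewrite !mxE.
  apply: (cvg_big (@add_continuous R)) => b _; apply: cvgM; last exact: cvg_cst.
  apply/cvgrPdist_lt => d d0; move/cvgrPdist_lt : e0 => /(_ _ d0); apply: filterS => k; rewrite sub0r normrN => ed.
  apply: le_lt_trans (_ : _ <= `|crd ((f : forall i, V i) i) - crd (x i (@phi k i ((f : forall i, V i) i)))|) _.
    by have := le_coord_norm (crd ((f : forall i, V i) i) - crd (x i (@phi k i ((f : forall i, V i) i)))) 0 b; rewrite !mxE.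
  by apply: lt_trans (xphi _ (Sf i)) _; exact: le_lt_trans (ler_norm _) ed.
- apply/integrableP; split; first exact: measurable_cst.
  rewrite integral_cst//= lte_mul_pinfty// ?sphp_setT//.
- have [A [mA A0 hA]] := sphp_ae; exists A; split=> //; apply: subset_trans hA.
  apply: subsetC => f Sf k _; rewrite /F gee0_abs// lee_fin; apply: HB => i; exact: xS.
move=> cF; split.
  have /integrableP[_ h] := iF; rewrite ge0_fin_numE; last by apply: integral_ge0 => f _; rewrite lee_fin.
  have E : (\int[sphp hN]_f `|(`|\det (sysrow f)|)%:E| = delta ev hN c u)%E by apply: eq_integral => f _; rewrite /= normr_id.
  by rewrite -E.
by apply: cvg_trans cF; apply: near_eq_cvg; near=> k; rewrite /= /F -(@riem_integral (p k) (@phi k) (@x k) (@mphi k)).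
Unshelve. all: by end_near. Qed.

End Convergence.
End RiemannSum.

Lemma crdZ (R : realType) (V : vectType R) a (v : V) : crd (a *: v) = a *: crd v.
Proof. exact: linearZ. Qed.

(** * The fibers between zonotopes *)

Section Fiber.
Context {R : realType} {n : nat} (X : manifold R n) (V : 'I_n -> vectType R)
  (ev : forall i : 'I_n, {linear V i -> (X -> R^o)}) (N : forall i, V i -> R).
Hypotheses (hN : forall i, is_norm (@N i)) (B_smooth : forall i, smooth_convex_body (unit_ball (@N i)))
  (ev_smooth : forall (i : 'I_n) (v : V i), smooth_fun (ev i v)).
Variables (c : chart X) (lambda : 'I_n -> R).
Hypothesis l0 : forall i, 0 <= lambda i.

Definition fiber u : set 'rV[R]_n := [set p | exists v : forall i, V i,
  (forall i, B_symm (@N i) (v i)) /\ p = \sum_i lambda i *: (crd (v i) *m Dmx ev i c u)].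

Definition deltaA (a : {ffun 'I_n -> 'I_n}) u : \bar R :=
  @delta R n X (fun r => V (a r)) (fun r => ev (a r)) (fun r => @N (a r)) (fun r => hN (a r)) c u.

(** This will be the volume of the fiber; [fine] loses nothing, since [riem_cvg] shows that [deltaA]
    is finite. *)
Definition kap u : R := n`!%:R^-1 * \sum_(a : {ffun 'I_n -> 'I_n}) (\prod_r lambda (a r)) * fine (deltaA a u).

Definition is_cells (q : R) p (phi : forall i, V i -> 'I_p.+1) (x : forall i, 'I_p.+1 -> V i) :=
  forall i, let Y := fun j => (wts hN phi i j / 2) *: crd (x i j) in
  [/\ forall j, measurable (@phi i @^-1` [set j] : set (@borelV R (V i))),
      forall v, unit_sphere (@N i) v -> `|crd v - crd (x i (@phi i v))| < q - 1,
      forall j, unit_sphere (@N i) (x i j) \/ x i j = 0,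
      forall v, zonI Y (crd v) -> B_symm (@N i) (q^-1 *: v) &
      forall v, B_symm (@N i) v -> zonI (fun j => q *: Y j) (crd v)].

(** The number of cells has to be common to all [i], because the generators of the sum are indexed
    by pairs (i, j); a maximum achieves this. *)
Lemma cells_exist q : 1 < q -> exists p phi x, @is_cells q p phi x.
Proof.
move=> q1; have [p0 p0P] := choice (fun i => symm_approx (hN i) (B_smooth i) q1).
pose p := (\max_i p0 i)%N.
have h i : exists px : (V i -> 'I_p.+1) * ('I_p.+1 -> V i),
   let Y := fun j => (fine (smeas (hN i) (px.1 @^-1` [set j])) / 2) *: crd (px.2 j) in
  [/\ forall j, measurable (px.1 @^-1` [set j] : set (@borelV R (V i))),
      forall v, unit_sphere (@N i) v -> `|crd v - crd (px.2 (px.1 v))| < q - 1,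
      forall j, unit_sphere (@N i) (px.2 j) \/ px.2 j = 0,
      forall v, zonI Y (crd v) -> B_symm (@N i) (q^-1 *: v) &
      forall v, B_symm (@N i) v -> zonI (fun j => q *: Y j) (crd v)].
  have [|phi [x H]] := p0P i p; first exact: (leq_bigmax i).
  by exists (phi, x).
exists p, (fun i => (projT1 (cid (h i))).1), (fun i => (projT1 (cid (h i))).2) => i.
exact: (projT2 (cid (h i))).
Qed.

Definition riemA p (phi : forall i, V i -> 'I_p.+1) (x : forall i, 'I_p.+1 -> V i) (a : {ffun 'I_n -> 'I_n}) u : R :=
  @riem R n X (fun r => V (a r)) (fun r => ev (a r)) (fun r => @N (a r)) (fun r => hN (a r)) c u p
    (fun r => @phi (a r)) (fun r => x (a r)).

Section Sandwich.
Variables (q : R) (p : nat) (phi : forall i, V i -> 'I_p.+1) (x : forall i, 'I_p.+1 -> V i).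
Hypotheses (q0 : 0 < q) (cl : @is_cells q p phi x).

Let w i j : R := wts hN phi i j.

Definition gen (ij : 'I_n * 'I_p.+1) u : 'rV[R]_n :=
  lambda ij.1 *: (((w ij.1 ij.2 / 2) *: crd (x ij.1 ij.2)) *m Dmx ev ij.1 c u).

Let sum_gen u (t : 'I_n * 'I_p.+1 -> R) k : \sum_ij t ij *: (k *: gen ij u) =
  \sum_i lambda i *: ((\sum_j t (i, j) *: (k *: ((w i j / 2) *: crd (x i j)))) *m Dmx ev i c u).
Proof.
rewrite (eq_bigr (fun ij => t (ij.1, ij.2) *: (k *: gen (ij.1, ij.2) u))); last by case.
rewrite -(pair_bigA _ (fun i j => t (i, j) *: (k *: gen (i, j) u)))/=; apply: eq_bigr => i _.
rewrite mulmx_suml scaler_sumr; apply: eq_bigr => j _; rewrite /gen /=.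
by rewrite -!scalemxAl !scalerA; congr (_ *: _); ring.
Qed.

Lemma gen_sub_fiber u z : zonI (gen^~ u) z -> fiber u (q^-1 *: z).
Proof.
move=> /zonIP[t [t1 ->]].
exists (fun i => q^-1 *: uncrd (\sum_j t (i, j) *: ((w i j / 2) *: crd (x i j)))); split.
  move=> i; have [_ _ _ h _] := cl i; apply: h; rewrite uncrdK; apply/zonIP.
  by exists (fun j => t (i, j)).
rewrite (eq_bigr (fun ij => t ij *: (1 *: gen ij u))); last by move=> ij _; rewrite scale1r.
rewrite sum_gen scaler_sumr; apply: eq_bigr => i _; rewrite crdZ uncrdK -!scalemxAl !scalerA mulrC.
by congr (_ *: (_ *m _)); apply: eq_bigr => j _; rewrite scale1r.
Qed.

Lemma fiber_sub_gen u z : fiber u z -> zonI (fun ij => q *: gen ij u) z.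
Proof.
move=> [v [Bv ->]].
have h i : exists t : 'I_p.+1 -> R, (forall j, `|t j| <= 1) /\ crd (v i) = \sum_j t j *: (q *: ((w i j / 2) *: crd (x i j))).
  by apply/zonIP; have [_ _ _ _ h] := cl i; exact: h.
have [t tP] := choice h; apply/zonIP; exists (fun ij => t ij.1 ij.2); split=> [ij|]; first exact: (tP ij.1).1.
by rewrite (sum_gen u (fun ij => t ij.1 ij.2)); apply: eq_bigr => i _; rewrite [in LHS](tP i).2.
Qed.

Lemma leb_gen u : leb (zonI (gen^~ u)) = (n`!%:R^-1 * \sum_(a : {ffun 'I_n -> 'I_n}) (\prod_r lambda (a r)) * riemA phi x a u)%:E.
Proof.
rewrite leb_zonI; congr EFin; rewrite mulrAC mulrC; congr (_ * _).
(* An n-tuple of generators is a tuple [a] of spaces together with a tuple [J] of cells. The 2^n of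
   the zonotope formula cancels the halves in the generators. *)
pose h (aJ : {ffun 'I_n -> 'I_n} * {ffun 'I_n -> 'I_p.+1}) : {ffun 'I_n -> 'I_n * 'I_p.+1} := [ffun r => (aJ.1 r, aJ.2 r)].
rewrite (reindex h)/=; last first.
  apply: onW_bij; exists (fun f : {ffun 'I_n -> 'I_n * 'I_p.+1} => ([ffun r => (f r).1], [ffun r => (f r).2])) => [[a J]|f].
    by congr (_, _); apply/ffunP => r; rewrite !ffunE.
  by apply/ffunP => r; rewrite !ffunE /=; case: (f r).
rewrite -(pair_bigA _ (fun a J => `|\det (\matrix_r gen (h (a, J) r) u)|))/= mulr_sumr; apply: eq_bigr => a _.
rewrite /riemA /riem !mulr_sumr; apply: eq_bigr => J _.
rewrite (_ : \matrix_r _ = \matrix_r ((lambda (a r) * (w (a r) (J r) / 2)) *: (crd (x (a r) (J r)) *m Dmx ev (a r) c u))); last first.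
  by apply/row_matrixP => r; rewrite !rowK /h ffunE /gen /= -scalemxAl scalerA.
rewrite det_rowZ normrM [X in _ * (X * _) = _]ger0_norm; last first.
  by apply: prodr_ge0 => r _; rewrite mulr_ge0// divr_ge0// wts_ge0.
rewrite !big_split/= prodr_const card_ord exprVn.
rewrite (_ : sysrow _ _ _ _ = \matrix_r (crd (x (a r) (J r)) *m Dmx ev (a r) c u)); last first.
  by apply/matrixP => r j; rewrite !mxE.
set A := \prod_i lambda _; set B := \prod_i w _ _; set D := `|_|.
field.
by rewrite expf_neq0.
Qed.

End Sandwich.
End Fiber.

(** True for arbitrary sets, as [leb] is an infimum over covers; the fibers are not known to be
    measurable at this point. *)
Lemma leb_le (R : realType) n (A B : set (borelR n)) : A `<=` B -> (@leb R n A <= leb B)%E.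
Proof.
move=> AB; apply: (@le_pm R 'I_n _ (fun=> measurableTypeR R) (fun=> @lebesgue_measure R)) => x; exact: AB.
Qed.

(** * Volume of the fibers and of their graph *)

Section FiberVolume.
Context {R : realType} {n : nat} (X : manifold R n) (V : 'I_n -> vectType R)
  (ev : forall i : 'I_n, {linear V i -> (X -> R^o)}) (N : forall i, V i -> R).
Hypotheses (hN : forall i, is_norm (@N i)) (B_smooth : forall i, smooth_convex_body (unit_ball (@N i)))
  (ev_smooth : forall (i : 'I_n) (v : V i), smooth_fun (ev i v)).
Variables (c : chart X) (lambda : 'I_n -> R).
Hypothesis l0 : forall i, 0 <= lambda i.
Local Notation fiber := (@fiber R n X V ev N c lambda).
Local Notation kap := (@kap R n X V ev N hN c lambda).
Local Notation gen := (@gen R n X V ev N hN c lambda).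
Local Notation deltaA := (@deltaA R n X V ev N hN c).
Local Notation Om := (cmap c @` cdom c).

Let deltaA_ge0 a u : (0 <= deltaA a u)%E.
Proof. exact: delta_ge0. Qed.

Lemma kap_ge0 u : 0 <= kap u.
Proof.
rewrite mulr_ge0//; apply: sumr_ge0 => a _; rewrite mulr_ge0//; last by rewrite fine_ge0.
by apply: prodr_ge0.
Qed.

Lemma Dmx_continuous i b j u : Om u -> {for u, continuous (fun u => Dmx ev i c u b j)}.
Proof.
move=> Ou; have [_ cu] := @evc_C1 _ _ X V ev ev_smooth i (uncrd (delta_mx 0 b)) c u Ou j.
by apply: (@eq_continuous_at _ _ (fun u => 'D_(delta_mx 0 j) (@evc _ _ X V ev i (uncrd (delta_mx 0 b)) c) u)) => // y; rewrite mxE.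
Qed.

Lemma measurable_kap : measurable_fun (Om : set (borelR n)) (fun u => (kap u)%:E : \bar R).
Proof.
apply/measurable_EFinP; apply: measurable_funM; first exact: measurable_cst.
apply: measurable_sum => a; apply: measurable_funM; first exact: measurable_cst.
apply: (@measurableT_comp _ _ _ _ _ _ (@fine R)) => //.
by apply: measurable_delta => //; exact: cmap_open.
Qed.

Section OneCell.
Variables (q : R) (p : nat) (phi : forall i, V i -> 'I_p.+1) (x : forall i, 'I_p.+1 -> V i).
Hypotheses (q0 : 0 < q) (cl : is_cells hN q phi x).

Let q_ge0 : 0 <= q. Proof. exact: ltW. Qed.
Let qV_ge0 : 0 <= q^-1. Proof. by rewrite invr_ge0. Qed.

Lemma fiber_le_gen u : (leb (fiber u) <= (q ^+ n)%:E * leb (zonI (gen phi x ^~ u)))%E.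
Proof.
rewrite -leb_zonIZ//; apply: leb_le => z; exact: fiber_sub_gen.
Qed.

Lemma gen_scaled_sub u z : zonI (fun ij => q^-1 *: gen phi x ij u) z -> fiber u z.
Proof.
move=> /zonIZ => /(_ q) h.
have /(@gen_sub_fiber _ _ _ _ ev _ hN c lambda q _ phi x cl) : zonI (gen phi x ^~ u) (q *: z).
  move: h; congr (zonI _ _); apply/funext => ij; by rewrite scalerA divff ?gt_eqF// scale1r.
by rewrite scalerA mulVf ?gt_eqF// scale1r.
Qed.

Let cancel_q (y : \bar R) : ((q ^+ n)%:E * ((q^-1 ^+ n)%:E * y) = y)%E.
Proof. by rewrite muleA -EFinM -exprMn divff ?gt_eqF// expr1n mul1e. Qed.

Lemma gen_le_fiber u : (leb (zonI (gen phi x ^~ u)) <= (q ^+ n)%:E * leb (fiber u))%E.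
Proof.
have h : ((q^-1 ^+ n)%:E * leb (zonI (gen phi x ^~ u)) <= leb (fiber u))%E.
  by rewrite -leb_zonIZ//; apply: leb_le => z; exact: gen_scaled_sub.
by rewrite -[leLHS]cancel_q; apply: lee_wpmul2l => //; rewrite lee_fin exprn_ge0.
Qed.

Lemma gen_continuous ij u : Om u -> {for u, continuous (gen phi x ij)}.
Proof.
move=> Ou; apply: continuous_row => j; rewrite /gen; set a := lambda _; set Y := _ *: crd _.
apply: (@eq_continuous_at _ _ (fun u => a * \sum_b Y 0 b * Dmx ev ij.1 c u b j)).
  by move=> u'; rewrite [in RHS]mxE [in RHS]mxE.
apply: continuousM_at; first exact: cst_continuous.
apply: continuous_bigsum => b; apply: continuousM_at; first exact: cst_continuous.
exact: Dmx_continuous.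
Qed.

Lemma measurable_leb_gen : measurable_fun (Om : set (borelR n)) (fun u => leb (zonI (gen phi x ^~ u)) : \bar R).
Proof.
rewrite [X in measurable_fun _ X](_ : _ = fun u => (2 ^+ n / n`!%:R * \sum_(f : {ffun 'I_n -> 'I_n * 'I_p.+1}) `|\det (\matrix_r gen phi x (f r) u)|)%:E); last first.
  by apply/funext => u; rewrite leb_zonI.
apply/measurable_EFinP; apply: (@measurable_fun_cont R n Om) => [|u Ou]; first exact: cmap_open.
apply: continuousM_at; first exact: cst_continuous.
apply: continuous_bigsum => f; apply: (@continuous_norm_at R _ R^o).
apply: continuous_det => i j.
apply: (@eq_continuous_at _ _ (fun u => gen phi x (f i) u 0 j)); first by move=> u'; rewrite mxE.
by apply: continuous_coord; exact: gen_continuous.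
Qed.

Definition fgraph (D : set 'rV[R]_n) : set (borelR (n + n)) :=
  [set w | D (lsubmx w) /\ fiber (lsubmx w) (rsubmx w)].

Hypothesis kapE : forall u, leb (fiber u) = (kap u)%:E.
Variables (D : set (borelR n)) (mD : measurable D) (DO : D `<=` Om).

Let oO : open Om. Proof. exact: cmap_open. Qed.

Let mk : measurable_fun D (fun u => (kap u)%:E : \bar R).
Proof. by apply: measurable_funS measurable_kap => //; exact: borel_open. Qed.

Let mg : measurable_fun D (fun u => leb (zonI (gen phi x ^~ u)) : \bar R).
Proof. by apply: measurable_funS measurable_leb_gen => //; exact: borel_open. Qed.

Let qq : (q ^+ (n + n))%:E = ((q ^+ n)%:E * (q ^+ n)%:E)%E.
Proof. by rewrite exprD EFinM. Qed.

Let leb_scaled r : 0 <= r -> leb (zgraph (fun ij u => r *: gen phi x ij u) D) =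
  ((r ^+ n)%:E * \int[@leb R n]_(u in D) leb (zonI (gen phi x ^~ u)))%E.
Proof.
move=> r0; have cX ij u : Om u -> {for u, continuous (fun u => r *: gen phi x ij u)}.
  by move=> Ou; apply: continuousZ_at; [exact: cst_continuous|exact: gen_continuous].
rewrite (@leb_zgraph R n _ (fun ij u => r *: gen phi x ij u) Om oO cX D mD DO).
rewrite -ge0_integralZl//; last by rewrite lee_fin exprn_ge0.
by apply: eq_integral => u _; rewrite -leb_zonIZ.
Qed.

(** One factor q^n comes from enclosing the fibers in dilated zonotopes, the other from comparing
    the volumes of the zonotopes with those of the fibers. *)
Lemma fgraph_le : (leb (fgraph D) <= (q ^+ (n + n))%:E * \int[@leb R n]_(u in D) (kap u)%:E)%E.
Proof.
apply: (@le_trans _ _ (leb (zgraph (fun ij u => q *: gen phi x ij u) D))).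
  by apply: leb_le => w [Dw fw]; split=> //; exact: fiber_sub_gen fw.
rewrite leb_scaled//.
rewrite qq -muleA; apply: lee_wpmul2l; first by rewrite lee_fin exprn_ge0.
rewrite -ge0_integralZl//; last 2 first.
- by move=> u _; rewrite lee_fin kap_ge0.
- by rewrite lee_fin exprn_ge0.
apply: ge0_le_integral => //.
- by apply: measurable_funeM.
- by move=> u Du; rewrite -kapE; exact: gen_le_fiber.
Qed.

Lemma fgraph_ge : (\int[@leb R n]_(u in D) (kap u)%:E <= (q ^+ (n + n))%:E * leb (fgraph D))%E.
Proof.
apply: (@le_trans _ _ ((q ^+ n)%:E * ((q ^+ n)%:E * leb (zgraph (fun ij u => q^-1 *: gen phi x ij u) D)))%E); last first.
  rewrite qq -muleA; apply: lee_wpmul2l; first by rewrite lee_fin exprn_ge0.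
  apply: lee_wpmul2l; first by rewrite lee_fin exprn_ge0.
  by apply: leb_le => w [Dw fw]; split=> //; exact: gen_scaled_sub fw.
rewrite leb_scaled//.
rewrite cancel_q -ge0_integralZl//; last by rewrite lee_fin exprn_ge0.
apply: ge0_le_integral => //.
- by move=> u _; rewrite lee_fin kap_ge0.
- by apply: measurable_funeM.
- by move=> u Du; rewrite -kapE; exact: fiber_le_gen.
Qed.

End OneCell.

Section Limit.

Let qk (k : nat) : R := 1 + k.+1%:R^-1.
Let qk1 k : 1 < qk k. Proof. by rewrite ltrDl invr_gt0. Qed.
Let qk0 k : 0 < qk k. Proof. exact: lt_trans (qk1 k). Qed.

Let qk_cvg : qk k - 1 @[k --> \oo] --> (0 : R).
Proof.
apply: cvg_trans (@cvg_harmonic R); apply: near_eq_cvg; near=> k.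
by rewrite /qk addrC addKr.
Unshelve. all: by end_near. Qed.

Let qkn_cvg : qk k ^+ n @[k --> \oo] --> (1 : R).
Proof.
have h : qk k @[k --> \oo] --> (1 : R).
  rewrite -[X in _ --> X]add0r; apply: (@cvg_trans _ ((fun k => (qk k - 1) + 1) @ \oo)).
    by apply: near_eq_cvg; near=> k; rewrite subrK.
  by apply: cvgD; [exact: qk_cvg|exact: cvg_cst].
by have := cvg_comp _ _ h (@exprn_continuous R n 1); rewrite expr1n.
Unshelve. all: by end_near. Qed.

Let cellT := {p : nat & ((forall i, V i -> 'I_p.+1) * (forall i, 'I_p.+1 -> V i))%type}.

Let cells_seq : exists s : nat -> cellT, forall k, is_cells hN (qk k) (projT2 (s k)).1 (projT2 (s k)).2.
Proof.
suff h k : exists s : cellT, is_cells hN (qk k) (projT2 s).1 (projT2 s).2 by have [s hs] := choice h; exists s.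
by have [p [phi [x h]]] := cells_exist hN B_smooth (qk1 k); exists (existT _ p (phi, x)).
Qed.

(** The fiber contains and is contained in dilates of zonotopes whose volumes are Riemann sums of
    [kap]. The dilations tend to 1 and the sums converge by [riem_cvg]. *)
Lemma leb_fiber u : leb (fiber u) = (kap u)%:E.
Proof.
have [s sP] := cells_seq.
pose L k : R := n`!%:R^-1 * \sum_(a : {ffun 'I_n -> 'I_n}) (\prod_r lambda (a r)) * riemA ev hN c (projT2 (s k)).1 (projT2 (s k)).2 a u.
have LE k : leb (zonI (gen (projT2 (s k)).1 (projT2 (s k)).2 ^~ u)) = (L k)%:E by exact: leb_gen.
have L_cvg : L k @[k --> \oo] --> kap u.
  apply: cvgM; first exact: cvg_cst.
  apply: (cvg_big (@add_continuous R)) => a _; apply: cvgM; first exact: cvg_cst.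
  have [||||fd] := @riem_cvg R n X (fun r => V (a r)) (fun r => ev (a r)) (fun r => @N (a r)) (fun r => hN (a r)) c u
    (fun k => projT1 (s k)) (fun k r => (projT2 (s k)).1 (a r)) (fun k r => (projT2 (s k)).2 (a r)) (fun k => qk k - 1).
  - by move=> k i j; have [h _ _ _ _] := sP k (a i); exact: h.
  - by move=> k i v Sv; have [_ h _ _ _] := sP k (a i); exact: h.
  - exact: qk_cvg.
  - by move=> k i j; have [_ _ h _ _] := sP k (a i); exact: h.
  by rewrite -(fineK fd) => /fine_cvgP[_ h]; exact: h.
have ub k : (leb (fiber u) <= (qk k ^+ n * L k)%:E)%E.
  by rewrite EFinM -LE; exact: (fiber_le_gen (qk0 k) (sP k)).
have lb k : ((L k)%:E <= (qk k ^+ n)%:E * leb (fiber u))%E.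
  by rewrite -LE; exact: (gen_le_fiber (qk0 k) (sP k)).
have ff : leb (fiber u) \is a fin_num.
  by rewrite ge0_fin_numE//; exact: le_lt_trans (ub 0%N) (ltry _).
rewrite -(fineK ff); congr EFin; apply/eqP; rewrite eq_le; apply/andP; split.
  have hc : qk k ^+ n * L k @[k --> \oo] --> 1 * kap u by apply: cvgM; [exact: qkn_cvg|exact: L_cvg].
  rewrite -[leRHS]mul1r; apply: (cvgr_to_ge hc).
  by near=> k; rewrite -lee_fin fineK.
have hd : qk k ^+ n * fine (leb (fiber u)) - L k @[k --> \oo] --> 1 * fine (leb (fiber u)) - kap u.
  by apply: cvgB L_cvg; apply: cvgM; [exact: qkn_cvg|exact: cvg_cst].
rewrite -[leRHS]mul1r -subr_ge0; apply: (cvgr_to_ge hd).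
by near=> k; rewrite subr_ge0 -lee_fin [leRHS]EFinM fineK.
Unshelve. all: by end_near. Qed.

(* [leb] is an outer measure, so the graph of the fibers need not be measurable:
   it lies between the graphs of two families of zonotopes. *)
Lemma leb_fgraph (D : set (borelR n)) : measurable D -> D `<=` Om ->
  leb (fgraph D) = (\int[@leb R n]_(u in D) (kap u)%:E)%E.
Proof.
move=> mD DO; apply/eqP; rewrite eq_le; apply/andP; split.
  apply: (@lee_exp_limit R (n + n)) => [|q q1]; first by apply: integral_ge0 => u _; rewrite lee_fin kap_ge0.
  have [p [phi [x h]]] := cells_exist hN B_smooth q1.
  by apply: (fgraph_le (lt_trans ltr01 q1) h leb_fiber).
apply: (@lee_exp_limit R (n + n)) => [|q q1]; first exact: measure_ge0.
have [p [phi [x h]]] := cells_exist hN B_smooth q1.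
by apply: (fgraph_ge (lt_trans ltr01 q1) h leb_fiber).
Qed.

End Limit.
End FiberVolume.

(** * From charts to the manifold *)

Lemma counting_modular (R : realType) (T : choiceType) (A B : set T) :
  (counting (A `|` B) + counting (A `&` B) = counting A + counting B :> \bar R)%E.
Proof.
have inf C (x : \bar R) : ~ finite_set C -> (0 <= x)%E -> (counting C + x = +oo)%E.
  by move=> iC x0; rewrite /counting asboolF//= addye// gt_eqF// (lt_le_trans _ x0)// ltNy0.
have [fA|iA] := pselect (finite_set A); last first.
  rewrite !inf//; try exact: counting_ge0.
  by move=> /(sub_finite_set (@subsetUl _ A B)).
have [fB|iB] := pselect (finite_set B); last first.
  rewrite [RHS]addeC !inf//; try exact: counting_ge0.
  by move=> /(sub_finite_set (@subsetUr _ A B)).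
rewrite /counting !asboolT//; last 2 first.
- by apply: sub_finite_set fA; exact: subIsetl.
- by rewrite finite_setU.
by rewrite fset_setU// fset_setI// -!EFinD -!natrD finmap.cardfsUI.
Qed.

Lemma fin_cancel (R : realType) (x y a b : \bar R) : a \is a fin_num -> (x + a = y + (a + b))%E -> (x = y + b)%E.
Proof. by move=> fa h; rewrite -[LHS](@addeK _ a x fa) h [(a + b)%E]addeC addeA (@addeK _ a (y + b)%E fa). Qed.

Section Global.
Context {R : realType} {n : nat} (X : manifold R n) (V : 'I_n -> vectType R)
  (ev : forall i : 'I_n, {linear V i -> (X -> R^o)}) (N : forall i, V i -> R).
Hypotheses (hN : forall i, is_norm (@N i)) (ev_smooth : forall (i : 'I_n) (v : V i), smooth_fun (ev i v)).
Arguments ev_smooth : clear implicits.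
Local Notation delta := (@delta R n X V ev N hN).

(** The factor 2^n undoes the normalization of the natural measures, so that in a chart [tot] is the
    integral of [delta]. *)
Definition tot (D : set X) : \bar R := ((2 ^+ n)%:E * average_solutions ev N D)%E.
Definition nu c (D : set X) : \bar R := (\int[@leb R n]_(u in cimg c D) delta c u)%E.

Let cancel2 (x : \bar R) : ((2 ^+ n)%:E * ((2 ^- n)%:E * x) = x)%E.
Proof. by rewrite muleA -EFinM divff ?mul1e// expf_neq0. Qed.

Lemma tot_chart c D : open D -> D `<=` cdom c -> tot D = nu c D.
Proof. by move=> oD Dc; rewrite /tot (average_chart ev_smooth hN oD Dc) cancel2. Qed.

Let mu : {measure set (hypsT V) -> \bar R} := pushm (sphp hN \x @leb R n)%E (@measurable_hyps R n V).
Let nb D (H : hypsT V) : \bar R := nb_solutions ev D H.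

Let totE D : open D -> tot D = (\int[mu]_(H in @AGs R n V) nb D H)%E.
Proof.
move=> oD; rewrite /tot (average_push ev_smooth hN oD) cancel2.
have mn : measurable_fun setT (nb D \_ (@AGs R n V)).
  by apply: (measurable_restrictT _ (@measurable_AGs R n V)).1; exact: (measurable_nb ev_smooth oD).
have n0 H : (0 <= (nb D \_ (@AGs R n V)) H)%E by rewrite patchE; case: ifP => // _; exact: counting_ge0.
rewrite [RHS]integral_mkcond [RHS]ge0_integral_pushforward//; last exact: measurable_hyps.
have mh := measurableT_comp mn (@measurable_hyps R n V).
by rewrite [RHS](@fubini_tonelli1 _ _ _ _ R (sphp hN) (@leb R n) _ mh)//; move=> p; exact: n0.
Qed.

Let mnb D : open D -> measurable_fun (@AGs R n V) (nb D).
Proof. by move=> oD; exact: (measurable_nb ev_smooth oD). Qed.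

Let nb_ge0 D H : (0 <= nb D H)%E. Proof. exact: counting_ge0. Qed.

Lemma tot_ge0 D : open D -> (0 <= tot D)%E.
Proof. by move=> oD; rewrite totE//; apply: integral_ge0 => H _; exact: nb_ge0. Qed.

(** Inclusion-exclusion holds for counts, also infinite ones. The proof is given for open sets, for
    which the number of solutions is known to be measurable. *)
Lemma tot_modular A B : open A -> open B -> (tot (A `|` B) + tot (A `&` B) = tot A + tot B)%E.
Proof.
move=> oA oB; have oU := openU oA oB; have oI := openI oA oB.
have sumE C D : open C -> open D -> (tot C + tot D = \int[mu]_(H in @AGs R n V) (nb C H + nb D H))%E.
  move=> oC oD; rewrite totE// totE//; apply/esym; apply: ge0_integralD.
  - exact: measurable_AGs.
  - by move=> H _; exact: nb_ge0.
  - exact: mnb.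
  - by move=> H _; exact: nb_ge0.
  - exact: mnb.
rewrite (sumE _ _ oU oI) (sumE _ _ oA oB); apply: eq_integral => H _; rewrite /nb /nb_solutions setIUl setIIl.
exact: counting_modular.
Qed.

Lemma le_tot A B : open A -> open B -> A `<=` B -> (tot A <= tot B)%E.
Proof.
move=> oA oB AB; rewrite !totE//; apply: ge0_le_integral => //.
- exact: measurable_AGs.
- exact: mnb.
- exact: mnb.
- by move=> H _; apply: le_counting; exact: setSI.
Qed.

Lemma tot_setU A B : open A -> open B -> (tot (A `|` B) <= tot A + tot B)%E.
Proof.
move=> oA oB; rewrite -tot_modular// leeDl//; exact: tot_ge0 (openI oA oB).
Qed.

Lemma tot0 : tot set0 = 0%E.
Proof.
rewrite totE; last exact: open0.
by rewrite integral0_eq// => H _; rewrite /nb /nb_solutions set0I /counting asboolT// fset_set0.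
Qed.

(** Finitely many solutions in the union already lie in one [W k], so the counts increase to the
    count of the union and monotone convergence applies. *)
Lemma tot_cvg (W : nat -> set X) : (forall k, open (W k)) -> {homo W : i j / (i <= j)%N >-> i `<=` j} ->
  tot (W k) @[k --> \oo] --> tot (\bigcup_k W k).
Proof.
move=> oW hW; have oU : open (\bigcup_k W k) by exact: bigcup_open.
have h := @cvg_monotone_convergence _ (hypsT V) R mu (@AGs R n V) (@measurable_AGs R n V) (fun k => nb (W k))
  (fun k => mnb (oW k)) (fun k H _ => nb_ge0 (W k) H) _.
rewrite totE//; have -> : (\int[mu]_(H in @AGs R n V) nb (\bigcup_k W k) H = \int[mu]_(H in @AGs R n V) limn (fun k => nb (W k) H))%E.
  apply: eq_integral => H _; apply/esym/cvg_lim => //.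
  apply: cvg_trans; first apply: (@ereal_nondecreasing_cvgn R (fun k => nb (W k) H)).
    by move=> i j ij; apply: le_counting; apply: setSI; exact: hW.
  suff -> : ereal_sup (range (fun k => nb (W k) H)) = nb (\bigcup_k W k) H by [].
  apply/eqP; rewrite eq_le; apply/andP; split.
    by apply: ge_ereal_sup => _ [k _ <-]; apply: le_counting; apply: setSI; exact: bigcup_sup.
  apply: counting_le => M /counting_geP[p [pinj pW]].
  have [k kP] : exists k, forall i, W k (p i).
    have hk i : exists k, W k (p i) by have [[k _ Wk] _] := pW i; exists k.
    have [k kP] := choice hk; exists (\max_i k i)%N => i; apply: (hW (k i)) => //; exact: (leq_bigmax i).
  apply: (@le_trans _ _ (nb (W k) H)); last by apply: ereal_sup_ubound; exists k.
  by apply/counting_geP; exists p; split=> // i; split=> //; have [] := pW i.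
apply: cvg_trans (h _) => //.
  by apply: near_eq_cvg; near=> k; rewrite totE.
by move=> H _ i j ij; apply: le_counting; apply: setSI; exact: hW.
Unshelve. all: by end_near. Qed.

(** The derivatives are continuous in [u] and the spheres bounded, so near [u] all entries of the
    system matrix have a common bound, and so has the determinant. *)
Lemma delta_bounded c u : (cmap c @` cdom c) u -> exists B : R, \forall u' \near u, (delta c u' <= B%:E)%E.
Proof.
move=> Ou; have [C CP] := choice (fun i => let: ex_intro2 C C0 HC := sphere_bounded (hN i) in ex_intro (fun C => 0 < C /\ _) C (conj C0 HC)).
pose e i b j : R := `|Dmx ev i c u b j| + 1.
pose G : R := \sum_i \sum_j \sum_b C i * e i b j.
have e0 i b j : 0 <= e i b j by rewrite addr_ge0.
have C0 i : 0 <= C i by rewrite ltW//; have [] := CP i.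
pose B := n`!%:R * G ^+ n * fine (sphp hN setT).
exists B; have : \forall u' \near u, forall i b j, `|Dmx ev i c u' b j| <= e i b j.
  apply: (@filter_forall _ _ _ (nbhs u) (nbhs_filter u)) => i.
  apply: (@filter_forall _ _ _ (nbhs u) (nbhs_filter u)) => b.
  apply: (@filter_forall _ _ _ (nbhs u) (nbhs_filter u)) => j.
  have cD0 : {for u, continuous (fun u => Dmx ev i c u b j)} by exact: Dmx_continuous.
  have cD := @continuous_norm_at R _ R^o (fun u => Dmx ev i c u b j) u cD0.
  have /cvgrPdist_lt/(_ 1 ltr01) := cD; apply: filterS => u'; rewrite /e distrC => /ltr_normlW; lra.
apply: filterS => u' hu'.
have fT : sphp hN setT \is a fin_num by rewrite ge0_fin_numE// sphp_setT.
rewrite /B EFinM fineK// -(@integral_cst _ (frames V) R (sphp hN) setT measurableT) deltaE.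
apply: ae_ge0_le_integral => //.
- exact: measurable_sysrow.
- by move=> f _; rewrite lee_fin mulr_ge0// exprn_ge0// sumr_ge0// => i _; rewrite sumr_ge0// => j _; rewrite sumr_ge0// => b _; rewrite mulr_ge0.
have [A [mA A0 hA]] := sphp_ae hN; exists A; split=> //; apply: subset_trans hA.
apply: subsetC => f Sf _; rewrite lee_fin; apply: det_bound => i j.
rewrite mxE mxE; apply: (le_trans (ler_norm_sum _ _ _)).
apply: (@le_trans _ _ (\sum_b C i * e i b j)).
  apply: ler_sum => b _; rewrite normrM ler_pM//; apply: le_trans (le_coord_norm _ _ _) _.
  by have [_] := CP i; apply; exact: Sf.
rewrite /G (bigD1 i)//= (bigD1 j)//= -!addrA lerDl addr_ge0//.
  by apply: sumr_ge0 => j' _; apply: sumr_ge0 => b _; rewrite mulr_ge0.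
by apply: sumr_ge0 => i' _; apply: sumr_ge0 => j' _; apply: sumr_ge0 => b _; rewrite mulr_ge0.
Qed.

Lemma tot_locally_finite (x : X) : exists W, [/\ open W, W x & (tot W < +oo)%E].
Proof.
have [c cx] := cdom_cover x; pose u := cmap c x.
have Ou : (cmap c @` cdom c) u by exists x.
have [B] := delta_bounded Ou => /nbhs_ballP[r /= r0 hB].
pose b := ball u (Num.min r 1).
have r10 : 0 < Num.min r 1 by rewrite lt_min r0 ltr01.
pose W := cdom c `&` cmap c @^-1` b.
have oW : open W.
  rewrite openE => y [cy By]; apply: filterI; first by apply: open_nbhs_nbhs; split=> //; exact: cdom_open.
  apply: (cmap_continuous cy); apply: open_nbhs_nbhs; split=> //; exact: ball_open.
have Wc : W `<=` cdom c by exact: subIsetl.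
have Wb : cimg c W `<=` b by move=> v [[y cy <-]]; rewrite /preimage /= cmapK// => -[].
exists W; split=> //; first by split=> //; exact: ballxx.
have mW : measurable (cimg c W : set (borelR n)) by apply: borel_open; exact: open_cimg.
rewrite (tot_chart oW Wc) /nu.
apply: (@le_lt_trans _ _ (\int[@leb R n]_(u in cimg c W) (Num.max B 0)%:E)%E).
  apply: ge0_le_integral => //.
  - by move=> v _; exact: delta_ge0.
  - apply: measurable_delta => //; first exact: open_cimg.
    by move=> v [].
  - move=> v /Wb vb; apply: (@le_trans _ _ B%:E); last by rewrite lee_fin le_max lexx.
    by apply: hB; apply: le_ball vb; rewrite ge_min lexx.
rewrite integral_cst// lte_mul_pinfty//; first by rewrite lee_fin le_max lexx orbT.
apply: (@leb_bounded R n _ (`|u| + 1)) => // v /Wb; rewrite /b -ball_normE /= => uv.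
have := ler_normB (u - v) u; rewrite addrAC subrr sub0r normrN => h.
apply: (le_trans h); rewrite addrC lerD2l ltW//; apply: (lt_le_trans uv); by rewrite ge_min lexx orbT.
Qed.

(** The closure of [U] is covered by finitely many open sets of finite [tot], and [tot] is
    subadditive on open sets. *)
Lemma tot_finite U : open U -> compact (closure U) -> (tot U < +oo)%E.
Proof.
move=> oU /compact_near_coveringP cU.
have [W WP] := choice tot_locally_finite.
pose G (l : seq X) : set X := [set y | exists2 x, x \in l & W x y].
have GP l : open (G l) /\ (tot (G l) < +oo)%E.
  elim: l => [|x l [oG tG]].
    by rewrite (_ : G [::] = set0) ?tot0; [split=> //; exact: open0|apply/seteqP; split=> // y []].
  have [oW _ tW] := WP x.
  have -> : G (x :: l) = W x `|` G l.
    apply/seteqP; split=> [y [z]|y [Wy|[z zl Wz]]].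
    - by rewrite inE => /orP[/eqP ->|zl] Wz; [left|right; exists z].
    - by exists x; rewrite // inE eqxx.
    - by exists z; rewrite // inE zl orbT.
  split; first exact: openU.
  by apply: le_lt_trans (tot_setU oW oG) _; exact: lte_add_pinfty.
(* Compactness as near covering, along the finite families ordered by inclusion. *)
pose F : set_system (seq X) := [set A | exists l0 : seq X, forall l : seq X, {subset l0 <= l} -> A l].
have FF : Filter F.
  split; first by exists [::].
  - move=> A B [a aA] [b bB]; exists (a ++ b) => l h; split; [apply: aA|apply: bB] => x xl; apply: h;
      by rewrite mem_cat xl ?orbT.
  - by move=> A B AB [a aA]; exists a => l /aA/AB.
have [|l0 hl0] := cU _ F (fun l y => G l y) FF.
  move=> x _; have [oW Wx _] := WP x.
  exists (W x, [set l : seq X | x \in l]) => /=.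
    split; first by apply: open_nbhs_nbhs; split.
    by exists [:: x] => l; apply; rewrite inE.
  by move=> [y l] [/= Wy xl]; exists x.
have [oG tG] := GP l0.
apply: le_lt_trans tG; apply: le_tot => // y /subset_closure Uy.
exact: (hl0 l0).
Qed.

Lemma measurable_cimg c (D : set X) : <<s @open X >> D -> measurable (cimg c D : set (borelR n)).
Proof.
pose C := [set D : set X | measurable (cimg c D : set (borelR n))].
have oO : open (cmap c @` cdom c) by exact: cmap_open.
suff : <<s @open X >> `<=` C by apply.
apply: smallest_sub; last by move=> A oA; apply: borel_open; exact: open_cimg.
split.
- by rewrite /C /= /cimg preimage_set0 setI0.
- move=> A mA; rewrite /C /= (_ : cimg c _ = (cmap c @` cdom c) `\` cimg c A).
    by apply: measurableD => //; exact: borel_open.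
  apply/seteqP; split=> [u [cu [_ h]]|u [cu h]]; first by split=> // -[].
  by split=> //; split=> // h'; apply: h.
- move=> F mF; rewrite /C /= /cimg preimage_bigcup setI_bigcupr; apply: bigcup_measurable => k _; exact: mF.
Qed.

(** The integrals [nu] involve only chart images, so measurability is required of these. *)
Definition bor (D : set X) := forall c, measurable (cimg c D : set (borelR n)).

Lemma bor_sigma D : <<s @open X >> D -> bor D.
Proof. by move=> mD c; exact: measurable_cimg. Qed.

Lemma bor_open D : open D -> bor D.
Proof. by move=> oD c; apply: borel_open; exact: open_cimg. Qed.

Lemma borI A B : bor A -> bor B -> bor (A `&` B).
Proof.
move=> mA mB c; rewrite (_ : cimg c _ = cimg c A `&` cimg c B); first exact: measurableI.
by rewrite /cimg preimage_setI setIIr.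
Qed.

Lemma borD A B : bor A -> bor B -> bor (A `\` B).
Proof.
move=> mA mB c; rewrite (_ : cimg c _ = cimg c A `\` cimg c B); first exact: measurableD.
apply/seteqP; split=> [u [cu [Au Bu]]|u [[cu Au] Bu]]; first by split=> // -[].
by split=> //; split=> // h; apply: Bu.
Qed.

Let mdelta c D : bor D -> measurable_fun (cimg c D : set (borelR n)) (delta c).
Proof.
move=> mD; have h := measurable_delta ev_smooth hN (@cmap_open _ _ X c) (@subset_refl _ _).
by apply: measurable_funS h; [apply: borel_open; exact: cmap_open|move=> u []].
Qed.

Lemma nu_ge0 c D : (0 <= nu c D)%E.
Proof. by apply: integral_ge0 => u _; exact: delta_ge0. Qed.

Let cimg_disj c (A B : set X) : A `&` B = set0 -> cimg c A `&` cimg c B = set0 :> set 'rV[R]_n.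
Proof.
move=> AB; apply/seteqP; split=> // u [[_ Au] [_ Bu]].
by have : set0 (@cinv _ _ X c u) by rewrite -[set0]AB.
Qed.

Lemma nu_bigcup c (F : nat -> set X) : (forall k, bor (F k)) -> trivIset setT F -> bor (\bigcup_k F k) ->
  nu c (\bigcup_k F k) = (\big[+%E/0]_(0 <= k <oo) nu c (F k))%E.
Proof.
move=> mF tF mUF; have E : cimg c (\bigcup_k F k) = \bigcup_k cimg c (F k).
  by rewrite /cimg preimage_bigcup setI_bigcupr.
rewrite /nu E ge0_integral_bigcup//; first by move=> k; exact: mF.
- by rewrite -E; exact: mdelta.
- by move=> u _; exact: delta_ge0.
- apply/trivIsetP => i j _ _ ij; apply: cimg_disj.
  by have /trivIsetP/(_ i j Logic.I Logic.I ij) := tF.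
Qed.

Lemma nu_bigU_le c p (F : 'I_p -> set X) E : (forall k, bor (F k)) -> trivIset setT F -> bor E ->
  (forall k, F k `<=` E) -> (\sum_k nu c (F k) <= nu c E)%E.
Proof.
move=> mF tF mE FE.
pose G k : set (borelR n) := cimg c (F k).
have mG k : measurable (G k) by exact: mF.
have GE : \big[setU/set0]_(k <- index_enum 'I_p) G k `<=` cimg c E.
  by elim/big_ind: _ => [//|A B sA sB u [/sA|/sB]//|k _ u [cu Fu]]; split=> //; exact: (FE k).
have tG : trivIset [set` index_enum 'I_p] G.
  apply/trivIsetP => i j _ _ ij; apply: cimg_disj.
  by have /trivIsetP/(_ i j Logic.I Logic.I ij) := tF.
rewrite -[leLHS](@ge0_integral_bigsetU _ _ R (@leb R n) _ G (delta c) (index_enum 'I_p) mG (index_enum_uniq _) tG).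
- apply: ge0_subset_integral => //; first by apply: bigsetU_measurable => k _.
    exact: mdelta.
  by move=> u _; exact: delta_ge0.
- apply: measurable_funS GE (mdelta mE); exact: mE.
- by move=> u _; exact: delta_ge0.
Qed.

Lemma nu_setU c A B : bor A -> bor B -> bor (A `|` B) -> A `&` B = set0 -> nu c (A `|` B) = (nu c A + nu c B)%E.
Proof.
move=> mA mB mAB AB.
have E : cimg c (A `|` B) = cimg c A `|` cimg c B by rewrite /cimg preimage_setU setIUr.
rewrite /nu E ge0_integral_setU//; try exact: mA; try exact: mB.
- by rewrite -E; exact: mdelta.
- by move=> u _; exact: delta_ge0.
- by have h := cimg_disj c AB; apply/disj_setPS => u; rewrite h.
Qed.

(* In the coordinates of [c], both sides come from finite measures that coincide
   with [tot] on open sets. *)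
Lemma nu_consistent U c c' D : open U -> (tot U < +oo)%E -> bor D -> D `<=` U -> D `<=` cdom c -> D `<=` cdom c' ->
  nu c D = nu c' D.
Proof.
move=> oU tU mD DU Dc Dc'.
pose W := U `&` cdom c `&` cdom c'.
have oW : open W by apply: openI; [apply: openI => //; exact: cdom_open|exact: cdom_open].
have mW := bor_open oW.
pose tau := cmap c \o @cinv _ _ X c'.
have ctau u : cimg c' W u -> {for u, continuous tau}.
  move=> [cu Wu]; apply: continuous_comp; first exact: cinv_continuous.
  by apply: cmap_continuous; have [[]] := Wu.
have oW' : open (cimg c' W) by exact: open_cimg.
have mtau : measurable_fun (cimg c' W : set (borelR n)) (tau : borelR n -> borelR n).
  exact: measurable_fun_cont_row.
pose m1 := dpush (@leb R n) (mW c) (mdelta mW) (fun u => delta_ge0 ev hN c u) (@measurable_id _ (borelR n) (cimg c W)).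
pose m2 := dpush (@leb R n) (mW c') (mdelta mW) (fun u => delta_ge0 ev hN c' u) mtau.
have pieceE A : cimg c W `&` id @^-1` A = cimg c (W `&` cmap c @^-1` A) /\
                cimg c' W `&` tau @^-1` A = cimg c' (W `&` cmap c @^-1` A).
  split; apply/seteqP; split=> [u [[cu Wu] Au]|u [cu [Wu Au]]].
  - split=> //; split=> //; rewrite /preimage /=; have [x cx xu] := cu.
    by rewrite -xu cmapK// xu.
  - split=> //; move: Au; rewrite /preimage /=; have [x cx xu] := cu.
    by rewrite -xu cmapK// xu.
  - by split.
  - by split.
have m12 A : open A -> m1 A = m2 A.
  move=> oA; have [E1 E2] := pieceE A.
  have oWA : open (W `&` cmap c @^-1` A).
    rewrite openE => x [Wx Ax]; apply: filterI; first exact: open_nbhs_nbhs.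
    by apply: (cmap_continuous (Wx.1.2)); exact: open_nbhs_nbhs.
  transitivity (tot (W `&` cmap c @^-1` A)).
    by rewrite (@tot_chart c)//; [rewrite /m1 /dpush E1|move=> x [[[]]]].
  by rewrite (@tot_chart c')//; [rewrite /m2 /dpush E2|move=> x [[[]]]].
have fin : (m1 setT < +oo)%E.
  rewrite /m1 /dpush preimage_setT setIT -/(nu c W) -(@tot_chart c)//; last by move=> x [[]].
  by apply: le_lt_trans tU; apply: le_tot => // x [[]].
have : m1 (cimg c D) = m2 (cimg c D) := borel_unique fin m12 (mD c).
rewrite /m1 /m2 /dpush.
have DW : D `<=` W by move=> x Dx; split; [split; [exact: DU|exact: Dc]|exact: Dc'].
have -> : cimg c W `&` id @^-1` cimg c D = cimg c D.
  by apply/seteqP; split=> [u []//|u [cu Du]]; split=> //; split=> //; exact: DW.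
have -> : cimg c' W `&` tau @^-1` cimg c D = cimg c' D.
  apply/seteqP; split=> [u [[cu Wu] [_ Du]]|u [cu Du]].
    split=> //; move: Du; rewrite /preimage /tau /= cmapK//; by have [[]] := Wu.
  split; first by split=> //; exact: DW.
  have dD : cdom c (@cinv _ _ X c' u) by exact: Dc.
  by split; [exists (@cinv _ _ X c' u)|rewrite /preimage /tau /= cmapK].
by [].
Qed.

(** * Disjoint pieces of a countable atlas *)

Section Atlas.
Variables (Wl : nat -> set X) (cl : nat -> chart X).
Hypotheses (oWl : forall k, open (Wl k)) (Wlc : forall k, Wl k `<=` cdom (cl k)) (WlT : \bigcup_k Wl k = setT).

Let ol m : set X := \big[setU/set0]_(l < m) Wl l.

Let ool m : open (ol m).
Proof. by rewrite /ol; elim/big_ind: _ => [|A B oA oB|l _]; [exact: open0|exact: openU|exact: oWl]. Qed.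

Let seqDUE m : seqDU Wl m = Wl m `\` ol m. Proof. by []. Qed.

Lemma bor_atlas m : bor (seqDU Wl m).
Proof. by rewrite seqDUE; apply: borD; exact: bor_open. Qed.

Variables (U : set X) (oU : open U) (fU : (tot U < +oo)%E).

(** Adding the open set [Wl m] changes [tot] by inclusion-exclusion. In the chart [cl m], the new
    open set splits into the overlap with the earlier ones and the new disjoint piece. *)
Lemma tot_partial m : tot (U `&` ol m) = (\sum_(l < m) nu (cl l) (U `&` seqDU Wl l))%E.
Proof.
elim: m => [|m IH]; first by rewrite /ol !big_ord0 setI0 tot0.
have oA : open (U `&` ol m) by exact: openI.
have oB : open (U `&` Wl m) by exact: openI.
have E : U `&` ol m.+1 = (U `&` ol m) `|` (U `&` Wl m) by rewrite /ol big_ord_recr/= setIUr.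
have := tot_modular oA oB; rewrite -E big_ord_recr/= -IH.
have oI := openI oA oB.
have Bc : U `&` Wl m `<=` cdom (cl m) by move=> x [_ /Wlc].
rewrite [tot (U `&` Wl m)](tot_chart oB Bc).
have -> : U `&` Wl m = (U `&` ol m `&` (U `&` Wl m)) `|` (U `&` seqDU Wl m).
  rewrite seqDUE; apply/seteqP; split=> [x [Ux Wx]|x [[[Ux _] [_ Wx]]|[Ux [Wx _]]]] //.
  by have [ox|nx] := pselect (ol m x); [left|right].
rewrite nu_setU; last 4 first.
- exact: bor_open.
- by apply: borI; [exact: bor_open|exact: bor_atlas].
- rewrite (_ : _ `|` _ = U `&` Wl m); first exact: bor_open.
  rewrite seqDUE; apply/seteqP; split=> [x [[[Ux _] [_ Wx]]|[Ux [Wx _]]]|x [Ux Wx]] //.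
  by have [ox|nx] := pselect (ol m x); [left|right].
- by apply/seteqP; split=> // x [[[_ ox] _] [_ [_ nx]]]; apply: nx.
have Ic : U `&` ol m `&` (U `&` Wl m) `<=` cdom (cl m) by move=> x [_ [_ /Wlc]].
rewrite [X in (_ + X)%E = _](_ : _ = nu (cl m) (U `&` ol m `&` (U `&` Wl m))); last first.
  rewrite (@tot_chart (cl m))//.
    congr nu; rewrite seqDUE; apply/seteqP; split=> [x [[Ux ox] [[[_ _] [_ Wx]]|[_ [Wx _]]]]|x [[Ux ox] [_ Wx]]] //.
    by split=> //; left.
  - apply: openI => //; rewrite (_ : _ `|` _ = U `&` Wl m)//.
    rewrite seqDUE; apply/seteqP; split=> [x [[[Ux _] [_ Wx]]|[Ux [Wx _]]]|x [Ux Wx]] //.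
    by have [ox|nx] := pselect (ol m x); [left|right].
  - move=> x [_ [[_ [_ /Wlc]]|[_ [/Wlc]]]]; by [].
(* [a] is the overlap; it is finite because [tot U] is, and can be cancelled on both sides. *)
set a := nu _ _; set b := nu _ _ => h.
have fa : a \is a fin_num.
  rewrite /a -(@tot_chart (cl m))// ge0_fin_numE ?tot_ge0//.
  by apply: le_lt_trans fU; apply: le_tot => // x [[]].
exact: fin_cancel fa h.
Qed.

Lemma tot_partial_cvg : tot (U `&` ol m) @[m --> \oo] --> tot U.
Proof.
rewrite [X in _ --> tot X](_ : U = \bigcup_m (U `&` ol m)).
  apply: tot_cvg => [m|i j ij]; first exact: openI.
  apply: setIS; exact: subset_bigsetU.
rewrite -setI_bigcupr (_ : \bigcup_m ol m = setT) ?setIT//.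
apply/seteqP; split=> // x _; have : setT x by []. rewrite -WlT => -[k _ Wx].
by exists k.+1 => //; rewrite /ol big_ord_recr; right.
Qed.

Lemma tot_total : tot U = (\big[+%E/0]_(0 <= l <oo) nu (cl l) (U `&` seqDU Wl l))%E.
Proof.
apply/esym/cvg_lim => //; apply: cvg_trans tot_partial_cvg; apply: near_eq_cvg; near=> m.
by rewrite tot_partial big_mkord.
Unshelve. all: by end_near. Qed.

(** The given pieces are refined by the atlas. On each refined piece the chart can be changed by
    [nu_consistent], and for a fixed member of the atlas the refined pieces are disjoint. *)
Lemma nu_pieces_le p (c : 'I_p -> chart X) (D : 'I_p -> set X) : (forall j, bor (D j)) ->
  (forall j, D j `<=` cdom (c j)) -> trivIset setT D -> (\sum_j nu (c j) (D j `&` U) <= tot U)%E.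
Proof.
move=> mD Dc tD.
have mDl j l : bor (D j `&` U `&` seqDU Wl l).
  by apply: borI (bor_atlas l); apply: borI => //; exact: bor_open.
have E j : nu (c j) (D j `&` U) = (\big[+%E/0]_(0 <= l <oo) nu (cl l) (D j `&` U `&` seqDU Wl l))%E.
  have DE : D j `&` U = \bigcup_l (D j `&` U `&` seqDU Wl l).
    by rewrite -setI_bigcupr -seqDU_bigcup_eq WlT setIT.
  have tDl : trivIset setT (fun l => D j `&` U `&` seqDU Wl l).
    apply/trivIsetP => a b _ _ ab; have /trivIsetP/(_ a b Logic.I Logic.I ab) := trivIset_seqDU Wl.
    by move=> h; apply/seteqP; split=> // x [[_ xa] [_ xb]]; have : set0 x by rewrite -[set0]h.
  have mU : bor (\bigcup_l (D j `&` U `&` seqDU Wl l)) by rewrite -DE; apply: borI => //; exact: bor_open.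
  have h := @nu_bigcup (c j) _ (mDl j) tDl mU; rewrite -DE in h; rewrite h.
  apply: eq_eseriesr => l _; apply: (nu_consistent oU fU) => //.
  - by move=> x [[]].
  - by move=> x [[/Dc]].
  - by move=> x [_ [/Wlc]].
rewrite (eq_bigr _ (fun j _ => E j)) -nneseries_sum; last by move=> j l _; exact: nu_ge0.
rewrite tot_total; apply: lee_nneseries => [l _ _|l _]; first by apply: sume_ge0 => j _; exact: nu_ge0.
apply: nu_bigU_le => //.
- apply/trivIsetP => a b _ _ ab; have /trivIsetP/(_ a b Logic.I Logic.I ab) := tD.
  by move=> h; apply/seteqP; split=> // x [[[xa _] _] [[xb _] _]]; have : set0 x by rewrite -[set0]h.
- by apply: borI (bor_atlas l); exact: bor_open.
- by move=> j x [[_ Ux] Wx].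
Qed.

End Atlas.
End Global.

(** Basis sets that fit into a chart cover the manifold. The others are replaced by the empty set,
    for which the point [x0] supplies some chart. *)
Lemma atlas_exists (R : realType) n (X : manifold R n) (x0 : X) : exists (Wl : nat -> set X) (cl : nat -> chart X),
  [/\ forall k, open (Wl k), forall k, Wl k `<=` cdom (cl k) & \bigcup_k Wl k = setT].
Proof.
have [E [oE bE]] := basis_enum X; have [c0 c0x] := cdom_cover x0.
have h k : exists wc : set X * chart X, [/\ open wc.1, wc.1 `<=` cdom wc.2 & (exists c, E k `<=` cdom c) -> wc.1 = E k].
  have [[c Ec]|nc] := pselect (exists c, E k `<=` cdom c); first by exists (E k, c); split=> //; exact: oE.
  by exists (set0, c0); split=> //; exact: open0.
have [wc wcP] := choice h; exists (fun k => (wc k).1), (fun k => (wc k).2); split.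
- by move=> k; have [] := wcP k.
- by move=> k; have [] := wcP k.
- apply/seteqP; split=> // x _; have [c cx] := cdom_cover x.
  have [k [kx kc]] := bE x _ (cdom_open c) cx; exists k => //=.
  by have [_ _ ->] := wcP k; [|exists c].
Qed.

(** * Covectors of the bodies in charts *)

Section Covectors.
Context {R : realType} {n : nat} (X : manifold R n) (V : 'I_n -> vectType R)
  (ev : forall i : 'I_n, {linear V i -> (X -> R^o)}).
Hypothesis ev_smooth : forall (i : 'I_n) (v : V i), smooth_fun (ev i v).

Let eps i b : dual (V i) := linfun (dualc (delta_mx b 0)).

Let epsE i b v : @eps i b v = crd v 0 b.
Proof.
rewrite lfunE /= /dualc mxE (bigD1 b)//= big1 => [|k kb]; last by rewrite [delta_mx _ _ _ _]mxE (negPf kb) mulr0.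
by rewrite [delta_mx _ _ _ _]mxE !eqxx mulr1 addr0.
Qed.

Let theta_eps i x : theta (ev i) x = \sum_b ev i (uncrd (delta_mx 0 b)) x *: @eps i b.
Proof.
apply/lfunP => v; rewrite thetaE sum_lfunE {1}[v]uncrd_sum linear_sum fct_sumE; apply: eq_bigr => b _.
by rewrite linearZ /= scale_lfunE epsE; exact: mulrC.
Qed.

(** [theta] is a combination of the constant coordinate forms [eps], with the basis functions as
    coefficients, so it is differentiated coefficientwise. *)
Lemma dtheta_eval i c x j v : cdom c x ->
  (dtheta (ev i) c x (delta_mx 0 j)) v = (crd v *m Dmx ev i c (cmap c x)) 0 j.
Proof.
move=> cx; set w := cmap c x; have Ow : (cmap c @` cdom c) w by exists x.
pose F b : 'rV[R]_n -> R := evc ev (uncrd (delta_mx 0 b) : V i) c.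
have dF b : derivable (F b) w (delta_mx 0 j) by have [] := evc_C1 ev_smooth (uncrd (delta_mx 0 b) : V i) Ow j.
pose G := @crd R (dual (V i)) \o (theta (ev i) \o @cinv _ _ X c).
have GE k : (fun y => G y 0 k) = \sum_b (crd (@eps i b) 0 k *: F b).
  apply/funext => y; rewrite fct_sumE /G /= theta_eps linear_sum summxE; apply: eq_bigr => b _.
  by rewrite linearZ mxE mulrC.
have dG k : derivable (fun y => G y 0 k) w (delta_mx 0 j).
  by rewrite GE; apply: derivable_sum => b; exact: derivableZ.
have [_ DG] := derivable_row dG.
rewrite /dtheta /pdiff -/G DG.
rewrite (_ : \row_k _ = \sum_b 'D_(delta_mx 0 j) (F b) w *: crd (@eps i b)); last first.
  apply/rowP => k; rewrite mxE GE derive_sum => [|b]; last exact: derivableZ.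
  rewrite summxE; apply: eq_bigr => b _; rewrite deriveZ// [RHS]mxE mulrC //.
rewrite linear_sum sum_lfunE [RHS]mxE; apply: eq_bigr => b _.
by rewrite linearZ /= crdK scale_lfunE epsE [Dmx _ _ _ _ _ _]mxE; exact: mulrC.
Qed.

Lemma dtheta_dualE i c x v : cdom c x -> dtheta_dual (ev i) x v c = crd v *m Dmx ev i c (cmap c x).
Proof.
move=> cx; rewrite /dtheta_dual; case: pselect => // h /=; apply/rowP => j.
by rewrite mxE dtheta_eval.
Qed.

Lemma Dmx_transition i c c' x u : cdom c x -> cdom c' x ->
  Dmx ev i c (cmap c x) *m u^T =
  Dmx ev i c' (cmap c' x) *m ('D_u (cmap c' \o @cinv _ _ X c) (cmap c x))^T.
Proof.
move=> cx cx'.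
pose Fm c u : 'rV[R]_(vdim (V i)) := \row_b evc ev (uncrd (delta_mx 0 b) : V i) c u.
have FmC d : C1on (cmap d @` cdom d) (Fm d).
  apply: C1on_row => [|b y Oy k]; first exact: cmap_open.
  rewrite (_ : (fun _ => _) = evc ev (uncrd (delta_mx 0 b) : V i) d); first exact: evc_C1 Oy k.
  by apply/funext => z; rewrite mxE.
have jacE d y : (cmap d @` cdom d) y -> jac (Fm d) y = (Dmx ev i d y)^T.
  move=> Oy; apply/matrixP => k b; have [dF _] := FmC d y Oy k.
  rewrite [LHS]mxE [RHS]mxE [RHS]mxE -(derive_coord b dF).2; congr ('D_ _ _ _).
  by apply/funext => z; rewrite mxE.
pose tau := cmap c' \o @cinv _ _ X c.
pose W := cdom c `&` cdom c'.
have WE : cimg c W = cmap c @` W by apply: cimgE; exact: subIsetl.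
have oW : open (cmap c @` W) by rewrite -WE; apply: open_cimg; apply: openI; exact: cdom_open.
have tC : C1on (cmap c @` W) tau := Cr_C1on (transition_smooth c c' 1%N).
have Ww : (cmap c @` W) (cmap c x) by exists x.
have tw : tau (cmap c x) = cmap c' x by rewrite /tau /= cmapK.
have Ow : (cmap c @` cdom c) (cmap c x) by exists x.
have Ow' : (cmap c' @` cdom c') (tau (cmap c x)) by rewrite tw; exists x.
have h1 : 'D_u (Fm c) (cmap c x) = u *m (Dmx ev i c (cmap c x))^T.
  by rewrite (row_derive u (@cmap_open _ _ X c) Ow (FmC c)) jacE.
have [dt tE] := row_differentiable oW Ww tC.
have [dF FE] := row_differentiable (@cmap_open _ _ X c') Ow' (FmC c').
have h2 : 'D_u (Fm c) (cmap c x) = 'D_u (Fm c' \o tau) (cmap c x).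
  apply: near_eq_derive; have : nbhs (cmap c x) (cmap c @` W) by apply: open_nbhs_nbhs.
  apply: filterS => _ [y [cy cy'] <-]; apply/rowP => b; rewrite !mxE /evc /tau /= cmapK// cmapK//.
have h3 : 'D_u (Fm c' \o tau) (cmap c x) = 'D_u tau (cmap c x) *m (Dmx ev i c' (cmap c' x))^T.
  rewrite deriveE; last exact: differentiable_comp.
  by rewrite (diff_comp dt dF) [LHS]/= FE [LHS]/= -(deriveE _ dt) (jacE _ _ Ow') tw.
by apply: trmx_inj; rewrite !trmx_mul !trmxK -h1 h2 h3.
Qed.

Variables (N : forall i, V i -> R).
Hypotheses (hN : forall i, is_norm (@N i)) (B_smooth : forall i, smooth_convex_body (unit_ball (@N i))).
Variables (lambda : 'I_n -> R) (U : set X).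
Hypothesis l0 : forall i, 0 <= lambda i.
Let E i := bbody (ev i) (symm_norm (@N i)).

Definition piece c (D : set X) : set (borelR (n + n)) :=
  [set row_mx (cmap c z.1) (z.2 c) | z in [set z | U z.1 /\ bsum lambda E z.1 z.2] `&` [set z | D z.1 /\ cotangent z.1 z.2]].

Lemma pieceE c D : D `<=` cdom c -> piece c D = fgraph ev N c lambda (cimg c (D `&` U)).
Proof.
move=> Dc; apply/seteqP; split=> [_ [[x xi] /= [[Ux [zeta [hz ->]]] [Dx _]] <-]|w [[cw [Dw Uw]] [v [Bv vE]]]].
  rewrite /fgraph /= row_mxKl row_mxKr; have cx := Dc _ Dx; split.
    by split; [exists x|rewrite /preimage /= cmapK].
  have hv i : exists v, B_symm (@N i) v /\ zeta i = dtheta_dual (ev i) x v.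
    have [v Bv <-] := hz i; exists v; split=> //.
    by rewrite -(unit_ball_symm_norm (hN i) (B_smooth i)).
  have h i : exists v, B_symm (@N i) v /\ zeta i c = crd v *m Dmx ev i c (cmap c x).
    by have [v [Bv zE]] := hv i; exists v; split=> //; rewrite zE dtheta_dualE.
  exists (fun i => projT1 (cid (h i))); split=> [i|]; first by have [] := projT2 (cid (h i)).
  by apply: eq_bigr => i _; have [_ <-] := projT2 (cid (h i)).
have [x cx xw] := cw.
have ux : @cinv _ _ X c (lsubmx w) = x by rewrite -xw cmapK.
rewrite /preimage /= ux in Dw Uw.
(* The same vectors v_i are used in every chart, so that the components are compatible. *)
pose xi : covector (X := X) := fun c' => \sum_i lambda i *: dtheta_dual (ev i) x (v i) c'.
exists (x, xi); last first.
  rewrite /= xw /xi (eq_bigr (fun i => lambda i *: (crd (v i) *m Dmx ev i c (lsubmx w)))).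
    by rewrite -vE hsubmxK.
  by move=> i _; rewrite dtheta_dualE// xw.
split=> /=; split=> //.
  exists (fun i => dtheta_dual (ev i) x (v i)); split=> // i.
  by exists (v i) => //; rewrite (unit_ball_symm_norm (hN i) (B_smooth i)).
split=> [d nd|d d' dx dx' u]; rewrite /xi.
  rewrite big1// => i _; rewrite /dtheta_dual; case: pselect => // h /=; by rewrite scaler0.
rewrite [LHS]mulmx_suml [RHS]mulmx_suml; apply: eq_bigr => i _; rewrite -[LHS]scalemxAl -[RHS]scalemxAl; congr (_ *: _).
by rewrite !dtheta_dualE// -!mulmxA (Dmx_transition i u dx dx').
Qed.

End Covectors.

Lemma sigma_openD (T : topologicalType) (A B : set T) : open A -> open B -> <<s @open T >> (A `\` B).
Proof.
move=> oA oB; have [_ sC sU] := smallest_sigma_algebra setT (@open T).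
have sO C : open C -> <<s @open T >> C by move=> oC; exact: sub_sigma_algebra.
have -> : A `\` B = setT `\` (setT `\` A `|` B).
  apply/seteqP; split=> [x [Ax Bx]|x [_ h]]; first by split=> // -[[]|].
  by split; [apply: contrapT => nA; apply: h; left|move=> Bx; apply: h; right].
apply: (sC); rewrite -bigcup2E; apply: (sU) => -[|[|k]] /=.
- by apply: (sC); exact: sO.
- exact: sO.
- by apply: sO; exact: open0.
Qed.

(** * Volume of a combination of the bodies *)

Section BodyVolume.
Context {R : realType} {n : nat} (X : manifold R n) (V : 'I_n -> vectType R)
  (ev : forall i : 'I_n, {linear V i -> (X -> R^o)}) (N : forall i, V i -> R).
Hypotheses (ev_smooth : forall (i : 'I_n) (v : V i), smooth_fun (ev i v))
  (hN : forall i, is_norm (@N i)) (B_smooth : forall i, smooth_convex_body (unit_ball (@N i))).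
Variable (U : set X).
Hypotheses (oU : open U) (cU : compact (closure U)).
Let E i := bbody (ev i) (symm_norm (@N i)).

Definition totA (a : {ffun 'I_n -> 'I_n}) (D : set X) : \bar R :=
  @tot R n X (fun r => V (a r)) (fun r => ev (a r)) (fun r => @N (a r)) D.
Definition nuA (a : {ffun 'I_n -> 'I_n}) c (D : set X) : \bar R :=
  @nu R n X (fun r => V (a r)) (fun r => ev (a r)) (fun r => @N (a r)) (fun r => hN (a r)) c D.

Let smA (a : {ffun 'I_n -> 'I_n}) : forall (r : 'I_n) (v : V (a r)), smooth_fun (ev (a r) v).
Proof. by move=> r; exact: ev_smooth. Qed.

Lemma totA_fin a : totA a U \is a fin_num.
Proof.
rewrite ge0_fin_numE; last exact: (tot_ge0 (fun r => hN (a r)) (@smA a) oU).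
exact: (tot_finite (fun r => hN (a r)) (@smA a) oU cU).
Qed.

Variable (lambda : 'I_n -> R).
Hypothesis l0 : forall i, 0 <= lambda i.
Let la (a : {ffun 'I_n -> 'I_n}) : R := n`!%:R^-1 * \prod_r lambda (a r).

Let la_ge0 a : 0 <= la a. Proof. by rewrite mulr_ge0// prodr_ge0. Qed.

Let nuA_ge0 a c D : (0 <= nuA a c D)%E. Proof. exact: nu_ge0. Qed.

Lemma leb_piece c D : bor D -> D `<=` cdom c ->
  leb (piece ev N lambda U c D) = (\sum_a (la a)%:E * nuA a c (D `&` U))%E.
Proof.
move=> mD Dc; rewrite pieceE//.
have mDU : bor (D `&` U) by apply: borI => //; exact: bor_open.
have sub : cimg c (D `&` U) `<=` cmap c @` cdom c by move=> u [].
rewrite (leb_fgraph hN B_smooth ev_smooth l0 (mDU c) sub).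
transitivity (\int[@leb R n]_(u in cimg c (D `&` U)) \sum_a ((la a)%:E * deltaA ev hN c a u))%E.
  apply: eq_integral => u /set_mem/sub Ou; rewrite /kap mulr_sumr -sumEFin; apply: eq_bigr => a _.
  rewrite mulrA EFinM fineK// ge0_fin_numE; last exact: delta_ge0.
  have [B hB] := delta_bounded (fun r => hN (a r)) (@smA a) Ou.
  by apply: le_lt_trans (nbhs_singleton hB) (ltry _).
have md a : measurable_fun (cimg c (D `&` U) : set (borelR n)) (deltaA ev hN c a).
  have h := measurable_delta (@smA a) (fun r => hN (a r)) (@cmap_open _ _ X c) (@subset_refl _ _).
  by apply: measurable_funS h => //; apply: borel_open; exact: cmap_open.
rewrite ge0_integral_sum; last 3 first.
- by [].
- by move=> a; apply: measurable_funeM.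
- by move=> a u _; rewrite mule_ge0 ?lee_fin//; exact: delta_ge0.
- by apply: eq_bigr => a _; rewrite ge0_integralZl//; [move=> u _; exact: delta_ge0|rewrite lee_fin].
Qed.

(** Every finite family of pieces in the supremum is bounded through [nu_pieces_le]. The disjoint
    pieces of an atlas approach the bound, since the partial sums of [tot_partial] converge. *)
Lemma bvol_bsum : bvol U (bsum lambda E) = (\sum_a la a * fine (totA a U))%:E.
Proof.
have totE : (\sum_a la a * fine (totA a U))%:E = (\sum_a (la a)%:E * totA a U)%E.
  by rewrite -sumEFin; apply: eq_bigr => a _; rewrite EFinM fineK// totA_fin.
(* An atlas requires a point; for empty [U] both sides are 0. *)
have [[x0 Ux0]|U0] := pselect (exists x, U x); last first.
  have UE : U = set0 by apply/seteqP; split=> // x Ux; apply: U0; exists x.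
  rewrite totE big1; last first.
    by move=> a _; rewrite /totA UE (tot0 (fun r => hN (a r)) (@smA a)) mule0.
  apply/eqP; rewrite eq_le; apply/andP; split.
    apply: ge_ereal_sup => _ [p [c [D [_ _ ->]]]]; rewrite big1// => j _.
    rewrite [X in leb X](_ : _ = set0) ?measure0//; apply/seteqP; split=> // w [[x xi] [[Ux _] _] _].
    by apply: U0; exists x.
  apply: ereal_sup_ubound; exists 0%N.
  have F : 'I_0 -> False by case.
  exists (fun j => False_rect _ (F j)), (fun j => False_rect _ (F j)); split=> [[]//|[]//|].
  by rewrite big_ord0.
have fT (a : {ffun 'I_n -> 'I_n}) := tot_finite (fun r => hN (a r)) (@smA a) oU cU.
have [Wl [cl [oWl Wlc WlT]]] := atlas_exists x0.
apply/eqP; rewrite eq_le; apply/andP; split.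
  apply: ge_ereal_sup => _ [p [c [D [hD tD ->]]]].
  have mD j : bor (D j) by apply: bor_sigma; have [] := hD j.
  have Dc j : D j `<=` cdom (c j) by have [] := hD j.
  rewrite (eq_bigr (fun j => \sum_a (la a)%:E * nuA a (c j) (D j `&` U))%E); last first.
    by move=> j _; exact: leb_piece.
  rewrite exchange_big /= totE; apply: lee_sum => a _.
  rewrite -ge0_sume_distrr; last by move=> j _; exact: nuA_ge0.
  apply: lee_wpmul2l; first by rewrite lee_fin.
  exact: (nu_pieces_le (fun r => hN (a r)) (@smA a) oWl Wlc WlT oU (fT a) mD Dc tD).
set s := bvol U _.
pose ol m : set X := \big[setU/set0]_(l < m) Wl l.
have le m : (\sum_a (la a)%:E * totA a (U `&` ol m) <= s)%E.
  apply: ereal_sup_ubound; exists m, (fun l => cl l), (fun l => seqDU Wl l); split.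
  - move=> j; split; last by move=> x [/Wlc].
    apply: sigma_openD; first exact: oWl.
    by elim/big_ind: _ => [|A B oA oB|l _]; [exact: open0|exact: openU|exact: oWl].
  - apply/trivIsetP => i j _ _ ij; have /trivIsetP := trivIset_seqDU Wl; exact.
  - rewrite [RHS](eq_bigr (fun j : 'I_m => \sum_a (la a)%:E * nuA a (cl j) (seqDU Wl j `&` U))%E); last first.
      move=> j _; apply: leb_piece; first exact: bor_atlas.
      by move=> x [/Wlc].
    rewrite exchange_big /=; apply: eq_bigr => a _.
    rewrite -ge0_sume_distrr; last by move=> j _; exact: nuA_ge0.
    congr (_ * _)%E; rewrite [LHS](tot_partial (fun r => hN (a r)) (@smA a) oWl Wlc oU (fT a)).
    by apply: eq_bigr => j _; rewrite setIC.
have cv : (\sum_a la a * fine (totA a (U `&` ol m))) @[m --> \oo] --> \sum_a la a * fine (totA a U).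
  apply: (cvg_big (@add_continuous R)) => a _; apply: cvgM; first exact: cvg_cst.
  have := tot_partial_cvg (fun r => hN (a r)) (@smA a) oWl WlT oU.
  by rewrite -/(totA a U) -(fineK (totA_fin a)) => /fine_cvgP[_ h]; exact: h.
have fo a m : totA a (U `&` ol m) \is a fin_num.
  have oo : open (U `&` ol m).
    apply: openI => //; rewrite /ol; by elim/big_ind: _ => [|A B oA oB|l _]; [exact: open0|exact: openU|exact: oWl].
  rewrite ge0_fin_numE; last exact: (tot_ge0 (fun r => hN (a r)) (@smA a) oo).
  by apply: le_lt_trans (fT a); apply: (le_tot (fun r => hN (a r)) (@smA a) oo oU); exact: subIsetl.
have les m : ((\sum_a la a * fine (totA a (U `&` ol m)))%:E <= s)%E.
  rewrite -sumEFin; apply: le_trans (le m); rewrite le_eqVlt; apply/orP; left; apply/eqP.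
  by apply: eq_bigr => a _; rewrite EFinM fineK// fo.
have cvE : (\sum_a la a * fine (totA a (U `&` ol m)))%:E @[m --> \oo] --> (\sum_a la a * fine (totA a U))%:E.
  by apply/cvg_EFin => //; near=> m.
rewrite -(cvg_lim _ cvE)//; apply: lime_le; first by apply/cvg_ex; eexists; exact: cvE.
by near=> m; exact: les.
Unshelve. all: by end_near. Qed.

End BodyVolume.

(** * The mixed volume *)

Section Multilinear.
Import -(notations) mpoly.
Context {R : realType} {n : nat}.
Local Notation ones := (Multinom [tuple 1%N | i < n]).

Let onesE i : fun_of_multinom ones i = 1%N.
Proof. by rewrite multinomE tnth_mktuple. Qed.

(** A sum with signs over the vertices of the unit cube extracts the multilinear coefficient. The
    arguments are nonnegative, and only there does [mixed_volume] prescribe the values of the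
    polynomial. *)
Lemma polarization (P : mpoly n R) : (forall a, mcoeff a P != 0 -> mdeg a = n) ->
  mcoeff ones P = \sum_(S : {set 'I_n}) (\prod_i (if i \in S then 1 else -1)) * meval (fun i => (i \in S)%:R) P.
Proof.
move=> hP; transitivity (\sum_(m <- msupp P) mcoeff m P * (m == ones)%:R).
  rewrite [in LHS](mpolyE P) raddf_sum /=; apply: eq_bigr => m _.
  by rewrite mcoeffZ mcoeffX.
under [RHS]eq_bigr => S _ do rewrite mevalE mulr_sumr.
rewrite exchange_big /= big_seq [RHS]big_seq; apply: eq_bigr => m; rewrite mcoeff_msupp => /hP dm.
under eq_bigr => S _ do rewrite mulrCA -big_split/=.
rewrite -mulr_sumr; congr (_ * _).
(* The alternating sum of a monomial factors into the 1 - 0^(m_i). It vanishes if some exponent is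
   0; otherwise the degree [n] forces all exponents to be 1. *)
transitivity (\prod_(i < n) (1 - 0 ^+ fun_of_multinom m i) : R); last first.
  rewrite bigA_distr; apply: eq_big => [S|S _]; first by rewrite ?inE.
  by apply: eq_bigr => i _; case: ifP => _; rewrite ?expr1n ?mul1r ?mulN1r.
have [->|m1] := eqVneq m ones; first by rewrite big1// => i _; rewrite onesE expr1 subr0.
have [i mi] : exists i, fun_of_multinom m i = 0%N.
  apply: contrapT => /forallNP h; move/eqP: m1; apply; apply/mnmP => i; rewrite onesE.
  have h1 j : (1 <= fun_of_multinom m j)%N by rewrite lt0n; apply/eqP; exact: h.
  apply/eqP; move: dm; rewrite mdegE (bigD1 i)//= => dm.
  have le : (\sum_(j < n | j != i) 1 <= \sum_(j < n | j != i) fun_of_multinom m j)%N by apply: leq_sum => j _.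
  have c1 : (\sum_(j < n | j != i) 1 = n.-1)%N by rewrite sum1_card cardC1 card_ord.
  rewrite c1 in le; have n0 : (0 < n)%N by case: (n) i {c1 le dm h h1} => [[]|].
  rewrite eqn_leq h1 andbT -(leq_add2r n.-1) add1n prednK//.
  by apply: leq_trans (leq_add (leqnn _) le) _; rewrite dm.
by rewrite (bigD1 i)//= mi expr0 subrr mul0r.
Qed.

Definition mon (a : {ffun 'I_n -> 'I_n}) : multinom n :=
  Multinom [tuple #|[set r | a r == i]%SET| | i < n].

Let monE a i : fun_of_multinom (mon a) i = #|[set r | a r == i]%SET|.
Proof. by rewrite multinomE tnth_mktuple. Qed.

Lemma mdeg_mon a : mdeg (mon a) = n.
Proof.
rewrite mdegE (eq_bigr (fun i => \sum_(r | a r == i) 1)%N); last by move=> i _; rewrite monE cardsE -sum1_card; apply: eq_bigl => r.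
transitivity (\sum_(r < n) 1)%N; last by rewrite sum1_card card_ord.
by rewrite [RHS](partition_big (fun r => a r) xpredT).
Qed.

Lemma meval_mon lambda a : meval lambda (mpolyX R (mon a)) = \prod_r lambda (a r).
Proof.
rewrite mevalX [RHS](partition_big (fun r => a r) xpredT)//=; apply: eq_bigr => i _.
rewrite (eq_bigr (fun=> lambda i)); last by move=> r /eqP ->.
by rewrite monE cardsE -prodr_const.
Qed.

Lemma mon_ones a : (mon a == ones) = injectiveb a.
Proof.
apply/eqP/injectiveP => [h r r' ar|inj].
  have : #|[set r0 | a r0 == a r]%SET| = 1%N by rewrite -monE h onesE.
  move=> /eqP/cards1P[z zE]; have : r \in [set r0 | a r0 == a r]%SET by rewrite inE.
  have : r' \in [set r0 | a r0 == a r]%SET by rewrite inE ar.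
  by rewrite zE !inE => /eqP -> /eqP ->.
apply/mnmP => i; rewrite monE onesE.
have [b ba ab] := injF_bij inj.
apply/eqP/cards1P; exists (b i); apply/setP => r; rewrite !inE.
by apply/eqP/eqP => [<-|->]; rewrite ?ba ?ab.
Qed.

Definition mixpoly (T : {ffun 'I_n -> 'I_n} -> R) : mpoly n R :=
  \sum_(a : {ffun 'I_n -> 'I_n}) (n`!%:R^-1 * T a) *: mpolyX R (mon a).

Lemma meval_mixpoly T lambda : meval lambda (mixpoly T) =
  \sum_(a : {ffun 'I_n -> 'I_n}) n`!%:R^-1 * (\prod_r lambda (a r)) * T a.
Proof.
rewrite raddf_sum /=; apply: eq_bigr => a _; rewrite mevalZ meval_mon; ring.
Qed.

Let mcoeff_mixpoly T b : mcoeff b (mixpoly T) = \sum_a n`!%:R^-1 * T a * (mon a == b)%:R.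
Proof. by rewrite raddf_sum /=; apply: eq_bigr => a _; rewrite mcoeffZ mcoeffX. Qed.

Lemma mdeg_mixpoly T b : mcoeff b (mixpoly T) != 0 -> mdeg b = n.
Proof.
rewrite mcoeff_mixpoly => Qb; have [a /eqP <-] : exists a, mon a == b; last exact: mdeg_mon.
apply: contrapT => nb; move/eqP: Qb; apply; apply: big1 => a _.
by case: eqP => [ab|_]; [exfalso; apply: nb; exists a; apply/eqP|rewrite mulr0].
Qed.

(** The monomial with all exponents 1 comes from the injective [a]. There are n! of them, which
    cancels the factor 1/n!. *)
Lemma mixed_coeff (T : {ffun 'I_n -> 'I_n} -> R) t (P : mpoly n R) :
  (forall a : {ffun 'I_n -> 'I_n}, injective a -> T a = t) ->
  (forall a, mcoeff a P != 0 -> mdeg a = n) ->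
  (forall lambda : 'I_n -> R, (forall i, 0 <= lambda i) -> meval lambda P = meval lambda (mixpoly T)) ->
  mcoeff ones P = t.
Proof.
move=> Tt hP PE; transitivity (mcoeff ones (mixpoly T)).
  rewrite !polarization//; last exact: mdeg_mixpoly.
  apply: eq_bigr => S _; congr (_ * _).
  by rewrite PE// => i; case: (_ \in _).
rewrite mcoeff_mixpoly (eq_bigr (fun a : {ffun 'I_n -> 'I_n} => (if injectiveb a then n`!%:R^-1 * t else 0))); last first.
  by move=> a _; rewrite mon_ones; case: injectiveP => [/Tt ->|_]; rewrite ?mulr1 ?mulr0.
rewrite -big_mkcond/= sumr_const.
rewrite (_ : #|_| = n`!).
  by rewrite -mulrnAl -mulr_natr mulVf ?mul1r// pnatr_eq0 -lt0n fact_gt0.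
have e := card_inj_ffuns 'I_n 'I_n; rewrite !card_ord ffactnn in e; rewrite -e.
by apply: eq_card => a; rewrite !inE.
Qed.

End Multilinear.

(** * Symmetry in the [n] spaces *)

Section Symmetry.
Context {R : realType} {n : nat} (X : manifold R n) (V : 'I_n -> vectType R)
  (ev : forall i : 'I_n, {linear V i -> (X -> R^o)}) (N : forall i, V i -> R).
Hypotheses (ev_smooth : forall (i : 'I_n) (v : V i), smooth_fun (ev i v))
  (hN : forall i, is_norm (@N i)) (B_smooth : forall i, smooth_convex_body (unit_ball (@N i))).

(* Permuting the factors permutes the rows of the determinants. *)
Lemma riem_perm c u p (phi : forall i, V i -> 'I_p.+1) (x : forall i, 'I_p.+1 -> V i) (a : {ffun 'I_n -> 'I_n}) :
  injective a -> riemA ev hN c phi x a u = riem ev hN c u phi x.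
Proof.
move=> ainj; have [b ba ab] := injF_bij ainj.
rewrite /riemA /riem (reindex (fun J : {ffun 'I_n -> 'I_p.+1} => [ffun r => J (a r)])); last first.
  apply: onW_bij; exists (fun J : {ffun 'I_n -> 'I_p.+1} => [ffun r => J (b r)]) => J;
    by apply/ffunP => r; rewrite !ffunE ?ba ?ab.
apply: eq_bigr => J _; congr (_ * _).
  rewrite [RHS](reindex a); last by apply: onW_bij; exists b.
  by apply: eq_bigr => r _; rewrite ffunE.
rewrite -[RHS](det_neg_abs _ (perm.perm ainj)); congr `|\det _|; apply/matrixP => i j.
by rewrite [LHS]mxE [RHS]mxE [RHS]mxE perm.permE ffunE.
Qed.

(** The two densities are integrals over different product spaces. Their Riemann sums for common
    partitions are equal by reindexing, and the equality passes to the limit. *)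
Lemma delta_perm c u (a : {ffun 'I_n -> 'I_n}) : injective a -> deltaA ev hN c a u = delta ev hN c u.
Proof.
move=> ainj; pose qk (k : nat) : R := 1 + k.+1%:R^-1.
have qk1 k : 1 < qk k by rewrite ltrDl invr_gt0.
have [s sP] : exists s : nat -> {p : nat & ((forall i, V i -> 'I_p.+1) * (forall i, 'I_p.+1 -> V i))%type},
    forall k, is_cells hN (qk k) (projT2 (s k)).1 (projT2 (s k)).2.
  have h k : exists s : {p : nat & ((forall i, V i -> 'I_p.+1) * (forall i, 'I_p.+1 -> V i))%type},
      is_cells hN (qk k) (projT2 s).1 (projT2 s).2.
    by have [p [phi [x h]]] := cells_exist hN B_smooth (qk1 k); exists (existT _ p (phi, x)).
  by have [s hs] := choice h; exists s.
have qk_cvg : qk k - 1 @[k --> \oo] --> (0 : R).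
  by apply: cvg_trans (@cvg_harmonic R); apply: near_eq_cvg; near=> k; rewrite /qk addrC addKr.
have cvgA (b : {ffun 'I_n -> 'I_n}) :
    (riemA ev hN c (projT2 (s k)).1 (projT2 (s k)).2 b u)%:E @[k --> \oo] --> deltaA ev hN c b u.
  have [||||_] := @riem_cvg R n X (fun r => V (b r)) (fun r => ev (b r)) (fun r => @N (b r)) (fun r => hN (b r)) c u
    (fun k => projT1 (s k)) (fun k r => (projT2 (s k)).1 (b r)) (fun k r => (projT2 (s k)).2 (b r)) (fun k => qk k - 1).
  - by move=> k i j; have [h _ _ _ _] := sP k (b i); exact: h.
  - by move=> k i v Sv; have [_ h _ _ _] := sP k (b i); exact: h.
  - exact: qk_cvg.
  - by move=> k i j; have [_ _ h _ _] := sP k (b i); exact: h.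
  by [].
have cvg0 : (riem ev hN c u (projT2 (s k)).1 (projT2 (s k)).2)%:E @[k --> \oo] --> delta ev hN c u.
  have [||||_] := @riem_cvg R n X V ev N hN c u
    (fun k => projT1 (s k)) (fun k r => (projT2 (s k)).1 r) (fun k r => (projT2 (s k)).2 r) (fun k => qk k - 1).
  - by move=> k i j; have [h _ _ _ _] := sP k i; exact: h.
  - by move=> k i v Sv; have [_ h _ _ _] := sP k i; exact: h.
  - exact: qk_cvg.
  - by move=> k i j; have [_ _ h _ _] := sP k i; exact: h.
  by [].
have h := cvgA a; rewrite -(cvg_lim _ h)// -(cvg_lim _ cvg0)//.
by congr (limn _); apply/funext => k; rewrite riem_perm.
Unshelve. all: by end_near. Qed.

Lemma tot_perm U (a : {ffun 'I_n -> 'I_n}) : open U -> compact (closure U) -> injective a ->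
  totA ev N a U = tot ev N U.
Proof.
move=> oU cU ainj.
have smA (r : 'I_n) (v : V (a r)) : smooth_fun (ev (a r) v) by exact: ev_smooth.
have [[x0 _]|U0] := pselect (exists x, U x); last first.
  have -> : U = set0 by apply/seteqP; split=> // x Ux; apply: U0; exists x.
  by rewrite /totA (tot0 (fun r => hN (a r)) smA) (tot0 hN ev_smooth).
have [Wl [cl [oWl Wlc WlT]]] := atlas_exists x0.
rewrite /totA (tot_total (fun r => hN (a r)) smA oWl Wlc WlT oU (tot_finite (fun r => hN (a r)) smA oU cU)).
rewrite (tot_total hN ev_smooth oWl Wlc WlT oU (tot_finite hN ev_smooth oU cU)).
apply: eq_eseriesr => l _; apply: eq_integral => u _; exact: delta_perm.
Qed.

End Symmetry.

Theorem theorem2 (R : realType) (n : nat) (X : manifold R n)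
    (V : 'I_n -> vectType R) (ev : forall i : 'I_n, {linear V i -> (X -> R^o)})
    (N : forall i : 'I_n, V i -> R) (U : set X)
    (ev_inj : forall i : 'I_n, injective (ev i))
    (ev_smooth : forall (i : 'I_n) (v : V i), smooth_fun (ev i v))
    (N_norm : forall i : 'I_n, is_norm (N i))
    (B_smooth : forall i : 'I_n, smooth_convex_body (unit_ball (N i)))
    (dualB_smooth :
       forall i : 'I_n, smooth_convex_body (unit_ball (dual_norm (N i))))
    (U_open : open U) (U_relcompact : compact (closure U)) :
  average_solutions ev N U =
    (n`!%:R / 2 ^+ n *
       mixed_volume U (fun i : 'I_n => bbody (ev i) (symm_norm (N i))))%:E.
Proof.
pose T a := fine (totA ev N a U).
pose E i := bbody (ev i) (symm_norm (N i)).
pose t := fine (tot ev N U).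
have Tt (a : {ffun 'I_n -> 'I_n}) : injective a -> T a = t.
  by move=> ainj; rewrite /T (tot_perm ev_smooth N_norm B_smooth U_open U_relcompact ainj).
have volE (lambda : 'I_n -> R) (l0 : forall i, 0 <= lambda i) :
    bvol U (bsum lambda E) = (\sum_(a : {ffun 'I_n -> 'I_n}) n`!%:R^-1 * (\prod_r lambda (a r)) * T a)%:E.
  exact: bvol_bsum.
have mixedE : mixed_volume U E = t / n`!%:R.
  (* [xget] returns some element of [S]; it is determined because [S] is nonempty and has only one
     element. *)
  rewrite /mixed_volume; set S := (X in xget 0 X).
  have uniq m : S m -> m = t / n`!%:R.
    move=> [P [hP PE ->]]; congr (_ / _); apply: (mixed_coeff Tt hP) => lambda l0.
    by apply: EFin_inj; rewrite -PE// volE// meval_mixpoly.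
  suff St : S (t / n`!%:R) by apply: uniq; exact: (xgetPex 0 (ex_intro _ _ St)).
  exists (mixpoly T); split; first exact: mdeg_mixpoly.
    by move=> lambda l0; rewrite volE// meval_mixpoly.
  by congr (_ / _); apply/esym; apply: (mixed_coeff Tt (@mdeg_mixpoly _ _ T)).
have tE : tot ev N U = t%:E.
  rewrite fineK// ge0_fin_numE; last exact: (tot_ge0 N_norm ev_smooth U_open).
  exact: (tot_finite N_norm ev_smooth U_open U_relcompact).
have two0 : 2 ^+ n != 0 :> R by rewrite expf_neq0.
have f0 : n`!%:R != 0 :> R by rewrite pnatr_eq0 -lt0n fact_gt0.
rewrite -/E mixedE; transitivity ((2 ^- n)%:E * tot ev N U)%E.
  by rewrite /tot muleA -EFinM mulVf// mul1e.
by rewrite tE -EFinM; congr EFin; field; apply/andP.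
Qed.
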